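(* Let $f\in L^2(\mathbb{R},d\mu)$, where $d\mu(x)=(2\pi)^{-1/2}e^{-x^2/2}\,dx$, and let $\eta$ be a standard normal random variable. Let $G=\{G(x),x\in\mathbb{R}_+\}$, $G(0)=0$, be a mean zero Gaussian process with stationary increments, with increments variance $\sigma^2$, satisfying: (i) $\sigma^2(h)$ is regularly varying at zero of index $\beta$ for some $1\le\beta\le 2$; (ii) $\lim_{h\to0}h^2/\sigma^2(h)=0$ and $\lim_{h\to0}\sigma^2(h)/h=0$; (iii) there is a constant $C$ such that $\frac{|\sigma^2(s+h)+\sigma^2(s-h)-2\sigma^2(s)|}{h^2}\le C\frac{\sigma^2(s)}{s^2}$ for all $s>0$ and $0<h\le s/8$; (iv) $\sigma^2(s)$ has a second derivative at each $s\ne0$. Set $\rho(s)=\frac12\frac{d^2}{ds^2}\sigma^2(s)$ for $s\neq 0$. Assume that there exists $\zeta>0$ such that for all $0<M<\infty$ there is $C_M<\infty$ with $$|\rho(x)|\le\frac{C_M}{|x|^{\zeta}},\qquad 0<|x|\le M,$$ and $$|\rho(x+h)-\rho(x)|\le C_M\frac{|h|}{|x|}\,|\rho(x)|,\qquad 4|h|\le|x|\le M,\ x\ne0.$$ Then for all integers $j_0\ge1$ such that $j_0\zeta<1$, and all $0\le a\le b<\infty$, $$\int_a^b f\left(\frac{G(x+h)-G(x)}{\sigma(h)}\right)dx=\sum_{j=0}^{j_0}\left(\frac{h}{\sigma(h)}\right)^{j}\frac{E(H_j(\eta)f(\eta))}{\sqrt{j!}}\,:(G')^j:(I_{[a,b]})+o\left(\frac{h}{\sigma(h)}\right)^{j_0}$$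 in $L^2$ (of the underlying probability space), as $h\downarrow0$.
   Context: The increments variance $\sigma^2$ is defined by $E(G(x)-G(y))^2=\sigma^2(x-y)=\sigma^2(|x-y|)$; it is regarded as an even function on $\mathbb{R}$, $\sigma^2\not\equiv0$, and $\sigma=\sqrt{\sigma^2}$. Regularly varying at zero of index $\beta$ means $\sigma^2(\lambda h)/\sigma^2(h)\to\lambda^\beta$ as $h\downarrow0$ for every $\lambda>0$. The condition $\sigma^2(h)/h\to0$ implies that $G$ has a version with continuous sample paths; this version is used. Also $f\not\equiv0$. $\{H_k\}_{k\ge0}$ are the Hermite polynomials normalized to be orthonormal in $L^2(\mathbb{R},d\mu)$ (with positive leading coefficient). For a mean zero Gaussian random variable $X$ with variance $\sigma_X^2$, the $k$-th Wick power is $:X^k:=\sum_{j=0}^{[k/2]}(-1)^j\binom{k}{2j}E(X^{2j})X^{k-2j}=\sqrt{k!}\,\sigma_X^kH_k(X/\sigma_X)$, and $:X^0:=1$. $\mathcal{B}_0(\mathbb{R}_+)$ is the set of bounded Lebesgue measurable functions on $\mathbb{R}_+$ with compact support. Generalized derivative $G'$: for elementary $g=\sum_{i=1}^n g_iI_{(a_i,b_i]}$ set $G'(g)=\sum_i g_i(G(b_i)-G(a_i))$. When $\rho$ is locally integrable one has $E(G'(g)G'(\tilde g))=\int\int\rho(t-s)g(s)\tilde g(t)\,ds\,dt$ for elementary $g,\tilde g$, and $G'$ extends by isometry (as $L^2$ limits) to the closure of the elementary functions in the norm $(\int\int\rho(t-s)g(s)g(t)\,ds\,dt)^{1/2}$,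 which contains $\mathcal{B}_0(\mathbb{R}_+)$. Thus $\{G'(g),g\in\mathcal{B}_0(\mathbb{R}_+)\}$ is a mean zero Gaussian field with that covariance. Wick power chaos: let $f_\delta$, $\delta\in(0,1]$, be a continuous approximate identity (continuous, nonnegative, symmetric, supported in $[-\delta,\delta]$, $\int f_\delta=1$), and $f_{x,\delta}(s)=f_\delta(s-x)$ (restricted to $s\in\mathbb{R}_+$). When $\rho^k$ is locally integrable, $k\ge1$, $:(G')^k:(g)=\lim_{\delta\to0}\int :(G'(f_{x,\delta}))^k:\,g(x)\,dx$, a limit in $L^2$, for $g\in\mathcal{B}_0(\mathbb{R}_+)$; it satisfies $E(:(G')^k:(g))^2=k!\int\int\rho^k(x-y)g(x)g(y)\,dx\,dy$. For $k=0$, $:(G')^0:(g)=\int g(x)\,dx$. *)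

(* Defs.v *)
From HB Require Import structures.
From mathcomp Require Import all_boot all_order all_algebra.
From mathcomp Require Import all_classical all_reals all_analysis.

Set Implicit Arguments.
Unset Strict Implicit.
Unset Printing Implicit Defensive.
Import Order.TTheory GRing.Theory Num.Theory.
Import numFieldNormedType.Exports.

Local Open Scope classical_set_scope.
Local Open Scope ring_scope.

Section gaussian_processes.
Context d (T : measurableType d) (R : realType) (P : probability T R).

(* [normal_prob 0 0] is not the Dirac mass at 0, so the degenerate case is
   treated apart. *)
Definition centered_gaussian_law (s : R) (A : set R) : \bar R :=
  if s == 0 then dirac (0 : R) A else normal_prob 0 s A.

Definition is_centered_gaussian (X : T -> R) : Prop :=
  measurable_fun setT X /\
  exists2 s : R, 0 <= s &
    forall A : set R, measurable A -> P (X @^-1` A) = centered_gaussian_law s A.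

(* Processes are indexed by R_+: [G x] is irrelevant for [x < 0]. *)
Definition centered_gaussian_process (G : R -> T -> R) : Prop :=
  forall (n : nat) (x c : 'I_n -> R), (forall i, 0 <= x i) ->
    is_centered_gaussian (fun w => \sum_(i < n) c i * G (x i) w).

Definition stationary_increments (G : R -> T -> R) : Prop :=
  forall (n : nat) (x y : 'I_n -> R) (h : R) (A : 'I_n -> set R),
    (forall i, 0 <= x i) -> (forall i, 0 <= y i) -> 0 <= h ->
    (forall i, measurable (A i)) ->
    P [set w | forall i, A i (G (x i + h) w - G (y i + h) w)] =
    P [set w | forall i, A i (G (x i) w - G (y i) w)].

Definition L2dist (X Y : T -> R) : \bar R :=
  'N[P]_(2%:E)[(fun w => (X w - Y w)%:E)]%E.

Definition wick_power (k : nat) (X : T -> R) (w : T) : R :=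
  \sum_(j < k./2.+1)
    (-1) ^+ j * ('C(k, 2 * j))%:R * fine ('E_P[(fun w' => X w' ^+ (2 * j))%R]) *
    X w ^+ (k - 2 * j).

(* The triple [(c, u, v)] stands for c I_(u,v]. *)
Definition elementary : Type := seq (R * R * R).

Definition elementary_on_Rplus (e : elementary) : Prop :=
  forall p, p \in e -> 0 <= p.1.2 <= p.2.

Definition elementary_fun (e : elementary) (s : R) : R :=
  \sum_(p <- e) p.1.1 * \1_`]p.1.2, p.2] s.

Definition elementary_deriv (G : R -> T -> R) (e : elementary) (w : T) : R :=
  \sum_(p <- e) p.1.1 * (G p.2 w - G p.1.2 w).

Definition rho_norm (rho g : R -> R) : R :=
  Num.sqrt (\int[lebesgue_measure]_(t in `[0%R, +oo[)
    \int[lebesgue_measure]_(s in `[0%R, +oo[) (rho (t - s) * g s * g t)).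

(* [Y] is a version of G'(g). *)
Definition is_gen_deriv (G : R -> T -> R) (rho g : R -> R) (Y : T -> R) : Prop :=
  measurable_fun setT Y /\
  exists e : nat -> elementary,
    [/\ forall n, elementary_on_Rplus (e n),
        rho_norm rho (fun s => elementary_fun (e n) s - g s) @[n --> \oo] --> (0 : R)
      & L2dist (elementary_deriv G (e n)) Y @[n --> \oo] --> 0%E].

Definition approximate_identity (phi : R -> R -> R) : Prop :=
  forall delta : R, 0 < delta <= 1 ->
    [/\ continuous (phi delta),
        forall s, 0 <= phi delta s,
        forall s, phi delta (- s) = phi delta s,
        forall s, delta < `|s| -> phi delta s = 0
      & (\int[lebesgue_measure]_s (phi delta s)%:E = 1)%E].

(* s |-> f_delta (s - x), restricted to R_+ *)
Definition translated (phi : R -> R -> R) (delta x s : R) : R :=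
  phi delta (s - x) * \1_`[0%R, +oo[ s.

(* [Z] is the L^2 limit of the integrals of :(G'(f_{x,delta}))^k: g(x).  For each
   x, G'(f_{x,delta}) is only defined up to a null set: pathwise integration in x
   uses a jointly measurable version [Y delta x], and the value of the integral
   does not depend on this version up to a null set. *)
Definition is_wick_chaos (G : R -> T -> R) (rho : R -> R) (phi : R -> R -> R)
    (k : nat) (g : R -> R) (Z : T -> R) : Prop :=
  measurable_fun setT Z /\
  exists Y : R -> R -> T -> R,
    [/\ forall delta, 0 < delta <= 1 ->
          measurable_fun setT (fun p : R * T => Y delta p.1 p.2),
        forall delta x, 0 < delta <= 1 -> 0 <= x ->
          is_gen_deriv G rho (translated phi delta x) (Y delta x)
      & L2dist (fun w => \int[lebesgue_measure]_(x in `[0%R, +oo[)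
                           (wick_power k (Y delta x) w * g x)) Z
          @[delta --> 0^'+] --> 0%E].

(* :(G')^k:(g); as for [lim], the value is meaningful when the limit exists. *)
Definition wick_chaos (G : R -> T -> R) (rho : R -> R) (phi : R -> R -> R)
    (k : nat) (g : R -> R) : T -> R :=
  if k is 0 then cst (\int[lebesgue_measure]_(x in `[0%R, +oo[) g x)
  else xget (cst 0) [set Z | is_wick_chaos G rho phi k g Z].

End gaussian_processes.

Section analysis.
Context (R : realType).

Definition regularly_varying_at_zero (s2 : R -> R) (beta : R) : Prop :=
  forall lambda : R, 0 < lambda ->
    s2 (lambda * h) / s2 h @[h --> 0^'+] --> lambda `^ beta.

Definition hermite_polynomials (H : nat -> {poly R}) : Prop :=
  [/\ forall k, size (H k) = k.+1,
      forall k, 0 < lead_coef (H k)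
    & forall i j,
        (\int[normal_prob 0 1]_x ((H i).[x] * (H j).[x])%:E = (i == j)%:R%:E)%E].

End analysis.

(* Main.v *)
Require Import Defs.
From HB Require Import structures.
From mathcomp Require Import all_boot all_order all_algebra.
From mathcomp Require Import all_classical all_reals all_analysis.
From mathcomp Require Import measurable_realfun ring lra.
Set Implicit Arguments.
Unset Strict Implicit.
Unset Printing Implicit Defensive.
Import Order.TTheory GRing.Theory Num.Theory.
Import numFieldNormedType.Exports.
Local Open Scope classical_set_scope.
Local Open Scope ring_scope.

(* Write [X_h x] for the normalized increment [(G (x + h) - G x) / sigma h], which is
   standard normal, and expand [f] in Hermite polynomials up to degree [j0].

   The degree-[j] term is [(h / sigma h)^j] times the integral over [[a, b]] of the
   [j]-th Wick power of the difference quotient [(G (x + h) - G x) / h]. This quotient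
   is [G'] tested against an averaging kernel of width [h], and so is [G'(f_{x,delta})].
   By Wick's formula [E :U^j: :V^j:] is [j! E(UV)^j], and the covariance of [G'] against
   two kernels at [x] and [y] differs from [rho (y - x)] by a power of the width times
   [|x - y|^-kappa], averaged over the kernels, for some [kappa < 1] larger than
   [j0 * zeta]. Hence the integrated Wick powers form a Cauchy family as the width tends
   to 0, with a rate, and both kinds of kernels have the same limit.

   The remainder [r] is orthogonal to the Hermite polynomials of degree at most [j0], so
   [|E r(X_h x) r(X_h y)| <= |c|^(j0 + 1) E r^2] with [c] the correlation of [X_h x] and
   [X_h y]. Off the diagonal [c] is [h^2 / sigma2 h] times a bounded quantity; in the
   strip [|x - y| < eta] one keeps only [|c|^j0], which is integrable and contributes
   [(h^2 / sigma2 h)^j0] times a power of [eta]. *)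

(** * Square-integrable functions *)

(** The limit [sigma2 h / h --> 0] gives [sigma2] derivative 0 at 0, so the derivative is continuous
    there and integrating [rho] twice returns [sigma2] with no extra mass on the diagonal; this
    identifies the covariance of increments with the double integral of [rho]. Integrating the bound
    on [rho] also gives [sigma2 h = O(h^(2 - zeta))], that is [h^zeta = O(q)] with
    [q = h^2 / sigma2 h]. This settles the intermediate degrees: the error in degree [j] is [q^j]
    times a mean square of order [h^(kappa - j zeta)], and each of the [j0 - j] missing factors [q]
    is paid by one [h^zeta], which leaves a positive power of [h]. Three obstacles shape the rest.
    The variables [G'(g)] are known only up to null sets, so estimates are proved for arbitrary
    versions, and jointly measurable ones are built separately. A kernel centered at [x < delta]
    loses mass at the origin; the error is absorbed by the integrable term [|x|^-kappa]. In the
    remainder, [eta] is fixed before [h]: the off-diagonal constant depends on [eta], but comes with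
    an additional factor [q], which tends to 0. *)

Section integrable_real_functions.
Context d (T : measurableType d) (R : realType) (mu : {measure set T -> \bar R}).
Implicit Types f g : T -> R.

Definition intg f := mu.-integrable setT (EFin \o f).

Lemma intg_meas f : intg f -> measurable_fun setT f.
Proof. by move=> /measurable_int/measurable_EFinP. Qed.

Lemma intgP f : measurable_fun setT f ->
  (\int[mu]_x `|f x|%:E < +oo)%E -> intg f.
Proof.
move=> mf h; apply/integrableP; split; first exact/measurable_EFinP.
by rewrite (eq_integral (fun x => `|f x|%:E)%E).
Qed.

Lemma eq_intg f g : f =1 g -> intg f -> intg g.
Proof. by move=> /funext ->. Qed.

Lemma intg_le f g : measurable_fun setT f -> (forall x, `|f x| <= g x) ->
  intg g -> intg f.
Proof.
move=> mf fg; apply: le_integrable => //=; first exact/measurable_EFinP.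
by move=> x _; rewrite lee_fin (le_trans (fg x))// ler_norm.
Qed.

Lemma intgD f g : intg f -> intg g -> intg (fun x => f x + g x).
Proof. by move=> hf hg; have := integrableD measurableT hf hg. Qed.

Lemma intgB f g : intg f -> intg g -> intg (fun x => f x - g x).
Proof. by move=> hf hg; have := integrableB measurableT hf hg. Qed.

Lemma intgZ c f : intg f -> intg (fun x => c * f x).
Proof. by move=> hf; have := integrableZl measurableT c hf. Qed.

Lemma intg0 : intg (fun=> 0).
Proof. exact: integrable0. Qed.

Lemma intg_abs f : intg f -> intg (fun x => `|f x|).
Proof. by move=> hf; have := integrable_norm hf. Qed.

Lemma intg_sum I (s : seq I) (F : I -> T -> R) :
  (forall i, intg (F i)) -> intg (fun x => \sum_(i <- s) F i x).
Proof.
move=> h; elim: s => [|i s ih].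
  by apply: eq_intg intg0 => x; rewrite big_nil.
by apply: eq_intg (intgD (h i) ih) => x; rewrite big_cons.
Qed.

Lemma IntD f g : intg f -> intg g ->
  \int[mu]_x (f x + g x) = \int[mu]_x f x + \int[mu]_x g x.
Proof. by move=> hf hg; rewrite RintegralD. Qed.

Lemma IntB f g : intg f -> intg g ->
  \int[mu]_x (f x - g x) = \int[mu]_x f x - \int[mu]_x g x.
Proof. by move=> hf hg; rewrite RintegralB. Qed.

Lemma IntZ c f : intg f -> \int[mu]_x (c * f x) = c * \int[mu]_x f x.
Proof. by move=> hf; rewrite RintegralZl. Qed.

Lemma IntN f : intg f -> \int[mu]_x (- f x) = - \int[mu]_x f x.
Proof.
by move=> hf; rewrite -mulN1r -IntZ//; apply: eq_Rintegral => x _; rewrite mulN1r.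
Qed.

Lemma Int_sum I (s : seq I) (F : I -> T -> R) : (forall i, intg (F i)) ->
  \int[mu]_x (\sum_(i <- s) F i x) = \sum_(i <- s) \int[mu]_x F i x.
Proof.
move=> h; elim: s => [|i s ih].
  rewrite big_nil (@eq_Rintegral _ _ _ mu setT (cst 0)); last first.
    by move=> x _; rewrite big_nil.
  by rewrite /Rintegral integral0.
rewrite big_cons -ih -IntD//; last exact: intg_sum.
by apply: eq_Rintegral => x _; rewrite big_cons.
Qed.

Lemma Int0 : \int[mu]_x (0 : R) = 0.
Proof. by rewrite /Rintegral integral0. Qed.

Lemma Int_eq0 f : (forall x, f x = 0) -> \int[mu]_x f x = 0.
Proof. by move=> h; rewrite -Int0; apply: eq_Rintegral => x _; exact: h. Qed.

Lemma le_Int f g : intg f -> intg g -> (forall x, f x <= g x) ->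
  \int[mu]_x f x <= \int[mu]_x g x.
Proof. by move=> hf hg fg; apply: le_Rintegral. Qed.

Lemma Int_ge0 f : (forall x, 0 <= f x) -> 0 <= \int[mu]_x f x.
Proof. by move=> h; apply: Rintegral_ge0. Qed.

Lemma norm_Int f : intg f -> `|\int[mu]_x f x| <= \int[mu]_x `|f x|.
Proof. by move=> hf; apply: le_normr_Rintegral. Qed.

Lemma EInt f : intg f -> (\int[mu]_x (f x)%:E = (\int[mu]_x f x)%:E)%E.
Proof. by move=> hf; rewrite /Rintegral fineK//; exact: integrable_fin_num. Qed.

Lemma intg_ge0P f : measurable_fun setT f -> (forall x, 0 <= f x) ->
  (\int[mu]_x (f x)%:E < +oo)%E -> intg f.
Proof.
move=> mf f0 h; apply: intgP => //; apply: le_lt_trans h.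
by rewrite (eq_integral (fun x => (f x)%:E)) // => x _; rewrite ger0_norm.
Qed.

Lemma Int_ge0_le f c : (forall x, 0 <= f x) -> 0 <= c ->
  (\int[mu]_x (f x)%:E <= c%:E)%E -> \int[mu]_x f x <= c.
Proof.
move=> f0 c0 h; rewrite /Rintegral -lee_fin fineK//.
rewrite ge0_fin_numE; last by apply: integral_ge0 => x _; rewrite lee_fin.
by apply: le_lt_trans h _; rewrite ltry.
Qed.

Lemma ae_eq_Int f g : measurable_fun setT f -> measurable_fun setT g ->
  {ae mu, forall x, f x = g x} -> \int[mu]_x f x = \int[mu]_x g x.
Proof.
move=> mf mg h; rewrite /Rintegral; congr fine; apply: ae_eq_integral => //.
- exact/measurable_EFinP.
- exact/measurable_EFinP.
- by apply: filterS h => x /= -> _.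
Qed.

Lemma ae_le_Int f g : intg f -> intg g -> {ae mu, forall x, f x <= g x} ->
  \int[mu]_x f x <= \int[mu]_x g x.
Proof.
move=> hf hg h; rewrite -subr_ge0 -IntB//.
have i2 := intg_abs (intgB hg hf).
rewrite (@ae_eq_Int _ (fun x => `|g x - f x|)); first exact: Int_ge0.
- exact: intg_meas (intgB hg hf).
- exact: intg_meas i2.
- by apply: filterS h => x fg; rewrite ger0_norm// subr_ge0.
Qed.

Definition sqintg f := measurable_fun setT f /\ intg (fun x => f x ^+ 2).

Definition msq f := \int[mu]_x (f x) ^+ 2.

Lemma msq_ge0 f : 0 <= msq f.
Proof. by apply: Int_ge0 => x; exact: sqr_ge0. Qed.

Lemma eq_sqintg f g : f =1 g -> sqintg f -> sqintg g.
Proof. by move=> /funext ->. Qed.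

Lemma sqintg_le f g : measurable_fun setT f -> (forall x, f x ^+ 2 <= g x) ->
  intg g -> sqintg f.
Proof.
move=> mf fg ig; split => //; apply: intg_le ig.
  exact: measurable_funX.
by move=> x; rewrite ger0_norm ?sqr_ge0.
Qed.

Lemma sqintgM f g : sqintg f -> sqintg g -> intg (fun x => f x * g x).
Proof.
move=> [mf hf] [mg hg]; apply: intg_le (intgD hf hg).
  exact: measurable_funM.
move=> x; rewrite normrM -(real_normK (num_real (f x))) -(real_normK (num_real (g x))).
have := sqr_ge0 (`|f x| - `|g x|); have := normr_ge0 (f x).
have := normr_ge0 (g x); nra.
Qed.

Lemma sqintgZ c f : sqintg f -> sqintg (fun x => c * f x).
Proof.
move=> [mf hf]; split; first exact: measurable_funM.
by apply: eq_intg (intgZ (c ^+ 2) hf) => x; rewrite exprMn.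
Qed.

Lemma sqintgD f g : sqintg f -> sqintg g -> sqintg (fun x => f x + g x).
Proof.
move=> hf hg; split; first exact: measurable_funD hf.1 hg.1.
apply: eq_intg (intgD (intgD hf.2 (intgZ 2 (sqintgM hf hg))) hg.2) => x; ring.
Qed.

Lemma sqintgN f : sqintg f -> sqintg (fun x => - f x).
Proof. by move=> /(sqintgZ (-1)); apply: eq_sqintg => x; rewrite mulN1r. Qed.

Lemma sqintgB f g : sqintg f -> sqintg g -> sqintg (fun x => f x - g x).
Proof. by move=> hf hg; exact: sqintgD hf (sqintgN hg). Qed.

Lemma sqintg0 : sqintg (fun=> 0).
Proof. by split; [exact: measurable_cst | apply: eq_intg intg0 => x; rewrite expr0n]. Qed.

Lemma sqintg_sum I (s : seq I) (F : I -> T -> R) :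
  (forall i, sqintg (F i)) -> sqintg (fun x => \sum_(i <- s) F i x).
Proof.
move=> h; elim: s => [|i s ih].
  by apply: eq_sqintg sqintg0 => x; rewrite big_nil.
by apply: eq_sqintg (sqintgD (h i) ih) => x; rewrite big_cons.
Qed.

Lemma msqZ c f : sqintg f -> msq (fun x => c * f x) = c ^+ 2 * msq f.
Proof.
move=> [_ hf]; rewrite /msq -IntZ//.
by apply: eq_Rintegral => x _; rewrite exprMn.
Qed.

Lemma msqN f : msq (fun x => - f x) = msq f.
Proof. by apply: eq_Rintegral => x _; rewrite sqrrN. Qed.

Lemma msqC f g : msq (fun x => f x - g x) = msq (fun x => g x - f x).
Proof. by apply: eq_Rintegral => x _; rewrite -sqrrN opprB. Qed.

Lemma msqD f g : sqintg f -> sqintg g ->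
  msq (fun x => f x + g x) = msq f + 2 * \int[mu]_x (f x * g x) + msq g.
Proof.
move=> hf hg; rewrite /msq -IntZ; last exact: sqintgM.
rewrite -IntD; [|exact: hf.2|exact: intgZ (sqintgM hf hg)].
rewrite -IntD; [|exact: intgD hf.2 (intgZ _ (sqintgM hf hg))|exact: hg.2].
by apply: eq_Rintegral => x _; ring.
Qed.

Lemma msqD_le f g : sqintg f -> sqintg g ->
  msq (fun x => f x + g x) <= 2 * msq f + 2 * msq g.
Proof.
move=> hf hg; rewrite /msq -(IntZ 2 hf.2) -(IntZ 2 hg.2).
rewrite -IntD; [|exact: intgZ hf.2|exact: intgZ hg.2].
apply: le_Int => [||x].
- exact: (sqintgD hf hg).2.
- exact: intgD (intgZ _ hf.2) (intgZ _ hg.2).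
- have := sqr_ge0 (f x - g x); nra.
Qed.

Lemma msqB_le f g h : sqintg f -> sqintg g -> sqintg h ->
  msq (fun x => f x - h x) <=
  2 * msq (fun x => f x - g x) + 2 * msq (fun x => g x - h x).
Proof.
move=> hf hg hh; apply: le_trans (msqD_le (sqintgB hf hg) (sqintgB hg hh)).
by rewrite le_eqVlt /msq; apply/orP; left; apply/eqP/eq_Rintegral => x _; ring.
Qed.

(** The quadratic [t -> msq (f + t g)] is nonnegative, and its value at the minimum gives the
    inequality. When [msq g = 0] it is affine in [t]; a nonzero slope would let it take the value
    -1. *)
Lemma cauchy_schwarz f g : sqintg f -> sqintg g ->
  (\int[mu]_x (f x * g x)) ^+ 2 <= msq f * msq g.
Proof.
move=> hf hg; set A := msq f; set B := \int[mu]_x _; set C := msq g.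
have key t : 0 <= A + 2 * t * B + t ^+ 2 * C.
  have := msq_ge0 (fun x => f x + t * g x).
  rewrite msqD//; last exact: sqintgZ.
  rewrite msqZ// (_ : \int[mu]_x (f x * (t * g x)) = t * B).
    by rewrite -/A -/C mulrA.
  rewrite -IntZ; last exact: sqintgM.
  by apply: eq_Rintegral => x _; ring.
have A0 : 0 <= A := msq_ge0 f; have C0 : 0 <= C := msq_ge0 g.
have [C00|Cn0] := eqVneq C 0.
  have [->|Bn0] := eqVneq B 0; first by rewrite expr0n mulr_ge0.
  have := key (- (A + 1) / (2 * B)); rewrite C00 mulr0 addr0 => h.
  have e : 2 * (- (A + 1) / (2 * B)) * B = - (A + 1) by field.
  by move: h; rewrite e; lra.
have Cgt : 0 < C by rewrite lt_neqAle eq_sym Cn0.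
have := key (- B / C).
have -> : A + 2 * (- B / C) * B + (- B / C) ^+ 2 * C = A - B ^+ 2 / C by field.
by rewrite subr_ge0 ler_pdivrMr.
Qed.

Lemma cauchy_schwarz_norm f g a b : sqintg f -> sqintg g -> 0 <= a -> 0 <= b ->
  msq f <= a ^+ 2 -> msq g <= b ^+ 2 -> `|\int[mu]_x (f x * g x)| <= a * b.
Proof.
move=> hf hg a0 b0 ha hb; rewrite -(@ler_pXn2r _ 2)// ?nnegrE ?mulr_ge0//.
rewrite real_normK ?num_real// exprMn (le_trans (cauchy_schwarz hf hg))//.
by apply: ler_pM => //; exact: msq_ge0.
Qed.

Lemma msq0_ae f : sqintg f -> msq f = 0 -> {ae mu, forall x, f x = 0}.
Proof.
move=> [mf hf] h.
have : (\int[mu]_x `|(f x ^+ 2)%:E| = 0)%E.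
  rewrite -[RHS]/((0 : R)%:E) -h /msq -EInt//.
  by apply: eq_integral => x _; rewrite /= ger0_norm ?sqr_ge0.
move/(@ae_eq_integral_abs _ _ _ mu _ measurableT) => H.
have /H : measurable_fun setT (fun x => (f x ^+ 2)%:E).
  by apply/measurable_EFinP; exact: measurable_funX.
by apply: filterS => x /= /(_ I) [] /eqP; rewrite sqrf_eq0 => /eqP.
Qed.

End integrable_real_functions.

(** * Almost sure limits of fast [L^2] Cauchy sequences *)

Section fast_cauchy.
Context (R : realType).

(* The superior limit is total and measurable in parameters; infinite values are
   sent to 0. *)
Definition rlim (u : nat -> R) : R := fine (limn_esup (EFin \o u)).

Lemma rlimE (u : nat -> R) l : u n @[n --> \oo] --> l -> rlim u = l.
Proof.
move=> ul; have /cvg_limn_einf_sup[_] : (EFin \o u) n @[n --> \oo] --> l%:E.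
  by apply: cvg_EFin => //; exact: nearW.
by rewrite /rlim => ->.
Qed.

Lemma measurable_rlim d (T : measurableType d) (X : nat -> T -> R) :
  (forall n, measurable_fun setT (X n)) ->
  measurable_fun setT (fun w => rlim (X^~ w)).
Proof.
move=> mX; rewrite /rlim.
apply: (@measurableT_comp _ _ _ _ _ _ (@fine R)) => //.
apply: (@measurable_fun_limn_esup _ _ _ _ (fun n w => (X n w)%:E)) => n.
exact/measurable_EFinP.
Qed.

Lemma exp2n_ge (n : nat) : n%:R <= (2 : R) ^+ n.
Proof. by rewrite -natrX ler_nat ltnW// ltn_expl. Qed.

Lemma small_div_exp2 (K e : R) : 0 < e -> exists n, K / 2 ^+ n < e.
Proof.
move=> e0; have [K0|K0] := lerP K 0.
  by exists 0%N; rewrite expr0 divr1; lra.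
exists (Num.truncn (K / e)).+1; rewrite ltr_pdivrMr ?exprn_gt0// mulrC.
rewrite -ltr_pdivrMr// (lt_le_trans (truncnS_gt _))//.
exact: exp2n_ge.
Qed.

Lemma cvg_div_exp2 (K : R) : K / 2 ^+ n @[n --> \oo] --> (0 : R).
Proof.
have := @cvg_geometric R K 2^-1.
rewrite ger0_norm ?invr_ge0// invf_lt1// ltr1n => /(_ isT).
by apply: cvg_trans; apply: near_eq_cvg; near=> n; rewrite /geometric /= exprVn.
Unshelve. all: end_near. Qed.

Context d (T : measurableType d) (mu : {measure set T -> \bar R}).

(** Cauchy-Schwarz with weights [2^i], whose inverses sum from [n] on to at most [2 / 2^n]. In the
    induction, the factor 2 of [(x + y)^2 <= 2 x^2 + 2 y^2] is compensated by the halving of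
    [2 / 2^n]. *)
Lemma telescoping_sqr (X : nat -> R) n k :
  (X (n + k)%N - X n) ^+ 2 <=
  2 / 2 ^+ n * \sum_(n <= i < n + k) 2 ^+ i * (X i.+1 - X i) ^+ 2.
Proof.
elim: k n => [|k ih] n.
  by rewrite addn0 subrr expr0n big_geq// mulr0.
have := ih n.+1; rewrite addSnnS => {}ih.
rewrite big_ltn ?addnS ?ltnS ?leq_addr// -addnS.
set S := \sum_(n.+1 <= i < n + k.+1) _ in ih *.
set x := X n.+1 - X n; set y := X (n + k.+1)%N - X n.+1 in ih *.
have -> : X (n + k.+1)%N - X n = x + y by rewrite /x /y; ring.
have h : (x + y) ^+ 2 <= 2 * x ^+ 2 + 2 * y ^+ 2.
  by have := sqr_ge0 (x - y); nra.
have p0 : (2 : R) ^+ n != 0 by rewrite expf_neq0.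
apply: (le_trans h); rewrite mulrDr lerD//.
  by rewrite le_eqVlt; apply/orP; left; apply/eqP; rewrite -/x; field.
apply: (le_trans (ler_wpM2l _ ih)) => //.
by rewrite exprS mulrA (_ : 2 * (2 / (2 * 2 ^+ n)) = 2 / 2 ^+ n)//; field.
Qed.

Context (X : nat -> T -> R) (C : R).
Hypothesis hX : forall n, sqintg mu (X n).
Hypothesis hC : forall n, msq mu (fun w => X n.+1 w - X n w) <= C / 4 ^+ n.

Let D n w := 2 ^+ n * (X n.+1 w - X n w) ^+ 2.

Let D0 n w : 0 <= D n w.
Proof. by rewrite mulr_ge0 ?sqr_ge0// exprn_ge0. Qed.

Let iD n : intg mu (D n).
Proof. exact: intgZ (sqintgB (hX n.+1) (hX n)).2. Qed.

Let S w := (\sum_(0 <= i <oo) (D i w)%:E)%E.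

Let mS : measurable_fun setT S.
Proof.
apply: ge0_emeasurable_sum => n.
  by move=> *; rewrite lee_fin.
by move=> _; apply/measurable_EFinP; exact: intg_meas.
Qed.

Let S0 w : (0 <= S w)%E.
Proof. by apply: nneseries_ge0 => *; rewrite lee_fin. Qed.

Let intS : (\int[mu]_w S w <= (2 * C)%:E)%E.
Proof.
rewrite integral_nneseries//; last 2 first.
  by move=> n; apply/measurable_EFinP; exact: intg_meas.
  by move=> *; rewrite lee_fin.
apply: lime_le.
  by apply: is_cvg_nneseries => n _ _; apply: integral_ge0 => *; rewrite lee_fin.
apply: nearW => n.
apply: (@le_trans _ _ (\sum_(0 <= i < n) (C / 2 ^+ i)%:E)%E).
  apply: lee_sum => i _; rewrite EInt// lee_fin IntZ; last first.
    exact: (sqintgB (hX _) (hX _)).2.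
  apply: (@le_trans _ _ (2 ^+ i * (C / 4 ^+ i))); first by rewrite ler_wpM2l ?exprn_ge0//; exact: hC.
  rewrite (_ : (4 : R) = 2 * 2); last by rewrite -natrM.
  rewrite exprMn le_eqVlt; apply/orP; left; apply/eqP.
  by field; rewrite expf_neq0.
have C0 : 0 <= C.
  by have := le_trans (msq_ge0 _ _) (hC 0); rewrite expr0 divr1.
rewrite sumEFin lee_fin.
have -> : \sum_(0 <= i < n) C / 2 ^+ i = 2 * C - 2 * C / 2 ^+ n.
  elim: n => [|n ih]; first by rewrite big_nil expr0 divr1 subrr.
  rewrite big_nat_recr//= ih exprS; field.
  by rewrite expf_neq0.
by rewrite gerBl// divr_ge0 ?exprn_ge0// mulr_ge0.
Qed.

Let iS : mu.-integrable setT S.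
Proof.
apply/integrableP; split=> //.
rewrite (eq_integral S) => [|x _]; last by rewrite gee0_abs.
by apply: le_lt_trans intS _; rewrite ltry.
Qed.

Let bnd w n k : S w \is a fin_num ->
  (X (n + k)%N w - X n w) ^+ 2 <= 2 / 2 ^+ n * fine (S w).
Proof.
move=> fS; apply: le_trans (telescoping_sqr (X^~ w) n k) _.
rewrite ler_wpM2l ?divr_ge0 ?exprn_ge0//.
rewrite -lee_fin fineK// -sumEFin.
apply: le_trans (nneseries_lim_ge (n + k) _); last by move=> *; rewrite lee_fin.
rewrite [leRHS](@big_cat_nat _ _ _ n)//= ?leq_addr//.
by apply: leeDr; apply: sume_ge0 => i _; rewrite lee_fin.
Qed.

Let cvgXw w : S w \is a fin_num -> X n w @[n --> \oo] --> rlim (X^~ w).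
Proof.
move=> fS.
have : cvg (X n w @[n --> \oo]).
  apply/cauchy_cvgP/cauchy_exP => e e0.
  have [n hn] := small_div_exp2 (2 * fine (S w)) (exprn_gt0 2 e0).
  exists (X n w).
  suff : \forall m \near \oo, ball (X n w) e (X m w) by [].
  near=> m; rewrite /ball/= distrC.
  have nm : (n <= m)%N by near: m; exists n.
  have := bnd n (m - n) fS; rewrite subnKC// => h.
  rewrite -(@ltr_pXn2r _ 2)// ?nnegrE ?(ltW e0)// real_normK ?num_real//.
  by apply: le_lt_trans hn; apply: le_trans h _; rewrite mulrAC.
by move=> /cvg_ex[l hl]; rewrite (rlimE hl).
Unshelve. all: end_near. Qed.

Let bndY w n : S w \is a fin_num ->
  (X n w - rlim (X^~ w)) ^+ 2 <= 2 / 2 ^+ n * fine (S w).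
Proof.
move=> fS.
have h : (X n w - X m w) ^+ 2 @[m --> \oo] --> (X n w - rlim (X^~ w)) ^+ 2.
  have hc : X n w - X m w @[m --> \oo] --> X n w - rlim (X^~ w).
    by apply: cvgB; [exact: cvg_cst|exact: cvgXw].
  exact: (cvgM hc hc).
apply: (ler_cvg_to h (cvg_cst _)).
near=> m; have nm : (n <= m)%N by near: m; exists n.
by have := bnd n (m - n) fS; rewrite subnKC// -sqrrN opprB.
Unshelve. all: end_near. Qed.

(** The rate [4^-n] beats the weights [2^n], so the series [S] has a finite integral and is finite
    almost everywhere; there the sequence is Cauchy with an explicit rate. Since [rlim] is defined
    everywhere, the limit stays jointly measurable when the variables depend measurably on a
    parameter. *)
Lemma fast_cauchy :
  [/\ {ae mu, forall w, X n w @[n --> \oo] --> rlim (X^~ w)},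
      sqintg mu (fun w => rlim (X^~ w)) &
      forall n, msq mu (fun w => X n w - rlim (X^~ w)) <= 4 * C / 2 ^+ n].
Proof.
have fS := integrable_ae measurableT iS.
have mY : measurable_fun setT (fun w => rlim (X^~ w)).
  by apply: measurable_rlim => n; exact: (hX n).1.
have key n : (\int[mu]_w ((X n w - rlim (X^~ w)) ^+ 2)%:E <= (4 * C / 2 ^+ n)%:E)%E.
  apply: (@le_trans _ _ (\int[mu]_w ((2 / 2 ^+ n)%:E * S w))%E).
    apply: ae_ge0_le_integral => //.
    - by move=> w _; rewrite lee_fin sqr_ge0.
    - apply/measurable_EFinP; apply: measurable_funX.
      by apply: measurable_funB => //; exact: (hX n).1.
    - move=> w _; apply: mule_ge0; last exact: S0.
      by rewrite lee_fin divr_ge0// exprn_ge0.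
    - exact: measurable_funeM.
    - apply: filterS fS => w /(_ I) hw _; rewrite -(fineK hw) -EFinM lee_fin.
      exact: bndY.
  rewrite ge0_integralZl ?lee_fin ?divr_ge0 ?exprn_ge0//.
  apply: le_trans (lee_wpmul2l _ intS) _; first by rewrite lee_fin divr_ge0// exprn_ge0.
  rewrite -EFinM lee_fin le_eqVlt; apply/orP; left; apply/eqP.
  by field; rewrite expf_neq0.
have sD n : sqintg mu (fun w => X n w - rlim (X^~ w)).
  split; first by apply: measurable_funB => //; exact: (hX n).1.
  apply: intg_ge0P.
  - by apply: measurable_funX; apply: measurable_funB => //; exact: (hX n).1.
  - by move=> x; exact: sqr_ge0.
  - by apply: le_lt_trans (key n) _; rewrite ltry.
split.
- by apply: filterS fS => w /(_ I); exact: cvgXw.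
- by apply: eq_sqintg (sqintgB (hX 0) (sD 0%N)) => w; ring.
- move=> n; have := key n; rewrite (EInt (sD n).2) lee_fin; exact.
Qed.

End fast_cauchy.

(** * Fubini's theorem for real-valued integrals *)

Section fubini_real.
Context (R : realType).

(** Section integrals in Fubini's theorem are extended reals, finite only almost everywhere; [fine]
    changes them on a null set. *)
Lemma intg_fine d (T : measurableType d) (mu : {measure set T -> \bar R}) (g : T -> \bar R) :
  mu.-integrable setT g ->
  intg mu (fine \o g) /\ (\int[mu]_x fine (g x) = fine (\int[mu]_x g x)%E)%R.
Proof.
move=> ig; have mg := measurable_int _ ig.
have mf : measurable_fun setT (EFin \o (fine \o g)).
  by apply/measurable_EFinP; exact: measurableT_comp.
have fg : {ae mu, forall x, setT x -> (EFin \o (fine \o g)) x = g x}.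
  by apply: filterS (integrable_ae measurableT ig) => x /(_ I) h _ /=; rewrite fineK.
split; last by rewrite /Rintegral; congr fine; apply: ae_eq_integral.
apply/integrableP; split=> //.
case/integrableP : ig => _; apply: le_lt_trans.
rewrite le_eqVlt; apply/orP; left; apply/eqP; apply: ae_eq_integral => //.
- exact: measurableT_comp.
- exact: measurableT_comp.
- by apply: filterS fg => x /(_ I) <-.
Qed.

Context d1 d2 (T1 : measurableType d1) (T2 : measurableType d2).
Context (m1 : {sigma_finite_measure set T1 -> \bar R}).
Context (m2 : {sigma_finite_measure set T2 -> \bar R}).
Implicit Type F : T1 * T2 -> R.

Lemma Fubini1 F : intg (m1 \x m2)%E F ->
  intg m1 (fun x => \int[m2]_y F (x, y)) /\
  \int[m1]_x \int[m2]_y F (x, y) = \int[(m1 \x m2)%E]_p F p.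
Proof.
move=> iF; have [h1 h2] := intg_fine (integrable_fubini_F iF).
by split=> //; rewrite [RHS]/Rintegral -(integral12_prod_meas1 iF) -h2.
Qed.

Lemma Fubini2 F : intg (m1 \x m2)%E F ->
  intg m2 (fun y => \int[m1]_x F (x, y)) /\
  \int[m2]_y \int[m1]_x F (x, y) = \int[(m1 \x m2)%E]_p F p.
Proof.
move=> iF; have mF := measurable_int _ iF.
have iG : m2.-integrable setT (fubini_G m1 (EFin \o F)).
  apply/integrableP; split; first exact: measurable_fubini_G iF.
  apply: le_lt_trans ((integrable21ltyP _ _ mF).1 iF).
  have mFa : measurable_fun setT (abse \o (EFin \o F)) by exact: measurableT_comp.
  apply: ge0_le_integral => //.
  - by apply: measurableT_comp => //; exact: measurable_fubini_G iF.
  - by apply: (measurable_fun_fubini_tonelli_G _ mFa) => p; exact: abse_ge0.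
  move=> y _; apply: le_abse_integral => //.
  exact: (measurableT_comp mF (pair2_measurable y)).
have [h1 h2] := intg_fine iG.
by split=> //; rewrite [RHS]/Rintegral -(integral21_prod_meas1 iF) -h2.
Qed.

Lemma intg_prodP F : measurable_fun setT F ->
  (\int[m1]_x \int[m2]_y `|F (x, y)|%:E < +oo)%E -> intg (m1 \x m2)%E F.
Proof.
move=> mF h; have mFe : measurable_fun setT (EFin \o F) by exact/measurable_EFinP.
exact/(integrable12ltyP _ _ mFe).
Qed.

Lemma ae_intg2 F : intg (m1 \x m2)%E F ->
  {ae m2, forall y, intg m1 (fun x => F (x, y))}.
Proof. by move=> iF; have := ae_integrable2 iF. Qed.

End fubini_real.

(** * Integrals of random fields *)

Section integrated_field.
Context d1 d (T1 : measurableType d1) (T : measurableType d) (R : realType).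
Context (m1 : {sigma_finite_measure set T1 -> \bar R}) (P : probability T R).

(** Vanishing outside a set of finite measure and a uniform second moment are what make
    [h w * Phi x w] integrable on the product for every square-integrable [h]; no integrability of
    the single paths is assumed. *)
Definition sqfield (A : set T1) (K : R) (Phi : T1 -> T -> R) :=
  [/\ measurable A, (m1 A < +oo)%E /\ 0 <= K,
      measurable_fun setT (fun p : T1 * T => Phi p.1 p.2),
      (forall x w, ~ A x -> Phi x w = 0) &
      (forall x, sqintg P (Phi x) /\ msq P (Phi x) <= K)].

Definition integrated (Phi : T1 -> T -> R) w := \int[m1]_x Phi x w.

Context (A : set T1) (K : R) (Phi : T1 -> T -> R) (hPhi : sqfield A K Phi).

Let mA : measurable A. Proof. by case: hPhi. Qed.
Let fA : (m1 A < +oo)%E. Proof. by case: hPhi => _ []. Qed.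
Let K0 : 0 <= K. Proof. by case: hPhi => _ []. Qed.
Let mPhi : measurable_fun setT (fun p : T1 * T => Phi p.1 p.2).
Proof. by case: hPhi. Qed.
Let Phi0 x w : ~ A x -> Phi x w = 0. Proof. by case: hPhi => _ _ _ + _; apply. Qed.
Let sPhi x : sqintg P (Phi x). Proof. by case: hPhi => _ _ _ _ /(_ x)[]. Qed.
Let bPhi x : msq P (Phi x) <= K. Proof. by case: hPhi => _ _ _ _ /(_ x)[]. Qed.

Let msec1 w : measurable_fun setT (fun x => Phi x w).
Proof. exact: (measurableT_comp mPhi (pair2_measurable w)). Qed.

Let mAE : m1 A = (fine (m1 A))%:E.
Proof. by rewrite fineK// ge0_fin_numE. Qed.

Let intg1A : intg m1 (\1_A : T1 -> R).
Proof.
apply: intg_ge0P => //.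
by rewrite integral_indic// setIT.
Qed.

(** By [|h Phi| <= h^2 + Phi^2], the integral over [w] is at most [msq h + K], and only the points
    of [A] contribute. *)
Lemma sqfield_intgM (h : T -> R) : sqintg P h ->
  intg (m1 \x P)%E (fun p => h p.2 * Phi p.1 p.2).
Proof.
move=> hh; apply: intg_prodP.
  by apply: measurable_funM => //; exact: (measurableT_comp hh.1 measurable_snd).
apply: (@le_lt_trans _ _ (\int[m1]_x ((msq P h + K) * \1_A x)%:E)%E); last first.
  by rewrite EInt ?ltry//; exact: intgZ.
have mF : measurable_fun setT (fun p : T1 * T => `|h p.2 * Phi p.1 p.2|%:E).
  apply/measurable_EFinP; apply: measurableT_comp => //; apply: measurable_funM => //.
  exact: (measurableT_comp hh.1 measurable_snd).
apply: ge0_le_integral => //.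
- by move=> x _; apply: integral_ge0 => y _; rewrite lee_fin.
- exact: (measurable_fun_fubini_tonelli_F _ mF).
- by apply/measurable_EFinP; apply: intg_meas; exact: (intgZ _ intg1A).
move=> x _ /=; rewrite EInt; last by apply: intg_abs; exact: sqintgM.
rewrite lee_fin indicE; have [/set_mem Ax|/negP nAx] := boolP (x \in A).
  rewrite mulr1; apply: (@le_trans _ _ (msq P h + msq P (Phi x))); last by rewrite lerD2l.
  rewrite -IntD; [|exact: hh.2|exact: (sPhi x).2].
  apply: le_Int.
  - by apply: intg_abs; exact: sqintgM.
  - exact: intgD hh.2 (sPhi x).2.
  move=> w; rewrite normrM.
  rewrite -(real_normK (num_real (h w))) -(real_normK (num_real (Phi x w))).
  have := sqr_ge0 (`|h w| - `|Phi x w|); have := normr_ge0 (h w).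
  have := normr_ge0 (Phi x w); nra.
rewrite mulr0 Int_eq0// => w /=.
by rewrite Phi0 ?mulr0 ?normr0// => /mem_set.
Qed.

Lemma sqfield_ae_intg : {ae P, forall w, intg m1 (fun x => Phi x w)}.
Proof.
have h1 : sqintg P (cst 1).
  split=> //; apply: eq_intg (_ : intg P (cst 1)); first by move=> w; rewrite expr1n.
  exact: finite_measure_integrable_cst.
apply: filterS (ae_intg2 (sqfield_intgM h1)) => w.
by apply: eq_intg => x /=; rewrite mul1r.
Qed.

Lemma measurable_integrated : measurable_fun setT (integrated Phi).
Proof.
have h1 : sqintg P (cst 1).
  split=> //; apply: eq_intg (_ : intg P (cst 1)); first by move=> w; rewrite expr1n.
  exact: finite_measure_integrable_cst.
have [h _] := Fubini2 (sqfield_intgM h1); move/intg_meas : h.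
apply: eq_measurable_fun => w _ /=.
by apply: eq_Rintegral => x _; rewrite /= mul1r.
Qed.

Let sqsec : (\int[P]_w \int[m1]_x ((Phi x w) ^+ 2)%:E <= (K * fine (m1 A))%:E)%E.
Proof.
have mF : measurable_fun setT (fun p : T1 * T => ((Phi p.1 p.2) ^+ 2)%:E).
  by apply/measurable_EFinP; exact: measurable_funX.
rewrite -(@fubini_tonelli _ _ _ _ _ m1 P _ mF); last first.
  by move=> p; rewrite lee_fin sqr_ge0.
apply: (@le_trans _ _ (\int[m1]_x (K * \1_A x)%:E)%E); last first.
  rewrite EInt; last exact: intgZ.
  by rewrite IntZ// /Rintegral integral_indic// setIT.
apply: ge0_le_integral => //.
- by move=> x _; apply: integral_ge0 => y _; rewrite lee_fin sqr_ge0.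
- apply: (measurable_fun_fubini_tonelli_F _ mF) => p.
  by rewrite lee_fin sqr_ge0.
- by apply/measurable_EFinP; apply: intg_meas; exact: (intgZ _ intg1A).
move=> x _ /=; rewrite EInt; last exact: (sPhi x).2.
rewrite lee_fin indicE; have [/set_mem Ax|/negP nAx] := boolP (x \in A).
  by rewrite mulr1; exact: bPhi.
rewrite mulr0 Int_eq0// => w /=.
by rewrite Phi0 ?expr0n// => /mem_set.
Qed.

(** Path by path, Cauchy-Schwarz in [x] against the indicator of [A] bounds the square by [m1 A]
    times the integral of [Phi^2], whose expectation is controlled by Tonelli. *)
Lemma sqintg_integrated : sqintg P (integrated Phi).
Proof.
split; first exact: measurable_integrated.
have mF : measurable_fun setT (fun p : T1 * T => ((Phi p.1 p.2) ^+ 2)%:E).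
  by apply/measurable_EFinP; exact: measurable_funX.
(* Adding 1 keeps the factor positive, so that its product with an infinite section integral is
   still [+oo]. *)
have m1p : 0 < fine (m1 A) + 1 by rewrite ltr_wpDl// fine_ge0.
apply: intg_ge0P.
- by apply: measurable_funX; exact: measurable_integrated.
- by move=> w; exact: sqr_ge0.
apply: (@le_lt_trans _ _ ((fine (m1 A) + 1)%:E * (K * fine (m1 A))%:E)%E); last by rewrite -EFinM ltry.
apply: le_trans (lee_wpmul2l _ sqsec); last by rewrite lee_fin ltW.
rewrite -ge0_integralZl//; last 3 first.
- apply: (@measurable_fun_fubini_tonelli_G _ _ _ _ _ m1 _ mF) => p.
  by rewrite lee_fin sqr_ge0.
- by move=> w _; apply: integral_ge0 => x _; rewrite lee_fin sqr_ge0.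
- by rewrite lee_fin ltW.
apply: ge0_le_integral => //.
- by move=> w _; rewrite lee_fin sqr_ge0.
- by apply/measurable_EFinP; apply: measurable_funX; exact: measurable_integrated.
- apply: measurable_funeM.
  apply: (@measurable_fun_fubini_tonelli_G _ _ _ _ _ m1 _ mF) => p.
  by rewrite lee_fin sqr_ge0.
move=> w _.
set I2 := (\int[m1]_x _)%E; have I20 : (0 <= I2)%E.
  by apply: integral_ge0 => x _; rewrite lee_fin sqr_ge0.
have [I2y|] := eqVneq I2 +oo%E.
  by rewrite I2y gt0_muley ?lte_fin// leey.
rewrite -ltey => fI2.
have sw : sqintg m1 (fun x => Phi x w).
  split=> //; apply: intg_ge0P => //; first exact: measurable_funX.
  by move=> x; exact: sqr_ge0.
have s1A : sqintg m1 (\1_A : T1 -> R).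
  split; first exact: measurable_indic.
  by apply: eq_intg intg1A => x; rewrite indicE; case: (_ \in _); rewrite /= ?expr1n ?expr0n.
have e1 : msq m1 (\1_A : T1 -> R) = fine (m1 A).
  have -> : msq m1 (\1_A : T1 -> R) = \int[m1]_x \1_A x.
    by apply: eq_Rintegral => x _; rewrite indicE; case: (_ \in _); rewrite /= ?expr1n ?expr0n.
  by rewrite /Rintegral integral_indic// setIT.
have := cauchy_schwarz s1A sw; rewrite e1.
have -> : \int[m1]_x (\1_A x * Phi x w) = integrated Phi w.
  apply: eq_Rintegral => x _; rewrite indicE; have [_|/negP nAx] := boolP (x \in A).
    by rewrite mul1r.
  by rewrite mul0r Phi0// => /mem_set.
move=> h; rewrite /I2 EInt; last exact: sw.2.
rewrite -EFinM lee_fin; apply: (le_trans h).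
by rewrite ler_wpM2r ?msq_ge0// lerDl.
Qed.

Lemma Int_integrated (h : T -> R) : sqintg P h ->
  intg m1 (fun x => \int[P]_w (h w * Phi x w)) /\
  \int[P]_w (h w * integrated Phi w) = \int[m1]_x \int[P]_w (h w * Phi x w).
Proof.
move=> hh; have iF := sqfield_intgM hh.
have [h1 e1] := Fubini1 iF; have [h2 e2] := Fubini2 iF.
split=> //; rewrite e1 -e2; apply: ae_eq_Int.
- by apply: measurable_funM; [exact: hh.1|exact: measurable_integrated].
- exact: intg_meas h2.
by apply: filterS sqfield_ae_intg => w hw; rewrite /= IntZ.
Qed.

(* [E D^2 = int_y E (D Phi_y) dy] and [E (D Phi_y) = int_x E (Phi_x Phi_y) dx]: only
   products of two measures are involved. *)
Lemma msq_integrated_le (V : T1 -> R) : intg m1 V ->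
  {ae m1, forall y, \int[m1]_x `|\int[P]_w (Phi y w * Phi x w)| <= V y} ->
  msq P (integrated Phi) <= \int[m1]_y V y.
Proof.
move=> iV hV; have [i1 e1] := Int_integrated sqintg_integrated.
rewrite [leLHS](_ : _ = \int[m1]_x \int[P]_w (integrated Phi w * Phi x w)); last first.
  by rewrite -e1; apply: eq_Rintegral => w _; rewrite expr2.
apply: ae_le_Int => //; apply: filterS hV => y; apply: le_trans.
have [i2 e2] := Int_integrated (sPhi y).
rewrite [leLHS](_ : _ = \int[m1]_x \int[P]_w (Phi y w * Phi x w)); last first.
  by rewrite -e2; apply: eq_Rintegral => w _; rewrite mulrC.
by apply: le_Int => // [|x]; [exact: intg_abs|exact: ler_norm].
Qed.

End integrated_field.

(** * Integration against a density *)

Section density.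
Context d (T : measurableType d) (R : realType).
Context (mu nu : {measure set T -> \bar R}) (g : T -> R).
Hypothesis mg : measurable_fun setT g.
Hypothesis g0 : forall x, 0 <= g x.
Hypothesis nuE : forall A, measurable A -> nu A = (\int[mu]_(x in A) (g x)%:E)%E.

Import HBNNSimple.

Let mge : measurable_fun setT (EFin \o g). Proof. exact/measurable_EFinP. Qed.

Let nnsfun_density (h : {nnsfun T >-> R}) :
  (\int[nu]_x (h x)%:E = \int[mu]_x ((h x)%:E * (g x)%:E))%E.
Proof.
have hE x : (h x)%:E = (\sum_(k \in range h) k%:E * (\1_(h @^-1` [set k]) x)%:E)%E.
  by rewrite fsumEFin //= fimfunE.
have hgE x : ((h x)%:E * (g x)%:E =
    \sum_(k \in range h) k%:E * (\1_(h @^-1` [set k]) x * g x)%:E)%E.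
  have kk k : (k%:E * (\1_(h @^-1` [set k]) x * g x)%:E =
     (k * (\1_(h @^-1` [set k]) x) * g x)%:E)%E by rewrite -EFinM mulrA.
  under eq_fsbigr do rewrite kk.
  rewrite fsumEFin// -EFinM; congr EFin.
  by rewrite {1}fimfunE mulr_fsuml.
have mh k : measurable (h @^-1` [set k]) by exact: measurable_sfunP.
under eq_integral do rewrite hE.
under [RHS]eq_integral do rewrite hgE.
rewrite ge0_integral_fsum//; last 2 first.
- by move=> r; exact/measurable_EFinP/measurableT_comp.
- by move=> r x _; exact: nnfun_muleindic_ge0.
rewrite ge0_integral_fsum//; last 2 first.
- move=> r; apply/measurable_EFinP/measurable_funM => //.
  by apply: measurable_funM => //; exact: measurable_indic.
- move=> r x _; rewrite EFinM muleA mule_ge0 ?lee_fin//.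
  exact: nnfun_muleindic_ge0.
apply: eq_fsbigr => k; rewrite inE => -[z _ <-{k}].
rewrite ge0_integralZl//; last 2 first.
- exact/measurable_EFinP.
- by rewrite lee_fin.
rewrite integral_indic// setIT nuE// ge0_integralZl//; last 3 first.
- by apply/measurable_EFinP/measurable_funM => //; exact: measurable_indic.
- by move=> x _; rewrite lee_fin mulr_ge0.
- by rewrite lee_fin.
congr (_ * _)%E; rewrite integral_mkcond; apply: eq_integral => x _.
rewrite patchE indicE; case: ifPn => _; by rewrite ?mul1r ?mul0r.
Qed.

Lemma ge0_integral_density (f : T -> R) : measurable_fun setT f ->
  (forall x, 0 <= f x) -> (\int[nu]_x (f x)%:E = \int[mu]_x (f x * g x)%:E)%E.
Proof.
move=> mf f0.
have mfe : measurable_fun setT (EFin \o f) by exact/measurable_EFinP.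
pose h := nnsfun_approx measurableT mfe.
have hf x : (h n x)%:E @[n --> \oo] --> (f x)%:E.
  by apply: cvg_nnsfun_approx => // y _; rewrite lee_fin.
have ndh x : nondecreasing_seq (fun n => (h n x)%:E).
  by move=> a b ab; rewrite lee_fin; exact/lefP/nd_nnsfun_approx.
transitivity (limn (fun n => \int[nu]_x (h n x)%:E)%E).
  rewrite -monotone_convergence//.
  - by apply: eq_integral => x _; exact/esym/cvg_lim.
  - by move=> n; exact/measurable_EFinP.
  - by move=> n x _; rewrite lee_fin.
rewrite (_ : (fun n => _) = (fun n => \int[mu]_x ((h n x)%:E * (g x)%:E))%E); last first.
  by apply/funext => n; exact: nnsfun_density.
rewrite -monotone_convergence//.
- apply: eq_integral => x _; apply/cvg_lim => //=.
  by rewrite EFinM; apply: cvgeMr => //; exact: hf.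
- by move=> n; apply: emeasurable_funM => //; exact/measurable_EFinP.
- by move=> n x _; rewrite mule_ge0 ?lee_fin.
- move=> x _ a b ab; apply: lee_wpmul2r; first by rewrite lee_fin.
  exact: ndh.
Qed.

Lemma Int_density (f : T -> R) : measurable_fun setT f ->
  intg mu (fun x => f x * g x) ->
  intg nu f /\ \int[nu]_x f x = \int[mu]_x (f x * g x).
Proof.
move=> mf iF.
have h1 : intg nu f.
  apply: intgP => //; rewrite ge0_integral_density//; last exact: measurableT_comp.
  rewrite (eq_integral (fun x => `|f x * g x|%:E)); last first.
    by move=> x _; rewrite normrM (ger0_norm (g0 x)).
  by rewrite EInt ?ltry//; exact: intg_abs.
split=> //.
pose fp x : R := Num.max (f x) 0; pose fm x : R := Num.max (- f x) 0.
have fE x : f x = fp x - fm x.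
  by rewrite /fp /fm; case: (lerP (f x) 0) => h; [rewrite max_l|rewrite max_r]; lra.
have mfp : measurable_fun setT fp by exact: measurable_maxr.
have mfm : measurable_fun setT fm by apply: measurable_maxr => //; exact: measurableT_comp.
have fp0 x : 0 <= fp x by rewrite le_max lexx orbT.
have fm0 x : 0 <= fm x by rewrite le_max lexx orbT.
have fpl x : fp x <= `|f x| by rewrite ge_max ler_norm normr_ge0.
have fml x : fm x <= `|f x| by rewrite ge_max -normrN ler_norm normr_ge0.
have ia := intg_abs iF.
have ig (h : T -> R) : measurable_fun setT h -> (forall x, 0 <= h x) -> (forall x, h x <= `|f x|) ->
    intg nu h /\ intg mu (fun x => h x * g x).
  move=> mh h0 hl; split.
    apply: intg_le (intg_abs h1) => // x; rewrite ger0_norm//.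
  apply: intg_le ia => [|x]; first exact: measurable_funM.
  by rewrite !normrM ler_wpM2r// ger0_norm.
have [i1 i2] := ig _ mfp fp0 fpl; have [i3 i4] := ig _ mfm fm0 fml.
have e (h : T -> R) : measurable_fun setT h -> (forall x, 0 <= h x) ->
    \int[nu]_x h x = \int[mu]_x (h x * g x).
  by move=> mh h0; rewrite /Rintegral ge0_integral_density.
rewrite (_ : \int[nu]_x f x = \int[nu]_x (fp x - fm x)); last first.
  by apply: eq_Rintegral => x _; exact: fE.
rewrite IntB// !e// -IntB//; apply: eq_Rintegral => x _.
by rewrite -mulrBl -fE.
Qed.

End density.

Section lebesgue_limits.
Context (R : realType).
Notation mu := (@lebesgue_measure R).

Lemma Int_itv_cvg (g : R -> R) : intg mu g ->
  \int[mu]_(x in `[(- n%:R)%R, n%:R]) g x @[n --> \oo] --> \int[mu]_x g x.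
Proof.
move=> ig; have mg := intg_meas ig.
have iabs := intg_abs ig.
pose f_ (n : nat) x := ((g \_ `[(- n%:R)%R, n%:R]) x)%:E.
have mf_ n : measurable_fun setT (f_ n).
  apply/measurable_EFinP; apply/(measurable_restrictT _ _).1 => //.
  exact: measurable_funTS.
have [|||||_ _ h] := @dominated_convergence _ _ _ mu setT measurableT f_
    (EFin \o g) (fun x => `|g x|%:E).
- exact: mf_.
- exact/measurable_EFinP.
- apply: aeW => x _; apply: cvg_EFin; first exact: nearW.
  apply: cvg_near_cst; exists (Num.truncn `|x|).+1 => // n /= hn.
  rewrite /f_ /= patchE mem_set//= in_itv/= -ler_norml.
  by rewrite (le_trans (ltW (truncnS_gt _)))// ler_nat.
- exact: iabs.
- apply: aeW => x n _; rewrite /f_ patchE; case: ifPn => _ //=.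
  by rewrite normr0 lee_fin.
rewrite (_ : (fun n : nat => _) = (fine \o (fun n => \int[mu]_x f_ n x)%E)); last first.
  by apply/funext => n /=; rewrite Rintegral_mkcond.
by apply: fine_cvg; move: h; rewrite /= EInt.
Qed.

End lebesgue_limits.

Section pointwise_derivatives.
Context (R : realType).
Implicit Types (f g : R -> R) (x a b c : R).

Lemma dvM f g x a b : is_derive x 1 f a -> is_derive x 1 g b ->
  is_derive x 1 (fun y => f y * g y) (a * g x + f x * b).
Proof.
move=> df dg; apply: is_derive_eq (is_deriveM df dg) _.
by rewrite addrC /GRing.scale /= mulrC.
Qed.

Lemma dvD f g x a b : is_derive x 1 f a -> is_derive x 1 g b ->
  is_derive x 1 (fun y => f y + g y) (a + b).
Proof. exact: is_deriveD. Qed.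

Lemma dvB f g x a b : is_derive x 1 f a -> is_derive x 1 g b ->
  is_derive x 1 (fun y => f y - g y) (a - b).
Proof. exact: is_deriveB. Qed.

Lemma dvZ f x a c : is_derive x 1 f a -> is_derive x 1 (fun y => c * f y) (c * a).
Proof. exact: is_deriveZ. Qed.

Lemma dvX n x : is_derive x 1 (fun y : R => y ^+ n) (n%:R * x ^+ n.-1).
Proof.
rewrite (_ : (fun y : R => y ^+ n) = horner 'X^n); last by apply/funext => y; rewrite hornerXn.
by apply: is_derive_eq; rewrite derivXn hornerMn hornerXn mulr_natl.
Qed.

Lemma dv_comp f g x a b : is_derive (g x) 1 f a -> is_derive x 1 g b ->
  is_derive x 1 (fun y => f (g y)) (a * b).
Proof. by move=> df dg; exact: (is_derive1_comp df dg). Qed.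

Lemma dv_affine f c b x a : is_derive (c * x + b) 1 f a ->
  is_derive x 1 (fun y => f (c * y + b)) (a * c).
Proof.
move=> df; apply: (@dv_comp f (fun y => c * y + b)) => //.
have := dvD (dvZ c (is_derive_id x (1 : R))) (is_derive_cst b x (1 : R)).
by rewrite addr0 mulr1.
Qed.

Lemma dv_continuous f x a : is_derive x 1 f a -> {for x, continuous f}.
Proof. by move=> [df _]; apply: differentiable_continuous; apply/derivable1_diffP. Qed.

End pointwise_derivatives.

(** * Density of polynomials in Gaussian L^2 *)

Section gaussian_moments.
Context (R : realType).
Notation mu := (@lebesgue_measure R).

Lemma normal_pdf0E (s x : R) : s != 0 ->
  normal_pdf 0 s x = normal_peak s * expR (- (2 * s ^+ 2)^-1 * x ^+ 2).
Proof.
move=> s0; rewrite normal_pdfE// /normal_fun subr0.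
congr (_ * expR _); rewrite -mulr_natl; field.
by [].
Qed.

Lemma exp_ge_pow (n : nat) (y : R) : 0 <= y -> y ^+ n <= n`!%:R * expR y.
Proof.
case: n => [|n] y0.
  by rewrite expr0 fact0 mul1r (le_trans _ (expR_ge1Dx _))// lerDl.
rewrite mulrC -ler_pdivrMr ?ltr0n ?fact_gt0//.
apply: le_trans (expR_ge1Dxn n y0); lra.
Qed.

(** Passing from deviation [s] to [2 s] leaves a spare factor [exp (- x^2 / k)], which absorbs every
    power of [x]. *)
Lemma normal_pdf_moment_le (s : R) (n : nat) : 0 < s ->
  exists2 C, 0 <= C & forall x, `|x| ^+ n * normal_pdf 0 s x <= C * normal_pdf 0 (2 * s) x.
Proof.
move=> s0.
have s_neq0 : s != 0 by rewrite gt_eqF.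
have s2_neq0 : 2 * s != 0 by rewrite mulf_neq0.
have pk : 0 < normal_peak s := normal_peak_gt0 s_neq0.
have pk2 : 0 < normal_peak (2 * s) := normal_peak_gt0 s2_neq0.
(* [1 / (2 s^2) - 1 / (8 s^2) = 3 / (8 s^2)], so [1 / k] is the spare rate in the exponent. *)
pose k : R := 8 / 3 * s ^+ 2.
have k0 : 0 < k by rewrite mulr_gt0 ?exprn_gt0.
pose C1 (m : nat) := k ^+ m * m`!%:R.
have C10 m : 0 <= C1 m by rewrite mulr_ge0 ?exprn_ge0 ?ltW.
have h (m : nat) (x : R) : (x ^+ 2) ^+ m * expR (- (2 * s ^+ 2)^-1 * x ^+ 2) <=
    C1 m * expR (- (2 * (2 * s) ^+ 2)^-1 * x ^+ 2).
  have e : expR (- (2 * s ^+ 2)^-1 * x ^+ 2) =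
      expR (- (x ^+ 2 / k)) * expR (- (2 * (2 * s) ^+ 2)^-1 * x ^+ 2).
    by rewrite -expRD /k; congr expR; field.
  rewrite e mulrA ler_wpM2r ?expR_ge0// expRN ler_pdivrMr ?expR_gt0//.
  have y0 : 0 <= x ^+ 2 / k by rewrite divr_ge0 ?sqr_ge0 ?ltW.
  rewrite /C1 -mulrA.
  have := ler_wpM2l (exprn_ge0 m (ltW k0)) (exp_ge_pow m y0).
  by rewrite -exprMn [k * _]mulrC divfK// gt_eqF.
exists (normal_peak s / normal_peak (2 * s) * (C1 0%N + C1 n)).
  by rewrite mulr_ge0 ?addr_ge0 ?divr_ge0 ?normal_peak_ge0.
move=> x; rewrite !normal_pdf0E// mulrCA.
rewrite (_ : _ * _ * (_ * _) = normal_peak s * ((C1 0%N + C1 n) *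
   expR (- (2 * (2 * s) ^+ 2)^-1 * x ^+ 2))); last by field; rewrite gt_eqF.
rewrite ler_wpM2l ?(ltW pk)//.
(* Odd powers are covered by [|x|^n <= 1 + (x^2)^n]. *)
rewrite (mulrDl (C1 0%N)); apply: le_trans (lerD (h 0%N x) (h n x)).
rewrite -mulrDl ler_wpM2r ?expR_ge0// expr0 -(real_normK (num_real x)) -exprM mulnC exprM.
by have := sqr_ge0 (`|x| ^+ n - 2^-1); lra.
Qed.

Lemma intg_normal_pdf (s : R) : intg mu (normal_pdf 0 s).
Proof. exact: integrable_normal_pdf. Qed.

Lemma intg_moment_pdf (s : R) (n : nat) : 0 < s ->
  intg mu (fun x => x ^+ n * normal_pdf 0 s x).
Proof.
move=> s0; have [C C0 h] := normal_pdf_moment_le n s0.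
apply: intg_le (intgZ C (intg_normal_pdf (2 * s))) => [|x].
  by apply: measurable_funM; [exact: measurable_funX|exact: measurable_normal_pdf].
by rewrite normrM normrX (ger0_norm (normal_pdf_ge0 _ _ _)).
Qed.

Lemma Int_normal_prob (s : R) (f : R -> R) : measurable_fun setT f ->
  intg mu (fun x => f x * normal_pdf 0 s x) ->
  intg (normal_prob 0 s) f /\
  \int[normal_prob 0 s]_x f x = \int[mu]_x (f x * normal_pdf 0 s x).
Proof.
move=> mf; apply: (@Int_density _ _ R mu (normal_prob 0 s) (normal_pdf 0 s)) => //.
- exact: measurable_normal_pdf.
- exact: normal_pdf_ge0.
Qed.

(** Integration by parts: the derivative of [x^n p] is [g]. The boundary terms at [-N] and [N] are
    [O(1 / N)] by the bound on the next moment, so the integral of [g] over the line is 0. *)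
Lemma pdf_moment_recursion (s : R) (n : nat) : 0 < s ->
  \int[mu]_x (x ^+ n.+1 * normal_pdf 0 s x) =
  s ^+ 2 * (n%:R * \int[mu]_x (x ^+ n.-1 * normal_pdf 0 s x)).
Proof.
move=> s0; have s_neq0 : s != 0 by rewrite gt_eqF.
pose p := normal_pdf 0 s; pose h x : R := x ^+ n * p x.
pose g x : R := n%:R * (x ^+ n.-1 * p x) - (s ^+ 2)^-1 * (x ^+ n.+1 * p x).
have ig : intg mu g by apply: intgB; apply: intgZ; exact: intg_moment_pdf.
have dh (x : R) : is_derive x 1 h (g x).
  rewrite (_ : h = fun x => x ^+ n *
    (normal_peak s * expR (- (2 * s ^+ 2)^-1 * x ^+ 2))); last first.
    by apply/funext => y; rewrite /h /p normal_pdf0E.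
  rewrite /g /p normal_pdf0E//.
  have de : is_derive x 1 (fun y : R => expR (- (2 * s ^+ 2)^-1 * y ^+ 2))
      (expR (- (2 * s ^+ 2)^-1 * x ^+ 2) * (- (2 * s ^+ 2)^-1 * (2%:R * x ^+ 1))).
    apply: (@dv_comp _ expR) (dvZ _ (dvX 2 x)).
  apply: is_derive_eq (dvM (dvX n x) (dvZ (normal_peak s) de)) _.
  by rewrite expr1 (exprS x n); field.
have cg : continuous g.
  have cp : continuous p by exact: continuous_normal_pdf.
  move=> x; apply: cvgB; apply: cvgM; try exact: cvg_cst.
  - by apply: cvgM; [exact: exprn_continuous|exact: cp].
  - by apply: cvgM; [exact: exprn_continuous|exact: cp].
have ftc (N : nat) : \int[mu]_(x in `[(- N%:R)%R, N%:R]) g x = h N%:R - h (- N%:R).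
  case: N => [|N].
    by rewrite oppr0 subrr set_itv1 Rintegral_set1.
  rewrite /Rintegral (@continuous_FTC2 _ g h)//.
  - by rewrite -subr_gt0 opprK addr_gt0 ?ltr0n.
  - exact: continuous_subspaceT.
  - have ch : continuous h by move=> x; apply: differentiable_continuous; apply/derivable1_diffP.
    split.
    + by move=> x _.
    + by apply: cvg_at_right_filter; exact: ch.
    + by apply: cvg_at_left_filter; exact: ch.
  - by move=> x _; rewrite derive1E; exact: derive_val.
have [C C0 hC] := normal_pdf_moment_le n.+1 s0.
have hb (N : nat) : (0 < N)%N -> forall x, `|x| = N%:R ->
    `|h x| <= C * normal_peak (2 * s) / N%:R.
  move=> N0 x xN; rewrite ler_pdivlMr ?ltr0n// mulrC -xN normrM normrX.
  rewrite mulrA -exprS (ger0_norm (normal_pdf_ge0 _ _ _)).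
  apply: le_trans (hC x) _; rewrite ler_wpM2l//; apply: normal_pdf_ub.
  by rewrite mulf_neq0.
have lim0 : \int[mu]_(x in `[(- N%:R)%R, N%:R]) g x @[N --> \oo] --> (0 : R).
  apply/norm_cvg0P; apply: (@squeeze_cvgr _ _ _ _ (cst 0)
     (fun N : nat => 2 * (C * normal_peak (2 * s)) * N%:R^-1)).
  - near=> N; rewrite normr_ge0 ftc /=.
    have N0 : (0 < N)%N by near: N; exists 1%N.
    apply: le_trans (ler_normB _ _) _.
    have h1 := hb N N0 N%:R (ger0_norm (ler0n _ _)).
    have h2 := hb N N0 (- N%:R); rewrite normrN in h2.
    have {}h2 := h2 (ger0_norm (ler0n _ _)).
    by rewrite -mulrA mulr2n mulrDl mul1r lerD.
  - exact: cvg_cst.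
  - rewrite -(mulr0 (2 * (C * normal_peak (2 * s)))); apply: cvgMr; rewrite -cvg_shiftS; exact: cvg_harmonic.
have : 0 = \int[mu]_x g x.
  by apply: (cvg_unique (@norm_hausdorff _ _) lim0); exact: Int_itv_cvg.
rewrite /g IntB; [|exact/intgZ/intg_moment_pdf|exact/intgZ/intg_moment_pdf].
rewrite !IntZ; [|exact: intg_moment_pdf|exact: intg_moment_pdf].
move=> /esym /eqP; rewrite subr_eq0 => /eqP ->.
by rewrite mulrA divff ?mul1r// expf_neq0.
Unshelve. all: end_near. Qed.

Lemma intg_moment (s : R) (n : nat) : 0 < s -> intg (normal_prob 0 s) (fun x => x ^+ n).
Proof.
move=> s0; apply: (Int_normal_prob _ _).1; first exact: measurable_funX.
exact: intg_moment_pdf.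
Qed.

Lemma Int_prob_cst d (T : measurableType d) (P : probability T R) (c : R) :
  \int[P]_x c = c.
Proof. by rewrite /Rintegral integral_cst// [X in (_ * X)%E]probability_setT mule1. Qed.

Lemma moment_recursion (s : R) (n : nat) : 0 < s ->
  \int[normal_prob 0 s]_x (x ^+ n.+1) =
  s ^+ 2 * (n%:R * \int[normal_prob 0 s]_x (x ^+ n.-1)).
Proof.
move=> s0.
have e m : \int[normal_prob 0 s]_x (x ^+ m) = \int[mu]_x (x ^+ m * normal_pdf 0 s x).
  apply: (Int_normal_prob _ _).2; first exact: measurable_funX.
  exact: intg_moment_pdf.
by rewrite !e pdf_moment_recursion.
Qed.

End gaussian_moments.

Section msq_dominated_convergence.
Context d (T : measurableType d) (R : realType) (mu : {measure set T -> \bar R}).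

Lemma msq_dct (f_ : nat -> T -> R) (f g : T -> R) :
  (forall n, measurable_fun setT (f_ n)) -> measurable_fun setT f ->
  (forall n x, (f_ n x - f x) ^+ 2 <= g x) -> intg mu g ->
  {ae mu, forall x, f_ n x @[n --> \oo] --> f x} ->
  msq mu (fun x => f_ n x - f x) @[n --> \oo] --> (0 : R).
Proof.
move=> mf_ mf hg ig hc.
have md n : measurable_fun setT (fun x => (f_ n x - f x) ^+ 2).
  by apply: measurable_funX; apply: measurable_funB.
have [|||||_ _ h] := @dominated_convergence _ _ _ mu setT measurableT
    (fun n x => ((f_ n x - f x) ^+ 2)%:E) (cst 0) (EFin \o g).
- by move=> n; exact/measurable_EFinP.
- exact: measurable_cst.
- apply: filterS hc => x hx _; apply: cvg_EFin; first exact: nearW.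
  have h0 : f_ n x - f x @[n --> \oo] --> (0 : R).
    by rewrite -(subrr (f x)); apply: cvgB; [exact: hx|exact: cvg_cst].
  by rewrite -[X in _ --> X](mulr0 (0 : R)); exact: (cvgM h0 h0).
- exact: ig.
- by apply: aeW => x n _ /=; rewrite lee_fin ger0_norm ?sqr_ge0.
move: h; rewrite integral0 => h.
exact: (fine_cvg h).
Qed.

Lemma cvg0_small (u : nat -> R) (e : R) : u n @[n --> \oo] --> (0 : R) -> 0 < e ->
  exists n, u n <= e.
Proof.
move=> /cvgrPdist_le h e0; have [n _ hn] := h _ e0.
by exists n; have := hn n (leqnn n); rewrite sub0r normrN; apply: le_trans; exact: ler_norm.
Qed.

End msq_dominated_convergence.

(** * Polynomial approximation of cosines *)

Section cosine_approximation.
Context (R : realType).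

Lemma poly_antiderivative (p : {poly R}) : exists q : {poly R}, q^`() = p /\ q.[0] = 0.
Proof.
exists (\poly_(i < (size p).+1) (p`_i.-1 / i%:R)); split.
  apply/polyP => i; rewrite coef_deriv coef_poly ltnS /=.
  case: ltnP => hi; last by rewrite mul0rn nth_default.
  by rewrite -[LHS]mulr_natr divfK// pnatr_eq0.
by rewrite horner_coef0 coef_poly /= invr0 mulr0.
Qed.

Let is_derive_pow_fact (N : nat) (x : R) :
  is_derive x 1 (fun y : R => y ^+ N.+1 / N.+1`!%:R) (x ^+ N / N`!%:R).
Proof.
have h := dvM (dvX N.+1 x) (is_derive_cst ((N.+1`!%:R)^-1 : R) x (1 : R)).
apply: is_derive_eq h _.
rewrite mulr0 addr0 /= factS natrM invfM mulrAC mulrA divff ?mul1r ?pnatr_eq0//.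
by rewrite mulrC.
Qed.

Let integrate_bound_pos (N : nat) (D D' : R -> R) :
  (forall x : R, is_derive x 1 D (D' x)) -> D 0 = 0 ->
  (forall x, 0 <= x -> D' x <= x ^+ N / N`!%:R) ->
  forall x, 0 <= x -> D x <= x ^+ N.+1 / N.+1`!%:R.
Proof.
move=> dD D0 hD x; rewrite le_eqVlt => /predU1P[<-|x0].
  by rewrite D0 expr0n mul0r.
pose E (y : R) := y ^+ N.+1 / N.+1`!%:R - D y.
have dE (y : R) : is_derive y 1 E (y ^+ N / N`!%:R - D' y) by exact: dvB.
have [|c] := @MVT _ E (fun y => y ^+ N / N`!%:R - D' y) 0 x x0 (fun y _ => dE y).
  by apply: continuous_subspaceT => y; exact: dv_continuous (dE y).
rewrite in_itv/= => /andP[c0 cx].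
have -> : E 0 = 0 by rewrite /E D0 expr0n mul0r subr0.
rewrite !subr0 => h; rewrite -subr_ge0 -/(E x) h; apply: mulr_ge0; last exact: ltW.
by rewrite subr_ge0 hD// ltW.
Qed.

Let integrate_bound (N : nat) (D D' : R -> R) :
  (forall x : R, is_derive x 1 D (D' x)) -> D 0 = 0 ->
  (forall x, `|D' x| <= `|x| ^+ N / N`!%:R) ->
  forall x, `|D x| <= `|x| ^+ N.+1 / N.+1`!%:R.
Proof.
move=> dD D0 hD.
have pos (F F' : R -> R) : (forall x : R, is_derive x 1 F (F' x)) -> F 0 = 0 ->
   (forall x, `|F' x| <= `|x| ^+ N / N`!%:R) ->
   forall x, 0 <= x -> `|F x| <= x ^+ N.+1 / N.+1`!%:R.
  move=> dF F0 hF x x0; rewrite ler_norml lerNl; apply/andP; split.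
    apply: (@integrate_bound_pos N (fun y => - F y) (fun y => - F' y)) => //.
    - by rewrite F0 oppr0.
    move=> y y0; have := hF y; rewrite (ger0_norm y0); apply: le_trans.
    by rewrite -normrN ler_norm.
  apply: (@integrate_bound_pos N F F') => // y y0.
  by have := hF y; rewrite (ger0_norm y0); apply: le_trans; exact: ler_norm.
move=> x; have [x0|x0] := leP 0 x.
  by rewrite (ger0_norm x0); exact: pos dD D0 hD x x0.
have := pos (fun y => D (-1 * y + 0)) (fun y => D' (-1 * y + 0) * -1).
rewrite !mulr0 !addr0 => /(_ _ D0 _ (- x)).
rewrite !mulN1r !opprK (ltr0_norm x0) addr0; apply => //.
- by move=> y; apply: dv_affine; exact: dD.
- by move=> y; rewrite addr0 mulN1r mulrN1 normrN (le_trans (hD _))// normrN.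
- by rewrite oppr_ge0 ltW.
Qed.

(** The derivative of [cos (x + b)] is [cos (x + (b + pi / 2))]: an induction over all phases [b]
    needs no sine, and each order follows from the previous one by integrating the error. *)
Lemma cos_taylor (N : nat) (b : R) : exists p : {poly R},
  forall x, `|cos (x + b) - p.[x]| <= `|x| ^+ N / N`!%:R.
Proof.
elim: N b => [|N ih] b.
  exists 0 => x; rewrite horner0 subr0 expr0 fact0 invr1 mulr1.
  by rewrite ler_norml cos_le1 cos_geN1.
have [p hp] := ih (b + pi / 2); have [q [qp q0]] := poly_antiderivative p.
exists (q + (cos b)%:P) => x.
apply: (@integrate_bound N (fun x => cos (x + b) - (q + (cos b)%:P).[x])
   (fun x => cos (x + (b + pi / 2)) - p.[x])) => //.
- move=> y; apply: dvB.
    have := @dv_affine _ cos 1 b y (- sin (1 * y + b)) (is_derive_cos _).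
    rewrite mul1r mulr1 addrA cosDpihalf.
    by rewrite (_ : (fun z => cos (1 * z + b)) = (fun z => cos (z + b)))//;
       apply/funext => z; rewrite mul1r.
  by apply: is_derive_eq; rewrite derivD derivC addr0 qp.
- by rewrite add0r hornerD q0 add0r hornerC subrr.
Qed.

End cosine_approximation.

(** * The closure of the polynomials and trigonometric sums *)

Section polynomial_density.
Context (R : realType).
Local Notation gam := (normal_prob (0 : R) 1).

Lemma intg_horner (s : R) (p : {poly R}) : 0 < s -> intg (normal_prob 0 s) (horner p).
Proof.
move=> s0.
suff : intg (normal_prob 0 s) (fun x : R => \sum_(i < size p) p`_i * x ^+ i).
  by apply: eq_intg => x; rewrite horner_coef.
by apply: intg_sum => i; apply: intgZ; exact: intg_moment.
Qed.

Lemma measurable_horner (p : {poly R}) : measurable_fun setT (horner p).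
Proof. exact: (intg_meas (intg_horner p ltr01)). Qed.

Lemma sqintg_horner (p : {poly R}) : sqintg gam (horner p).
Proof.
split; first exact: measurable_horner.
by apply: eq_intg (intg_horner (p ^+ 2) ltr01) => x; rewrite horner_exp.
Qed.

Definition poly_closure (f : R -> R) :=
  sqintg gam f /\ forall e, 0 < e -> exists p : {poly R}, msq gam (fun x => f x - p.[x]) <= e.

Lemma poly_closure_poly p : poly_closure (horner p).
Proof.
split=> [|e e0]; first exact: sqintg_horner.
exists p; rewrite /msq Int_eq0 ?ltW// => x.
by rewrite subrr expr0n.
Qed.

Lemma eq_poly_closure f g : f =1 g -> poly_closure f -> poly_closure g.
Proof. by move=> /funext ->. Qed.

Lemma poly_closureD f g : poly_closure f -> poly_closure g ->
  poly_closure (fun x => f x + g x).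
Proof.
move=> [sf hf] [sg hg]; split=> [|e e0]; first exact: sqintgD.
have e4 : 0 < e / 4 by rewrite divr_gt0.
have [p hp] := hf _ e4; have [q hq] := hg _ e4; exists (p + q).
have := msqD_le (sqintgB sf (sqintg_horner p)) (sqintgB sg (sqintg_horner q)).
rewrite (_ : (fun x => f x - p.[x] + (g x - q.[x])) =
   (fun x => f x + g x - (p + q).[x])); last first.
  by apply/funext => x; rewrite hornerD; ring.
by move/le_trans; apply; lra.
Qed.

Lemma poly_closureZ c f : poly_closure f -> poly_closure (fun x => c * f x).
Proof.
move=> [sf hf]; split=> [|e e0]; first exact: sqintgZ.
have c0 : 0 < 1 + c ^+ 2 by rewrite ltr_wpDr// sqr_ge0.
have [p hp] := hf (e / (1 + c ^+ 2)) (divr_gt0 e0 c0); exists (c *: p).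
rewrite (_ : (fun x => _) = (fun x => c * (f x - p.[x]))); last first.
  by apply/funext => x; rewrite hornerZ mulrBr.
rewrite msqZ; last exact: sqintgB sf (sqintg_horner p).
apply: (@le_trans _ _ ((1 + c ^+ 2) * (e / (1 + c ^+ 2)))); last first.
  by rewrite mulrC divfK// gt_eqF.
by apply: ler_pM => //; [exact: sqr_ge0|exact: msq_ge0|lra].
Qed.

Lemma poly_closureB f g : poly_closure f -> poly_closure g ->
  poly_closure (fun x => f x - g x).
Proof.
move=> hf hg; apply: eq_poly_closure (poly_closureD hf (poly_closureZ (-1) hg)) => x.
by rewrite mulN1r.
Qed.

Lemma poly_closure_sum I (s : seq I) (F : I -> R -> R) :
  (forall i, poly_closure (F i)) -> poly_closure (fun x => \sum_(i <- s) F i x).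
Proof.
move=> h; elim: s => [|i s ih].
  by apply: eq_poly_closure (poly_closure_poly 0) => x; rewrite big_nil horner0.
by apply: eq_poly_closure (poly_closureD (h i) ih) => x; rewrite big_cons.
Qed.

Lemma poly_closure_lim f : sqintg gam f ->
  (forall e, 0 < e -> exists2 g, poly_closure g & msq gam (fun x => f x - g x) <= e) ->
  poly_closure f.
Proof.
move=> sf h; split=> // e e0; have e4 : 0 < e / 4 by rewrite divr_gt0.
have [g [sg hg] fg] := h _ e4; have [p hp] := hg _ e4; exists p.
by apply: le_trans (msqB_le sf sg (sqintg_horner p)) _; lra.
Qed.

Lemma moment2_step (n : nat) :
  \int[gam]_x (x ^+ n.+2) = n.+1%:R * \int[gam]_x (x ^+ n).
Proof. by rewrite moment_recursion// expr1n mul1r. Qed.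

Lemma even_moment_le (n : nat) : \int[gam]_x (x ^+ n.*2) <= 2 ^+ n * n`!%:R.
Proof.
elim: n => [|n ih].
  by rewrite double0 expr0 fact0 mulr1 [leLHS](Int_prob_cst gam).
rewrite doubleS moment2_step.
have : n.*2.+1%:R * \int[gam]_x (x ^+ n.*2) <= (2 * n.+1%:R) * (2 ^+ n * n`!%:R).
  apply: ler_pM => //.
  - by apply: Int_ge0 => x; rewrite -mul2n exprM exprn_ge0// sqr_ge0.
  - by rewrite -natrM ler_nat mul2n doubleS ltnW.
move/le_trans; apply; rewrite factS natrM exprS.
by rewrite le_eqVlt; apply/orP; left; apply/eqP; ring.
Qed.

(** The square of the Taylor error of order [N] is at most [(a x)^(2 N) / N!^2], and the moment of
    order [2 N] is at most [2^N N!]. What remains is a term of the series of [exp (2 a^2)], which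
    tends to 0. *)
Lemma poly_closure_cos (a b : R) : poly_closure (fun x => cos (a * x + b)).
Proof.
have mc : measurable_fun setT (fun x : R => cos (a * x + b)).
  apply: continuous_measurable_fun => x.
  exact: dv_continuous (dv_affine (is_derive_cos _)).
have sc : sqintg gam (fun x => cos (a * x + b)).
  apply: (@sqintg_le _ _ _ _ _ (cst 1)) => //.
    by move=> x; have := cos2Dsin2 (a * x + b); have := sqr_ge0 (sin (a * x + b)); rewrite /=; lra.
  exact: finite_measure_integrable_cst.
split=> // e e0.
have bnd N : exists p : {poly R}, msq gam (fun x => cos (a * x + b) - p.[x]) <=
    exp_coeff (2 * a ^+ 2) N.
  have [p hp] := cos_taylor N b; exists (p \Po (a *: 'X)).
  have pE x : (p \Po (a *: 'X)).[x] = p.[a * x] by rewrite horner_comp hornerZ hornerX.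
  pose C := a ^+ N.*2 / N`!%:R ^+ 2.
  apply: (@le_trans _ _ (\int[gam]_x (C * x ^+ N.*2))).
    apply: le_Int.
    - exact: (sqintgB sc (sqintg_horner _)).2.
    - by apply: intgZ; exact: intg_moment.
    move=> x; rewrite pE -(real_normK (num_real (cos _ - _))).
    have := hp (a * x); rewrite -(@ler_pXn2r _ 2)// ?nnegrE ?divr_ge0//.
    move/le_trans; apply; rewrite expr_div_n -exprM muln2 -mul2n !exprM real_normK ?num_real//.
    by rewrite (exprMn 2 a x) (exprMn N (a ^+ 2)) /C -(exprM a) mul2n mulrAC.
  rewrite IntZ; last exact: intg_moment.
  have C0 : 0 <= C by rewrite divr_ge0 ?sqr_ge0// -mul2n exprM exprn_ge0 ?sqr_ge0.
  apply: le_trans (ler_wpM2l C0 (even_moment_le N)) _.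
  rewrite /exp_coeff /= /C le_eqVlt; apply/orP; left; apply/eqP.
  rewrite exprMn -exprM mul2n; field.
  by rewrite pnatr_eq0 -lt0n fact_gt0.
have [N hN] := cvg0_small (cvg_series_cvg_0 (is_cvg_series_exp_coeff (2 * a ^+ 2))) e0.
by have [p hp] := bnd N; exists p; exact: le_trans hN.
Qed.

Definition trig (s : seq (R * R * R)) x := \sum_(t <- s) t.1.1 * cos (t.1.2 * x + t.2).

Definition is_trig (f : R -> R) := exists s, f =1 trig s.

Lemma is_trig_closure f : is_trig f -> poly_closure f.
Proof.
move=> [s fs]; apply: (@eq_poly_closure (trig s)) => [x|]; first by rewrite fs.
by apply: poly_closure_sum => t; apply: poly_closureZ; exact: poly_closure_cos.
Qed.

Lemma is_trigD f g : is_trig f -> is_trig g -> is_trig (fun x => f x + g x).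
Proof. by move=> [s fs] [t gt]; exists (s ++ t) => x; rewrite /trig big_cat fs gt. Qed.

Lemma is_trig_cos c a b : is_trig (fun x => c * cos (a * x + b)).
Proof. by exists [:: (c, a, b)] => x; rewrite /trig big_seq1. Qed.

Lemma eq_is_trig f g : f =1 g -> is_trig f -> is_trig g.
Proof. by move=> /funext ->. Qed.

Lemma is_trig_cst c : is_trig (fun=> c).
Proof.
by apply: eq_is_trig (is_trig_cos c 0 0) => x; rewrite mul0r addr0 cos0 mulr1.
Qed.

Lemma is_trig_sum I (s : seq I) (F : I -> R -> R) :
  (forall i, is_trig (F i)) -> is_trig (fun x => \sum_(i <- s) F i x).
Proof.
move=> h; elim: s => [|i s ih].
  by apply: eq_is_trig (is_trig_cst 0) => x; rewrite big_nil.
by apply: eq_is_trig (is_trigD (h i) ih) => x; rewrite big_cons.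
Qed.

(** Product-to-sum formula. Thanks to the phases, cosines alone span an algebra, in which
    polynomials such as [steep] can be evaluated. *)
Lemma is_trigM f g : is_trig f -> is_trig g -> is_trig (fun x => f x * g x).
Proof.
move=> [s fs] [t gt].
apply: (@eq_is_trig (fun x => \sum_(i <- s) \sum_(j <- t)
   (i.1.1 * cos (i.1.2 * x + i.2)) * (j.1.1 * cos (j.1.2 * x + j.2)))).
  move=> x; rewrite fs gt /trig mulr_suml; apply: eq_bigr => i _.
  by rewrite mulr_sumr.
apply: is_trig_sum => -[[c a] b]; apply: is_trig_sum => -[[c' a'] b'] /=.
have h := is_trigD (is_trig_cos (c * c' / 2) (a + a') (b + b'))
                   (is_trig_cos (c * c' / 2) (a - a') (b - b')).
apply: eq_is_trig h => x.
rewrite (_ : (a + a') * x + (b + b') = (a * x + b) + (a' * x + b')); last by ring.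
rewrite (_ : (a - a') * x + (b - b') = (a * x + b) - (a' * x + b')); last by ring.
by rewrite cosD cosB; field.
Qed.

Lemma is_trigX f n : is_trig f -> is_trig (fun x => f x ^+ n).
Proof.
move=> h; elim: n => [|n ih]; first by apply: eq_is_trig (is_trig_cst 1) => x; rewrite expr0.
by apply: eq_is_trig (is_trigM h ih) => x; rewrite exprS.
Qed.

(* [(1 - u^n)^(2^n) >= 1 - (2 u)^n], so this tends to 1 for [0 <= u < 1/2]; it tends
   to 0 for [1/2 < u <= 1]. *)
Definition steep (n : nat) (u : R) := (1 - u ^+ n) ^+ (2 ^ n).

Lemma is_trig_steep n f : is_trig f -> is_trig (fun x => steep n (f x)).
Proof.
move=> h; apply: is_trigX; apply: is_trigD (is_trig_cst 1) _.
by apply: eq_is_trig (is_trigM (is_trig_cst (-1)) (is_trigX n h)) => x; rewrite mulN1r.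
Qed.

Lemma bernoulli_ineq (t : R) n : -1 <= t -> 1 + n%:R * t <= (1 + t) ^+ n.
Proof.
move=> t1; elim: n => [|n ih]; first by rewrite mul0r addr0 expr0.
rewrite exprS; apply: (@le_trans _ _ ((1 + t) * (1 + n%:R * t))).
  have : 0 <= n%:R * t ^+ 2 by rewrite mulr_ge0 ?sqr_ge0.
  by rewrite -natr1; lra.
by rewrite ler_wpM2l//; lra.
Qed.

Lemma steep_bounds n u : 0 <= u <= 1 -> 0 <= steep n u <= 1.
Proof.
move=> /andP[u0 u1]; have h : 0 <= 1 - u ^+ n <= 1.
  by rewrite subr_ge0 exprn_ile1//= gerBl exprn_ge0.
by case/andP: h => h1 h2; rewrite /steep exprn_ge0//= exprn_ile1.
Qed.

Lemma cvg_steep1 u : 0 <= u < 2^-1 -> steep n u @[n --> \oo] --> (1 : R).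
Proof.
move=> /andP[u0 u1].
apply: (@squeeze_cvgr _ _ _ _ (fun n => 1 - 1 * (2 * u) ^+ n) (cst 1)).
- apply: nearW => n; have /andP[_ ->] : 0 <= steep n u <= 1.
    by apply: steep_bounds; rewrite u0/=; lra.
  rewrite andbT mul1r exprMn -natrX.
  have un : u ^+ n <= 1 by rewrite exprn_ile1//; lra.
  have := @bernoulli_ineq (- u ^+ n) (2 ^ n)%N; rewrite mulrN; apply; lra.
- rewrite -[X in _ --> X](subr0 1); apply: cvgB; first exact: cvg_cst.
  by apply: cvg_geometric; rewrite ger0_norm; lra.
- exact: cvg_cst.
Qed.

(** Multiplying by [(1 + u^n)^(2^n)], which is at least [(2 u)^n] by Bernoulli, gives
    [(1 - u^(2 n))^(2^n) <= 1]. *)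
Lemma cvg_steep0 u : 2^-1 < u <= 1 -> steep n u @[n --> \oo] --> (0 : R).
Proof.
move=> /andP[u0 u1].
apply: (@squeeze_cvgr _ _ _ _ (cst 0) (fun n => 1 * ((2 * u)^-1) ^+ n)).
- apply: nearW => n; have /andP[-> _] : 0 <= steep n u <= 1.
    by apply: steep_bounds; rewrite u1/=; lra.
  rewrite mul1r /= exprVn.
  have p0 : 0 < (2 * u) ^+ n by rewrite exprn_gt0//; lra.
  rewrite -[leRHS]mul1r ler_pdivlMr//.
  have un0 : 0 <= u ^+ n by rewrite exprn_ge0//; lra.
  have un1 : u ^+ n <= 1 by rewrite exprn_ile1//; lra.
  have s0 : 0 <= steep n u by rewrite exprn_ge0// subr_ge0.
  apply: (@le_trans _ _ (steep n u * (1 + u ^+ n) ^+ (2 ^ n))).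
    rewrite ler_wpM2l//; apply: le_trans (@bernoulli_ineq (u ^+ n) (2 ^ n)%N _); last by lra.
    by rewrite exprMn -natrX; lra.
  rewrite /steep -exprMn exprn_ile1//.
    by rewrite mulr_ge0//; lra.
  have := sqr_ge0 (u ^+ n); lra.
- exact: cvg_cst.
- by apply: cvg_geometric; rewrite ger0_norm ?invr_ge0 ?invf_lt1; lra.
Qed.

End polynomial_density.

(** * From rays to all square-integrable functions *)

Section polynomial_density_all.
Context (R : realType).
Local Notation gam := (normal_prob (0 : R) 1).

Lemma sqintg_bounded d (T : measurableType d) (P : probability T R) (f : T -> R) (c : R) :
  measurable_fun setT f -> (forall x, `|f x| <= c) -> sqintg P f.
Proof.
move=> mf hf; apply: (@sqintg_le _ _ _ _ _ (cst (c ^+ 2))) => //; last first.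
  exact: finite_measure_integrable_cst.
move=> x; rewrite -(real_normK (num_real _)) ler_pXn2r ?nnegrE//.
exact: le_trans (hf x).
Qed.

Lemma poly_closure_dct (f_ : nat -> R -> R) (f : R -> R) (g : R -> R) :
  (forall n, poly_closure (f_ n)) -> sqintg gam f ->
  (forall n x, (f_ n x - f x) ^+ 2 <= g x) -> intg gam g ->
  {ae gam, forall x, f_ n x @[n --> \oo] --> f x} -> poly_closure f.
Proof.
move=> hf_ sf hg ig hc; apply: poly_closure_lim => // e e0.
have [n hn] := cvg0_small (msq_dct (fun n => (hf_ n).1.1) sf.1 hg ig hc) e0.
by exists (f_ n) => //; rewrite msqC.
Qed.

Lemma ae_neq_point (a : R) : {ae gam, forall x, x != a}.
Proof.
exists [set a]; split => //.
  by rewrite /= /normal_prob integral_set1.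
by move=> x /= /negP; rewrite negbK => /eqP.
Qed.

(** A periodic function cannot follow a ray on the whole line. On the window [|x - a| < L] the sign
    of [sin ((x - a) / L)] is that of [x - a], so [steep n (u x)] tends to the indicator; outside,
    the squared error is at most 1, hence at most [((x - a) / L)^2], as in Chebyshev's
    inequality. *)
Lemma poly_closure_ray (a : R) : poly_closure (\1_`]a, +oo[ : R -> R).
Proof.
have mi : measurable_fun setT (\1_`]a, +oo[ : R -> R) by exact: measurable_indic.
have b1 (x : R) : 0 <= (\1_`]a, +oo[ : R -> R) x <= 1.
  by rewrite indicE; case: (_ \in _); rewrite /= ?lexx ?ler01.
have si : sqintg gam (\1_`]a, +oo[ : R -> R).
  apply: (@sqintg_bounded _ _ _ _ 1) => // x; have := b1 x; case/andP => h0 h1.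
  by rewrite ger0_norm.
apply: poly_closure_lim => // e e0.
pose K := msq gam (fun x => ('X - a%:P).[x]).
have K0 : 0 <= K := msq_ge0 _ _.
(* With this width, [K / L^2 <= e / 2], where [K] is the second moment about [a]. *)
pose L : R := 1 + 2 * K / e.
have L1 : 1 <= L by rewrite lerDl; apply: divr_ge0; [apply: mulr_ge0|exact: ltW].
have L0 : 0 < L by exact: lt_le_trans L1.
pose u x : R := 2^-1 + (- 2^-1) * cos (L^-1 * x + (- (a / L) - pi / 2)).
have uE x : u x = (1 - sin ((x - a) / L)) / 2.
  rewrite /u -cosBpihalf (_ : (x - a) / L - pi / 2 = L^-1 * x + (- (a / L) - pi / 2)); first by field.
  by field; rewrite gt_eqF.
have u01 x : 0 <= u x <= 1.
  rewrite uE; have := sin_geN1 ((x - a) / L); have := sin_le1 ((x - a) / L); lra.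
have tu : is_trig u by apply: is_trigD; [exact: is_trig_cst|exact: is_trig_cos].
pose q n x := steep n (u x).
have vq n : poly_closure (q n) by apply: is_trig_closure; exact: is_trig_steep.
have qb n x : 0 <= q n x <= 1 by exact: steep_bounds.
have dqb n x : (q n x - \1_`]a, +oo[ x) ^+ 2 <= 1.
  rewrite -(expr1n _ 2) -(real_normK (num_real (_ - _))) ler_pXn2r ?nnegrE// ler_norml.
  by have := qb n x; have := b1 x; lra.
pose W : set R := [set x | `|x - a| < L].
have mW : measurable W.
  rewrite (_ : W = `]a - L, a + L[%classic); first exact: measurable_itv.
  apply/seteqP; split => x; rewrite /W /= in_itv /= ltr_norml; lra.
have mh n : measurable_fun setT (fun x => (q n x - \1_`]a, +oo[ x) * \1_W x).
  apply: measurable_funM; last exact: measurable_indic.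
  by apply: measurable_funB => //; exact: (vq n).1.1.
have key (x : R) : x != a ->
    (q n x - \1_`]a, +oo[ x) * \1_W x @[n --> \oo] --> (0 : R).
  move=> xa.
  rewrite [\1_W x]indicE; have [/set_mem xW|_] := boolP (x \in W); last first.
    by under eq_fun do rewrite mulr0; exact: cvg_cst.
  under eq_fun do rewrite mulr1.
  have xL : `|(x - a) / L| < 1.
    by rewrite normrM normfV (gtr0_norm L0) ltr_pdivrMr// mul1r.
  have pi2 := pi_ge2 R.
  have [xlta|] := ltP x a.
    have -> : (\1_`]a, +oo[ : R -> R) x = 0.
      by rewrite indicE memNset//= in_itv/= andbT; apply/negP; rewrite -leNgt ltW.
    under eq_fun do rewrite subr0.
    apply: cvg_steep0; rewrite (andP (u01 x)).2 andbT uE.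
    have : 0 < sin (- ((x - a) / L)).
      apply: sin_gt0_pi; rewrite -mulNr opprB divr_gt0 ?subr_gt0//=.
      apply: lt_le_trans (_ : 1 <= _); last by lra.
      by move: xL; rewrite -normrN -mulNr opprB; apply: le_lt_trans; exact: ler_norm.
    by rewrite sinN; lra.
  rewrite le_eqVlt eq_sym (negbTE xa) /= => agtx.
  have -> : (\1_`]a, +oo[ : R -> R) x = 1.
    by rewrite indicE mem_set//= in_itv/= andbT.
  rewrite -(subrr (1 : R)); apply: cvgB; last exact: cvg_cst.
  apply: cvg_steep1; rewrite (andP (u01 x)).1/= uE.
  have : 0 < sin ((x - a) / L).
    apply: sin_gt0_pi; rewrite divr_gt0 ?subr_gt0//=.
    apply: lt_le_trans (_ : 1 <= _); last by lra.
    by apply: le_lt_trans xL; exact: ler_norm.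
  lra.
have h0 : msq gam (fun x => (q n x - \1_`]a, +oo[ x) * \1_W x - 0) @[n --> \oo] --> (0 : R).
  apply: (@msq_dct _ _ _ _ _ _ (cst 1)) => //.
  - move=> n x; rewrite subr0 exprMn -[leRHS](mulr1 1).
    apply: ler_pM; [exact: sqr_ge0|exact: sqr_ge0|exact: dqb|].
    by rewrite indicE; case: (_ \in _); rewrite /= ?expr1n ?expr0n.
  - exact: finite_measure_integrable_cst.
  have := ae_neq_point a.
  by apply: (@filterS _ _ (ae_filter_ringOfSetsType gam)) => x; exact: key.
have e2 : 0 < e / 2 by lra.
have [n hn] := cvg0_small h0 e2; exists (q n) => //; rewrite msqC.
have s1 : sqintg gam (fun x => (q n x - \1_`]a, +oo[ x) * \1_W x - 0).
  apply: (@sqintg_bounded _ _ _ _ 1) => //.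
    by apply: measurable_funB; [exact: mh|exact: measurable_cst].
  move=> x; rewrite subr0 normrM -[leRHS](mulr1 1) ler_pM//.
    by rewrite ler_norml; have := qb n x; have := b1 x; lra.
  by rewrite indicE; case: (_ \in _); rewrite /= ?normr1 ?normr0.
apply: (@le_trans _ _ (\int[gam]_x (((q n x - \1_`]a, +oo[ x) * \1_W x - 0) ^+ 2 +
     L^-1 ^+ 2 * ('X - a%:P).[x] ^+ 2))).
  apply: le_Int.
  - exact: (sqintgB (vq n).1 si).2.
  - by apply: intgD; [exact: s1.2|apply: intgZ; exact: (sqintg_horner _).2].
  move=> x; rewrite subr0 hornerXsubC [\1_W x]indicE; have [/set_mem xW|] := boolP (x \in W).
    by rewrite mulr1 lerDl mulr_ge0 ?sqr_ge0.
  rewrite notin_setE /W /= => /negP; rewrite -leNgt => xW.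
  rewrite mulr0 expr0n add0r; apply: le_trans (dqb n x) _.
  rewrite -exprMn -(expr1n _ 2) -(real_normK (num_real (_ * _))) ler_pXn2r ?nnegrE//.
  by rewrite normrM normfV (gtr0_norm L0) mulrC ler_pdivlMr// mul1r.
rewrite IntD; last 2 first.
- exact: s1.2.
- by apply: intgZ; exact: (sqintg_horner _).2.
rewrite IntZ; last exact: (sqintg_horner _).2.
have hK : L^-1 ^+ 2 * K <= e / 2.
  rewrite exprVn mulrC ler_pdivrMr ?exprn_gt0//.
  have eL : e * L = e + 2 * K by rewrite /L; field; rewrite gt_eqF.
  have : e * L <= e * L ^+ 2 by rewrite ler_pM2l// expr2 ler_pMr.
  by lra.
have -> : e = e / 2 + e / 2 by field.
exact: lerD.
Qed.

(** Open rays form a system stable under intersection that generates the Borel sets; complements and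
    disjoint unions stay in the closure, the latter by dominated convergence. *)
Lemma poly_closure_indic (A : set R) : measurable A -> poly_closure (\1_A : R -> R).
Proof.
move=> mA.
have G1 : (measurable : set (set R)) = <<s @RGenOInfty.G R >> by exact: RGenOInfty.measurableE.
have sA1 (B : set R) : measurable B -> sqintg gam (\1_B : R -> R).
  move=> mB; apply: (@sqintg_bounded _ _ _ _ 1); first exact: measurable_indic.
  by move=> x; rewrite indicE; case: (_ \in _); rewrite /= ?normr1 ?normr0.
have one : poly_closure (fun=> 1 : R).
  by apply: eq_poly_closure (poly_closure_poly 1) => x; rewrite hornerE.
apply: (@dynkin_induction _ R (@RGenOInfty.G R) (fun B => poly_closure (\1_B : R -> R))) => //.
- move=> _ _ [x ->] [y ->]; exists (Num.max x y).
  apply/seteqP; split => z /=; rewrite !in_itv/= !andbT gt_max; first by case=> -> ->.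
  by move/andP.
- by apply: eq_poly_closure one => x; rewrite indicE in_setT.
- by move=> _ [x ->]; exact: poly_closure_ray.
- move=> S mS hS; apply: eq_poly_closure (poly_closureB one hS) => x.
  by rewrite !indicE in_setC; case: (_ \in _); rewrite /= ?subrr ?subr0.
- move=> F mF tF hF.
  have mU : measurable (\bigcup_k F k) by exact: bigcup_measurable.
  have sumE n x : \sum_(k < n) (\1_(F k) x : R) = \1_(\big[setU/set0]_(k < n) F k) x.
    elim: n => [|n ih]; first by rewrite !big_ord0 indic0.
    rewrite !big_ord_recr /= ih !indicE in_setU.
    have [h1|] := boolP (x \in \big[setU/set0]_(k < n) F k);
      have [h2|] := boolP (x \in F n); rewrite /= ?addr0 ?add0r//.
    move/set_mem : h1; rewrite -bigcup_mkord => -[k /= kn Fk].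
    move/set_mem : h2 => Fn.
    have := tF k n I I; rewrite setIC => /(_ _) knE.
    by exfalso; move: kn; rewrite knE ?ltnn//; exists x.
  apply: (@poly_closure_dct (fun n x => \sum_(k < n) \1_(F k) x) _ (cst 1)) => //.
  - by move=> n; apply: poly_closure_sum.
  - exact: sA1.
  - move=> n x; rewrite sumE !indicE.
    by case: (x \in _); case: (x \in _) => /=; rewrite ?subrr ?subr0 ?sub0r ?sqrrN ?expr1n ?expr0n.
  - exact: finite_measure_integrable_cst.
  apply: aeW => x; apply: cvg_near_cst.
  have [/set_mem[k _ Fk]|nF] := boolP (x \in \bigcup_k F k).
    exists k.+1 => // n /= kn; rewrite sumE !indicE !mem_set//.
      by exists k.
    by rewrite -bigcup_mkord; exists k.
  apply: nearW => n; rewrite sumE !indicE (negbTE nF) memNset//.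
  rewrite -bigcup_mkord => -[k _ Fk]; move/negP: nF; apply; apply/mem_set.
  by exists k.
- by rewrite -G1.
Qed.

Import HBNNSimple.

Lemma poly_closure_ge0 (f : R -> R) : sqintg gam f -> (forall x, 0 <= f x) -> poly_closure f.
Proof.
move=> sf f0.
have mfe : measurable_fun setT (EFin \o f) by apply/measurable_EFinP; exact: sf.1.
pose h := nnsfun_approx measurableT mfe.
have hle n x : h n x <= f x.
  rewrite -lee_fin /h nnsfun_approxE.
  by apply: (le_approx (f := EFin \o f)) => // y _; rewrite lee_fin.
have hv n : poly_closure (h n).
  suff : poly_closure (fun x : R => \sum_(y <- finmap.enum_fset (fset_set (range (h n))))
     (y : R) * \1_(h n @^-1` [set y]) x).
    by apply: eq_poly_closure => x; rewrite [RHS]fimfunE fsbig_finite//=.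
  apply: poly_closure_sum => y; apply: poly_closureZ; apply: poly_closure_indic.
  exact: measurable_sfunP.
apply: (@poly_closure_dct h f (fun x => f x ^+ 2)) => //.
- move=> n x; rewrite -[leLHS]sqrrN opprB ler_pXn2r ?nnegrE ?subr_ge0//.
  by rewrite gerBl.
- exact: sf.2.
apply: aeW => x.
have hc : (h n x)%:E @[n --> \oo] --> (f x)%:E.
  by apply: cvg_nnsfun_approx => // y _; rewrite lee_fin.
exact: (fine_cvg hc).
Qed.

Theorem poly_dense (f : R -> R) : sqintg gam f ->
  forall e, 0 < e -> exists p : {poly R}, msq gam (fun x => f x - p.[x]) <= e.
Proof.
move=> sf; suff [] : poly_closure f by [].
have mf := sf.1.
have part (g : R -> R) : measurable_fun setT g ->
   (forall x, 0 <= g x <= `|f x|) -> poly_closure g.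
  move=> mg hg; apply: poly_closure_ge0; last by move=> x; have /andP[] := hg x.
  apply: (@sqintg_le _ _ R (normal_prob 0 1) g _ mg _ sf.2).
  move=> x; have /andP[g0 gf] := hg x.
  by rewrite -(real_normK (num_real (f x))) ler_pXn2r ?nnegrE.
have mx := @measurable_maxr _ _ R setT.
have h1 : poly_closure (fun x => Num.max (f x) 0).
  apply: part; first exact: mx.
  by move=> x; rewrite le_max lexx orbT ge_max ler_norm normr_ge0.
have h2 : poly_closure (fun x => Num.max (- f x) 0).
  apply: part; first by apply: mx => //; exact: measurableT_comp.
  by move=> x; rewrite le_max lexx orbT ge_max -normrN ler_norm normr_ge0.
apply: eq_poly_closure (poly_closureB h1 h2) => x.
by case: (lerP (f x) 0) => h; [rewrite max_l|rewrite max_r]; lra.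
Qed.

End polynomial_density_all.

(** * Wick powers and correlation bounds *)

Section hermite_variance.
Context (R : comNzRingType).

(* [He v k] at a centered Gaussian variable of variance [v] is its [k]-th Wick power. *)
Fixpoint He (v : R) (n : nat) : {poly R} :=
  if n is m.+1 then 'X * He v m - v *: (He v m)^`() else 1.

Lemma deriv_He v n : (He v n)^`() = n%:R *: He v n.-1.
Proof.
elim: n => [|n ih]; first by rewrite derivC scale0r.
rewrite /= derivB derivM derivX mul1r derivZ.
case: n ih => [|n] ih.
  by rewrite ih !scale0r mulr0 deriv0 scaler0 subr0 addr0 scale1r.
rewrite ih derivZ -scalerAr scalerA (mulrC v) -scalerA /=.
by rewrite -[in RHS]natr1 scalerDl scale1r scalerBr -addrA addrC.
Qed.

(** Here [e j] stands for the moment of order [2 j] of a centered Gaussian variable of variance [v],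
    which turns the recursion into the explicit sum that defines Wick powers. The step is Pascal's
    rule together with [(k - 2 j) C(k, 2 j) = (2 j + 1) C(k, 2 j + 1)]. *)
Lemma He_moments (v : R) (e : nat -> R) : e 0%N = 1 ->
  (forall j, e j.+1 = j.*2.+1%:R * v * e j) -> forall k,
  He v k = \sum_(j < k.+1) ((-1) ^+ j * 'C(k, j.*2)%:R * e j) *: 'X^(k - j.*2).
Proof.
move=> e0 eS; elim=> [|k ih].
  by rewrite big_ord1 /= expr0 mul1r mul1r e0 scale1r expr0.
rewrite /= {}ih; set S := \sum_(j < k.+1) _.
have -> : 'X * S = \sum_(j < k.+2) ((-1) ^+ j * 'C(k, j.*2)%:R * e j) *: 'X^(k.+1 - j.*2).
  rewrite /S [RHS]big_ord_recr /= bin_small ?mulr0 ?mul0r ?scale0r ?addr0; last first.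
    by rewrite -addnn ltn_addr.
  rewrite mulr_sumr; apply: eq_bigr => j _; rewrite -scalerAr.
  have [jk|kj] := leqP j.*2 k; first by rewrite -exprS subSn.
  by rewrite bin_small// mulr0 mul0r !scale0r.
have -> : v *: S^`() = - \sum_(j < k.+1)
   ((-1) ^+ j.+1 * ('C(k, j.*2.+1)%:R * e j.+1)) *: 'X^(k.+1 - j.+1.*2).
  rewrite /S raddf_sum scaler_sumr -sumrN; apply: eq_bigr => j _.
  rewrite /= derivZ derivXn -scaler_nat !scalerA -scaleNr.
  rewrite doubleS !subSS subnS; congr (_ *: _).
  rewrite eS exprS -!mulrA !mulN1r opprK.
  have := congr1 (fun n => n%:R : R) (mul_bin_left k j.*2).
  rewrite !natrM; move: (k - j.*2)%:R 'C(k, j.*2)%:R j.*2.+1%:R 'C(k, j.*2.+1)%:R.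
  move=> a b c g h; transitivity (v * (-1) ^+ j * e j * (a * b)); first by ring.
  by rewrite -h; ring.
rewrite opprK big_ord_recl [in RHS]big_ord_recl /= !bin0 -addrA; congr (_ + _).
rewrite -big_split /=; apply: eq_bigr => j _.
rewrite /bump /= add1n -scalerDl -mulrA -mulrDr -mulrDl.
by rewrite -[in RHS]mulrA !doubleS binS natrD.
Qed.

End hermite_variance.

(** * Gaussian integration by parts and Wick's formula *)

Section gaussian_pairs.
Context d (T : measurableType d) (R : realType) (P : probability T R).

(* Gaussianity is only used through the moments of linear combinations. *)
Definition gmom (X : T -> R) :=
  [/\ measurable_fun setT X, (forall n, intg P (fun w => X w ^+ n)),
      \int[P]_w X w = 0 &
      forall n, \int[P]_w (X w ^+ n.+2) = n.+1%:R * msq P X * \int[P]_w (X w ^+ n)].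

Lemma gmom_sqintgX X n : gmom X -> sqintg P (fun w => X w ^+ n).
Proof.
move=> [mX iX _ _]; split; first exact: measurable_funX.
by apply: eq_intg (iX (n * 2)%N) => w; rewrite exprM.
Qed.

Lemma gmom_sqintg X : gmom X -> sqintg P X.
Proof. by move=> /(gmom_sqintgX 1). Qed.

Definition gpair (U V : T -> R) := forall s t, gmom (fun w => s * U w + t * V w).

Lemma gpairC U V : gpair U V -> gpair V U.
Proof.
move=> h s t; rewrite (_ : (fun w => _) = (fun w => t * U w + s * V w)); first exact: h.
by apply/funext => w; rewrite addrC.
Qed.

Lemma gpair1 U V : gpair U V -> gmom U.
Proof.
move=> h; rewrite (_ : U = (fun w => 1 * U w + 0 * V w)); first exact: h.
by apply/funext => w; rewrite mul1r mul0r addr0.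
Qed.

Lemma gpair2 U V : gpair U V -> gmom V.
Proof. by move=> /gpairC/gpair1. Qed.

Section pair.
Context (U V : T -> R) (hUV : gpair U V).

Let gU : gmom U := gpair1 hUV.
Let gV : gmom V := gpair2 hUV.

Let v := msq P U.
Let u := msq P V.
Let c := \int[P]_w (U w * V w).

Let M i j := \int[P]_w (U w ^+ i * V w ^+ j).

Let iM i j : intg P (fun w => U w ^+ i * V w ^+ j).
Proof. by apply: sqintgM; exact: gmom_sqintgX. Qed.

(** The mixed moments of total degree [n] become the coefficients of one polynomial in [s], the
    moment of order [n] of [s U + V]. Gaussianity for all [s] is then an identity between
    polynomials. *)
Let A n : {poly R} := \poly_(i < n.+1) (M i (n - i) *+ 'C(n, i)).

Let AE n s : (A n).[s] = \int[P]_w ((s * U w + V w) ^+ n).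
Proof.
rewrite horner_poly.
rewrite (_ : \int[P]_w _ = \int[P]_w (\sum_(i < n.+1)
    ('C(n, i)%:R * s ^+ i) * (U w ^+ i * V w ^+ (n - i)))); last first.
  apply: eq_Rintegral => w _; rewrite addrC exprDn; apply: eq_bigr => i _.
  by rewrite exprMn -mulr_natl; ring.
rewrite Int_sum; last by move=> i; exact: intgZ.
apply: eq_bigr => i _; rewrite IntZ// -/(M _ _) -[M _ _ *+ _]mulr_natl; ring.
Qed.

Let Q : {poly R} := v *: 'X^2 + (2 * c) *: 'X + u%:P.

Let QE s : Q.[s] = msq P (fun w => s * U w + V w).
Proof.
rewrite msqD; [|exact: sqintgZ (gmom_sqintg gU)|exact: gmom_sqintg gV].
rewrite msqZ; last exact: gmom_sqintg gU.
rewrite (_ : \int[P]_w (s * U w * V w) = s * c); last first.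
  rewrite -IntZ; last exact: sqintgM (gmom_sqintg gU) (gmom_sqintg gV).
  by apply: eq_Rintegral => w _; rewrite mulrA.
by rewrite /Q !hornerD !hornerZ hornerX hornerXn hornerC /v /u; ring.
Qed.

Let eq_polyR (p q : {poly R}) : (forall x, p.[x] = q.[x]) -> p = q.
Proof.
move=> h; apply/eqP; rewrite -subr_eq0; apply: contraT => nz.
have := @max_poly_roots R (p - q) [seq i%:R | i <- iota 0 (size (p - q))] nz.
rewrite size_map size_iota ltnn => -> //.
  by apply/allP => x _; rewrite rootE hornerD hornerN h subrr.
rewrite map_inj_uniq ?iota_uniq//; exact: (@mulrIn R 1 (oner_neq0 R)).
Qed.

Let gs s : gmom (fun w => s * U w + V w).
Proof.
rewrite (_ : (fun w => _) = (fun w => s * U w + 1 * V w)); first exact: hUV.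
by apply/funext => w; rewrite mul1r.
Qed.

Let A0 : A 0 = 1.
Proof. by apply: eq_polyR => s; rewrite AE hornerE [LHS]Int_prob_cst. Qed.

Let A1 : A 1 = 0.
Proof. by apply: eq_polyR => s; rewrite AE hornerE; case: (gs s). Qed.

Let AS n : A n.+2 = n.+1%:R *: (Q * A n).
Proof.
apply: eq_polyR => s; rewrite hornerZ hornerM !AE QE mulrA.
by case: (gs s) => _ _ _ ->.
Qed.

(** [A n] behaves like a multiple of [Q^(n / 2)]: the relation [(A m)' Q = m (v X + c) A m]
    propagates from [m] to [m + 2], since [Q' = 2 (v X + c)], and it simplifies the derivative of
    [Q A n]. *)
Let dA n : (A n.+2)^`() = (n.+1%:R * n.+2%:R) *: ((v *: 'X + c%:P) * A n).
Proof.
have dQ : Q^`() = 2 *: (v *: 'X + c%:P).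
  rewrite /Q !derivD !derivZ derivXn derivX derivC addr0 expr1 scalerDr -mulr_natl.
  by rewrite -!mul_polyC -?polyC_natr !polyCM mulr1; ring.
have gen m : A m.+2 = m.+1%:R *: (Q * A m) -> (A m)^`() * Q = m%:R *: ((v *: 'X + c%:P) * A m) ->
    (A m.+2)^`() = (m.+1%:R * m.+2%:R) *: ((v *: 'X + c%:P) * A m).
  move=> e h; rewrite e derivZ derivM dQ [Q * _]mulrC h -scalerAl -scalerDl scalerA.
  by rewrite -natrD addnC addn2.
suff h m : (A m)^`() * Q = m%:R *: ((v *: 'X + c%:P) * A m) by apply: gen.
have [k] := ubnP m; elim: k m => // k ih [|[|m]] mk.
- by rewrite A0 derivC mul0r scale0r.
- by rewrite A1 deriv0 mul0r mulr0 scaler0.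
rewrite (gen m (AS m) (ih m _)); last by rewrite ltnS in mk; apply: leq_trans mk.
rewrite AS -scalerAl -scalerAr scalerA; congr (_ *: _); first by rewrite mulrC.
by rewrite -mulrA [A m * _]mulrC.
Qed.

(** This is the coefficient of [X^i] in [dA], once the binomial factors are matched. *)
Let stein_mon i j : M i.+1 j = i%:R * v * M i.-1 j + j%:R * c * M i j.-1.
Proof.
case e : (i + j)%N => [|n].
  move/eqP : e; rewrite addn_eq0 => /andP[/eqP-> /eqP->]; rewrite !mul0r addr0.
  rewrite /M (_ : \int[P]_w _ = \int[P]_w U w); first by case: gU.
  by apply: eq_Rintegral => w _; rewrite expr1 expr0 mulr1.
have := congr1 (fun p : {poly R} => p`_i) (dA n).
have ej : j = (n.+1 - i)%N by rewrite -e addnC addnK.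
have iln : (i < n.+2)%N by rewrite ltnS -e leq_addr.
rewrite coef_deriv coef_poly ltnS iln subSS -ej.
rewrite coefZ [(_ *: _ + _) * _]mulrDl coefD -[v *: _ * _]scalerAl coefZ coefXM coefCM !coef_poly.
(* both sides are divisible by [n.+2 * 'C(n.+1, i)] *)
have C0 : (n.+2%:R * 'C(n.+1, i)%:R : R) != 0.
  by rewrite mulf_neq0 ?pnatr_eq0// -lt0n bin_gt0 -ltnS.
have b1 : (i.+1%:R * 'C(n.+2, i.+1)%:R : R) = n.+2%:R * 'C(n.+1, i)%:R.
  by rewrite -!natrM mul_bin_diag.
have b2 : (n.+1%:R * 'C(n, i)%:R : R) = j%:R * 'C(n.+1, i)%:R.
  by rewrite -!natrM ej mul_bin_down.
have b3 : (0 < i)%N -> (n.+1%:R * 'C(n, i.-1)%:R : R) = i%:R * 'C(n.+1, i)%:R.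
  by move=> i0; rewrite -!natrM mul_bin_diag prednK.
move=> h; apply: (mulfI C0).
rewrite -b1.
transitivity (M i.+1 j *+ 'C(n.+2, i.+1) *+ i.+1).
  by rewrite -[RHS]mulr_natl -[M _ _ *+ _]mulr_natl; ring.
rewrite h; clear h.
have -> : (if (i < n.+1)%N then M i (n - i) *+ 'C(n, i) else 0) = M i j.-1 *+ 'C(n, i).
  case: ltnP => hi; last by rewrite bin_small// mulr0n.
  by rewrite ej subSn.
case: i e ej iln C0 b1 b2 b3 => [|i] e ej iln C0 b1 b2 b3 /=.
  rewrite b1 mul0r mulr0 add0r -[M _ _ *+ _]mulr_natl.
  transitivity (n.+2%:R * c * M 0 j.-1 * (n.+1%:R * 'C(n, 0)%:R)); first by ring.
  by rewrite b2; ring.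
have iln1 : (i < n.+1)%N by [].
have -> : (n - i)%N = j by rewrite ej subSS.
rewrite iln1 b1 -[M i j *+ _]mulr_natl -[M i.+1 _ *+ _]mulr_natl.
transitivity (n.+2%:R * v * M i j * (n.+1%:R * 'C(n, i)%:R) +
   n.+2%:R * c * M i.+1 j.-1 * (n.+1%:R * 'C(n, i.+1)%:R)); first by ring.
by rewrite b2 (b3 isT); ring.
Qed.

Definition mixed (p q : {poly R}) := \int[P]_w (p.[U w] * q.[V w]).

Lemma sqintg_poly X (p : {poly R}) : gmom X -> sqintg P (fun w => p.[X w]).
Proof.
move=> hX; apply: (@eq_sqintg _ _ _ _ (fun w => \sum_(i < size p) p`_i * X w ^+ i)).
  by move=> w; rewrite horner_coef.
by apply: sqintg_sum => i; apply: sqintgZ; exact: gmom_sqintgX.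
Qed.

Lemma intg_mixed p q : intg P (fun w => p.[U w] * q.[V w]).
Proof. by apply: sqintgM; exact: sqintg_poly. Qed.

Let mixedDl p p' q : mixed (p + p') q = mixed p q + mixed p' q.
Proof.
rewrite /mixed -IntD; [|exact: intg_mixed|exact: intg_mixed].
by apply: eq_Rintegral => w _; rewrite hornerD mulrDl.
Qed.

Let mixedDr p q q' : mixed p (q + q') = mixed p q + mixed p q'.
Proof.
rewrite /mixed -IntD; [|exact: intg_mixed|exact: intg_mixed].
by apply: eq_Rintegral => w _; rewrite hornerD mulrDr.
Qed.

Let mixedZl a p q : mixed (a *: p) q = a * mixed p q.
Proof.
rewrite /mixed -IntZ; last exact: intg_mixed.
by apply: eq_Rintegral => w _; rewrite hornerZ mulrA.
Qed.

Let mixedZr a p q : mixed p (a *: q) = a * mixed p q.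
Proof.
rewrite /mixed -IntZ; last exact: intg_mixed.
by apply: eq_Rintegral => w _; rewrite hornerZ mulrCA.
Qed.

Let mixed0l q : mixed 0 q = 0.
Proof. by rewrite -(scale0r (0 : {poly R})) mixedZl mul0r. Qed.

Let mixed0r p : mixed p 0 = 0.
Proof. by rewrite -(scale0r (0 : {poly R})) mixedZr mul0r. Qed.

(** Gaussian integration by parts for a pair; bilinearity reduces it to monomials. *)
Lemma stein p q : mixed ('X * p) q = v * mixed p^`() q + c * mixed p q^`().
Proof.
rewrite -{1 2 3}(coefK p) poly_def.
elim/big_ind : _ => [|p1 p2 h1 h2|i _].
- by rewrite mulr0 deriv0 !mixed0l !mulr0 addr0.
- by rewrite mulrDr derivD !mixedDl h1 h2; ring.
rewrite -{1 2 3}(coefK q) poly_def.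
elim/big_ind : _ => [|q1 q2 h1 h2|j _].
- by rewrite deriv0 !mixed0r !mulr0 addr0.
- by rewrite derivD !mixedDr h1 h2; ring.
rewrite -scalerAr !derivZ !mixedZl !mixedZr -exprS !derivXn.
rewrite -[_ *+ i]scaler_nat -[_ *+ j]scaler_nat !mixedZl !mixedZr.
have e k l : mixed 'X^k 'X^l = M k l.
  by apply: eq_Rintegral => w _; rewrite !hornerXn.
by rewrite !e stein_mon; ring.
Qed.

End pair.

Lemma mean_He V n : gmom V -> \int[P]_w (He (msq P V) n.+1).[V w] = 0.
Proof.
move=> gV.
(* [stein] is applied to [V] and the variable 0, with 1 as second polynomial, which leaves
   integration by parts in one variable. *)
have g0 : gpair V (fun=> 0).
  move=> s t; case: (gV) => mV iV eV rV.
  have hn m : intg P (fun w => (s * V w + t * 0) ^+ m).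
    by apply: eq_intg (intgZ (s ^+ m) (iV m)) => w; rewrite mulr0 addr0 exprMn.
  have e n' : \int[P]_w ((s * V w + t * 0) ^+ n') = s ^+ n' * \int[P]_w (V w ^+ n').
    by rewrite -IntZ//; apply: eq_Rintegral => w _; rewrite mulr0 addr0 exprMn.
  split => //.
  - by have := hn 1%N => /intg_meas.
  - by have := e 1%N; rewrite !expr1 => ->; rewrite eV mulr0.
  - by move=> m; rewrite /msq !e rV /msq !exprS; ring.
have := stein g0 (He (msq P V) n) 1.
have m1 p : mixed V (fun=> 0) p 1 = \int[P]_w p.[V w].
  by apply: eq_Rintegral => w _; rewrite hornerE mulr1.
rewrite !m1 derivC => h.
have i1 : intg P (fun w => ('X * He (msq P V) n).[V w]).
  by apply: eq_intg (intg_mixed g0 ('X * He (msq P V) n) 1) => w; rewrite !hornerE.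
have i2 : intg P (fun w => ((He (msq P V) n)^`()).[V w]).
  by apply: eq_intg (intg_mixed g0 ((He (msq P V) n)^`()) 1) => w; rewrite !hornerE.
rewrite (_ : \int[P]_w _ = \int[P]_w (('X * He (msq P V) n).[V w] -
   msq P V * ((He (msq P V) n)^`()).[V w])); last first.
  by apply: eq_Rintegral => w _; rewrite /= hornerD hornerN hornerZ.
rewrite IntB//; last exact: intgZ.
rewrite IntZ// h [mixed _ _ _ 0](_ : _ = 0); first by ring.
by apply: Int_eq0 => w; rewrite horner0 mulr0.
Qed.

(** Integration by parts is applied to [X He_j]: the term with the variance of [U] cancels the
    second term of the recursion, and what remains lowers both degrees by one, with the factor [k]
    times the covariance. *)
Theorem wick_formula U V j k : gpair U V ->
  \int[P]_w ((He (msq P U) j).[U w] * (He (msq P V) k).[V w]) =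
  (j == k)%:R * j`!%:R * (\int[P]_w (U w * V w)) ^+ j.
Proof.
move=> h; elim: j k => [|j ih] k.
  rewrite expr0 mulr1 fact0 mulr1.
  case: k => [|k] /=.
    rewrite -[RHS](Int_prob_cst P).
    by apply: eq_Rintegral => w _; rewrite !hornerE.
  rewrite -[RHS](@mean_He V k (gpair2 h)).
  by apply: eq_Rintegral => w _; rewrite hornerE mul1r.
set c := \int[P]_w (U w * V w) in ih *; set v := msq P U in ih *.
set u := msq P V in ih *.
rewrite (_ : \int[P]_w _ = \int[P]_w (('X * He v j).[U w] * (He u k).[V w] -
   v * ((He v j)^`().[U w] * (He u k).[V w]))); last first.
  by apply: eq_Rintegral => w _; rewrite /= hornerD hornerN hornerZ; ring.
rewrite IntB; [|exact: intg_mixed|exact/intgZ/intg_mixed].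
rewrite IntZ; last exact: intg_mixed.
have := stein h (He v j) (He u k); rewrite /mixed -/v -/c => ->.
rewrite [LHS]addrAC subrr add0r deriv_He.
rewrite (_ : \int[P]_w _ = k%:R * \int[P]_w ((He v j).[U w] * (He u k.-1).[V w])); last first.
  rewrite -IntZ; last exact: intg_mixed.
  by apply: eq_Rintegral => w _; rewrite hornerZ mulrCA.
rewrite ih; case: k => [|k] /=; first by rewrite !mul0r mulr0.
rewrite eqSS; have [->|_] := eqVneq j k; last by rewrite !mul0r !mulr0.
by rewrite factS natrM exprS; ring.
Qed.

End gaussian_pairs.

(** * Normal laws and Hermite polynomials *)

Section gaussian_law.
Context (R : realType).
Local Notation gam := (normal_prob (0 : R) 1).

Section law.
Context d (T : measurableType d) (P : probability T R) (X : T -> R).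
Context (nu : {measure set (measurableTypeR R) -> \bar R}).
Hypothesis mX : measurable_fun setT X.
Hypothesis law : forall A : set R, measurable A -> P (X @^-1` A) = nu A.

Lemma law_intg (f : R -> R) : measurable_fun setT f -> intg nu f ->
  intg P (fun w => f (X w)) /\ \int[P]_w f (X w) = \int[nu]_x f x.
Proof.
move=> mf hf.
pose mX_mixin := isMeasurableFun.Build _ _ T (measurableTypeR R) X mX.
pose Xp : {mfun T >-> measurableTypeR R} := HB.pack X mX_mixin.
have e (g : measurableTypeR R -> \bar R) := @eq_measure_integral _ (measurableTypeR R) R
  setT (pushforward P (Xp : T -> measurableTypeR R)) nu g (fun A mA _ => esym (law mA)).
have i2 : intg P (fun w => f (X w)).
  apply: intgP; first exact: measurableT_comp.
  have := @ge0_integral_pushforward _ _ T (measurableTypeR R) R X mX P setT (fun x => `|f x|%:E).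
  rewrite preimage_setT => h.
  apply: (@le_lt_trans _ _ (\int[nu]_x `|f x|%:E)%E); last first.
    by rewrite EInt ?ltry//; exact: intg_abs.
  rewrite le_eqVlt; apply/orP; left; apply/eqP.
  refine (etrans _ (esym (e mX (fun x => `|f x|%:E)))); apply: esym; apply: h => //.
  by apply/measurable_EFinP; exact: measurableT_comp.
split=> //; rewrite /Rintegral; congr fine.
refine (etrans _ (esym (e mX (fun x => (f x)%:E)))); apply: esym.
have := @integral_pushforward _ _ T (measurableTypeR R) R X mX P setT (EFin \o f).
rewrite preimage_setT; apply => //.
by apply/measurable_EFinP.
Qed.

Lemma law_sqintg (f : R -> R) : sqintg nu f ->
  sqintg P (fun w => f (X w)) /\ msq P (fun w => f (X w)) = msq nu f.
Proof.
move=> [mf hf]; have [i e] := law_intg (measurable_funX 2 mf) hf.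
by split=> //; split=> //; exact: measurableT_comp.
Qed.

End law.

Lemma second_moment (s : R) : 0 < s -> \int[normal_prob 0 s]_x (x ^+ 2) = s ^+ 2.
Proof.
move=> s0; rewrite (moment_recursion 1 s0) mul1r /=.
rewrite [X in _ * X](_ : _ = 1) ?mulr1//.
exact: (Int_prob_cst (normal_prob 0 s) 1).
Qed.

Lemma first_moment (s : R) : 0 < s -> \int[normal_prob 0 s]_x (x ^+ 1) = 0.
Proof. by move=> s0; rewrite (moment_recursion 0 s0) mul0r mulr0. Qed.

Section gaussian.
Context d (T : measurableType d) (P : probability T R) (X : T -> R).
Hypothesis mX : measurable_fun setT X.

Lemma normal_gmom s : 0 < s ->
  (forall A : set R, measurable A -> P (X @^-1` A) = normal_prob 0 s A) ->
  gmom P X /\ msq P X = s ^+ 2.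
Proof.
move=> s0 law.
have h n : intg P (fun w => X w ^+ n) /\
    \int[P]_w (X w ^+ n) = \int[normal_prob 0 s]_x (x ^+ n).
  apply: (@law_intg _ _ P X (normal_prob 0 s) mX law (fun x : R => x ^+ n)).
    exact: measurable_funX.
  exact: intg_moment.
have e2 : msq P X = s ^+ 2.
  by rewrite /msq (h 2%N).2 second_moment.
split=> //; split=> // [n||n]; first exact: (h n).1.
  by have := (h 1%N).2; rewrite first_moment// => <-.
by rewrite !(h _).2 e2 moment_recursion//=; ring.
Qed.

Lemma dirac_gmom :
  (forall A : set R, measurable A -> P (X @^-1` A) = dirac (0 : R) A) ->
  gmom P X /\ msq P X = 0.
Proof.
move=> law.
have h n : intg P (fun w => X w ^+ n) /\ \int[P]_w (X w ^+ n) = 0 ^+ n.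
  have mn : measurable_fun setT (fun x : R => x ^+ n) by exact: measurable_funX.
  have [|i ->] := @law_intg _ _ P X (dirac (0 : measurableTypeR R)) mX law (fun x : R => x ^+ n) mn.
  - apply: intgP => //; rewrite integral_dirac//= ?diracT ?mul1e ?ltry//.
    by apply/measurable_EFinP; exact: measurableT_comp.
  split=> //; rewrite /Rintegral integral_dirac//= ?diracT ?mul1e//.
    by rewrite indicE in_setT mul1r.
  exact/measurable_EFinP.
have e2 : msq P X = 0 by rewrite /msq (h 2%N).2 expr0n.
split=> //; split=> // [n||n]; first exact: (h n).1.
  by have := (h 1%N).2; rewrite expr1 => <-.
by rewrite !(h _).2 e2 expr0n mulr0 mul0r.
Qed.

Lemma centered_gaussian_gmom : is_centered_gaussian P X -> gmom P X.
Proof.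
move=> [_ [s s0 law]]; have [s00|sn0] := eqVneq s 0.
  apply: (dirac_gmom _).1 => A mA.
  by rewrite law// /centered_gaussian_law s00 eqxx.
apply: (@normal_gmom s _ _).1; first by rewrite lt_neqAle eq_sym sn0.
by move=> A mA; rewrite law// /centered_gaussian_law (negbTE sn0).
Qed.

Lemma centered_gaussian_std : is_centered_gaussian P X -> msq P X = 1 ->
  forall A : set R, measurable A -> P (X @^-1` A) = normal_prob 0 1 A.
Proof.
move=> [_ [s s0 law]] X1; have [s00|sn0] := eqVneq s 0.
  have [_] : gmom P X /\ msq P X = 0.
    by apply: dirac_gmom => A mA; rewrite law// /centered_gaussian_law s00 eqxx.
  by move=> /eqP; rewrite X1 oner_eq0.
have s_gt0 : 0 < s by rewrite lt_neqAle eq_sym sn0.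
have law' (A : set R) : measurable A -> P (X @^-1` A) = normal_prob 0 s A.
  by move=> mA; rewrite law// /centered_gaussian_law (negbTE sn0).
have [_ e] := normal_gmom s_gt0 law'.
suff -> : 1 = s by [].
by apply/eqP; rewrite -(@eqrXn2 _ 2)// ?ler01// expr1n -e X1.
Qed.

End gaussian.

Section hermite.

(** With both variables equal to the identity, Wick's formula yields the orthogonality of the
    Hermite polynomials. *)
Lemma gam_pair : gpair gam (@id R) (@id R).
Proof.
move=> s t.
have i n : intg gam (fun x : R => (s * x + t * x) ^+ n).
  apply: eq_intg (intgZ ((s + t) ^+ n) (intg_moment n ltr01)) => x.
  by rewrite -exprMn mulrDl.
have e n : \int[gam]_x ((s * x + t * x) ^+ n) = (s + t) ^+ n * \int[gam]_x (x ^+ n).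
  rewrite -IntZ; last exact: intg_moment.
  by apply: eq_Rintegral => x _; rewrite -exprMn mulrDl.
split=> //.
- by have := intg_meas (i 1%N).
- by have := e 1%N; rewrite first_moment// mulr0.
by move=> n; rewrite /msq !e moment_recursion//= second_moment// !exprS; ring.
Qed.

Definition dotp (p q : {poly R}) := \int[gam]_x (p.[x] * q.[x]).

Lemma dotpDl p p' q : dotp (p + p') q = dotp p q + dotp p' q.
Proof.
rewrite /dotp -IntD; [|exact: sqintgM (sqintg_horner _) (sqintg_horner _)..].
by apply: eq_Rintegral => x _; rewrite hornerD mulrDl.
Qed.

Lemma dotpZl a p q : dotp (a *: p) q = a * dotp p q.
Proof.
rewrite /dotp -IntZ; last exact: sqintgM (sqintg_horner _) (sqintg_horner _).
by apply: eq_Rintegral => x _; rewrite hornerZ mulrA.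
Qed.

Lemma dotpC p q : dotp p q = dotp q p.
Proof. by apply: eq_Rintegral => x _; rewrite mulrC. Qed.

Lemma dotp0l q : dotp 0 q = 0.
Proof. by rewrite -(scale0r (0 : {poly R})) dotpZl mul0r. Qed.

Lemma dotp_suml I (s : seq I) (F : I -> {poly R}) q :
  dotp (\sum_(i <- s) F i) q = \sum_(i <- s) dotp (F i) q.
Proof.
elim: s => [|i s ih]; first by rewrite !big_nil dotp0l.
by rewrite !big_cons dotpDl ih.
Qed.

Definition orthonormal_polys (h : nat -> {poly R}) :=
  (forall k, size (h k) = k.+1) /\ (forall i j, dotp (h i) (h j) = (i == j)%:R).

Lemma orthonormal_span h : orthonormal_polys h -> forall n (p : {poly R}), (size p <= n)%N ->
  p = \sum_(i < n) dotp p (h i) *: h i.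
Proof.
move=> [sh oh] n p sp.
have [a pa] : exists a : nat -> R, p = \sum_(i < n) a i *: h i.
  elim: n p sp => [|n ih] p sp.
    exists (fun=> 0); rewrite big_ord0; apply/eqP.
    by rewrite -size_poly_eq0 -leqn0.
  have l0 : (h n)`_n != 0.
    by have := lead_coef_eq0 (h n); rewrite lead_coefE sh /= => ->; rewrite -size_poly_eq0 sh.
  have : (size (p - (p`_n / (h n)`_n) *: h n)%R <= n)%N.
    apply/leq_sizeP => j; rewrite leq_eqVlt => /predU1P[<-|nj].
      by rewrite coefB coefZ divfK// subrr.
    rewrite coefB coefZ. rewrite (nth_default _ (leq_trans sp nj)).
    by rewrite [(h n)`_j]nth_default ?sh// mulr0 subr0.
  move=> /ih[a ha]; exists (fun i => if i == n then p`_n / (h n)`_n else a i).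
  rewrite big_ord_recr /= eqxx -[LHS](subrK ((p`_n / (h n)`_n) *: h n)) {1}ha.
  by congr (_ + _); apply: eq_bigr => i _; rewrite ltn_eqF.
rewrite {1}pa; apply: eq_bigr => i _; congr (_ *: _).
rewrite pa dotp_suml (bigD1 i)//= dotpZl oh eqxx mulr1 big1 ?addr0// => j ji.
by rewrite dotpZl oh [_ == _](negbTE ji) mulr0.
Qed.

Lemma size_He (n : nat) : size (He (1 : R) n) = n.+1.
Proof.
elim: n => [|n ih]; first by rewrite size_poly1.
have s1 : size ('X * He (1 : R) n) = n.+2.
  by rewrite mulrC size_mulX ?ih// -size_poly_eq0 ih.
rewrite /= size_polyDl s1// size_polyN scale1r.
by rewrite (ltn_trans (lt_size_deriv _))// ?ih// -size_poly_eq0 ih.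
Qed.

Lemma lead_He (n : nat) : 0 < lead_coef (He (1 : R) n).
Proof.
elim: n => [|n ih]; first by rewrite lead_coef1.
have s1 : size ('X * He (1 : R) n) = n.+2.
  by rewrite mulrC size_mulX ?size_He// -size_poly_eq0 size_He.
rewrite /= lead_coefDl; first by rewrite mulrC lead_coefMX.
rewrite s1 size_polyN scale1r.
by rewrite (ltn_trans (lt_size_deriv _))// ?size_He// -size_poly_eq0 size_He.
Qed.

Definition He1 n : {poly R} := (Num.sqrt n`!%:R)^-1 *: He 1 n.

Let sqf_neq0 n : Num.sqrt n`!%:R != 0 :> R.
Proof. by rewrite gt_eqF// sqrtr_gt0 ltr0n fact_gt0. Qed.

Lemma orthonormal_He1 : orthonormal_polys He1.
Proof.
split=> [k|i j]; first by rewrite size_scale ?size_He// invr_neq0.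
rewrite /He1 dotpZl dotpC dotpZl dotpC.
have e1 : msq gam (@id R) = 1.
  by rewrite /msq second_moment// expr1n.
have := @wick_formula _ _ _ gam id id i j gam_pair; rewrite e1 /= -/(dotp _ _) => ->.
have -> : \int[gam]_x (x * x) = 1 by rewrite -[RHS]e1.
rewrite expr1n mulr1; have [<-|_] := eqVneq i j; last by rewrite mul0r !mulr0.
rewrite mul1r; have := sqr_sqrtr (ler0n R i`!); have := sqf_neq0 i.
by move: (Num.sqrt _) => r r0 <-; rewrite mulr1n; field.
Qed.

Lemma hermite_orthonormal H : hermite_polynomials H -> orthonormal_polys H.
Proof.
move=> [sH lH oH]; split=> // i j; have := oH i j.
rewrite EInt; last exact: sqintgM (sqintg_horner _) (sqintg_horner _).
by case.
Qed.

(** Orthogonality to all lower degrees makes [H k] a multiple of [He1 k]; the factor has square 1,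
    and the positive leading coefficients exclude -1. *)
Lemma hermiteE H : hermite_polynomials H -> forall k, H k = He1 k.
Proof.
move=> hH k; have oH := hermite_orthonormal hH; have o1 := orthonormal_He1.
have [sH lH _] := hH.
have sk : (size (H k) <= k.+1)%N by rewrite sH.
have := orthonormal_span o1 sk; rewrite big_ord_recr /= big1 ?add0r; last first.
  move=> i _; have si : (size (He1 i) <= i.+1)%N by rewrite o1.1.
  suff -> : dotp (H k) (He1 i) = 0 by rewrite scale0r.
  rewrite dotpC (orthonormal_span oH si) dotp_suml big1// => j _; rewrite dotpZl oH.2 ltn_eqF ?mulr0//.
  by rewrite (leq_trans (ltn_ord j))// -ltnS ltnS.
set a := dotp _ _ => e.
have a2 : a ^+ 2 = 1.
  have := oH.2 k k; rewrite eqxx e dotpZl dotpC dotpZl o1.2 eqxx.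
  by rewrite /= mulr1 -expr2.
have : 0 < a.
  have l0 : 0 < lead_coef (He1 k).
    by rewrite lead_coefZ mulr_gt0 ?lead_He// invr_gt0 sqrtr_gt0 ltr0n fact_gt0.
  by have := lH k; rewrite e lead_coefZ pmulr_lgt0.
move=> a0; have : a = 1 by apply/eqP; rewrite -(@eqrXn2 _ 2) ?ltW// a2 expr1n.
by move=> a1; rewrite e a1 scale1r.
Qed.

End hermite.

End gaussian_law.

(** * Correlation of functions of a Gaussian pair *)

Section correlation_bound.
Context (R : realType) d (T : measurableType d) (P : probability T R).
Local Notation gam := (normal_prob (0 : R) 1).
Context (X Y : T -> R).
Hypothesis mX : measurable_fun setT X.
Hypothesis mY : measurable_fun setT Y.
Hypothesis lX : forall A : set R, measurable A -> P (X @^-1` A) = gam A.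
Hypothesis lY : forall A : set R, measurable A -> P (Y @^-1` A) = gam A.
Hypothesis gXY : gpair P X Y.

Let c := \int[P]_w (X w * Y w).

Let sX (f : R -> R) : sqintg gam f ->
  sqintg P (fun w => f (X w)) /\ msq P (fun w => f (X w)) = msq gam f.
Proof. exact: law_sqintg. Qed.

Let sY (f : R -> R) : sqintg gam f ->
  sqintg P (fun w => f (Y w)) /\ msq P (fun w => f (Y w)) = msq gam f.
Proof. exact: law_sqintg. Qed.

Let msq_id : msq gam (@id R) = 1.
Proof. by rewrite /msq second_moment// expr1n. Qed.

Let sid : sqintg gam (@id R).
Proof. by apply: eq_sqintg (sqintg_horner 'X) => x; rewrite hornerX. Qed.

Let msqX1 : msq P X = 1.
Proof. by rewrite (sX sid).2. Qed.

Let msqY1 : msq P Y = 1.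
Proof. by rewrite (sY sid).2. Qed.

Lemma norm_correlation_le1 : `|c| <= 1.
Proof.
rewrite -[leRHS](mulr1 1); apply: cauchy_schwarz_norm => //.
- exact: (sX sid).1.
- exact: (sY sid).1.
- by rewrite msqX1 expr1n.
- by rewrite msqY1 expr1n.
Qed.

Let E_He1 i j : \int[P]_w ((He1 R i).[X w] * (He1 R j).[Y w]) = (i == j)%:R * c ^+ i.
Proof.
have h := wick_formula i j gXY; rewrite msqX1 msqY1 -/c in h.
have iW : intg P (fun w => (He 1 i).[X w] * (He 1 j).[Y w]) by exact: intg_mixed.
rewrite (_ : \int[P]_w _ = \int[P]_w ((Num.sqrt i`!%:R)^-1 * (Num.sqrt j`!%:R)^-1 *
   ((He 1 i).[X w] * (He 1 j).[Y w]))); last first.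
  by apply: eq_Rintegral => w _; rewrite !hornerZ; ring.
rewrite IntZ// h; have [<-|_] := eqVneq i j; last by rewrite !mul0r mulr0.
have r0 : Num.sqrt i`!%:R != 0 :> R by rewrite gt_eqF// sqrtr_gt0 ltr0n fact_gt0.
move: (sqr_sqrtr (ler0n R i`!)) r0; move: (Num.sqrt _) => r <- r0.
by rewrite mulr1n; field.
Qed.

(** By Wick's formula the integral is the sum of the [a_i^2 c^i], where only indices [i >= m] occur
    and [|c| <= 1]. *)
Let poly_correlation (m : nat) (p : {poly R}) :
  (forall j, (j < m)%N -> dotp p (He1 R j) = 0) ->
  `|\int[P]_w (p.[X w] * p.[Y w])| <= `|c| ^+ m * dotp p p.
Proof.
move=> hp; have o1 := orthonormal_He1 R.
have pE := orthonormal_span o1 (leqnn (size p)).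
pose N := size p; pose a i := dotp p (He1 R i).
have pXE x : p.[x] = \sum_(i < N) a i * (He1 R i).[x].
  by rewrite {1}pE horner_sum; apply: eq_bigr => i _; rewrite hornerZ.
have gX := gpair1 gXY; have gY := gpair2 gXY.
have sHX i : sqintg P (fun w => (He1 R i).[X w]) := (sX (sqintg_horner _)).1.
have sHY i : sqintg P (fun w => (He1 R i).[Y w]) := (sY (sqintg_horner _)).1.
have -> : \int[P]_w (p.[X w] * p.[Y w]) = \sum_(i < N) a i ^+ 2 * c ^+ i.
  rewrite (_ : \int[P]_w _ = \int[P]_w (\sum_(i < N) \sum_(j < N)
      a i * a j * ((He1 R i).[X w] * (He1 R j).[Y w]))); last first.
    apply: eq_Rintegral => w _; rewrite !pXE mulr_suml; apply: eq_bigr => i _.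
    by rewrite mulr_sumr; apply: eq_bigr => j _; ring.
  have iij (i j : 'I_N) : intg P (fun w => a i * a j * ((He1 R i).[X w] * (He1 R j).[Y w])).
    by apply: intgZ; exact: sqintgM.
  rewrite Int_sum; last by move=> i; exact: intg_sum.
  apply: eq_bigr => i _; rewrite Int_sum// (bigD1 i)//= IntZ; last exact: sqintgM.
  rewrite E_He1 eqxx mul1r expr2 big1 ?addr0// => j ji.
  rewrite IntZ; last exact: sqintgM.
  by rewrite E_He1 eq_sym [_ == _](negbTE ji) mul0r mulr0.
have -> : dotp p p = \sum_(i < N) a i ^+ 2.
  rewrite {1}pE dotp_suml; apply: eq_bigr => i _.
  by rewrite dotpZl (dotpC (He1 R i)) -/(a i) expr2.
rewrite mulr_sumr; apply: le_trans (ler_norm_sum _ _ _) _; apply: ler_sum => i _.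
have [im|mi] := ltnP i m.
  by rewrite /a hp// expr0n mul0r normr0 mulr0.
rewrite normrM [`|c ^+ _|]normrX (ger0_norm (sqr_ge0 _)) mulrC ler_wpM2r ?sqr_ge0//.
have := norm_correlation_le1 => c1.
by rewrite -(subnKC mi) exprD ler_piMr ?exprn_ge0// exprn_ile1.
Qed.

Let msq_horner (p : {poly R}) : msq gam (horner p) = dotp p p.
Proof. by apply: eq_Rintegral => x _; rewrite expr2. Qed.

(** Removing the components of index below [m] from an approximating polynomial costs little: [r]
    has none, so each of them is, up to sign, a component of the approximation error. *)
Let project_poly (m : nat) (r : R -> R) : sqintg gam r ->
  (forall j, (j < m)%N -> \int[gam]_x (r x * (He1 R j).[x]) = 0) ->
  forall e, 0 < e -> exists p : {poly R},
    (forall j, (j < m)%N -> dotp p (He1 R j) = 0) /\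
    msq gam (fun x => r x - p.[x]) <= e.
Proof.
move=> sr hr e e0; have o1 := orthonormal_He1 R.
(* The error [e'] is counted twice for [p0], and twice for each of the [m] removed components. *)
have m0 : 0 < 2 * m.+1%:R :> R by rewrite mulr_gt0.
have [p0 hp0] := poly_dense sr (divr_gt0 e0 m0); set e' := _ / _ in hp0.
pose b j := dotp p0 (He1 R j); pose q := \sum_(j < m) b j *: He1 R j.
have bq j : (j < m)%N -> dotp q (He1 R j) = b j.
  move=> jm; rewrite dotp_suml (bigD1 (Ordinal jm))//= dotpZl o1.2 eqxx mulr1.
  by rewrite big1 ?addr0// => i ij; rewrite dotpZl o1.2 [_ == _](negbTE ij) mulr0.
have qq : dotp q q = \sum_(j < m) b j ^+ 2.
  rewrite {1}/q dotp_suml; apply: eq_bigr => j _.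
  by rewrite dotpZl dotpC bq// expr2.
have sd : sqintg gam (fun x => r x - p0.[x]) by exact: sqintgB (sqintg_horner _).
have b2 (j : 'I_m) : b j ^+ 2 <= e'.
  have -> : b j = - \int[gam]_x ((r x - p0.[x]) * (He1 R j).[x]).
    rewrite (_ : \int[gam]_x _ = \int[gam]_x (r x * (He1 R j).[x] - p0.[x] * (He1 R j).[x])).
      rewrite IntB ?hr// ?sub0r ?opprK//; first exact: sqintgM (sqintg_horner _).
      exact: sqintgM (sqintg_horner _) (sqintg_horner _).
    by apply: eq_Rintegral => x _; rewrite mulrBl.
  rewrite sqrrN; apply: le_trans (cauchy_schwarz sd (sqintg_horner _)) _.
  by rewrite msq_horner o1.2 eqxx mulr1.
exists (p0 - q); split=> [j jm|].
  by rewrite -[p0 - q]addrC dotpDl -scaleN1r dotpZl bq// mulN1r addrC subrr.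
have := msqD_le sd (sqintg_horner q).
rewrite (_ : (fun x => r x - p0.[x] + q.[x]) = (fun x => r x - (p0 - q).[x])); last first.
  by apply/funext => x; rewrite hornerD hornerN; ring.
move=> /le_trans; apply.
rewrite msq_horner.
rewrite qq; have : \sum_(j < m) b j ^+ 2 <= m%:R * e'.
  by rewrite -[in leRHS](card_ord m) mulr_natl -sumr_const; apply: ler_sum.
have : 2 * m.+1%:R * e' = e by rewrite /e' mulrC divfK// gt_eqF.
by rewrite -natr1; lra.
Qed.

(* For polynomials the bound is the expansion of Mehler's kernel; it extends to
   [L^2] because both sides are continuous. *)
Theorem correlation_bound (m : nat) (r : R -> R) : sqintg gam r ->
  (forall j, (j < m)%N -> \int[gam]_x (r x * (He1 R j).[x]) = 0) ->
  `|\int[P]_w (r (X w) * r (Y w))| <= `|c| ^+ m * msq gam r.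
Proof.
move=> sr hr; pose N := Num.sqrt (msq gam r).
have N0 : 0 <= N by exact: sqrtr_ge0.
have N2 : N ^+ 2 = msq gam r by rewrite sqr_sqrtr// msq_ge0.
have c1 := norm_correlation_le1.
have cm1 : `|c| ^+ m <= 1 by rewrite exprn_ile1.
have cm0 : 0 <= `|c| ^+ m by rewrite exprn_ge0.
(* Replacing [r] by [p] costs at most [2 N e + e^2] in the squared norm, and [e N + (N + e) e] in
   the two cross terms; then [e^2 <= e]. *)
have key e : 0 < e -> e <= 1 ->
    `|\int[P]_w (r (X w) * r (Y w))| <= `|c| ^+ m * N ^+ 2 + e * (4 * N + 2).
  move=> e0 e1; have [p [hp rp]] := project_poly sr hr (exprn_gt0 2 e0).
  have sp := sqintg_horner p; have sd := sqintgB sr sp.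
  have h1 : `|\int[gam]_x (r x * (r x - p.[x]))| <= N * e.
    by apply: cauchy_schwarz_norm => //; [exact: ltW|rewrite N2].
  have pn : msq gam (horner p) <= (N + e) ^+ 2.
    have -> : msq gam (horner p) = msq gam r + 2 * \int[gam]_x (r x * (- (r x - p.[x])))
        + msq gam (fun x => r x - p.[x]).
      rewrite -[msq gam (fun x => r x - _)]msqN -msqD//; last exact: sqintgN.
      by apply: eq_Rintegral => x _; ring.
    have -> : \int[gam]_x (r x * (- (r x - p.[x]))) = - \int[gam]_x (r x * (r x - p.[x])).
      rewrite -IntN; last exact: sqintgM.
      by apply: eq_Rintegral => x _; rewrite mulrN.
    by move: h1; rewrite ler_norml -N2 => /andP[]; nra.
  have [srX eX] := sX sr; have [srY eY] := sY sr.
  have [spX epX] := sX sp; have [spY epY] := sY sp.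
  have [sdX edX] := sX sd; have [sdY edY] := sY sd.
  have -> : \int[P]_w (r (X w) * r (Y w)) = \int[P]_w (p.[X w] * p.[Y w]) +
     (\int[P]_w ((r (X w) - p.[X w]) * r (Y w)) + \int[P]_w (p.[X w] * (r (Y w) - p.[Y w]))).
    rewrite -IntD; [|exact: sqintgM..].
    rewrite -IntD; [|exact: sqintgM|by apply: intgD; exact: sqintgM].
    by apply: eq_Rintegral => w _; ring.
  have b1 := poly_correlation hp.
  have b2 : `|\int[P]_w ((r (X w) - p.[X w]) * r (Y w))| <= e * N.
    by apply: cauchy_schwarz_norm => //; [exact: ltW|rewrite edX; exact: rp|rewrite eY N2].
  have b3 : `|\int[P]_w (p.[X w] * (r (Y w) - p.[Y w]))| <= (N + e) * e.
    by apply: cauchy_schwarz_norm => //; [rewrite addr_ge0// ltW|exact: ltW|rewrite epX; exact: pn|rewrite edY; exact: rp].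
  have dpp : dotp p p <= (N + e) ^+ 2.
    by rewrite -msq_horner.
  apply: le_trans (ler_normD _ _) _.
  apply: le_trans (lerD b1 (le_trans (ler_normD _ _) (lerD b2 b3))) _.
  have : `|c| ^+ m * dotp p p <= `|c| ^+ m * (N + e) ^+ 2 by rewrite ler_wpM2l.
  have : `|c| ^+ m * (2 * N * e + e ^+ 2) <= 2 * N * e + e ^+ 2.
    by rewrite ler_piMl// addr_ge0 ?sqr_ge0// !mulr_ge0// ltW.
  have : e ^+ 2 <= e by rewrite expr2 ler_piMl// ltW.
  lra.
rewrite -N2 leNgt; apply/negP => lt.
set u := `|\int[P]_w _| in lt key; set w := `|c| ^+ m * N ^+ 2 in lt key.
have K0 : 0 < 4 * N + 2 by lra.
pose e := Num.min 1 ((u - w) / (2 * (4 * N + 2))).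
have e0 : 0 < e by rewrite lt_min ltr01 divr_gt0 ?subr_gt0// mulr_gt0.
have e1 : e <= 1 by rewrite ge_min lexx.
have e2 : e <= (u - w) / (2 * (4 * N + 2)) by rewrite ge_min lexx orbT.
have := key e e0 e1.
have : e * (4 * N + 2) <= (u - w) / 2.
  apply: le_trans (ler_wpM2r (ltW K0) e2) _; rewrite le_eqVlt; apply/orP; left.
  by apply/eqP; field; rewrite gt_eqF.
by move: lt; lra.
Qed.

End correlation_bound.

(** * The density of the increments variance *)

Section singular_kernel.
Context (R : realType).
Notation lam := (@lebesgue_measure R).

(** At the singularity the value is the default of the power: 0 for [k != 0] and 1 for [k = 0]. *)
Definition pk (k x : R) : R := `|x| `^ (- k).

Lemma pk_ge0 k x : 0 <= pk k x.
Proof. exact: powR_ge0. Qed.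

Lemma pkN k x : pk k (- x) = pk k x.
Proof. by rewrite /pk normrN. Qed.

Lemma pk_le k x y : 0 <= k -> y != 0 -> `|y| <= `|x| -> pk k x <= pk k y.
Proof.
move=> k0 y0 yx; have yp : 0 < `|y| by rewrite normr_gt0.
have xp := lt_le_trans yp yx.
rewrite /pk !powRN lef_pV2 ?posrE ?powR_gt0//.
by apply: ge0_ler_powR => //; rewrite nnegrE.
Qed.

Lemma pkM k x y : pk k (x * y) = pk k x * pk k y.
Proof. by rewrite /pk normrM powRM. Qed.

Lemma pkD k l x : x != 0 -> pk (k + l) x = pk k x * pk l x.
Proof. by move=> x0; rewrite /pk opprD powRD// normr_eq0 x0 implybT. Qed.

Lemma pkX k n x : pk k x ^+ n = pk (n%:R * k) x.
Proof. by rewrite /pk -powR_mulrn ?powR_ge0// -powRrM; congr (_ `^ _); ring. Qed.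

Lemma measurable_pk k : measurable_fun setT (pk k).
Proof.
by apply: (@measurableT_comp _ _ _ _ _ _ (@powR R ^~ (- k)));
  [exact: measurable_powR|exact: normr_measurable].
Qed.

Section integral_bound.
Context (k : R) (k0 : 0 <= k) (k1 : k < 1).

Let a : R := 2 `^ k.

Let a0 : 0 < a. Proof. exact: powR_gt0. Qed.

Let a2 : a < 2.
Proof.
rewrite /a -[ltRHS]powRr1// /powR ifF ?ifF; try by apply/eqP; lra.
by rewrite ltr_expR mul1r gtr_pMl// ln_gt0// ltr1n.
Qed.

Let bll v (n : nat) : set R := `[v - 2 / 2 ^+ n, v + 2 / 2 ^+ n].

(** Dyadic shells: for the least [n] with [2^-n <= |x - v|], the kernel is at most [a^n] and [x]
    lies in the ball of radius [2 / 2^n]. After integration the ratio is [a / 2], which is below 1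
    because [k < 1]. *)
Let pk_dyadic (v x : R) :
  ((pk k (x - v))%:E <= 1%:E + \sum_(0 <= n <oo) (a ^+ n * \1_(bll v n) x)%:E)%E.
Proof.
have S0 : (0 <= \sum_(0 <= n <oo) (a ^+ n * \1_(bll v n) x)%:E)%E.
  by apply: nneseries_ge0 => n _ _; rewrite lee_fin mulr_ge0// exprn_ge0// ltW.
have [h|h] := leP 1 `|x - v|.
  apply: (@le_trans _ _ 1%E); last by rewrite leeDl.
  rewrite lee_fin; have -> : 1 = pk k 1 by rewrite /pk normr1 powR1.
  by apply: pk_le; rewrite ?oner_neq0// normr1.
have [xv|xv] := eqVneq (x - v) 0.
  apply: (@le_trans _ _ 1%E); last by rewrite leeDl.
  rewrite lee_fin /pk xv normr0; have [->|kn0] := eqVneq k 0; first by rewrite oppr0 powRr0.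
  by rewrite powR0 ?oppr_eq0.
have ex : exists n, 1 / 2 ^+ n <= `|x - v|.
  have x0 : 0 < `|x - v| by rewrite normr_gt0.
  by have [n hn] := small_div_exp2 1 x0; exists n; exact: ltW.
case: (ex_minnP ex) => n hn nmin.
have xb : x \in bll v n.
  rewrite inE /bll /= in_itv/=.
  have : `|x - v| <= 2 / 2 ^+ n.
    case: n hn nmin => [|n] hn nmin; first by rewrite expr0 divr1; lra.
    have : ~~ (1 / 2 ^+ n <= `|x - v|) by apply/negP => /nmin; rewrite ltnn.
    by rewrite -ltNge exprS invfM mulrA divff// => /ltW.
  by rewrite ler_norml => /andP[? ?]; apply/andP; split; lra.
apply: (@le_trans _ _ (a ^+ n * \1_(bll v n) x)%:E); last first.
  apply: (@le_trans _ _ (\sum_(0 <= n <oo) (a ^+ n * \1_(bll v n) x)%:E)%E); last first.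
    by rewrite leeDr// lee_fin.
  apply: le_trans (nneseries_lim_ge n.+1 _); last first.
    by move=> m _ _; rewrite lee_fin mulr_ge0// exprn_ge0// ltW.
  rewrite big_nat_recr//= leeDr//; apply: sume_ge0 => m _.
  by rewrite lee_fin mulr_ge0// exprn_ge0// ltW.
rewrite indicE xb mulr1 lee_fin.
have p2 : 0 < (1 : R) / 2 ^+ n by rewrite divr_gt0// exprn_gt0.
apply: (@le_trans _ _ (pk k (1 / 2 ^+ n))).
  by apply: pk_le; rewrite ?gt_eqF// ger0_norm ?(ltW p2).
have an0 : a != 0 by rewrite gt_eqF.
have h2 : pk k 2^-1 = a.
  have e : 2^-1 `^ k * a = 1 by rewrite /a -powRM ?invr_ge0// mulVf// powR1.
  have -> : pk k 2^-1 = (2^-1 `^ k)^-1 by rewrite /pk ger0_norm ?invr_ge0// powRN.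
  by rewrite (_ : 2^-1 `^ k = a^-1) ?invrK//; apply: (mulIf an0); rewrite e mulVf.
rewrite le_eqVlt; apply/orP; left; apply/eqP; elim: (n) => [|m ih].
  by rewrite !expr0 divr1 /pk normr1 powR1.
by rewrite !exprS invfM mulrCA pkM h2 ih.
Qed.

(** Sum of the geometric series [4 (a / 2)^n]: the ball of index [n] has length [4 / 2^n]. *)
Let C : R := 4 / (1 - a / 2).

Lemma pk_int_le : exists2 C, 0 <= C & forall v (A : set R), measurable A ->
  (\int[lam]_(x in A) (pk k (x - v))%:E <= C%:E + lam A)%E.
Proof.
have q1 : 0 < 1 - a / 2 by have := a2; lra.
exists C => [|v A mA]; first by apply: divr_ge0 => //; exact: ltW.
have mb n : measurable (bll v n) by exact: measurable_itv.
have mT n : measurable_fun setT (fun x => (a ^+ n * \1_(bll v n) x)%:E).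
  apply/measurable_EFinP/measurable_funM; first exact: measurable_cst.
  by apply: measurable_indic; exact: mb.
have T0 n x : (0 <= (a ^+ n * \1_(bll v n) x)%:E)%E.
  by rewrite lee_fin mulr_ge0// exprn_ge0// ltW.
have mS : measurable_fun setT (fun x => \sum_(0 <= n <oo) (a ^+ n * \1_(bll v n) x)%:E)%E.
  exact: ge0_emeasurable_sum.
have S0 x : (0 <= \sum_(0 <= n <oo) (a ^+ n * \1_(bll v n) x)%:E)%E.
  exact: nneseries_ge0.
apply: (@le_trans _ _ (\int[lam]_(x in A) (1%:E + \sum_(0 <= n <oo) (a ^+ n * \1_(bll v n) x)%:E))%E).
  apply: ge0_le_integral => //.
  - by move=> x _; rewrite lee_fin pk_ge0.
  - apply/measurable_EFinP; apply: measurable_funTS; apply: (measurableT_comp (measurable_pk k)).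
    by apply: measurable_funB.
  - by apply: measurable_funTS; apply: emeasurable_funD.
rewrite ge0_integralD//; last exact: measurable_funTS.
rewrite integral_cst// mul1e addeC leeD2r//.
apply: (@le_trans _ _ (\int[lam]_x (\sum_(0 <= n <oo) (a ^+ n * \1_(bll v n) x)%:E))%E).
  by apply: ge0_subset_integral.
rewrite integral_nneseries//.
apply: lime_le.
  by apply: is_cvg_nneseries => n _ _; exact: integral_ge0.
apply: nearW => n.
rewrite (_ : (\sum_(0 <= i < n) _)%E = (\sum_(0 <= i < n) (4 * (a / 2) ^+ i)%:E)%E); last first.
  apply: eq_bigr => i _.
  under eq_integral do rewrite EFinM.
  rewrite ge0_integralZl//; last first.
  - by rewrite lee_fin exprn_ge0// ltW.
  - by apply/measurable_EFinP; apply: measurable_indic; exact: mb.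
  rewrite integral_indic; [|exact: measurableT|exact: mb].
  rewrite setIT /bll /= lebesgue_measure_itv /= lte_fin.
  have p2 : 0 < (2 : R) / 2 ^+ i by rewrite divr_gt0// exprn_gt0.
  rewrite ifT; last by rewrite ltrD2l; lra.
  rewrite -EFinB -EFinM expr_div_n; congr EFin; field.
  by rewrite expf_neq0.
rewrite sumEFin lee_fin.
have -> : \sum_(0 <= i < n) 4 * (a / 2) ^+ i = C - C * (a / 2) ^+ n.
  elim: n => [|n ih]; first by rewrite big_nil expr0 mulr1 subrr.
  rewrite big_nat_recr//= ih exprS /C; field.
  by have := a2; lra.
by rewrite gerBl// mulr_ge0// ?divr_ge0// ?exprn_ge0// ?divr_ge0// ltW.
Qed.

End integral_bound.

End singular_kernel.

(** * Fundamental theorem of calculus across a singularity *)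

Section ftc_singular.
Context (R : realType).
Notation lam := (@lebesgue_measure R).

(** The primitive of [g] and [F] have the same derivative inside and are continuous up to the
    endpoints, so the mean value theorem makes their difference constant. *)
Let FTC_oo (F g : R -> R) (a b : R) : a < b ->
  lam.-integrable `[a, b] (EFin \o g) ->
  {within `[a, b], continuous F} ->
  (forall x, a < x < b -> is_derive x 1 F (g x) /\ {for x, continuous g}) ->
  \int[lam]_(x in `[a, b]) g x = F b - F a.
Proof.
move=> ab ig cF h; pose I x := \int[lam]_(t in `[a, x]) g t.
have cI : {within `[a, b], continuous I}.
  exact: (parameterized_integral_continuous (ltW ab) ig).
have dI x : x \in `]a, b[ -> is_derive x 1 (fun y => I y - F y) 0.
  rewrite in_itv/= => axb; have [dF cg] := h x axb; case/andP: axb => ax xb.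
  have [d1 d2] := continuous_FTC1 xb ig ax cg.
  rewrite -(subrr (g x)); apply: dvB dF.
  by apply: DeriveDef => //; rewrite -derive1E d2.
have [|c cab] := @MVT R (fun y => I y - F y) (fun=> 0) a b ab dI.
  by move=> x; apply: cvgB; [exact: cI|exact: cF].
rewrite mul0r => /eqP; rewrite subr_eq0 => /eqP e.
have Ia : I a = 0 by rewrite /I set_itv1 Rintegral_set1.
by move: e; rewrite Ia /I; lra.
Qed.

(** The point [p] is meant for the singularity of [rho (t - s)] at [s = t]. Splitting there makes it
    an endpoint, where [FTC_oo] asks for no derivative. *)
Lemma FTC_singular (F g : R -> R) (p a b : R) : a <= b ->
  lam.-integrable `[a, b] (EFin \o g) -> continuous F ->
  (forall x, x != p -> is_derive x 1 F (g x) /\ {for x, continuous g}) ->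
  \int[lam]_(x in `[a, b]) g x = F b - F a.
Proof.
rewrite le_eqVlt => /predU1P[<- _ _ _|ab ig cF h].
  by rewrite subrr set_itv1 Rintegral_set1.
have cF' u v : {within `[u, v], continuous F} by exact: continuous_subspaceT.
have [pab|pab] := boolP (a < p < b); last first.
  apply: FTC_oo => // x axb; apply: h; apply: contraNneq pab => <-.
  by case/andP: axb => -> ->.
case/andP: pab => ap pb.
have i1 : lam.-integrable `[a, p] (EFin \o g).
  apply: integrableS ig => //; apply: subset_itvl; rewrite bnd_simp; exact: ltW.
have i2 : lam.-integrable `[p, b] (EFin \o g).
  apply: integrableS ig => //; apply: subset_itvr; rewrite bnd_simp; exact: ltW.
have e1 : \int[lam]_(x in `[a, p]) g x = F p - F a.
  by apply: FTC_oo => // x /andP[_ xp]; apply: h; rewrite lt_eqF.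
have e2 : \int[lam]_(x in `[p, b]) g x = F b - F p.
  by apply: FTC_oo => // x /andP[px _]; apply: h; rewrite gt_eqF.
have := @Rintegral_itvB R g (BLeft a) (BRight b) p ig.
rewrite !bnd_simp => /(_ (ltW ap) (ltW pb)).
rewrite Rintegral_itv_obnd_cbnd; last first.
  by apply: integrableS i2 => //; apply: subset_itvr; rewrite bnd_simp.
by rewrite e1 e2; lra.
Qed.

End ftc_singular.

(** * Regularity of [sigma2] and of its derivative *)

Section variance_function.
Context (R : realType).
Notation lam := (@lebesgue_measure R).

(* The value of [rho] at 0 is irrelevant and is normalized to 0. *)
Record variance_density (sigma2 rho : R -> R) (zeta : R) : Prop := {
  vd_even : forall h, sigma2 (- h) = sigma2 h;
  vd_zero : sigma2 0 = 0;
  vd_lim : sigma2 h / h @[h --> 0^'] --> (0 : R);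
  vd_derivable : forall s : R, s != 0 ->
    derivable sigma2 s 1 /\ derivable (derive1 sigma2) s 1;
  vd_rho : forall s : R, s != 0 -> rho s = 2^-1 * derive1n 2 sigma2 s;
  vd_rho0 : rho 0 = 0;
  vd_zeta : 0 < zeta < 1;
  vd_bound : forall M : R, 0 < M -> exists C : R,
     (forall x : R, 0 < `|x| <= M -> `|rho x| <= C / `|x| `^ zeta) /\
     (forall x h : R, x != 0 -> 4 * `|h| <= `|x| <= M ->
        `|rho (x + h) - rho x| <= C * (`|h| / `|x|) * `|rho x|) }.

Context (sigma2 rho : R -> R) (zeta : R) (vd : variance_density sigma2 rho zeta).

Let z0 : 0 < zeta. Proof. by case/andP: (vd_zeta vd). Qed.
Let z1 : zeta < 1. Proof. by case/andP: (vd_zeta vd). Qed.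

Lemma rho_bound (M : R) : exists2 C, 0 < C &
  (forall x, `|x| <= M -> `|rho x| <= C * pk zeta x) /\
  (forall x h : R, 4 * `|h| <= `|x| <= M ->
     `|rho (x + h) - rho x| <= C * (`|h| / `|x|) * `|rho x|).
Proof.
have M0 : 0 < `|M| + 1 by rewrite ltr_wpDl.
have [C [h1 h2]] := vd_bound vd M0.
have C0 : 0 < `|C| + 1 by rewrite ltr_wpDl.
have CC : C <= `|C| + 1 by rewrite (le_trans (ler_norm C))// lerDl.
have MM x : x <= M -> x <= `|M| + 1.
  by move=> h; rewrite (le_trans h)// (le_trans (ler_norm M))// lerDl.
exists (`|C| + 1) => //; split=> [x xM|x h /andP[hx xM]].
  have [->|x0] := eqVneq x 0.
    by rewrite (vd_rho0 vd) normr0 mulr_ge0 ?pk_ge0 ?ltW.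
  apply: le_trans (h1 x _) _; first by rewrite normr_gt0 x0 MM.
  by rewrite -powRN; apply: ler_wpM2r => //; exact: powR_ge0.
have [x0|x0] := eqVneq x 0.
  have -> : h = 0.
    apply/eqP; rewrite -normr_le0; move: hx; rewrite x0 normr0.
    by have := normr_ge0 h; lra.
  by rewrite addr0 subrr !normr0 mul0r mulr0 mul0r.
apply: le_trans (h2 x h x0 _) _; first by rewrite hx MM.
by apply: ler_wpM2r => //; apply: ler_wpM2r => //; exact: divr_ge0.
Qed.

Lemma rho_continuous x : x != 0 -> {for x, continuous rho}.
Proof.
move=> x0; have [C C0 [_ hC]] := rho_bound `|x|.
have xp : 0 < `|x| by rewrite normr_gt0.
pose K := C * `|rho x| / `|x|.
have K0 : 0 <= K by rewrite divr_ge0// mulr_ge0// ltW.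
apply/cvgrPdist_le => e e0; near=> y.
have hy : `|rho (x + (y - x)) - rho x| <= C * (`|y - x| / `|x|) * `|rho x|.
  apply: hC; rewrite lexx andbT distrC.
  have : `|x - y| <= `|x| / 4.
    by near: y; apply: cvgr_dist_le; [exact: cvg_id|rewrite divr_gt0].
  by lra.
rewrite (_ : x + (y - x) = y) in hy; last by ring.
rewrite distrC (le_trans hy)// (_ : _ * _ * _ = K * `|y - x|); last by rewrite /K; ring.
have : `|x - y| <= e / (K + 1).
  by near: y; apply: cvgr_dist_le; [exact: cvg_id|rewrite divr_gt0// ltr_wpDl].
rewrite distrC ler_pdivlMr ?ltr_wpDl// => h.
apply: le_trans h; rewrite mulrC ler_wpM2l//; lra.
Unshelve. all: end_near. Qed.

Lemma measurable_rho : measurable_fun setT rho.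
Proof.
have -> : [set: R] = [set x | x != 0] `|` [set 0].
  by apply/seteqP; split => x //= _; have [->|] := eqVneq x 0; [right|left].
have oD : open [set x : R | x != 0].
  rewrite (_ : [set x : R | x != 0] = ~` [set 0]); first exact: closed_openC.
  by apply/seteqP; split => x /= /eqP.
apply/measurable_funU; [exact: open_measurable|exact: measurable_set1|].
split; last exact: measurable_fun_set1.
apply: open_continuous_measurable_fun => // x; rewrite inE /= => x0.
exact: rho_continuous.
Qed.

(* The value at 0 is the true derivative, because [sigma2 h / h] tends to 0. *)
Definition dsigma2 (x : R) : R := if x == 0 then 0 else derive1 sigma2 x.

Lemma is_derive_sigma2 (x : R) : is_derive x 1 sigma2 (dsigma2 x).
Proof.
rewrite /dsigma2; case: eqVneq => [->|x0]; last first.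
  by have [d1 _] := vd_derivable vd x0; refine (DeriveDef d1 _); rewrite derive1E.
have h : h^-1 *: (sigma2 (h *: 1 + 0) - sigma2 0) @[h --> 0^'] --> (0 : R).
  have := vd_lim vd; apply: cvg_trans; apply: near_eq_cvg; near=> h.
  by rewrite (vd_zero vd) subr0 addr0 /GRing.scale /= mulr1 mulrC.
apply: DeriveDef; first by apply/cvg_ex; exists 0.
by apply/cvg_lim => //.
Unshelve. all: end_near. Qed.

Lemma is_derive_dsigma2 (x : R) : x != 0 -> is_derive x 1 dsigma2 (2 * rho x).
Proof.
move=> x0; have [_ d2] := vd_derivable vd x0.
have h : is_derive x 1 (derive1 sigma2) (2 * rho x).
  refine (DeriveDef d2 _).
  have := vd_rho vd x0; rewrite derive1nS derive1n1 derive1E => ->.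
  by move: ('D_1 _ x) => D; field.
apply: near_eq_is_derive h.
near=> y; rewrite /dsigma2 ifF//; apply/negbTE.
near: y; apply: open_nbhs_nbhs; split => //; exact: open_neq.
Unshelve. all: end_near. Qed.

Lemma dsigma2N x : dsigma2 (- x) = - dsigma2 x.
Proof.
have h := @dv_affine _ sigma2 (-1) 0 x (dsigma2 (-1 * x + 0)) (is_derive_sigma2 _).
have e : (fun y => sigma2 (-1 * y + 0)) = sigma2.
  by apply/funext => y; rewrite mulN1r addr0 (vd_even vd).
rewrite e in h; have [_ e1] := h; have [_ e2] := is_derive_sigma2 x.
by move: e1; rewrite e2 mulN1r addr0 => ->; rewrite mulrN1 opprK.
Qed.

(** The bound on [rho] is integrated by comparing [dsigma2] with [W] on [[y, x]], where
    [W' = 2 C x^-zeta]. Letting [y] tend to 0 requires points near 0 at which [dsigma2] is small. *)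
Lemma dsigma2_bound (M : R) : exists2 C, 0 < C &
  forall x, `|x| <= M -> `|dsigma2 x| <= C * `|x| `^ (1 - zeta).
Proof.
have [C C0 [hC _]] := rho_bound M.
pose K := 2 * C / (1 - zeta).
have z10 : 0 < 1 - zeta by rewrite subr_gt0.
have K0 : 0 < K by rewrite divr_gt0 ?mulr_gt0.
exists K => // x; wlog x0 : x / 0 <= x => [hw|].
  have [x0|x0] := leP 0 x; first exact: hw.
  by rewrite -[`|dsigma2 x|]normrN -dsigma2N -[`|x|]normrN; apply: hw; rewrite oppr_ge0 ltW.
rewrite (ger0_norm x0) => xM; move: x0; rewrite le_eqVlt => /predU1P[<-|x0].
  by rewrite /dsigma2 eqxx normr0 mulr_ge0 ?powR_ge0 ?ltW.
pose W (y : R) := K * y `^ (1 - zeta).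
have dW (y : R) : 0 < y -> is_derive y 1 W (2 * (C * pk zeta y)).
  move=> y0; apply: is_derive_eq (dvZ K (is_derive1_powR (1 - zeta) y0)) _.
  rewrite /pk gtr0_norm// (_ : 1 - zeta - 1 = - zeta); last by ring.
  by rewrite /K; field; rewrite gt_eqF.
have step (y : R) : 0 < y -> y < x -> `|dsigma2 x - dsigma2 y| <= W x - W y.
  move=> y0 yx; have gen (g g' : R -> R) : (forall t, y <= t <= x -> is_derive t 1 g (g' t)) ->
      (forall t, y < t < x -> 0 <= g' t) -> g y <= g x.
    move=> dg g0; have [t||t] := @MVT R g g' y x yx.
    - by rewrite in_itv/= => /andP[h1 h2]; apply: dg; rewrite !ltW.
    - apply/subspace_continuousP => t; rewrite /= in_itv/= => h.
      by apply: cvg_within_filter; exact: (dv_continuous (dg t h)).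
    rewrite in_itv/= => h e.
    by rewrite -subr_ge0 e mulr_ge0 ?g0// subr_ge0 ltW.
  have tp t : y <= t -> 0 < t by exact: lt_le_trans.
  have r t : y < t < x -> `|rho t| <= C * pk zeta t.
    move=> /andP[h1 h2]; apply: hC; rewrite gtr0_norm ?tp ?(ltW h1)//.
    exact: le_trans (ltW h2) xM.
  have h1 : W y - dsigma2 y <= W x - dsigma2 x.
    apply: (gen (fun t => W t - dsigma2 t) (fun t => 2 * (C * pk zeta t) - 2 * rho t)).
      move=> t /andP[h1 h2]; apply: dvB; first exact: dW (tp t h1).
      by apply: is_derive_dsigma2; rewrite gt_eqF ?tp.
    by move=> t ht; have := r t ht; rewrite ler_norml => /andP[]; lra.
  have h2 : W y + dsigma2 y <= W x + dsigma2 x.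
    apply: (gen (fun t => W t + dsigma2 t) (fun t => 2 * (C * pk zeta t) + 2 * rho t)).
      move=> t /andP[h3 h2]; apply: dvD; first exact: dW (tp t h3).
      by apply: is_derive_dsigma2; rewrite gt_eqF ?tp.
    by move=> t ht; have := r t ht; rewrite ler_norml => /andP[]; lra.
  by rewrite ler_norml; apply/andP; split; lra.
apply/ler_addgt0Pr => e e0; rewrite -/(W x).
(* The mean value theorem on [[0, h]] turns the smallness of [sigma2 h / h] into a point where
   [dsigma2] is small. *)
have [y [y0 yx hy]] : exists y, [/\ 0 < y, y < x & `|dsigma2 y| <= e].
  have := vd_lim vd => /cvgrPdist_le /(_ e e0).
  rewrite /dnbhs /= => -[r /= r0 hr].
  pose h := Num.min x (r / 2).
  have h0 : 0 < h by rewrite lt_min x0 divr_gt0.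
  have hr2 : h <= r / 2 by rewrite ge_min lexx orbT.
  have hx : h <= x by rewrite ge_min lexx.
  have := hr h; rewrite /ball_ /= !sub0r !normrN gtr0_norm// => /(_ _ _) hh.
  have {}hh : `|sigma2 h / h| <= e by apply: hh; [lra|rewrite gt_eqF].
  have [|t] := @MVT R sigma2 dsigma2 0 h h0 (fun t _ => is_derive_sigma2 t).
    by apply: continuous_subspaceT => t; exact: dv_continuous (is_derive_sigma2 t).
  rewrite in_itv/= (vd_zero vd) !subr0 => /andP[t0 th] et.
  exists t; split=> //; first exact: lt_le_trans hx.
  by move: hh; rewrite et mulfK// gt_eqF.
have W0 : 0 <= W y by rewrite mulr_ge0 ?powR_ge0 ?ltW.
have := step y y0 yx; have := ler_normD (dsigma2 x - dsigma2 y) (dsigma2 y).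
by rewrite subrK; lra.
Unshelve. all: end_near. Qed.

Lemma dsigma2_continuous : continuous dsigma2.
Proof.
move=> x; have [->|x0] := eqVneq x 0; last exact: dv_continuous (is_derive_dsigma2 x0).
have [C C0 hC] := dsigma2_bound 1.
rewrite /continuous_at {2}/dsigma2 eqxx; apply/norm_cvg0P.
have z10 : 0 < 1 - zeta by rewrite subr_gt0.
apply/cvgrPdist_le => e e0.
have d0 : 0 < (e / C) `^ (1 - zeta)^-1 by rewrite powR_gt0// divr_gt0.
near=> y; rewrite sub0r normrN normr_id.
have y1 : `|y| <= 1 by near: y; apply: cvgr0_norm_le; [exact: cvg_id|exact: ltr01].
have y2 : `|y| <= (e / C) `^ (1 - zeta)^-1.
  by near: y; apply: cvgr0_norm_le; [exact: cvg_id|exact: d0].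
apply: le_trans (hC y y1) _; rewrite mulrC -ler_pdivlMr//.
apply: (@le_trans _ _ (((e / C) `^ (1 - zeta)^-1) `^ (1 - zeta))).
  by apply: ge0_ler_powR; rewrite ?nnegrE ?powR_ge0 ?(ltW z10).
by rewrite -powRrM mulVf ?gt_eqF// powRr1// divr_ge0// ltW.
Unshelve. all: end_near. Qed.

(** Where [sigma2 x > 0] this reads [x^zeta <= C x^2 / sigma2 x], and it is in this form that powers
    of [h] are exchanged for powers of [h^2 / sigma2 h] in the expansion. *)
Lemma sigma2_bound (M : R) : exists2 C, 0 < C &
  forall x, 0 < x <= M -> `|sigma2 x| <= C * x ^+ 2 * pk zeta x.
Proof.
have [C C0 hC] := dsigma2_bound M; exists C => // x /andP[x0 xM].
have [|t] := @MVT R sigma2 dsigma2 0 x x0 (fun t _ => is_derive_sigma2 t).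
  by apply: continuous_subspaceT => t; exact: dv_continuous (is_derive_sigma2 t).
rewrite in_itv/= (vd_zero vd) !subr0 => /andP[t0 tx] ->.
rewrite normrM (gtr0_norm x0) expr2 mulrA mulrAC.
rewrite ler_wpM2r ?(ltW x0)//.
apply: le_trans (hC t _) _; first by rewrite gtr0_norm// (le_trans (ltW tx)).
rewrite -mulrA ler_wpM2l ?(ltW C0)// /pk gtr0_norm// (gtr0_norm x0).
have -> : x * x `^ (- zeta) = x `^ (1 - zeta).
  rewrite [RHS]powRD; last by rewrite (gt_eqF x0) implybT.
  by rewrite (powRr1 (ltW x0)).
by apply: ge0_ler_powR; rewrite ?nnegrE ?ltW// subr_gt0.
Qed.

End variance_function.

(** * The covariance form of the generalized derivative *)

Section bilinear_form.
Context (R : realType).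
Notation lam := (@lebesgue_measure R).
Notation lam2 := ((@lebesgue_measure R) \x (@lebesgue_measure R))%E.

(** Bounded functions with compact support in the half-line, with interval and bound kept explicit,
    since constants must be uniform over families of kernels. *)
Definition bcs (N K : R) (g : R -> R) :=
  [/\ measurable_fun setT g, (forall x, `|g x| <= K) &
      (forall x, ~~ (0 <= x <= N) -> g x = 0)].

Lemma bcs_le N K g : bcs N K g -> forall x, `|g x| <= K * \1_`[0, N] x.
Proof.
move=> [_ h1 h2] x; rewrite indicE; have [_|] := boolP (x \in _); first by rewrite mulr1.
by rewrite notin_setE/= in_itv/= => /negP h; rewrite h2// normr0 mulr0.
Qed.

Lemma bcsW N N' K K' g : N <= N' -> K <= K' -> bcs N K g -> bcs N' K' g.
Proof.
move=> NN KK [h1 h2 h3]; split=> // x; first exact: le_trans (h2 x) KK.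
move=> hx; apply: h3; apply: contra hx => /andP[-> h]/=; exact: le_trans h NN.
Qed.

Lemma bcsD N K K' g g' : bcs N K g -> bcs N K' g' -> bcs N (K + K') (fun x => g x + g' x).
Proof.
move=> [h1 h2 h3] [h4 h5 h6]; split=> [|x|x hx]; first exact: measurable_funD.
- by apply: le_trans (ler_normD _ _) _; exact: lerD.
- by rewrite h3// h6// addr0.
Qed.

Lemma bcsZ N K c g : bcs N K g -> bcs N (`|c| * K) (fun x => c * g x).
Proof.
move=> [h1 h2 h3]; split=> [|x|x hx]; first exact: measurable_funM.
- by rewrite normrM ler_wpM2l.
- by rewrite h3// mulr0.
Qed.

Lemma bcsB N K K' g g' : bcs N K g -> bcs N K' g' -> bcs N (K + K') (fun x => g x - g' x).
Proof.
move=> h h'; have := bcsD h (bcsZ (-1) h'); rewrite normrN1 mul1r.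
rewrite (_ : (fun x => g x + -1 * g' x) = (fun x => g x - g' x))//.
by apply/funext => x; rewrite mulN1r.
Qed.

Lemma bcs0 N : bcs N 0 (fun=> 0).
Proof. by split=> // x; rewrite normr0. Qed.

Lemma bcs_K0 N K g : bcs N K g -> 0 <= K.
Proof. by move=> [_ h _]; exact: le_trans (normr_ge0 _) (h 0). Qed.

Let mfst : measurable_fun setT (fun p : R * R => p.1).
Proof. exact: measurable_fst. Qed.

Let msnd : measurable_fun setT (fun p : R * R => p.2).
Proof. exact: measurable_snd. Qed.

Let mdiff : measurable_fun setT (fun p : R * R => p.1 - p.2).
Proof. exact: measurable_funB. Qed.

Lemma continuous_affine (f : R -> R) (c b s : R) : {for c * s + b, continuous f} ->
  {for s, continuous (fun y => f (c * y + b))}.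
Proof.
move=> cf; apply: (@continuous_comp R R R (fun y : R => c * y + b) f) => //.
by apply: cvgD; [apply: cvgM; [exact: cvg_cst|exact: cvg_id]|exact: cvg_cst].
Qed.

Lemma measurable_diff (f : R -> R) : measurable_fun setT f ->
  measurable_fun setT (fun p : R * R => f (p.1 - p.2)).
Proof. by move=> mf; exact: (measurableT_comp mf mdiff). Qed.

Lemma measurable_comp1 (f : R -> R) : measurable_fun setT f ->
  measurable_fun setT (fun p : R * R => f p.1).
Proof. by move=> mf; exact: (measurableT_comp mf mfst). Qed.

Lemma measurable_comp2 (f : R -> R) : measurable_fun setT f ->
  measurable_fun setT (fun p : R * R => f p.2).
Proof. by move=> mf; exact: (measurableT_comp mf msnd). Qed.

Lemma intg_singular_kernel (k : R) : 0 <= k < 1 -> exists2 C, 0 <= C &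
  forall (N L : R) (F : R * R -> R), 0 <= N -> 0 <= L -> measurable_fun setT F ->
  (forall p, `|F p| <= L * (pk k (p.1 - p.2) * \1_`[0, N] p.2 * \1_`[0, N] p.1)) ->
  intg lam2 F /\ \int[lam2]_p `|F p| <= L * (N * (C + N)).
Proof.
move=> /andP[k0 k1]; have [C C0 hC] := pk_int_le k0 k1; exists C => // N L F N0 L0 mF hF.
have mN : measurable (`[0, N] : set R) by exact: measurable_itv.
have lN : (lam `[0%R, N] = N%:E)%E.
  rewrite lebesgue_measure_itv/= lte_fin; case: ltgtP N0 => // [_|<-] _.
    by rewrite -EFinB subr0.
  by [].
have mFa : measurable_fun setT (fun p : R * R => `|F p|%:E).
  by apply/measurable_EFinP; exact: measurableT_comp.
have bnd : (\int[lam]_x \int[lam]_y `|F (x, y)|%:E <= (L * (N * (C + N)))%:E)%E.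
  apply: (@le_trans _ _ (\int[lam]_x ((L * (C + N)) * \1_`[0, N] x)%:E)%E).
    apply: ge0_le_integral => //.
    - by move=> x _; apply: integral_ge0 => y _; rewrite lee_fin.
    - by apply: (@measurable_fun_fubini_tonelli_F _ _ _ _ R lam _ mFa) => p; rewrite lee_fin.
    - by apply/measurable_EFinP/measurable_funM => //; exact: measurable_indic.
    move=> x _; apply: (@le_trans _ _ (\int[lam]_(y in `[0%R, N])
        ((L * \1_`[0%R, N] x)%:E * (pk k (y - x))%:E))%E).
      rewrite [leRHS]integral_mkcond; apply: ge0_le_integral => //.
      - exact: (measurableT_comp mFa (pair1_measurable x)).
      - apply/(measurable_restrictT _ _).1 => //; apply: measurable_funTS.
        apply/measurable_EFinP/measurable_funM => //.
        apply: (measurableT_comp (measurable_pk k)); exact: measurable_funB.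
      move=> y _; rewrite patchE; have := hF (x, y); rewrite /= [\1_`[0, N] y]indicE.
      case: ifPn => _; rewrite ?mulr0 ?mul0r ?mulr0 lee_fin//.
      by move/le_trans; apply; rewrite -pkN opprB mulr1 mulrA mulrAC.
    have cx0 : 0 <= L * \1_`[0, N] x by rewrite mulr_ge0.
    rewrite ge0_integralZl//; last 2 first.
    - apply/measurable_EFinP; apply: measurable_funTS.
      apply: (measurableT_comp (measurable_pk k)); exact: measurable_funB.
    - by move=> y _; rewrite lee_fin pk_ge0.
    apply: le_trans (lee_wpmul2l _ (hC x _ mN)) _; first by rewrite lee_fin.
    by rewrite [lam _]lN -EFinD -EFinM lee_fin mulrAC.
  under eq_integral do rewrite EFinM.
  rewrite ge0_integralZl//; last 2 first.
  - by apply/measurable_EFinP; exact: measurable_indic.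
  - by rewrite lee_fin mulr_ge0// addr_ge0.
  rewrite integral_indic// setIT [X in (_ * X)%E]lN -EFinM lee_fin.
  by rewrite le_eqVlt; apply/orP; left; apply/eqP; ring.
have iF : intg lam2 F by apply: intg_prodP => //; apply: le_lt_trans bnd _; rewrite ltry.
split=> //; apply: Int_ge0_le => //.
  by rewrite mulr_ge0// mulr_ge0// addr_ge0.
by rewrite (@fubini_tonelli1 _ _ _ _ R lam lam _ mFa)// => p; rewrite lee_fin.
Qed.

Context (sigma2 rho : R -> R) (zeta : R) (vd : variance_density sigma2 rho zeta).

(* the covariance of G'(g) and G'(g') *)
Definition Bf (g g' : R -> R) := \int[lam2]_p (rho (p.1 - p.2) * g p.2 * g' p.1).

Let zz : 0 <= zeta < 1.
Proof. by case/andP: (vd_zeta vd) => /ltW -> ->. Qed.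

Lemma measurable_Bf N K K' g g' : bcs N K g -> bcs N K' g' ->
  measurable_fun setT (fun p : R * R => rho (p.1 - p.2) * g p.2 * g' p.1).
Proof.
move=> [mg _ _] [mg' _ _]; apply: measurable_funM; last exact: measurable_comp1.
apply: measurable_funM; last exact: measurable_comp2.
exact: measurable_diff (measurable_rho vd).
Qed.

(** Integrability of the singular kernel makes the form continuous for the uniform norm on a fixed
    interval, which is why uniform approximation by step functions is enough later. *)
Lemma Bf_bound (N : R) : 0 <= N -> exists2 C, 0 <= C &
  forall K K' g g', bcs N K g -> bcs N K' g' ->
    intg lam2 (fun p => rho (p.1 - p.2) * g p.2 * g' p.1) /\ `|Bf g g'| <= C * K * K'.
Proof.
move=> N0; have [C C0 hC] := intg_singular_kernel zz.
have [D D0 [hD _]] := rho_bound vd N.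
exists (D * (N * (C + N))) => [|K K' g g' hg hg'].
  by rewrite mulr_ge0 ?(ltW D0)// mulr_ge0// addr_ge0.
have K0 := bcs_K0 hg; have K'0 := bcs_K0 hg'.
have [||p|i1 i2] := hC N (D * K * K') (fun p => rho (p.1 - p.2) * g p.2 * g' p.1) N0.
- by rewrite !mulr_ge0// ltW.
- exact: measurable_Bf hg hg'.
- have h1 := bcs_le hg p.2; have h2 := bcs_le hg' p.1.
  move: h1 h2; rewrite !normrM !indicE.
  have [|_] := boolP (p.2 \in `[0, N]%classic); last first.
    rewrite mulr0 => h1 _; have -> : `|g p.2| = 0 by apply/eqP; rewrite eq_le h1 normr_ge0.
    by rewrite !mulr0 !mul0r mulr0.
  have [|_] := boolP (p.1 \in `[0, N]%classic); last first.
    rewrite !mulr0 => _ _ h2; have -> : `|g' p.1| = 0 by apply/eqP; rewrite eq_le h2 normr_ge0.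
    by rewrite !mulr0.
  rewrite !inE /= !in_itv/= !mulr1 => /andP[a1 a2] /andP[a3 a4] h1 h2.
  have hd : `|p.1 - p.2| <= N by rewrite ler_norml; apply/andP; split; lra.
  have := hD _ hd => h3.
  rewrite (_ : D * K * K' * _ = D * pk zeta (p.1 - p.2) * K * K'); last by ring.
  by apply: ler_pM => //; exact: ler_pM.
split=> //; apply: le_trans (norm_Int i1) _; apply: le_trans i2 _.
by rewrite le_eqVlt; apply/orP; left; apply/eqP; ring.
Qed.

Section algebra.
Context (N K1 K2 K3 : R) (g1 g2 g3 : R -> R).
Hypothesis N0 : 0 <= N.
Hypothesis h1 : bcs N K1 g1.
Hypothesis h2 : bcs N K2 g2.
Hypothesis h3 : bcs N K3 g3.

Lemma intg_Bf : intg lam2 (fun p => rho (p.1 - p.2) * g1 p.2 * g2 p.1).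
Proof. by have [C _ /(_ _ _ _ _ h1 h2)[]] := Bf_bound N0. Qed.

End algebra.

Lemma BfDl N K1 K2 K3 g1 g2 g3 : 0 <= N -> bcs N K1 g1 -> bcs N K2 g2 -> bcs N K3 g3 ->
  Bf (fun x => g1 x + g2 x) g3 = Bf g1 g3 + Bf g2 g3.
Proof.
move=> N0 h1 h2 h3; rewrite /Bf -IntD; [|exact: (intg_Bf N0 h1 h3)|exact: (intg_Bf N0 h2 h3)].
by apply: eq_Rintegral => p _; ring.
Qed.

Lemma BfDr N K1 K2 K3 g1 g2 g3 : 0 <= N -> bcs N K1 g1 -> bcs N K2 g2 -> bcs N K3 g3 ->
  Bf g3 (fun x => g1 x + g2 x) = Bf g3 g1 + Bf g3 g2.
Proof.
move=> N0 h1 h2 h3; rewrite /Bf -IntD; [|exact: (intg_Bf N0 h3 h1)|exact: (intg_Bf N0 h3 h2)].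
by apply: eq_Rintegral => p _; ring.
Qed.

Lemma BfZl N K1 K2 g1 g2 c : 0 <= N -> bcs N K1 g1 -> bcs N K2 g2 ->
  Bf (fun x => c * g1 x) g2 = c * Bf g1 g2.
Proof.
move=> N0 h1 h2; rewrite /Bf -IntZ; last exact: (intg_Bf N0 h1 h2).
by apply: eq_Rintegral => p _; ring.
Qed.

Lemma BfZr N K1 K2 g1 g2 c : 0 <= N -> bcs N K1 g1 -> bcs N K2 g2 ->
  Bf g1 (fun x => c * g2 x) = c * Bf g1 g2.
Proof.
move=> N0 h1 h2; rewrite /Bf -IntZ; last exact: (intg_Bf N0 h1 h2).
by apply: eq_Rintegral => p _; ring.
Qed.

Lemma Bf_fubini N K1 K2 g1 g2 : 0 <= N -> bcs N K1 g1 -> bcs N K2 g2 ->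
  Bf g1 g2 = \int[lam]_t \int[lam]_s (rho (t - s) * g1 s * g2 t).
Proof.
move=> N0 h1 h2; rewrite /Bf -(Fubini1 (intg_Bf N0 h1 h2)).2.
by apply: eq_Rintegral.
Qed.

Lemma rho_normE N K g : 0 <= N -> bcs N K g -> rho_norm rho g = Num.sqrt (Bf g g).
Proof.
move=> N0 h; rewrite (Bf_fubini N0 h h) /rho_norm; congr Num.sqrt.
have g0 x : x \notin (`[0, +oo[%classic : set R) -> g x = 0.
  rewrite notin_setE/= in_itv/= andbT => /negP hx; case: h => _ _; apply.
  by rewrite (negbTE hx).
rewrite Rintegral_mkcond; apply: eq_Rintegral => t _; rewrite patchE.
case: ifPn => [_|/g0 ht]; last by rewrite Int_eq0// => s; rewrite ht mulr0.
rewrite Rintegral_mkcond; apply: eq_Rintegral => s _; rewrite patchE.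
by case: ifPn => [//|/g0 hs]; rewrite hs mulr0 mul0r.
Qed.

Lemma bcs_indic (N c d : R) : 0 <= c -> d <= N -> bcs N 1 (\1_`]c, d]).
Proof.
move=> c0 dN; split=> [|x|x].
- exact: measurable_indic.
- by rewrite indicE; case: (_ \in _); rewrite /= ?normr1 ?normr0.
- move=> hx; rewrite indicE memNset//= in_itv/= => /andP[h1 h2].
  by move/negP: hx; apply; apply/andP; split; lra.
Qed.

(** Two integrations of [rho]. The inner one crosses the singularity at [s = t] and produces
    [dsigma2], whose continuity at 0 makes the outer one regular. *)
Lemma Bf_indic (a b c d : R) : 0 <= a <= b -> 0 <= c <= d ->
  Bf (\1_`]c, d]) (\1_`]a, b]) =
  2^-1 * (sigma2 (b - c) - sigma2 (a - c) - sigma2 (b - d) + sigma2 (a - d)).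
Proof.
move=> /andP[a0 ab] /andP[c0 cd].
pose N := Num.max b d.
have bN : b <= N by rewrite le_max lexx.
have dN : d <= N by rewrite le_max lexx orbT.
have N0 : 0 <= N by lra.
have hc := bcs_indic c0 dN; have ha := bcs_indic a0 bN.
rewrite (Bf_fubini N0 hc ha).
have itvE (u v : R) (f : R -> R) : \int[lam]_s (f s * \1_`]u, v] s) =
    \int[lam]_(s in `]u, v]) f s.
  rewrite [RHS]Rintegral_mkcond; apply: eq_Rintegral => s _.
  by rewrite patchE indicE; case: ifPn => _; rewrite ?mulr1 ?mulr0.
have inner (t : R) : lam.-integrable `[c, d] (EFin \o (fun s => rho (t - s))) /\
    \int[lam]_(s in `]c, d]) rho (t - s) = 2^-1 * (dsigma2 sigma2 (t - c) - dsigma2 sigma2 (t - d)).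
  have mr : measurable_fun setT (fun s : R => rho (t - s)).
    by apply: (measurableT_comp (measurable_rho vd)); exact: measurable_funB.
  have [C C0 [hC _]] := rho_bound vd (`|t| + `|c| + `|d|).
  have /andP[z0 z1] := zz.
  have [D D0 hD] := pk_int_le z0 z1.
  have i1 : lam.-integrable `[c, d] (EFin \o (fun s => rho (t - s))).
    apply/integrableP; split; first by apply/measurable_EFinP; exact: measurable_funTS.
    apply: (@le_lt_trans _ _ (\int[lam]_(s in `[c, d]) (C%:E * (pk zeta (s - t))%:E))%E).
      apply: ge0_le_integral => //.
      - by apply: measurableT_comp => //; apply/measurable_EFinP; exact: measurable_funTS.
      - apply: measurable_funeM; apply/measurable_EFinP; apply: measurable_funTS.
        by apply: (measurableT_comp (measurable_pk zeta)); exact: measurable_funB.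
      move=> s; rewrite /= in_itv/= => /andP[cs sd].
      rewrite lee_fin -pkN opprB; apply: hC.
      apply: le_trans (ler_normB _ _) _; rewrite -addrA lerD2l.
      by have := ler_norm d; have := ler_norm (- c); rewrite normrN ler_norml => ? ?;
         apply/andP; split; have := normr_ge0 d; have := normr_ge0 c; lra.
    rewrite ge0_integralZl//; last 3 first.
    - apply/measurable_EFinP; apply: measurable_funTS.
      by apply: (measurableT_comp (measurable_pk zeta)); exact: measurable_funB.
    - by move=> s _; rewrite lee_fin pk_ge0.
    - by rewrite lee_fin ltW.
    apply: (@le_lt_trans _ _ (C%:E * (D%:E + lam `[c, d]))%E).
      by apply: lee_wpmul2l; [rewrite lee_fin ltW|apply: hD].
    rewrite lebesgue_measure_itv/=; case: ifPn => _.
      by rewrite -EFinB -EFinD -EFinM ltry.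
    by rewrite adde0 -EFinM ltry.
  split=> //; rewrite Rintegral_itv_obnd_cbnd; last first.
    by apply: integrableS i1 => //; apply: subset_itvr; rewrite bnd_simp.
  pose F s := - 2^-1 * dsigma2 sigma2 (-1 * s + t).
  have Fe (s : R) : F s = - 2^-1 * dsigma2 sigma2 (t - s) by rewrite /F mulN1r addrC.
  have -> : 2^-1 * (dsigma2 sigma2 (t - c) - dsigma2 sigma2 (t - d)) = F d - F c.
    by rewrite !Fe; move: (dsigma2 _ _) (dsigma2 _ _) => u v; ring.
  apply: (@FTC_singular _ F (fun s => rho (t - s)) t) => //.
  - move=> s; apply: cvgM; first exact: cvg_cst.
    exact: (@continuous_affine (dsigma2 sigma2) (-1) t s (dsigma2_continuous vd (x:=_))).
  - move=> s st; have ts0 : -1 * s + t != 0.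
      by apply: contra_neq st => h; lra.
    split.
      apply: is_derive_eq (dvZ _ (dv_affine (is_derive_dsigma2 vd ts0))) _.
      by rewrite (_ : -1 * s + t = t - s); [field|ring].
    have -> : (fun s => rho (t - s)) = (fun s => rho (-1 * s + t)).
      by apply/funext => y; rewrite mulN1r addrC.
    exact: (@continuous_affine rho (-1) t s (rho_continuous vd ts0)).
transitivity (\int[lam]_t (2^-1 * (dsigma2 sigma2 (t - c) - dsigma2 sigma2 (t - d)) * \1_`]a, b] t)).
  apply: eq_Rintegral => t _; rewrite -(inner t).2 -itvE.
  rewrite indicE; case: (_ \in _); rewrite ?mulr1 ?mulr0.
    by apply: eq_Rintegral => s _; rewrite mulr1.
  by rewrite Int_eq0// => s; rewrite mulr0.
rewrite itvE.
pose H t := 2^-1 * (dsigma2 sigma2 (t - c) - dsigma2 sigma2 (t - d)).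
have cs (u : R) : continuous (fun t : R => dsigma2 sigma2 (t - u)).
  move=> t; rewrite (_ : (fun t => _) = (fun t => dsigma2 sigma2 (1 * t + (- u)))).
    exact: (@continuous_affine (dsigma2 sigma2) 1 (- u) t (dsigma2_continuous vd (x:=_))).
  by apply/funext => y; rewrite mul1r.
have cH : continuous H.
  by move=> t; apply: cvgM; [exact: cvg_cst|apply: cvgB; exact: cs].
have iH : lam.-integrable `[a, b] (EFin \o H).
  apply: continuous_compact_integrable; first exact: segment_compact.
  exact: continuous_subspaceT.
rewrite Rintegral_itv_obnd_cbnd; last first.
  by apply: integrableS iH => //; apply: subset_itvr; rewrite bnd_simp.
pose F t := 2^-1 * (sigma2 (1 * t + (- c)) - sigma2 (1 * t + (- d))).
have dF (t : R) : is_derive t 1 F (H t).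
  apply: is_derive_eq (dvZ _ (dvB (dv_affine (is_derive_sigma2 vd _))
     (dv_affine (is_derive_sigma2 vd _)))) _.
  by rewrite !mul1r !mulr1.
have -> : 2^-1 * (sigma2 (b - c) - sigma2 (a - c) - sigma2 (b - d) + sigma2 (a - d)) = F b - F a.
  rewrite /F !mul1r; move: (sigma2 _) (sigma2 _) (sigma2 _) (sigma2 _) => u v w z; ring.
(* [H] is continuous everywhere, so the exceptional point may be any; it is placed outside
   [[a, b]]. *)
apply: (@FTC_singular _ F H (a - 1)) => //.
- by move=> t; exact: dv_continuous (dF t).
- by move=> t _; split; [exact: dF|exact: cH].
Qed.

End bilinear_form.

(** * Versions of the generalized derivative *)

Section gaussian_closure.
Context d (T : measurableType d) (R : realType) (P : probability T R).

Lemma sqintg_cst (c : R) : sqintg P (fun=> c).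
Proof.
split; first exact: measurable_cst.
exact: finite_measure_integrable_cst.
Qed.

Lemma sqintg_intg (X : T -> R) : sqintg P X -> intg P X.
Proof. by move=> h; apply: eq_intg (sqintgM (sqintg_cst 1) h) => w; rewrite mul1r. Qed.

Lemma mean_close (X Y : T -> R) : sqintg P X -> sqintg P Y ->
  (\int[P]_w X w - \int[P]_w Y w) ^+ 2 <= msq P (fun w => X w - Y w).
Proof.
move=> hX hY; rewrite -IntB; [|exact: sqintg_intg..].
have := cauchy_schwarz (sqintg_cst 1) (sqintgB hX hY).
rewrite {1}(_ : (fun w => 1 * _) = (fun w => X w - Y w)); last first.
  by apply/funext => w; rewrite mul1r.
by rewrite {1}/msq expr1n Int_prob_cst mul1r.
Qed.

Lemma ae_sqintg (X Y : T -> R) : measurable_fun setT Y -> sqintg P X ->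
  {ae P, forall w, X w = Y w} -> sqintg P Y.
Proof.
move=> mY [mX iX] XY; split=> //.
have m2 : measurable_fun setT (fun w => Y w ^+ 2) by exact: measurable_funX.
apply/integrableP; split; first exact/measurable_EFinP.
move/integrableP: iX => [m1 h].
apply: le_lt_trans h; rewrite le_eqVlt; apply/orP; left; apply/eqP.
apply: ae_eq_integral => //.
- by apply: measurableT_comp => //; exact/measurable_EFinP.
- by apply: measurableT_comp => //; exact: m1.
- by apply: filterS XY => w /= -> _.
Qed.

(** Iterating the moment relation gives the constant [(2 j - 1)!!], the same for all [X]. *)
Lemma even_moment (j : nat) : exists2 c : R, 0 <= c & forall X, gmom P X ->
  \int[P]_w (X w ^+ (j * 2)) = c * msq P X ^+ j.
Proof.
elim: j => [|j [c c0 h]].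
  exists 1 => // X _; rewrite mul0n mulr1 -[RHS](Int_prob_cst P 1).
  by apply: eq_Rintegral => w _; rewrite expr0.
exists ((j * 2).+1%:R * c) => [|X gX]; first by rewrite mulr_ge0.
case: (gX) => _ _ _ hX; rewrite mulSn add2n hX h// exprS; ring.
Qed.

(** Induction through [x^(k+1) - y^(k+1) = x (x^k - y^k) + y^k (x - y)]; the inequalities [mix]
    absorb lower powers into the highest ones. *)
Lemma exp_diff_sqr (k : nat) : exists2 c : R, 0 <= c & forall x y : R,
  (x ^+ k - y ^+ k) ^+ 2 <= c * ((x - y) ^+ 2 * (1 + x ^+ (k * 2) + y ^+ (k * 2))).
Proof.
have mix (a b : R) n : 0 <= a -> 0 <= b -> a * b ^+ n <= a ^+ n.+1 + b ^+ n.+1.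
  move=> a0 b0; have [ab|/ltW ba] := leP a b.
    apply: (@le_trans _ _ (b ^+ n.+1)); last by rewrite lerDr exprn_ge0.
    by rewrite exprS ler_wpM2r// exprn_ge0.
  apply: (@le_trans _ _ (a ^+ n.+1)); last by rewrite lerDl exprn_ge0.
  by rewrite exprS ler_wpM2l// lerXn2r ?nnegrE.
have mix1 (a : R) n : 0 <= a -> a <= 1 + a ^+ n.+1.
  by move=> a0; have := mix a 1 n a0 ler01; rewrite !expr1n mulr1 addrC.
have mix2 (a : R) n : 0 <= a -> a ^+ n <= 1 + a ^+ n.+1.
  by move=> a0; have := mix 1 a n ler01 a0; rewrite !expr1n mul1r.
elim: k => [|k [c c0 h]].
  by exists 0 => // x y; rewrite !expr0 subrr expr0n mul0r.
exists (6 * c + 2) => [|x y]; first by rewrite addr_ge0// mulr_ge0.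
have x0 := sqr_ge0 x; have y0 := sqr_ge0 y.
have Ex n : x ^+ (n * 2) = (x ^+ 2) ^+ n by rewrite mulnC exprM.
have Ey n : y ^+ (n * 2) = (y ^+ 2) ^+ n by rewrite mulnC exprM.
have := h x y; rewrite !Ex !Ey.
have m1 := mix _ _ k x0 y0; have m2 := mix1 _ k x0; have m3 := mix2 _ k y0.
have eX : x ^+ 2 * (x ^+ 2) ^+ k = (x ^+ 2) ^+ k.+1 by rewrite [RHS]exprS.
have p1 : 0 <= (x ^+ 2) ^+ k.+1 by rewrite exprn_ge0.
have p2 : 0 <= (y ^+ 2) ^+ k.+1 by rewrite exprn_ge0.
have p3 : 0 <= (y ^+ 2) ^+ k by rewrite exprn_ge0.
have eY : (y ^+ k) ^+ 2 = (y ^+ 2) ^+ k by rewrite -!exprM mulnC.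
move: m1 m2 m3 eX p1 p2 p3 eY; move: ((x ^+ 2) ^+ k.+1) ((y ^+ 2) ^+ k.+1) => X1 Y1.
move: ((x ^+ 2) ^+ k) ((y ^+ 2) ^+ k) => X0 Y0 m1 m2 m3 eX p1 p2 p3 eY hk.
have -> : x ^+ k.+1 - y ^+ k.+1 = x * (x ^+ k - y ^+ k) + y ^+ k * (x - y).
  by rewrite !exprS; ring.
apply: (@le_trans _ _ (2 * (x ^+ 2 * (x ^+ k - y ^+ k) ^+ 2) + 2 * (Y0 * (x - y) ^+ 2))).
  rewrite -eY; move: (y ^+ k) (x - y) => v z; move: (x ^+ k - v) => u.
  have := sqr_ge0 (x * u - v * z); lra.
have h1 : x ^+ 2 * (x ^+ k - y ^+ k) ^+ 2 <= x ^+ 2 * (c * ((x - y) ^+ 2 * (1 + X0 + Y0))).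
  by apply: ler_wpM2l.
have z0 := sqr_ge0 (x - y); move: h1 z0; move: ((x - y) ^+ 2) => z h1 z0.
have cz0 : 0 <= c * z by rewrite mulr_ge0.
have h2 : c * z * (x ^+ 2 + X1 + x ^+ 2 * Y0) <= c * z * (3 * (1 + X1 + Y1)).
  by apply: ler_wpM2l => //; lra.
have h3 : z * Y0 <= z * (1 + X1 + Y1) by apply: ler_wpM2l => //; lra.
have e1 : x ^+ 2 * (c * (z * (1 + X0 + Y0))) = c * z * (x ^+ 2 + X1 + x ^+ 2 * Y0).
  by rewrite -eX; ring.
have e2 : (6 * c + 2) * (z * (1 + X1 + Y1)) =
    2 * (c * z * (3 * (1 + X1 + Y1))) + 2 * (z * (1 + X1 + Y1)) by ring.
rewrite e2 (mulrC Y0 z); rewrite e1 in h1; lra.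
Qed.

(** The fourth moment of a Gaussian variable is a multiple of its squared variance. Hence
    Cauchy-Schwarz applied to [(X - Y)^2] and a polynomial weight loses only a constant, and taking
    powers is Lipschitz in [L^2] when variances are bounded. *)
Lemma msq_power_diff (k : nat) (V : R) : 0 <= V -> exists2 M : R, 0 <= M & forall X Y,
  gmom P X -> gmom P Y -> gmom P (fun w => X w - Y w) -> msq P X <= V -> msq P Y <= V ->
  msq P (fun w => X w ^+ k - Y w ^+ k) <= M * msq P (fun w => X w - Y w).
Proof.
move=> V0; have [c c0 hc] := exp_diff_sqr k.
have [a a0 ha] := even_moment (k * 2); have [a2 a20 ha2] := even_moment 2.
pose B := a * V ^+ (k * 2).
have B0 : 0 <= B by rewrite mulr_ge0// exprn_ge0.
pose b := 2 + 4 * B + 4 * B.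
have b1 : 1 <= b by rewrite /b; lra.
exists (c * ((1 + a2) * b)) => [|X Y gX gY gD vX vY].
  by apply: mulr_ge0 => //; apply: mulr_ge0; [exact: addr_ge0|exact: le_trans ler01 b1].
pose D w := X w - Y w; pose W w := 1 + (X w ^+ (k * 2) + Y w ^+ (k * 2)).
have m2k Z : gmom P Z -> msq P Z <= V -> msq P (fun w => Z w ^+ (k * 2)) <= B.
  move=> gZ vZ; rewrite /msq (_ : \int[P]_w _ = \int[P]_w (Z w ^+ (k * 2 * 2))); last first.
    by apply: eq_Rintegral => w _; rewrite [RHS]exprM.
  by rewrite ha// ler_wpM2l// lerXn2r ?nnegrE// msq_ge0.
have sX := gmom_sqintgX (k * 2) gX; have sY := gmom_sqintgX (k * 2) gY.
have sW : sqintg P W by apply: sqintgD (sqintg_cst 1) _; exact: sqintgD.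
have sD : sqintg P (fun w => D w ^+ 2) := gmom_sqintgX 2 gD.
have mW : msq P W <= b ^+ 2.
  apply: (@le_trans _ _ b); last by rewrite expr2 ler_peMl// (le_trans ler01).
  apply: le_trans (msqD_le (sqintg_cst 1) (sqintgD sX sY)) _.
  have := msqD_le sX sY; have := m2k _ gX vX; have := m2k _ gY vY.
  have -> : msq P (fun=> 1) = 1 by rewrite /msq expr1n Int_prob_cst.
  rewrite /b; lra.
have mD : msq P (fun w => D w ^+ 2) <= ((1 + a2) * msq P D) ^+ 2.
  rewrite {1}/msq (_ : \int[P]_w _ = \int[P]_w (D w ^+ (2 * 2))); last first.
    by apply: eq_Rintegral => w _; rewrite [RHS]exprM.
  rewrite ha2// exprMn ler_wpM2r ?sqr_ge0//; nra.
have := cauchy_schwarz_norm sD sW _ (le_trans ler01 b1) mD mW.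
move=> /(_ (mulr_ge0 (addr_ge0 ler01 a20) (msq_ge0 _ _))) h.
apply: (@le_trans _ _ (c * `|\int[P]_w (D w ^+ 2 * W w)|)); last first.
  have -> : c * ((1 + a2) * b) * msq P D = c * ((1 + a2) * msq P D * b) by ring.
  by rewrite ler_wpM2l.
apply: (@le_trans _ _ (c * \int[P]_w (D w ^+ 2 * W w))); last first.
  by rewrite ler_wpM2l// ler_norm.
have iDW : intg P (fun w => D w ^+ 2 * W w) by exact: sqintgM.
rewrite -IntZ//; apply: le_Int => [||w].
- exact: (sqintgB (gmom_sqintgX k gX) (gmom_sqintgX k gY)).2.
- exact: intgZ.
- by have := hc (X w) (Y w); rewrite /W addrA.
Qed.

Lemma cvg_of_sqr_le (u : nat -> R) (l K : R) : (forall n, (u n - l) ^+ 2 <= K / 2 ^+ n) ->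
  u n @[n --> \oo] --> l.
Proof.
move=> h; apply/cvgrPdist_le => /= e e0.
have := cvg_div_exp2 K => /cvgrPdist_le /(_ (e ^+ 2) (exprn_gt0 2 e0)) [N _ hN].
exists N => // n /hN /=; rewrite sub0r normrN => hn.
rewrite distrC -(@ler_pXn2r _ 2)// ?nnegrE ?(ltW e0)// real_normK ?num_real//.
by apply: le_trans (h n) _; apply: le_trans hn; exact: ler_norm.
Qed.

Section limit.
Context (X : nat -> T -> R) (Y : T -> R) (C : R).
Hypothesis gX : forall n, gmom P (X n).
Hypothesis gXX : forall n m, gmom P (fun w => X n w - X m w).
Hypothesis sY : sqintg P Y.
Hypothesis hXY : forall n, msq P (fun w => X n w - Y w) <= C / 4 ^+ n.

Let C0 : 0 <= C.
Proof. by have := le_trans (msq_ge0 _ _) (hXY 0); rewrite expr0 divr1. Qed.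

Let C4 n : C / 4 ^+ n <= C.
Proof.
by rewrite ler_pdivrMr ?exprn_gt0// ler_peMr// exprn_ege1// ler1n.
Qed.

Let V := 2 * C + 2 * msq P Y.

Let vX n : msq P (X n) <= V.
Proof.
have sXn := gmom_sqintg (gX n).
have := msqD_le (sqintgB sXn sY) sY.
rewrite (_ : (fun x => X n x - Y x + Y x) = X n); last first.
  by apply/funext => w; rewrite subrK.
by have := le_trans (hXY n) (C4 n); rewrite /V; lra.
Qed.

Let step n : msq P (fun w => X n.+1 w - X n w) <= (4 * C) / 4 ^+ n.
Proof.
have s1 := gmom_sqintg (gX n.+1); have s2 := gmom_sqintg (gX n).
have := msqB_le s1 sY s2; rewrite (msqC _ Y).
have := hXY n; have := hXY n.+1.
have : C / 4 ^+ n.+1 <= C / 4 ^+ n.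
  by rewrite ler_wpM2l// lef_pV2 ?posrE ?exprn_gt0// ler_weXn2l// ler1n.
rewrite -[4 * C / _]mulrA; lra.
Qed.

(** By [msq_power_diff] the powers inherit the rate [4^-n], so each has its own almost sure limit
    and [L^2] rate. *)
Let powers k : {ae P, forall w, X n w ^+ k @[n --> \oo] --> rlim (fun n => X n w ^+ k)} /\
  sqintg P (fun w => rlim (fun n => X n w ^+ k)) /\
  exists K, forall n, msq P (fun w => X n w ^+ k - rlim (fun n => X n w ^+ k)) <= K / 2 ^+ n.
Proof.
have V0 : 0 <= V by rewrite addr_ge0// mulr_ge0//; exact: msq_ge0.
have [M M0 hM] := msq_power_diff k V0.
have [||h1 h2 h3] := @fast_cauchy R _ T P (fun n w => X n w ^+ k) (M * (4 * C)).
- by move=> n; exact: gmom_sqintgX.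
- move=> n; apply: le_trans (hM _ _ (gX n.+1) (gX n) (gXX _ _) (vX _) (vX _)) _.
  by rewrite -mulrA ler_wpM2l.
by split=> //; split=> //; exists (4 * (M * (4 * C))).
Qed.

Let limE : {ae P, forall w, X n w @[n --> \oo] --> Y w}.
Proof.
have [h1 [h2 [K h3]]] := powers 1.
have h0 : msq P (fun w => rlim (fun n => X n w ^+ 1) - Y w) = 0.
  apply/eqP; rewrite eq_le msq_ge0 andbT.
  apply/ler_addgt0Pr => e e0; rewrite add0r.
  have [n hn] := small_div_exp2 (2 * K + 2 * C) e0.
  apply: le_trans (ltW hn).
  have sX1 := gmom_sqintgX 1 (gX n).
  apply: le_trans (msqB_le h2 sX1 sY) _; rewrite msqC.
  have := h3 n; have := hXY n.
  have : C / 4 ^+ n <= C / 2 ^+ n.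
    by rewrite ler_wpM2l// lef_pV2 ?posrE ?exprn_gt0// lerXn2r ?nnegrE// ler_nat.
  have -> : msq P (fun x => X n x ^+ 1 - Y x) = msq P (fun w => X n w - Y w) by [].
  have -> : (2 * K + 2 * C) / 2 ^+ n = 2 * (K / 2 ^+ n) + 2 * (C / 2 ^+ n).
    by rewrite mulrDl !mulrA.
  lra.
have sB : sqintg P (fun w => rlim (fun n => X n w ^+ 1) - Y w) by exact: sqintgB.
have := msq0_ae sB h0; move: h1; apply: filterS2 => w hw /eqP.
by rewrite subr_eq0 => /eqP <-.
Qed.

Let power_limit k : sqintg P (fun w => Y w ^+ k) /\
  \int[P]_w (X n w ^+ k) @[n --> \oo] --> \int[P]_w (Y w ^+ k).
Proof.
have [h1 [h2 [K h3]]] := powers k.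
have mYk : measurable_fun setT (fun w => Y w ^+ k) by exact: measurable_funX sY.1.
have ae1 : {ae P, forall w, rlim (fun n => X n w ^+ k) = Y w ^+ k}.
  apply: filterS limE => w hw; apply: rlimE.
  elim: k {h1 h2 h3 mYk} => [|k IH]; first by under eq_fun do rewrite expr0; exact: cvg_cst.
  by rewrite exprS; under eq_fun do rewrite exprS; exact: cvgM.
have s1 := ae_sqintg mYk h2 ae1; split=> //.
rewrite (_ : \int[P]_w (Y w ^+ k) = \int[P]_w rlim (fun n => X n w ^+ k)); last first.
  apply: ae_eq_Int => //; [exact: h2.1|].
  by apply: filterS ae1 => w ->.
apply: (@cvg_of_sqr_le _ _ K) => n.
exact: le_trans (mean_close (gmom_sqintgX k (gX n)) h2) (h3 n).
Qed.

(** Every power of [X n] converges in mean to the same power of [Y], so the relations between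
    moments pass to the limit. *)
Lemma gmom_limit : gmom P Y.
Proof.
have mom k := (power_limit k).2.
split=> [|n||n].
- exact: sY.1.
- exact: sqintg_intg (power_limit n).1.
- have h0 : \int[P]_w (X n w ^+ 1) @[n --> \oo] --> \int[P]_w (Y w ^+ 1) := mom 1%N.
  have h1 : (fun n => \int[P]_w (X n w ^+ 1)) = (fun=> 0).
    by apply/funext => n; case: (gX n).
  rewrite h1 in h0; apply: (cvg_unique (@norm_hausdorff _ _) h0); exact: cvg_cst.
have h0 := mom n.+2; have h2 := cvgM (cvgM (cvg_cst (n.+1%:R : R)) (mom 2%N)) (mom n).
have e : (fun m => \int[P]_w (X m w ^+ n.+2)) =
    (fun m => n.+1%:R * \int[P]_w (X m w ^+ 2) * \int[P]_w (X m w ^+ n)).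
  by apply/funext => m; case: (gX m).
rewrite e in h0; apply: (cvg_unique (@norm_hausdorff _ _) h0); exact: h2.
Qed.

End limit.

End gaussian_closure.

Section L2_distance.
Context d (T : measurableType d) (R : realType) (P : probability T R).

Let L2distE (X Y : T -> R) :
  L2dist P X Y = ((\int[P]_w ((X w - Y w) ^+ 2)%:E) `^ 2^-1)%E.
Proof.
rewrite /L2dist unlock /=; congr (_ `^ _)%E; apply: eq_integral => w _.
by rewrite /= powR_mulrn// real_normK// num_real.
Qed.

Lemma L2dist_msq (X Y : T -> R) : sqintg P (fun w => X w - Y w) ->
  L2dist P X Y = (Num.sqrt (msq P (fun w => X w - Y w)))%:E.
Proof. by move=> s; rewrite L2distE (EInt s.2) poweR_EFin powR12_sqrt// msq_ge0. Qed.

Lemma L2dist_le (X Y : T -> R) e : 0 <= e -> sqintg P (fun w => X w - Y w) ->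
  msq P (fun w => X w - Y w) <= e ^+ 2 -> (L2dist P X Y <= e%:E)%E.
Proof.
move=> e0 s h; rewrite L2dist_msq// lee_fin -(ger0_norm e0) -sqrtr_sqr.
exact: ler_wsqrtr.
Qed.

Lemma L2dist_sqintg (X Y : T -> R) : measurable_fun setT X -> measurable_fun setT Y ->
  L2dist P X Y \is a fin_num -> sqintg P (fun w => X w - Y w).
Proof.
move=> mX mY h.
have mXY : measurable_fun setT (fun w => (X w - Y w) ^+ 2).
  by apply: measurable_funX; exact: measurable_funB.
split; first exact: measurable_funB.
apply: intg_ge0P => // [w|]; first exact: sqr_ge0.
rewrite ltey; apply: contraTneq h => e.
by rewrite L2distE e poweRyr ?invr_eq0.
Qed.

Lemma L2dist_cvg0 I (F : set_system I) (FF : Filter F) (X : I -> T -> R) (Z : T -> R) :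
  (forall e : R, 0 < e -> \forall i \near F, sqintg P (fun w => X i w - Z w) /\
     msq P (fun w => X i w - Z w) <= e) ->
  L2dist P (X i) Z @[i --> F] --> 0%E.
Proof.
move=> h; apply/fine_cvgP; split.
  by apply: filterS (h 1 ltr01) => i [s _]; rewrite L2dist_msq.
apply/cvgrPdist_le => /= e e0.
apply: filterS (h _ (exprn_gt0 2 e0)) => i [s hi].
rewrite sub0r normrN L2dist_msq//= ger0_norm ?sqrtr_ge0//.
by rewrite -(ger0_norm (ltW e0)) -sqrtr_sqr; exact: ler_wsqrtr.
Qed.

Lemma cvg0_L2dist I (F : set_system I) (FF : Filter F) (X : I -> T -> R) (Z : T -> R) :
  measurable_fun setT Z -> (\forall i \near F, measurable_fun setT (X i)) ->
  L2dist P (X i) Z @[i --> F] --> 0%E ->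
  forall e : R, 0 < e -> \forall i \near F, sqintg P (fun w => X i w - Z w) /\
     msq P (fun w => X i w - Z w) <= e.
Proof.
move=> mZ mX /fine_cvgP[h1 /cvgrPdist_le h2] e e0.
have se0 : 0 < Num.sqrt e by rewrite sqrtr_gt0.
apply: filterS3 mX h1 (h2 _ se0) => i mXi fi /=.
have s := L2dist_sqintg mXi mZ fi.
rewrite sub0r normrN L2dist_msq//= ger0_norm ?sqrtr_ge0// => h; split=> //.
by rewrite -(sqr_sqrtr (msq_ge0 P _)) -[leRHS](sqr_sqrtr (ltW e0)) lerXn2r ?nnegrE ?sqrtr_ge0.
Qed.

End L2_distance.

(** * Covariance of elementary derivatives *)

Section gaussian_derivative.
Context d (T : measurableType d) (R : realType) (P : probability T R).
Context (G : R -> T -> R) (sigma2 rho : R -> R) (zeta : R).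
Hypothesis vd : variance_density sigma2 rho zeta.
Hypothesis hG : centered_gaussian_process P G.
Hypothesis hS : forall x y : R, 0 <= x -> 0 <= y ->
  msq P (fun w => G x w - G y w) = sigma2 (x - y).
Notation dG := (elementary_deriv G).
Notation wf := (@elementary_on_Rplus R).
Notation Bf := (Bf rho).

Lemma gmom_lin (s : seq (R * R)) : (forall q, q \in s -> 0 <= q.2) ->
  gmom P (fun w => \sum_(q <- s) q.1 * G q.2 w).
Proof.
move=> hs; pose x0 := (0, 0) : R * R.
have := @hG (size s) (fun i => (nth x0 s i).2) (fun i => (nth x0 s i).1).
move=> /(_ (fun i => hs _ (mem_nth _ (ltn_ord i)))) h.
have := centered_gaussian_gmom h.1 h.
rewrite (_ : (fun w => \sum_(i < _) _) = (fun w => \sum_(q <- s) q.1 * G q.2 w))//.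
by apply/funext => w; rewrite (big_nth x0) big_mkord.
Qed.

Lemma gmom_dG e : wf e -> gmom P (dG e).
Proof.
move=> we; pose s := flatten [seq [:: (p.1.1, p.2); (- p.1.1, p.1.2)] | p <- e].
have -> : dG e = (fun w => \sum_(q <- s) q.1 * G q.2 w).
  apply/funext => w; rewrite /elementary_deriv /s big_flatten big_map.
  by apply: eq_bigr => p _; rewrite !big_cons big_nil /=; ring.
apply: gmom_lin => q /flatten_mapP[p /we /andP[p1 p2]].
by rewrite !inE => /orP[/eqP->|/eqP->]//=; exact: le_trans p1 p2.
Qed.

Lemma gmom_increment x y : 0 <= x -> 0 <= y -> gmom P (fun w => G x w - G y w).
Proof.
move=> x0 y0; have := @gmom_lin [:: (1, x); (-1, y)].
rewrite (_ : (fun w => \sum_(q <- _) _) = (fun w => G x w - G y w)).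
  by apply=> q; rewrite !inE => /orP[/eqP->|/eqP->].
by apply/funext => w; rewrite !big_cons big_nil/=; ring.
Qed.

(** Polarization: a product of two increments is half of a signed sum of four squared increments. *)
Let cov_increments a b c e : 0 <= a -> 0 <= b -> 0 <= c -> 0 <= e ->
  \int[P]_w ((G e w - G c w) * (G b w - G a w)) =
  2^-1 * (sigma2 (b - c) - sigma2 (a - c) - sigma2 (b - e) + sigma2 (a - e)).
Proof.
move=> a0 b0 c0 e0; rewrite -!hS//.
have sq x y : 0 <= x -> 0 <= y -> intg P (fun w => (G x w - G y w) ^+ 2).
  by move=> x0 y0; exact: (gmom_sqintg (gmom_increment x0 y0)).2.
have i1 := sq _ _ b0 c0; have i2 := sq _ _ a0 c0; have i3 := sq _ _ b0 e0.
have i4 := sq _ _ a0 e0.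
rewrite /msq -IntB// -IntB//; last exact: intgB.
rewrite -IntD//; last by apply: intgB => //; exact: intgB.
rewrite -IntZ; last by apply: intgD => //; apply: intgB => //; exact: intgB.
by apply: eq_Rintegral => w _; field.
Qed.

Definition elin (s : R) (e : elementary R) t e' : elementary R :=
  [seq ((s * p.1.1, p.1.2), p.2) | p <- e] ++ [seq ((t * p.1.1, p.1.2), p.2) | p <- e'].

Lemma wf_elin s e t e' : wf e -> wf e' -> wf (elin s e t e').
Proof.
move=> we we' p; rewrite mem_cat => /orP[/mapP[q qe ->]|/mapP[q qe ->]].
- exact: we qe.
- exact: we' qe.
Qed.

Lemma elin_fun s e t e' x :
  elementary_fun (elin s e t e') x = s * elementary_fun e x + t * elementary_fun e' x.
Proof.
rewrite /elementary_fun big_cat !big_map !mulr_sumr.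
by congr (_ + _); apply: eq_bigr => p _; rewrite mulrA.
Qed.

Lemma elin_deriv s e t e' w : dG (elin s e t e') w = s * dG e w + t * dG e' w.
Proof.
rewrite /elementary_deriv big_cat !big_map !mulr_sumr.
by congr (_ + _); apply: eq_bigr => p _; rewrite mulrA.
Qed.

Lemma bcs_elementary e : wf e -> exists N K, 0 <= N /\ bcs N K (elementary_fun e).
Proof.
elim: e => [|p e IH] we.
  exists 0, 0; split=> //; rewrite (_ : elementary_fun _ = fun=> 0); first exact: bcs0.
  by apply/funext => x; rewrite /elementary_fun big_nil.
have [q qe|N [K [N0 hN]]] := IH; first by apply: we; rewrite inE qe orbT.
have /andP[p0 p1] := we p (mem_head _ _).
exists (Num.max N p.2), (`|p.1.1| * 1 + K); split; first by rewrite le_max N0.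
rewrite (_ : elementary_fun _ =
    fun x => p.1.1 * \1_`]p.1.2, p.2] x + elementary_fun e x); last first.
  by apply/funext => x; rewrite /elementary_fun big_cons.
apply: bcsD; last by apply: bcsW hN => //; rewrite le_max lexx.
by apply: bcsZ; apply: bcs_indic => //; rewrite le_max lexx orbT.
Qed.

Let Bf0l N K g : 0 <= N -> bcs N K g -> Bf (fun=> 0) g = 0.
Proof.
move=> N0 h; have := BfZl vd 0 N0 (bcs0 N) h.
by under eq_fun do rewrite mul0r; rewrite mul0r.
Qed.

Let Bf0r N K g : 0 <= N -> bcs N K g -> Bf g (fun=> 0) = 0.
Proof.
move=> N0 h; have := BfZr vd 0 N0 h (bcs0 N).
by under eq_fun do rewrite mul0r; rewrite mul0r.
Qed.

Let dG_cons p e : dG (p :: e) = fun w => p.1.1 * (G p.2 w - G p.1.2 w) + dG e w.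
Proof. by apply/funext => w; rewrite /elementary_deriv big_cons. Qed.

Let fun_cons (p : R * R * R) e : elementary_fun (p :: e) =
  fun x => p.1.1 * \1_`]p.1.2, p.2] x + elementary_fun e x.
Proof. by apply/funext => x; rewrite /elementary_fun big_cons. Qed.

Let sq_incr (p : R * R * R) : 0 <= p.1.2 <= p.2 ->
  sqintg P (fun w => p.1.1 * (G p.2 w - G p.1.2 w)).
Proof.
move=> /andP[p0 p1]; apply: sqintgZ; apply: gmom_sqintg.
by apply: gmom_increment => //; exact: le_trans p0 p1.
Qed.

Let cov_single p e : 0 <= p.1.2 <= p.2 -> wf e ->
  \int[P]_w (p.1.1 * (G p.2 w - G p.1.2 w) * dG e w) =
  Bf (fun x => p.1.1 * \1_`]p.1.2, p.2] x) (elementary_fun e).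
Proof.
move=> hp; have /andP[p0 p1] := hp; elim: e => [|q e IH] we.
  have b1 : bcs p.2 (`|p.1.1| * 1) (fun x => p.1.1 * \1_`]p.1.2, p.2] x).
    by apply: bcsZ; exact: bcs_indic.
  rewrite (_ : elementary_fun [::] = fun=> 0); last first.
    by apply/funext => x; rewrite /elementary_fun big_nil.
  rewrite (Bf0r (le_trans p0 p1) b1) Int_eq0// => w.
  by rewrite /elementary_deriv big_nil mulr0.
have we' : wf e by move=> r re; apply: we; rewrite inE re orbT.
have hq := we q (mem_head _ _); have /andP[q0 q1] := hq.
have [N [K [N0 hN]]] := bcs_elementary we'.
pose M := Num.max N (Num.max p.2 q.2).
have NM : N <= M by rewrite le_max lexx.
have pM : p.2 <= M by rewrite !le_max lexx orbT.
have qM : q.2 <= M by rewrite !le_max lexx !orbT.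
have M0 : 0 <= M by exact: le_trans NM.
have b1 := bcs_indic p0 pM; have b2 := bcs_indic q0 qM.
have b3 := bcsW NM (lexx K) hN.
rewrite fun_cons (BfDr vd M0 (bcsZ _ b2) b3 (bcsZ _ b1)) -IH//.
rewrite (BfZr vd _ M0 (bcsZ _ b1) b2) (BfZl vd _ M0 b1 b2) (Bf_indic vd hq hp).
have s1 := sq_incr hp; have s2 := sq_incr hq.
have s3 : sqintg P (dG e) := gmom_sqintg (gmom_dG we').
rewrite dG_cons (_ : \int[P]_w _ = \int[P]_w (p.1.1 * (G p.2 w - G p.1.2 w) *
    (q.1.1 * (G q.2 w - G q.1.2 w)) + p.1.1 * (G p.2 w - G p.1.2 w) * dG e w)); last first.
  by apply: eq_Rintegral => w _; rewrite mulrDr.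
rewrite IntD; [|exact: sqintgM..]; congr (_ + _).
rewrite -cov_increments//; [|exact: le_trans q1|exact: le_trans p1].
rewrite mulrA -IntZ; first by apply: eq_Rintegral => w _; ring.
apply: sqintgM; apply: gmom_sqintg; apply: gmom_increment => //.
- exact: le_trans p1.
- exact: le_trans q1.
Qed.

Lemma cov_elementary e e' : wf e -> wf e' ->
  \int[P]_w (dG e w * dG e' w) = Bf (elementary_fun e) (elementary_fun e').
Proof.
elim: e => [|p e IH] we we'.
  have [N [K [N0 hN]]] := bcs_elementary we'.
  rewrite (_ : elementary_fun [::] = fun=> 0); last first.
    by apply/funext => x; rewrite /elementary_fun big_nil.
  rewrite (Bf0l N0 hN) Int_eq0// => w.
  by rewrite /elementary_deriv big_nil mul0r.
have we1 : wf e by move=> r re; apply: we; rewrite inE re orbT.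
have hp := we p (mem_head _ _); have /andP[p0 p1] := hp.
have [N [K [N0 hN]]] := bcs_elementary we1.
have [N' [K' [N0' hN']]] := bcs_elementary we'.
pose M := Num.max N (Num.max p.2 N').
have NM : N <= M by rewrite le_max lexx.
have pM : p.2 <= M by rewrite !le_max lexx orbT.
have qM : N' <= M by rewrite !le_max lexx !orbT.
have M0 : 0 <= M by exact: le_trans NM.
have b1 := bcs_indic p0 pM; have b3 := bcsW NM (lexx K) hN.
have b2 := bcsW qM (lexx K') hN'.
rewrite fun_cons (BfDl vd M0 (bcsZ _ b1) b3 b2) -IH// -cov_single//.
have s1 := sq_incr hp; have s2 := gmom_sqintg (gmom_dG we').
have s3 : sqintg P (dG e) := gmom_sqintg (gmom_dG we1).
rewrite -IntD; [|exact: sqintgM..].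
by apply: eq_Rintegral => w _; rewrite dG_cons mulrDl.
Qed.

End gaussian_derivative.

Section versions.
Context d (T : measurableType d) (R : realType) (P : probability T R).
Context (G : R -> T -> R) (sigma2 rho : R -> R) (zeta : R).
Hypothesis vd : variance_density sigma2 rho zeta.
Hypothesis hG : centered_gaussian_process P G.
Hypothesis hS : forall x y : R, 0 <= x -> 0 <= y ->
  msq P (fun w => G x w - G y w) = sigma2 (x - y).
Notation dG := (elementary_deriv G).
Notation wf := (@elementary_on_Rplus R).
Notation Bf := (Bf rho).

(* Step functions approximate [g] uniformly on a fixed interval, which controls the
   [rho]-norm and avoids working with its closure. *)
Definition regulated (N : R) (g : R -> R) := (exists K, bcs N K g) /\
  forall e, 0 < e -> exists2 E, wf E & bcs N e (fun x => elementary_fun E x - g x).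

(** One and the same step function approximates [g] uniformly and [Y] in [L^2], so that covariances
    and Gaussianity pass from increments to [Y] in a single limit. *)
Definition version (N : R) (g : R -> R) (Y : T -> R) :=
  [/\ (exists K, bcs N K g), sqintg P Y & forall e, 0 < e -> exists E,
    [/\ wf E, bcs N e (fun x => elementary_fun E x - g x) & msq P (fun w => dG E w - Y w) <= e]].

Lemma regulated_bcs N g (E : elementary R) e : bcs N e (fun x => elementary_fun E x - g x) ->
  forall K, bcs N K g -> bcs N (e + K) (elementary_fun E).
Proof.
move=> h K hg; have := bcsD h hg.
by rewrite (_ : (fun x => _ - g x + g x) = elementary_fun E)//; apply/funext => x; rewrite subrK.
Qed.

Lemma version_regulated N g Y : version N g Y -> regulated N g.
Proof. by move=> [h _ h2]; split=> // e /h2[E [h3 h4 _]]; exists E. Qed.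

Lemma regulatedW N N' g : N <= N' -> regulated N g -> regulated N' g.
Proof.
move=> NN [[K hK] h]; split; first by exists K; exact: bcsW hK.
by move=> e /h[E wE hE]; exists E => //; exact: bcsW hE.
Qed.

Lemma regulated_elementary E : wf E -> exists2 N, 0 <= N & regulated N (elementary_fun E).
Proof.
move=> wE; have [N [K [N0 hN]]] := bcs_elementary wE.
exists N => //; split=> [|e e0]; first by exists K.
exists E => //; rewrite (_ : (fun x => _) = fun=> 0); last first.
  by apply/funext => x; rewrite subrr.
exact: bcsW (lexx N) (ltW e0) (bcs0 N).
Qed.

Let lin_scale (s t e : R) : 0 < e -> exists2 e', 0 < e' &
  `|s| * e' + `|t| * e' <= e /\ 2 * (s ^+ 2 * e') + 2 * (t ^+ 2 * e') <= e.
Proof.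
move=> e0; pose L := 1 + `|s| + `|t| + 2 * s ^+ 2 + 2 * t ^+ 2.
have h1 := normr_ge0 s; have h2 := normr_ge0 t.
have h3 := sqr_ge0 s; have h4 := sqr_ge0 t.
have L0 : 0 < L by rewrite /L; lra.
have q0 : 0 < e / L by exact: divr_gt0.
exists (e / L) => //.
have eL : L * (e / L) = e by rewrite mulrC divfK// gt_eqF.
split; rewrite -[leRHS]eL /L; move: q0; move: (e / L) => q q0; nra.
Qed.

Lemma regulated_lin N s g t g' : regulated N g -> regulated N g' ->
  regulated N (fun x => s * g x + t * g' x).
Proof.
move=> [[K hK] h] [[K' hK'] h']; split.
  by exists (`|s| * K + `|t| * K'); apply: bcsD; exact: bcsZ.
move=> e /(lin_scale s t)[e' e'0 [ee _]].
have [E wE hE] := h _ e'0; have [E' wE' hE'] := h' _ e'0.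
exists (elin s E t E'); first exact: wf_elin.
apply: (bcsW (lexx N) ee); have := bcsD (bcsZ s hE) (bcsZ t hE').
congr (bcs _ _ _); apply/funext => x; rewrite elin_fun; ring.
Qed.

Lemma version_lin N s g Y t g' Y' : version N g Y -> version N g' Y' ->
  version N (fun x => s * g x + t * g' x) (fun w => s * Y w + t * Y' w).
Proof.
move=> [[K hK] sY h] [[K' hK'] sY' h']; split.
- by exists (`|s| * K + `|t| * K'); apply: bcsD; exact: bcsZ.
- by apply: sqintgD; exact: sqintgZ.
move=> e /(lin_scale s t)[e' e'0 [ee1 ee2]].
have [E [wE hE mE]] := h _ e'0; have [E' [wE' hE' mE']] := h' _ e'0.
have sE := gmom_sqintg (gmom_dG hG wE); have sE' := gmom_sqintg (gmom_dG hG wE').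
have s1 := sqintgB sE sY; have s2 := sqintgB sE' sY'.
exists (elin s E t E'); split; first exact: wf_elin.
  apply: (bcsW (lexx N) ee1); have := bcsD (bcsZ s hE) (bcsZ t hE').
  by congr (bcs _ _ _); apply/funext => x; rewrite elin_fun; ring.
rewrite (_ : (fun w => _) = fun w => s * (dG E w - Y w) + t * (dG E' w - Y' w)); last first.
  by apply/funext => w; rewrite elin_deriv; ring.
apply: le_trans (msqD_le (sqintgZ s s1) (sqintgZ t s2)) _.
rewrite !msqZ//; apply: le_trans ee2.
by apply: lerD; rewrite ler_wpM2l// ler_wpM2l ?sqr_ge0.
Qed.

Lemma version_gmom N g Y : version N g Y -> gmom P Y.
Proof.
move=> [_ sY h].
have h4 n : exists E, [/\ wf E, bcs N ((4 : R) ^- n) (fun x => elementary_fun E x - g x)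
    & msq P (fun w => dG E w - Y w) <= 4 ^- n].
  by apply: h; rewrite invr_gt0 exprn_gt0.
have [E hE] := choice h4.
apply: (@gmom_limit _ _ _ P (fun n => dG (E n)) Y 1) => //.
- by move=> n; case: (hE n) => w1 _ _; exact: gmom_dG.
- move=> n m; case: (hE n) => w1 _ _; case: (hE m) => w2 _ _.
  have := gmom_dG hG (@wf_elin _ (-1) _ 1 _ w2 w1).
  rewrite (_ : dG _ = fun w => dG (E n) w - dG (E m) w)//.
  by apply/funext => w; rewrite elin_deriv; ring.
- by move=> n; rewrite div1r; case: (hE n).
Qed.

Lemma version_gpair N g Y g' Y' : version N g Y -> version N g' Y' -> gpair P Y Y'.
Proof. by move=> h h' s t; exact: version_gmom (version_lin s t h h'). Qed.

Let Bf_expand N K K' e g g' E E' : 0 <= N -> bcs N K g -> bcs N K' g' ->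
  bcs N e (fun x => elementary_fun E x - g x) -> bcs N e (fun x => elementary_fun E' x - g' x) ->
  Bf (elementary_fun E) (elementary_fun E') - Bf g g' =
  Bf (fun x => elementary_fun E x - g x) (elementary_fun E') +
  Bf g (fun x => elementary_fun E' x - g' x).
Proof.
move=> N0 hg hg' hE hE'; have bE' := regulated_bcs hE' hg'.
have h1 := BfDl vd N0 hE hg bE'; have h2 := BfDr vd N0 hE' hg' hg.
move: h1 h2; under eq_fun do rewrite subrK; move=> ->.
under eq_fun do rewrite subrK; move=> ->; ring.
Qed.

Let eq_of_le_all (x y L : R) : (forall e, 0 < e -> e <= 1 -> `|x - y| <= e * L) -> x = y.
Proof.
move=> h; apply/eqP; rewrite -subr_eq0 -normr_le0; apply/ler_addgt0Pr => e e0; rewrite add0r.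
pose L' := 1 + `|L|; have L'0 : 0 < L' by rewrite /L' ltr_wpDr.
pose e' := Num.min 1 (e / L').
have e'0 : 0 < e' by rewrite lt_min ltr01 divr_gt0.
apply: le_trans (h e' e'0 _) _; first by rewrite ge_min lexx.
apply: (@le_trans _ _ (e' * L')).
  rewrite ler_wpM2l ?(ltW e'0)// /L'; have := ler_norm L; lra.
by rewrite -ler_pdivlMr// ge_min lexx orbT.
Qed.

Lemma version_cov N g Y g' Y' : 0 <= N -> version N g Y -> version N g' Y' ->
  \int[P]_w (Y w * Y' w) = Bf g g'.
Proof.
move=> N0 [[K hK] sY h] [[K' hK'] sY' h'].
have [C C0 hC] := Bf_bound vd N0.
pose y' := 1 + msq P Y'; pose al := 2 + 2 * msq P Y.
have my := msq_ge0 P Y; have my' := msq_ge0 P Y'.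
have K0 := bcs_K0 hK; have K'0 := bcs_K0 hK'.
apply: (@eq_of_le_all _ _ (y' + al + C * (1 + K') + C * K)) => e e0 e1.
(* The accuracy bounds mean squares: asking for [e^2] makes the terms given by Cauchy-Schwarz linear
   in [e]. *)
have e20 : 0 < e ^+ 2 by rewrite exprn_gt0.
have ee : e ^+ 2 <= e by rewrite expr2 ler_piMl// ltW.
have [E [wE hE mE]] := h _ e20; have [E' [wE' hE' mE']] := h' _ e20.
have sE := gmom_sqintg (gmom_dG hG wE); have sE' := gmom_sqintg (gmom_dG hG wE').
have s1 := sqintgB sE sY; have s2 := sqintgB sE' sY'.
have hB := Bf_expand N0 hK hK' hE hE'.
rewrite -(cov_elementary vd hG hS wE wE') in hB.
have b1 : `|\int[P]_w ((dG E w - Y w) * Y' w)| <= e * y'.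
  apply: cauchy_schwarz_norm => //; rewrite ?(ltW e0)//.
  - by rewrite /y'; lra.
  - by rewrite /y'; nra.
have b2 : `|\int[P]_w (dG E w * (dG E' w - Y' w))| <= al * e.
  apply: cauchy_schwarz_norm => //; rewrite ?(ltW e0)//.
  - by rewrite /al; lra.
  have := msqD_le s1 sY; rewrite (_ : (fun x => _ - Y x + Y x) = dG E); last first.
    by apply/funext => w; rewrite subrK.
  rewrite /al; nra.
have b3 := (hC _ _ _ _ hE (regulated_bcs hE' hK')).2.
have b4 := (hC _ _ _ _ hK hE').2.
have -> : \int[P]_w (Y w * Y' w) = \int[P]_w (dG E w * dG E' w) -
    \int[P]_w (dG E w * (dG E' w - Y' w)) - \int[P]_w ((dG E w - Y w) * Y' w).
  rewrite -IntB; [|exact: sqintgM..].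
  rewrite -IntB; [|by apply: intgB; exact: sqintgM|exact: sqintgM].
  by apply: eq_Rintegral => w _; ring.
have b3' : C * e ^+ 2 * (e ^+ 2 + K') <= e * (C * (1 + K')).
  rewrite mulrAC [leRHS]mulrC; apply: ler_pM => //.
  - by rewrite mulr_ge0// addr_ge0// ltW.
  - exact: ltW.
  - by rewrite ler_wpM2l// lerD2r (le_trans ee).
have b4' : C * K * e ^+ 2 <= e * (C * K).
  by rewrite [leRHS]mulrC ler_wpM2l// mulr_ge0.
move: hB b1 b2 b3 b4; move: (\int[P]_w _) (\int[P]_w _) (\int[P]_w _) => i1 i2 i3.
move: (Bf _ (elementary_fun E')) (Bf g _) (Bf g _) => B1 B2 B3 hB.
rewrite !ler_norml => /andP[? ?] /andP[? ?] /andP[? ?] /andP[? ?].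
by apply/andP; split; lra.
Qed.

(** On step functions the form is a variance, and nonnegativity passes to uniform limits. *)
Lemma Bf_psd N g : 0 <= N -> regulated N g -> 0 <= Bf g g.
Proof.
move=> N0 [[K hK] h]; have [C C0 hC] := Bf_bound vd N0; have K0 := bcs_K0 hK.
rewrite leNgt; apply/negP => neg; pose L := 1 + C * (1 + K) + C * K.
have L0 : 0 < L by rewrite /L; have := mulr_ge0 C0 K0; nra.
pose e := Num.min 1 (- Bf g g / (2 * L)).
have e0 : 0 < e by rewrite lt_min ltr01/= divr_gt0 ?oppr_gt0// mulr_gt0.
have e1 : e <= 1 by rewrite ge_min lexx.
have eL : e * L <= - Bf g g / 2.
  rewrite -ler_pdivlMr// -mulrA -invfM ge_min; apply/orP; right; exact: lexx.
have [E wE hE] := h _ e0.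
have hB := Bf_expand N0 hK hK hE hE.
have b3 := (hC _ _ _ _ hE (regulated_bcs hE hK)).2.
have b4 := (hC _ _ _ _ hK hE).2.
have := msq_ge0 P (dG E).
rewrite (_ : msq P (dG E) = Bf (elementary_fun E) (elementary_fun E)); last first.
  by rewrite -(cov_elementary vd hG hS wE wE); apply: eq_Rintegral => w _; rewrite expr2.
have b3' : C * e * (e + K) <= e * (C * (1 + K)).
  by rewrite mulrAC [leRHS]mulrC ler_wpM2r ?(ltW e0)// ler_wpM2l// lerD2r.
move: eL; rewrite /L; move: hB b3 b4 b3' neg.
move: (Bf _ (elementary_fun E)) (Bf g g) (Bf (elementary_fun E) _) (Bf g _) => B1 B2 B3 B4 hB.
rewrite !ler_norml => /andP[? ?] /andP[? ?] b3' neg eL ?.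
lra.
Qed.

(** The sequence in [is_gen_deriv] is close to [g] only in the [rho]-norm. A uniform approximation
    [E] of [g] is close to [g] in that norm as well, hence [dG E] is close to [dG (En n)], and so to
    [Y]. *)
Lemma gen_deriv_version N g Y : 0 <= N -> regulated N g -> is_gen_deriv P G rho g Y ->
  version N g Y.
Proof.
move=> N0 rg [mY [En [wEn cvg1 cvg2]]]; have [[K hK] h] := rg.
have mdG n : measurable_fun setT (dG (En n)) by case: (gmom_dG hG (wEn n)).
have c2 e : 0 < e -> \forall n \near \oo, sqintg P (fun w => dG (En n) w - Y w) /\
    msq P (fun w => dG (En n) w - Y w) <= e.
  by apply: (cvg0_L2dist _ mY _ cvg2); exact: nearW.
have [C C0 hC] := Bf_bound vd N0.
have sY : sqintg P Y.
  have [n _ /(_ n (leqnn n))[s1 _]] := c2 1 ltr01.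
  have sE := gmom_sqintg (gmom_dG hG (wEn n)).
  by apply: eq_sqintg (sqintgB sE s1) => w; rewrite subKr.
split=> //; first by exists K.
(* Final count: [2 (2 q + 2 q)] for the distance between the two step functions, and [2 q] for the
   distance to [Y]. *)
move=> e e0; pose q := e / 10.
have q0 : 0 < q by rewrite divr_gt0.
have [e1 [e10 e1e] Ce1] : exists2 e1, 0 < e1 /\ e1 <= e & C * e1 * e1 <= q.
  pose e1 := Num.min (Num.min 1 e) (q / (1 + C)).
  have c10 : 0 < 1 + C by rewrite ltr_pwDl.
  have e10 : 0 < e1 by rewrite !lt_min ltr01 e0 divr_gt0.
  have h1 : e1 <= 1 by rewrite !ge_min lexx.
  have h2 : e1 <= e by rewrite !ge_min lexx orbT.
  have h3 : e1 * (1 + C) <= q by rewrite -ler_pdivlMr// !ge_min lexx !orbT.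
  exists e1 => //; have : C * e1 * e1 <= C * e1 by rewrite ler_piMr// mulr_ge0// ltW.
  lra.
have [E wE hE] := h _ e10.
have [n [[s1 m1] r1]] : exists n, (sqintg P (fun w => dG (En n) w - Y w) /\
    msq P (fun w => dG (En n) w - Y w) <= q) /\
    `|0 - rho_norm rho (fun s => elementary_fun (En n) s - g s)| <= Num.sqrt q.
  have sq0 : 0 < Num.sqrt q by rewrite sqrtr_gt0.
  have [n1 _ hn1] := c2 _ q0.
  have /cvgrPdist_le/(_ _ sq0)[n2 _ hn2] := cvg1.
  exists (maxn n1 n2); split; first by apply: hn1; exact: leq_maxl.
  by apply: hn2; exact: leq_maxr.
have [N1 [K1 [N10 hN1]]] := bcs_elementary (wEn n).
pose M := Num.max N N1.
have NM : N <= M by rewrite le_max lexx.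
have N1M : N1 <= M by rewrite le_max lexx orbT.
have M0 : 0 <= M by exact: le_trans NM.
pose u x := elementary_fun E x - g x; pose v x := elementary_fun (En n) x - g x.
have bu : bcs M e1 u := bcsW NM (lexx _) hE.
have bg : bcs M K g := bcsW NM (lexx _) hK.
have bv : bcs M (K1 + K) v := bcsB (bcsW N1M (lexx _) hN1) bg.
have rM : regulated M g := regulatedW NM rg.
have ru : regulated M u.
  have [N2 N20 rE] := regulated_elementary wE.
  split=> [|e2 e20]; first by exists e1.
  have [E2 wE2 hE2] := rM.2 _ e20.
  exists (elin 1 E (-1) E2); first exact: wf_elin.
  have := bcsZ (-1) hE2; rewrite normrN1 mul1r.
  by congr (bcs _ _ _); apply/funext => x; rewrite elin_fun /u; ring.
have rv : regulated M v.
  split=> [|e2 e20]; first by exists (K1 + K).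
  have [E2 wE2 hE2] := rM.2 _ e20.
  exists (elin 1 (En n) (-1) E2); first exact: wf_elin.
  have := bcsZ (-1) hE2; rewrite normrN1 mul1r.
  by congr (bcs _ _ _); apply/funext => x; rewrite elin_fun /v; ring.
have Qv : Bf v v <= q.
  have := Bf_psd M0 rv; move: r1; rewrite sub0r normrN (rho_normE vd M0 bv) => r1 Qv0.
  rewrite ger0_norm ?sqrtr_ge0// in r1.
  by rewrite -(sqr_sqrtr Qv0) -(sqr_sqrtr (ltW q0)) lerXn2r ?nnegrE ?sqrtr_ge0.
have Qu : Bf u u <= q.
  by apply: le_trans Ce1; apply: le_trans (ler_norm _) _; exact: (hC _ _ _ _ hE hE).2.
(* Parallelogram identity, with the nonnegative term at [u + v] dropped. *)
have par : Bf (fun x => u x - v x) (fun x => u x - v x) <= 2 * Bf u u + 2 * Bf v v.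
  have p0 := Bf_psd M0 (regulated_lin 1 1 ru rv).
  have Nv := bcsZ (-1) bv.
  have e1u : (fun x => u x - v x) = (fun x => u x + -1 * v x).
    by apply/funext => x; rewrite mulN1r.
  have e2u : (fun x => 1 * u x + 1 * v x) = (fun x => u x + v x).
    by apply/funext => x; rewrite !mul1r.
  move: p0; rewrite e1u e2u.
  rewrite (BfDl vd M0 bu bv (bcsD bu bv)) (BfDr vd M0 bu bv bu) (BfDr vd M0 bu bv bv).
  rewrite (BfDl vd M0 bu Nv (bcsD bu Nv)) (BfDr vd M0 bu Nv bu) (BfDr vd M0 bu Nv Nv).
  rewrite (BfZr vd _ M0 bu bv) (BfZl vd _ M0 bv bu) (BfZl vd _ M0 bv Nv) (BfZr vd _ M0 bv bv).
  lra.
have sE := gmom_sqintg (gmom_dG hG wE); have sEn := gmom_sqintg (gmom_dG hG (wEn n)).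
exists E; split=> //; first exact: bcsW (lexx _) e1e hE.
apply: le_trans (msqB_le sE sEn sY) _.
have : msq P (fun x => dG E x - dG (En n) x) <= 2 * q + 2 * q.
  have := cov_elementary vd hG hS (@wf_elin _ 1 _ (-1) _ wE (wEn n))
     (@wf_elin _ 1 _ (-1) _ wE (wEn n)).
  have -> : elementary_fun (elin 1 E (-1) (En n)) = (fun x => u x - v x).
    by apply/funext => x; rewrite elin_fun /u /v; ring.
  have -> : msq P (fun x => dG E x - dG (En n) x) =
      \int[P]_w (dG (elin 1 E (-1) (En n)) w * dG (elin 1 E (-1) (En n)) w).
    by apply: eq_Rintegral => w _; rewrite elin_deriv; ring.
  by move=> ->; apply: le_trans par _; lra.
have : e = 10 * q by rewrite /q; field.
move: m1; lra.
Qed.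

Lemma version_gen_deriv N g Y : 0 <= N -> version N g Y -> is_gen_deriv P G rho g Y.
Proof.
move=> N0 [[K hK] sY h]; split; first exact: sY.1.
have [C C0 hC] := Bf_bound vd N0.
have h4 n : exists E, [/\ wf E, bcs N ((2 : R) ^- n) (fun x => elementary_fun E x - g x)
    & msq P (fun w => dG E w - Y w) <= 2 ^- n].
  by apply: h; rewrite invr_gt0 exprn_gt0.
have [E hE] := choice h4.
exists E; split=> [n||].
- by case: (hE n).
- apply: (@cvg_of_sqr_le _ _ _ C) => n; rewrite subr0.
  case: (hE n) => _ hb _; rewrite (rho_normE vd N0 hb).
  have i1 : (2 : R) ^- n <= 1 by rewrite invf_le1 ?exprn_gt0// exprn_ege1// ler1n.
  have i0 : 0 <= (2 : R) ^- n by rewrite invr_ge0 exprn_ge0.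
  have b := (hC _ _ _ _ hb hb).2.
  have b' : Bf (fun x => elementary_fun (E n) x - g x) (fun x => elementary_fun (E n) x - g x)
      <= C / 2 ^+ n.
    apply: le_trans (ler_norm _) _; apply: le_trans b _.
    by rewrite ler_piMr// mulr_ge0.
  have [Q0|Q0] := leP 0 (Bf (fun x => elementary_fun (E n) x - g x)
      (fun x => elementary_fun (E n) x - g x)); first by rewrite sqr_sqrtr.
  by rewrite ler0_sqrtr ?(ltW Q0)// expr0n mulr_ge0.
apply: L2dist_cvg0 => e e0.
have [n0 hn0] := small_div_exp2 1 e0.
exists n0 => // n /= nn; case: (hE n) => w1 _ m1; split.
  by apply: sqintgB => //; exact: gmom_sqintg (gmom_dG hG w1).
apply: le_trans m1 _; apply: le_trans (ltW hn0); rewrite div1r.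
by rewrite lef_pV2 ?posrE ?exprn_gt0// ler_weXn2l// ler1n.
Qed.

End versions.

(** * Averaging kernels *)

Section power_kernels.
Context (R : realType).

(** Tangent line at [z] of a convex function: Bernoulli's inequality for [t / z - 1]. *)
Lemma tangent_exp (n : nat) (t z : R) : 0 <= t -> 0 <= z ->
  z ^+ n.+1 + n.+1%:R * z ^+ n * (t - z) <= t ^+ n.+1.
Proof.
move=> t0; rewrite le_eqVlt => /predU1P[<-|z0].
  rewrite expr0n add0r subr0; case: n => [|n]; first by rewrite expr0 !mul1r expr1.
  by rewrite expr0n mulr0 mul0r exprn_ge0.
have h : -1 <= t / z - 1 by rewrite lerBrDr addNr divr_ge0// ltW.
have := bernoulli_ineq n.+1 h; rewrite addrCA subrr addr0 => b.
have := ler_wpM2l (exprn_ge0 n.+1 (ltW z0)) b.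
rewrite -exprMn (mulrC z) divfK ?gt_eqF//; apply: le_trans.
rewrite le_eqVlt; apply/orP; left; apply/eqP; rewrite exprS; field.
by rewrite gt_eqF.
Qed.

Lemma exp_diff_le (n : nat) (a b m : R) : `|a| <= m -> `|b| <= m ->
  `|a ^+ n.+1 - b ^+ n.+1| <= n.+1%:R * m ^+ n * `|a - b|.
Proof.
move=> am bm; rewrite subrXX normrM mulrC ler_wpM2r//.
apply: le_trans (ler_norm_sum _ _ _) _.
apply: (@le_trans _ _ (\sum_(i < n.+1) m ^+ n)); last first.
  by rewrite sumr_const card_ord -[in leLHS]mulr_natl.
apply: ler_sum => i _; rewrite normrM !normrX.
have -> : m ^+ n = m ^+ (n.+1.-1 - i) * m ^+ i by rewrite -exprD subnK// -ltnS.
by apply: ler_pM; rewrite ?exprn_ge0//; apply: lerXn2r; rewrite ?nnegrE// (le_trans _ am).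
Qed.

(** The factor [|u|^tau <= r^tau] gains a power of the scale at the price of a stronger
    singularity. *)
Lemma pk_near (k tau u r : R) : 0 < k -> 0 <= tau -> `|u| <= r ->
  pk k u <= r `^ tau * pk (k + tau) u.
Proof.
move=> k0 tau0 ur; have [->|u0] := eqVneq u 0.
  by rewrite {1}/pk normr0 powR0 ?oppr_eq0 ?gt_eqF// mulr_ge0 ?powR_ge0.
rewrite pkD// mulrCA -[leLHS]mulr1 ler_wpM2l ?pk_ge0//.
have up : 0 < `|u| by rewrite normr_gt0.
rewrite /pk powRN -ler_pdivrMr ?invr_gt0 ?powR_gt0// mul1r invrK.
by apply: ge0_ler_powR => //; rewrite nnegrE ?(ltW up)// (le_trans _ ur)// ltW.
Qed.

(** Since [r / |u| <= 1] and [tau <= 1], the ratio is at most [(r / |u|)^tau]. *)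
Lemma pk_far (k tau u r : R) : 0 <= tau <= 1 -> 0 < r -> r <= `|u| ->
  r / `|u| * pk k u <= r `^ tau * pk (k + tau) u.
Proof.
move=> /andP[tau0 tau1] r0 ru; have up := lt_le_trans r0 ru.
have u0 : u != 0 by rewrite -normr_gt0.
rewrite pkD// mulrC [leRHS]mulrCA ler_wpM2l ?pk_ge0//.
have -> : pk tau u = `|u|^-1 `^ tau by rewrite /pk -powR_inv1// -powRrM mulN1r.
rewrite -powRM ?invr_ge0 ?(ltW r0)//.
apply: ger1_powR => //; rewrite divr_gt0//=.
by rewrite ler_pdivrMr// mul1r.
Qed.

End power_kernels.

Section averaging_kernels.
Context (R : realType).
Notation lam := (@lebesgue_measure R).
Notation lam2 := ((@lebesgue_measure R) \x (@lebesgue_measure R))%E.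

(* Near the origin a translated kernel loses the part of its mass that falls on
   the negative half-line, whence the condition in [kern_int1]. *)
Record kern (N eps x : R) (psi : R -> R) : Prop := {
  kern_bcs : exists K, bcs N K psi;
  kern_ge0 : forall s, 0 <= psi s;
  kern_supp : forall s, eps < `|s - x| -> psi s = 0;
  kern_int : \int[lam]_s psi s <= 1;
  kern_int1 : eps <= x -> \int[lam]_s psi s = 1 }.

Section two_kernels.
Context (N eps x y : R) (psi psi' : R -> R).
Hypothesis N0 : 0 <= N.
Hypothesis kx : kern N eps x psi.
Hypothesis ky : kern N eps y psi'.

Let in0N g s : (exists K, bcs N K g) -> g s != 0 -> 0 <= s <= N.
Proof. by move=> [K [_ _ h]]; apply: contraNT => /h ->. Qed.

Let supp (p : R * R) : psi p.2 * psi' p.1 != 0 ->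
  `|p.1 - p.2| <= N /\ `|p.1 - p.2 - (y - x)| <= 2 * eps.
Proof.
rewrite mulf_eq0 negb_or => /andP[h1 h2].
have /andP[a1 a2] := in0N (kern_bcs kx) h1; have /andP[a3 a4] := in0N (kern_bcs ky) h2.
split; first by rewrite ler_norml; apply/andP; split; lra.
have b1 : `|p.2 - x| <= eps by rewrite leNgt; apply: contra h1 => /(kern_supp kx) ->.
have b2 : `|p.1 - y| <= eps by rewrite leNgt; apply: contra h2 => /(kern_supp ky) ->.
by move: b1 b2; rewrite !ler_norml => /andP[? ?] /andP[? ?]; apply/andP; split; lra.
Qed.

Lemma kern_intg (k : R -> R) (L k0 : R) : measurable_fun setT k -> 0 <= k0 < 1 ->
  (forall v, `|v| <= N -> `|k v| <= L * pk k0 v) ->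
  intg lam2 (fun p => k (p.1 - p.2) * psi p.2 * psi' p.1).
Proof.
move=> mk k01 hk; have [C C0 hC] := intg_singular_kernel k01.
have [K hK] := kern_bcs kx; have [K' hK'] := kern_bcs ky.
have K0 := bcs_K0 hK; have K'0 := bcs_K0 hK'.
have mF : measurable_fun setT (fun p : R * R => k (p.1 - p.2) * psi p.2 * psi' p.1).
  case: hK => mg _ _; case: hK' => mg' _ _.
  apply: measurable_funM; last exact: measurable_comp1.
  apply: measurable_funM; last exact: measurable_comp2.
  exact: measurable_diff.
apply: (hC N (`|L| * K * K') _ N0 _ mF _).1; first by rewrite !mulr_ge0.
move=> p; have [e0|e0] := eqVneq (psi p.2 * psi' p.1) 0.
  rewrite -mulrA e0 mulr0 normr0; apply: mulr_ge0; first by rewrite !mulr_ge0.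
  by rewrite !mulr_ge0 ?pk_ge0.
have [h1 _] := supp e0; move: e0; rewrite mulf_eq0 negb_or => /andP[e1 e2].
have /andP[a1 a2] := in0N (kern_bcs kx) e1; have /andP[a3 a4] := in0N (kern_bcs ky) e2.
rewrite !indicE !mem_set ?mulr1/= ?in_itv/= ?a1 ?a2 ?a3 ?a4//.
rewrite !normrM (_ : `|L| * K * K' * _ = `|L| * pk k0 (p.1 - p.2) * K * K'); last by ring.
have b1 : `|psi p.2| <= K by case: hK.
have b2 : `|psi' p.1| <= K' by case: hK'.
have b3 : `|k (p.1 - p.2)| <= `|L| * pk k0 (p.1 - p.2).
  by apply: le_trans (hk _ h1) _; rewrite ler_wpM2r ?pk_ge0// ler_norm.
by apply: ler_pM => //; exact: ler_pM.
Qed.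

Lemma kern_le (k k' : R -> R) : intg lam2 (fun p => k (p.1 - p.2) * psi p.2 * psi' p.1) ->
  intg lam2 (fun p => k' (p.1 - p.2) * psi p.2 * psi' p.1) ->
  (forall v, `|v| <= N -> `|v - (y - x)| <= 2 * eps -> k v <= k' v) ->
  Bf k psi psi' <= Bf k' psi psi'.
Proof.
move=> i1 i2 h; apply: le_Int => // p; rewrite -!mulrA.
have [->|e0] := eqVneq (psi p.2 * psi' p.1) 0; first by rewrite !mulr0.
have [h1 h2] := supp e0; rewrite ler_wpM2r//; last exact: h.
by apply: mulr_ge0; [exact: kern_ge0 kx _|exact: kern_ge0 ky _].
Qed.

Lemma kern_norm (k : R -> R) : intg lam2 (fun p => k (p.1 - p.2) * psi p.2 * psi' p.1) ->
  intg lam2 (fun p => `|k (p.1 - p.2)| * psi p.2 * psi' p.1) /\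
  `|Bf k psi psi'| <= Bf (fun v => `|k v|) psi psi'.
Proof.
move=> i1; have e p : `|k (p.1 - p.2) * psi p.2 * psi' p.1| =
    `|k (p.1 - p.2)| * psi p.2 * psi' p.1.
  by rewrite !normrM (ger0_norm (kern_ge0 kx _)) (ger0_norm (kern_ge0 ky _)).
have i2 := intg_abs i1; have n1 := norm_Int i1.
by rewrite (funext e) in i2 n1.
Qed.

Lemma kern_intg_cst c : intg lam2 (fun p => c * psi p.2 * psi' p.1).
Proof.
have z : 0 <= (0 : R) < 1 by rewrite lexx ltr01.
apply: (@kern_intg (fun=> c) `|c| 0 _ z) => // v _.
by rewrite /pk oppr0 powRr0 mulr1.
Qed.

Lemma kern_cst c : Bf (fun=> c) psi psi' = c * (\int[lam]_s psi s * \int[lam]_t psi' t).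
Proof.
rewrite /Bf -(Fubini1 (kern_intg_cst c)).2.
have [K hK] := kern_bcs kx; have [K' hK'] := kern_bcs ky.
have ib g L : bcs N L g -> intg lam g.
  move=> hg; have mg : measurable_fun setT g by case: hg.
  have i : intg lam (fun s => L * \1_`[0, N] s).
    apply: intgZ; apply: intg_ge0P => //.
    by rewrite integral_indic// setIT/= lebesgue_measure_itv/=; case: ifP => _; rewrite ?ltry// -EFinB ltry.
  exact: (@intg_le _ _ _ lam _ _ mg (bcs_le hg) i).
have i1 := ib _ _ hK; have i2 := ib _ _ hK'.
transitivity (\int[lam]_t (c * \int[lam]_s psi s * psi' t)); last by rewrite IntZ//; ring.
apply: eq_Rintegral => t _ /=.
transitivity (\int[lam]_s (c * psi' t * psi s)); last by rewrite IntZ//; ring.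
by apply: eq_Rintegral => s _; ring.
Qed.

Lemma kern_mass : 0 <= \int[lam]_s psi s * \int[lam]_t psi' t <= 1.
Proof.
have h1 := kern_int kx; have h2 := kern_int ky.
have g1 : 0 <= \int[lam]_s psi s by apply: Int_ge0 => s; exact: kern_ge0 kx s.
have g2 : 0 <= \int[lam]_s psi' s by apply: Int_ge0 => s; exact: kern_ge0 ky s.
by rewrite mulr_ge0//= mulr_ile1.
Qed.

(** Jensen's inequality, by integrating the tangent line at [z]. The product measure may have mass
    below 1, and the missing mass contributes with the favorable sign. *)
Lemma kern_jensen n (k : R -> R) : (forall v, 0 <= k v) ->
  intg lam2 (fun p => k (p.1 - p.2) * psi p.2 * psi' p.1) ->
  intg lam2 (fun p => k (p.1 - p.2) ^+ n.+1 * psi p.2 * psi' p.1) ->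
  Bf k psi psi' ^+ n.+1 <= Bf (fun v => k v ^+ n.+1) psi psi'.
Proof.
move=> k0 i1 i2; set z := Bf k psi psi'.
have psi0 p : 0 <= psi p.2 * psi' p.1 :> R.
  by apply: mulr_ge0; [exact: kern_ge0 kx _|exact: kern_ge0 ky _].
have z0 : 0 <= z by apply: Int_ge0 => p; rewrite -mulrA mulr_ge0.
set m := \int[lam]_s psi s * \int[lam]_t psi' t; have /andP[m0 m1] := kern_mass.
pose al := z ^+ n.+1 - n.+1%:R * z ^+ n * z; pose be := n.+1%:R * z ^+ n.
apply: (@le_trans _ _ (al * m + be * z)).
  have -> : al * m + be * z = z ^+ n.+1 * (1 + n%:R * (1 - m)).
    by rewrite /al /be -(natr1 n) exprS; ring.
  by rewrite ler_peMr ?exprn_ge0// lerDl mulr_ge0// subr_ge0.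
rewrite /m -kern_cst /be /z {2}/Bf -IntZ// /Bf -IntD; last 2 first.
- exact: kern_intg_cst.
- exact: intgZ.
apply: le_Int => //; first by apply: intgD; [exact: kern_intg_cst|exact: intgZ].
move=> p; rewrite -![_ * psi p.2 * psi' p.1]mulrA [be' in be' + _]mulrC.
have := ler_wpM2r (psi0 p) (tangent_exp n (k0 (p.1 - p.2)) z0).
by apply: le_trans; rewrite le_eqVlt; apply/orP; left; apply/eqP; rewrite /al -/z; ring.
Qed.

End two_kernels.

End averaging_kernels.

(** * Powers of averaged covariances *)

Section kernel_estimate.
Context (R : realType) (sigma2 rho : R -> R) (zeta : R).
Notation lam := (@lebesgue_measure R).
Notation lam2 := ((@lebesgue_measure R) \x (@lebesgue_measure R))%E.
Hypothesis vd : variance_density sigma2 rho zeta.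

Let z01 : 0 <= zeta < 1.
Proof. by case/andP: (vd_zeta vd) => /ltW -> ->. Qed.

Lemma kern_intg_rho N eps x y psi psi' : 0 <= N -> kern N eps x psi -> kern N eps y psi' ->
  intg lam2 (fun p => rho (p.1 - p.2) * psi p.2 * psi' p.1).
Proof.
move=> N0 kx ky; have [C C0 [hC _]] := rho_bound vd N.
exact: (kern_intg N0 kx ky (measurable_rho vd) z01 hC).
Qed.

Lemma kern_intg_pk k N eps x y psi psi' : 0 <= k < 1 -> 0 <= N -> kern N eps x psi ->
  kern N eps y psi' -> intg lam2 (fun p => pk k (p.1 - p.2) * psi p.2 * psi' p.1).
Proof.
move=> k01 N0 kx ky; apply: (kern_intg N0 kx ky (measurable_pk k) k01 (L := 1)) => v _.
by rewrite mul1r ger0_norm ?pk_ge0.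
Qed.

Lemma kern_scale (psi psi' : R -> R) c (k : R -> R) :
  intg lam2 (fun p => k (p.1 - p.2) * psi p.2 * psi' p.1) ->
  intg lam2 (fun p => c * k (p.1 - p.2) * psi p.2 * psi' p.1) /\
  Bf (fun v => c * k v) psi psi' = c * Bf k psi psi'.
Proof.
move=> i; have e p : c * (k (p.1 - p.2) * psi p.2 * psi' p.1) =
  c * k (p.1 - p.2) * psi p.2 * psi' p.1 by rewrite !mulrA.
have i2 := intgZ c i; rewrite (funext e) in i2; split=> //.
by rewrite /Bf -IntZ//; apply: eq_Rintegral => p _; rewrite e.
Qed.

(** With [8 eps <= |y - x|], points of the two supports are at least [|y - x| / 2] apart, so only
    values of [rho] away from the singularity enter. *)
Lemma kern_far N : 0 <= N -> exists2 C, 0 < C & forall eps x y psi psi', 0 < eps ->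
  0 <= x <= N -> 0 <= y <= N -> kern N eps x psi -> kern N eps y psi' ->
  8 * eps <= `|y - x| -> `|Bf rho psi psi'| <= C * pk zeta (y - x).
Proof.
move=> N0; have [C C0 [hC _]] := rho_bound vd N.
have h2 : 0 < pk zeta 2^-1 by rewrite powR_gt0// normr_gt0 invr_eq0.
exists (C * pk zeta 2^-1) => [|eps x y psi psi' e0 /andP[x0 xN] /andP[y0 yN] kx ky far].
  by rewrite mulr_gt0.
have u0 : y - x != 0 by rewrite -normr_gt0; apply: lt_le_trans far; rewrite mulr_gt0.
have [i1 n1] := kern_norm kx ky (kern_intg_rho N0 kx ky).
apply: le_trans n1 _.
apply: (@le_trans _ _ (Bf (fun=> C * pk zeta 2^-1 * pk zeta (y - x)) psi psi')).
  apply: (kern_le kx ky (k' := fun=> _) i1 (kern_intg_cst N0 kx ky _)) => v vN vu.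
  apply: le_trans (hC _ vN) _; rewrite -mulrA ler_wpM2l ?(ltW C0)// -pkM.
  apply: pk_le; first by case/andP: z01.
    by rewrite mulf_neq0// invr_eq0.
  rewrite normrM ger0_norm ?invr_ge0//.
  have := ler_normB v (v - (y - x)); rewrite subKr; lra.
rewrite (kern_cst N0 kx ky) ler_piMr//.
  by rewrite mulr_ge0 ?pk_ge0// mulr_ge0 ?pk_ge0// ltW.
by case/andP: (kern_mass kx ky).
Qed.

Context (n : nat) (kap : R).
Hypothesis kapP : n.+1%:R * zeta < kap < 1.
Let tau := kap - n.+1%:R * zeta.

Let jz : 0 < n.+1%:R * zeta.
Proof. by rewrite mulr_gt0//; case/andP: (vd_zeta vd). Qed.

Let tau01 : 0 <= tau <= 1.
Proof. by case/andP: kapP => ? ?; have := jz; rewrite /tau => ?; apply/andP; split; lra. Qed.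

Let kapE : n.+1%:R * zeta + tau = kap.
Proof. by rewrite /tau; ring. Qed.

Let kap01 : 0 <= kap < 1.
Proof. by case/andP: kapP => h ->; rewrite (le_trans (ltW jz) (ltW h)). Qed.

Let powR_scale (a eps : R) : 1 <= a -> 0 < eps -> (a * eps) `^ tau <= a * eps `^ tau.
Proof.
move=> a1 e0; rewrite powRM ?(ltW e0)// ?(le_trans ler01)//.
by rewrite ler_wpM2r ?powR_ge0// ler1_powR//; case/andP: tau01.
Qed.

(** Three regimes. For [|y - x| < 8 eps] the two terms are bounded separately, the first by Jensen.
    Farther away, if [x] or [y] is below [eps], mass may be missing, and a crude bound is charged to
    [|x|^-kap] or [|y|^-kap]. Otherwise both masses are 1 and the regularity of [rho] gives a
    relative error [eps / |y - x|]. In each case the spare exponent [tau] yields [eps^tau]. *)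
Lemma kernel_estimate N : 0 <= N -> exists2 C, 0 < C & forall eps x y psi psi', 0 < eps ->
  0 < x <= N -> 0 < y <= N -> kern N eps x psi -> kern N eps y psi' ->
  `|Bf rho psi psi' ^+ n.+1 - rho (y - x) ^+ n.+1| <=
  C * eps `^ tau * (Bf (pk kap) psi psi' + pk kap (y - x) + pk kap x + pk kap y).
Proof.
move=> N0; have [C1 C10 [hC hL]] := rho_bound vd N.
have [D D0 hD] := kern_far N0.
pose M := D + C1; have M0 : 0 < M by rewrite addr_gt0.
pose c1 := 10 * C1 ^+ n.+1; pose c2 := 2 * M ^+ n.+1.
pose c3 := n.+1%:R * M ^+ n * (2 * C1 ^+ 2).
have c10 : 0 < c1 by rewrite mulr_gt0// exprn_gt0.
have c20 : 0 < c2 by rewrite mulr_gt0// exprn_gt0.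
have c30 : 0 < c3 by rewrite !mulr_gt0// exprn_gt0.
exists (c1 + c2 + c3) => [|eps x y psi psi' e0 /andP[x0 xN] /andP[y0 yN] kx ky].
  by rewrite !addr_gt0.
have uN : `|y - x| <= N by rewrite ler_norml; apply/andP; split; lra.
have ipk := kern_intg_pk kap01 N0 kx ky.
set A := Bf (pk kap) psi psi'; set u := y - x in uN *.
have A0 : 0 <= A.
  apply: Int_ge0 => p; rewrite !mulr_ge0 ?pk_ge0//; [exact: kern_ge0 kx _|exact: kern_ge0 ky _].
have pu := pk_ge0 kap u; have px := pk_ge0 kap x; have py := pk_ge0 kap y.
have E0 : 0 <= eps `^ tau by exact: powR_ge0.
have fin X c : 0 <= X -> X <= A + pk kap u + pk kap x + pk kap y -> 0 <= c ->
    c <= c1 + c2 + c3 ->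
    c * (eps `^ tau * X) <= (c1 + c2 + c3) * eps `^ tau * (A + pk kap u + pk kap x + pk kap y).
  move=> X0 hX cc0 hc; rewrite -mulrA; apply: ler_pM => //; first exact: mulr_ge0.
  exact: ler_wpM2l.
have pow_rho v : `|v| <= N -> `|rho v| ^+ n.+1 <= C1 ^+ n.+1 * pk (n.+1%:R * zeta) v.
  move=> vN; rewrite -pkX -exprMn; apply: lerXn2r; rewrite ?nnegrE ?hC//.
  by rewrite mulr_ge0 ?pk_ge0// ltW.
have [near|far] := ltP `|u| (8 * eps).
  (* [10 = 8 + 2]: the differences [v] seen by the kernels are within [2 eps] of [y - x]. *)
  have near_pow v : `|v| <= N -> `|v| <= 10 * eps ->
      `|rho v| ^+ n.+1 <= c1 * (eps `^ tau * pk kap v).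
    move=> vN v10; apply: le_trans (pow_rho v vN) _.
    rewrite /c1 (mulrC 10) -mulrA ler_wpM2l ?exprn_ge0 ?(ltW C10)//.
    have tau0 : 0 <= tau by case/andP: tau01.
    apply: le_trans (pk_near jz tau0 v10) _; rewrite kapE mulrA ler_wpM2r ?pk_ge0//.
    by apply: powR_scale => //; lra.
  have irho := kern_intg_rho N0 kx ky.
  have [iabs nabs] := kern_norm kx ky irho.
  have jz01 : 0 <= n.+1%:R * zeta < 1 by rewrite (ltW jz)/=; case/andP: kapP; apply: lt_trans.
  have ipow : intg lam2 (fun p => `|rho (p.1 - p.2)| ^+ n.+1 * psi p.2 * psi' p.1).
    have mp : measurable_fun setT (fun v => `|rho v| ^+ n.+1).
      by apply: measurable_funX; apply: measurableT_comp => //; exact: measurable_rho vd.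
    apply: (kern_intg N0 kx ky mp jz01 (L := C1 ^+ n.+1)) => v vN.
    by rewrite ger0_norm ?exprn_ge0// pow_rho.
  have [isc esc] := kern_scale (c1 * eps `^ tau) ipk.
  have jen := kern_jensen N0 kx ky (n := n) (fun v => normr_ge0 (rho v)) iabs ipow.
  have b1 : `|Bf rho psi psi'| ^+ n.+1 <= c1 * (eps `^ tau * A).
    apply: (@le_trans _ _ (Bf (fun v => `|rho v|) psi psi' ^+ n.+1)).
      by apply: lerXn2r; rewrite ?nnegrE// (le_trans _ nabs).
    apply: le_trans jen _; rewrite mulrA -esc.
    apply: (kern_le kx ky ipow isc) => v vN vu; rewrite -mulrA near_pow//.
    by have := ler_normD (v - u) u; rewrite subrK; lra.
  have b2 : `|rho u| ^+ n.+1 <= c1 * (eps `^ tau * pk kap u).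
    by apply: near_pow => //; lra.
  apply: le_trans (ler_normB _ _) _; rewrite !normrX.
  apply: le_trans (lerD b1 b2) _; rewrite -mulrDr -mulrDr; apply: fin; lra.
have ru : `|rho u| <= M * pk zeta u.
  by apply: le_trans (hC _ uN) _; rewrite ler_wpM2r ?pk_ge0// /M; lra.
have x0N : 0 <= x <= N by rewrite ltW.
have y0N : 0 <= y <= N by rewrite ltW.
have cu : `|Bf rho psi psi'| <= M * pk zeta u.
  apply: le_trans (hD _ _ _ _ _ e0 x0N y0N kx ky far) _.
  by rewrite ler_wpM2r ?pk_ge0// /M; lra.
have m0 : 0 <= M * pk zeta u by rewrite mulr_ge0 ?pk_ge0// ltW.
have crude : `|Bf rho psi psi' ^+ n.+1 - rho u ^+ n.+1| <= c2 * pk (n.+1%:R * zeta) u.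
  apply: le_trans (ler_normB _ _) _; rewrite !normrX.
  rewrite /c2 -mulrA -pkX -exprMn mulr_natl mulr2n.
  by apply: lerD; apply: lerXn2r; rewrite ?nnegrE.
(* Here [z < eps <= |y - x|]: the singularity at [y - x] is dominated by the one at [z], and
   [z < eps] then supplies the factor [eps^tau]. *)
have edge z : 0 < z -> z <= N -> z < eps -> pk kap z <= A + pk kap u + pk kap x + pk kap y ->
    `|Bf rho psi psi' ^+ n.+1 - rho u ^+ n.+1| <=
    (c1 + c2 + c3) * eps `^ tau * (A + pk kap u + pk kap x + pk kap y).
  move=> z0 zN ze hz; apply: le_trans crude _.
  apply: (@le_trans _ _ (c2 * (eps `^ tau * pk kap z))); last first.
    by apply: fin => //; rewrite ?pk_ge0//; lra.
  rewrite ler_wpM2l ?(ltW c20)//.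
  have tau0 : 0 <= tau by case/andP: tau01.
  apply: (@le_trans _ _ (pk (n.+1%:R * zeta) z)).
    by apply: pk_le; rewrite ?(ltW jz) ?gt_eqF// (gtr0_norm z0); lra.
  by rewrite -kapE; apply: pk_near => //; rewrite gtr0_norm// ltW.
have [xe|ex] := ltP x eps; first by apply: (edge x) => //; lra.
have [ye|ey] := ltP y eps; first by apply: (edge y) => //; lra.
have irho := kern_intg_rho N0 kx ky.
have icst := kern_intg_cst N0 kx ky (- rho u).
have mass1 : Bf (fun=> - rho u) psi psi' = - rho u.
  by rewrite (kern_cst N0 kx ky) (kern_int1 kx ex) (kern_int1 ky ey) !mulr1.
have e p : rho (p.1 - p.2) * psi p.2 * psi' p.1 + - rho u * psi p.2 * psi' p.1 =
    (rho (p.1 - p.2) - rho u) * psi p.2 * psi' p.1 by ring.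
have idiff := intgD irho icst; rewrite (funext e) in idiff.
have Ediff : Bf rho psi psi' - rho u = Bf (fun v => rho v - rho u) psi psi'.
  rewrite -[X in _ + X]mass1 /Bf -IntD//.
  by apply: eq_Rintegral => p _; rewrite e.
have up : 0 < `|u| by apply: lt_le_trans far; rewrite mulr_gt0.
pose L := 2 * C1 ^+ 2 * (eps / `|u| * pk zeta u).
have lip : `|Bf rho psi psi' - rho u| <= L.
  rewrite Ediff; have [i1 n1] := kern_norm kx ky (k := fun v => rho v - rho u) idiff.
  apply: le_trans n1 _; apply: (@le_trans _ _ (Bf (fun=> L) psi psi')).
    apply: (kern_le kx ky (k' := fun=> _) i1 (kern_intg_cst N0 kx ky _)) => v vN vu.
    (* [4 |v - u| <= 8 eps <= |u|]: this is where the threshold 8 comes from. *)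
    have h4 : 4 * `|v - u| <= `|u| <= N by rewrite uN andbT; move: vu far; rewrite -/u; lra.
    have := hL _ _ h4; rewrite [u + _]addrC subrK => /le_trans; apply.
    have -> : L = C1 * (2 * eps / `|u|) * (C1 * pk zeta u) by rewrite /L; ring.
    have q0 : 0 <= `|v - u| / `|u| by rewrite divr_ge0.
    apply: ler_pM => //; [by rewrite mulr_ge0// ltW| |exact: hC].
    by rewrite ler_wpM2l ?(ltW C10)// ler_wpM2r// invr_ge0.
  rewrite (kern_cst N0 kx ky) (kern_int1 kx ex) (kern_int1 ky ey) !mulr1 lexx//.
apply: le_trans (exp_diff_le n cu ru) _.
apply: (@le_trans _ _ (c3 * (eps `^ tau * pk kap u))); last by apply: fin; lra.
apply: (@le_trans _ _ (n.+1%:R * (M * pk zeta u) ^+ n * L)).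
  by rewrite ler_wpM2l// mulr_ge0// exprn_ge0.
have -> : n.+1%:R * (M * pk zeta u) ^+ n * L = c3 * (eps / `|u| * pk (n.+1%:R * zeta) u).
  by rewrite -pkX exprMn exprS /L /c3; ring.
rewrite ler_wpM2l ?(ltW c30)// -kapE; apply: pk_far => //; lra.
Qed.

End kernel_estimate.

Section nonnegative_integrals.
Context d (T : measurableType d) (R : realType) (mu : {measure set T -> \bar R}).

Lemma ge0_le_int (f g : T -> \bar R) : (forall x, (0 <= f x)%E) ->
  measurable_fun setT f -> measurable_fun setT g -> (forall x, (f x <= g x)%E) ->
  (\int[mu]_x f x <= \int[mu]_x g x)%E.
Proof. by move=> f0 mf mg fg; apply: ge0_le_integral. Qed.

Lemma int_scale (c : R) (f : T -> R) : 0 <= c -> measurable_fun setT f ->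
  (forall x, 0 <= f x) -> (\int[mu]_x (c * f x)%:E = c%:E * \int[mu]_x (f x)%:E)%E.
Proof.
move=> c0 mf f0; under eq_integral do rewrite EFinM.
rewrite ge0_integralZl//; first exact/measurable_EFinP.
by move=> x _; rewrite lee_fin.
Qed.

End nonnegative_integrals.

(** * Families of kernels indexed by their centers *)

Section kernel_families.
Context (R : realType).
Notation lam := (@lebesgue_measure R).
Notation lam2 := ((@lebesgue_measure R) \x (@lebesgue_measure R))%E.

(** [fam_col] fixes the point [s] and integrates over the center [x]: translates of one kernel have
    both marginals bounded by 1. *)
Record kfamily (N b eps : R) (psi : R -> R -> R) : Prop := {
  fam_kern : forall x, 0 <= x <= b -> kern N eps x (psi x);
  fam_bound : exists K, forall x, 0 <= x <= b -> bcs N K (psi x);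
  fam_ge0 : forall x s, 0 <= psi x s;
  fam_meas : measurable_fun setT (fun p : R * R => psi p.1 p.2);
  fam_col : forall s, (\int[lam]_x (psi x s * \1_`[0%R, b] x)%:E <= 1)%E }.

Lemma lam_itv (b : R) : 0 <= b -> (lam `[0%R, b] = b%:E)%E.
Proof.
move=> b0; rewrite lebesgue_measure_itv/= lte_fin; case: ltgtP b0 => // [_|<-] _.
  by rewrite -EFinB subr0.
by [].
Qed.

Lemma indic_itv_intg (b : R) : 0 <= b ->
  intg lam (\1_`[0, b] : R -> R) /\ \int[lam]_x (\1_`[0, b] x) = b.
Proof.
move=> b0; have e : (\int[lam]_x (\1_`[0%R, b] x)%:E = b%:E)%E.
  by rewrite integral_indic// setIT; exact: lam_itv.
split; last by rewrite /Rintegral e.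
by apply: intg_ge0P => //; rewrite e ltry.
Qed.

Section kappa.
Context (kap : R).
Hypothesis kap01 : 0 <= kap < 1.

Lemma pk_intg : exists2 C, 0 <= C & forall v b, 0 <= b ->
  intg lam (fun x => pk kap (v - x) * \1_`[0, b] x) /\
  \int[lam]_x (pk kap (v - x) * \1_`[0, b] x) <= C + b.
Proof.
have /andP[k0 k1] := kap01; have [C C0 hC] := pk_int_le k0 k1.
exists C => // v b b0.
have m : measurable_fun setT (fun x : R => pk kap (v - x) * \1_`[0, b] x).
  apply: measurable_funM => //; apply: (measurableT_comp (measurable_pk kap)).
  exact: measurable_funB.
have p x : 0 <= pk kap (v - x) * \1_`[0, b] x by rewrite mulr_ge0 ?pk_ge0.
have h : (\int[lam]_x (pk kap (v - x) * \1_`[0%R, b] x)%:E <= (C + b)%:E)%E.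
  have -> : (\int[lam]_x (pk kap (v - x) * \1_`[0%R, b] x)%:E =
      \int[lam]_(x in `[0%R, b]) (pk kap (x - v))%:E)%E.
    rewrite [RHS]integral_mkcond; apply: eq_integral => x _.
    rewrite patchE indicE -pkN opprB; case: (_ \in _); rewrite ?mulr1 ?mulr0//.
  by apply: le_trans (hC v _ (measurable_itv _)) _; rewrite EFinD lam_itv.
split; last by apply: Int_ge0_le => //; rewrite addr_ge0.
by apply: intg_ge0P => //; apply: le_lt_trans h _; rewrite ltry.
Qed.

Lemma column_bound N : 0 <= N -> exists2 C, 0 <= C & forall b eps y psi phi,
  kfamily N b eps psi -> kern N eps y phi ->
  intg lam (fun x => Bf (pk kap) (psi x) phi * \1_`[0, b] x) /\
  \int[lam]_x (Bf (pk kap) (psi x) phi * \1_`[0, b] x) <= C.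
Proof.
move=> N0; have [C C0 hC] := pk_intg; exists (C + N); first by rewrite addr_ge0.
move=> b eps y psi phi fam ky.
have [K' hK'] := kern_bcs ky; have mphi : measurable_fun setT phi by case: hK'.
have phi0 := kern_ge0 ky.
(* One function of [((x, t), s)], so that Tonelli can be applied to nested pairs. *)
pose F (q : R * R * R) : \bar R :=
  (pk kap (q.1.2 - q.2) * psi q.1.1 q.2 * phi q.1.2 * \1_`[0, b] q.1.1)%:E.
have F0 q : (0 <= F q)%E.
  by rewrite lee_fin !mulr_ge0 ?pk_ge0//; exact: fam_ge0 fam _ _.
have m1 : measurable_fun setT (fun q : R * R * R => q.1) by exact: measurable_fst.
have m2 : measurable_fun setT (fun q : R * R * R => q.2) by exact: measurable_snd.
have m11 : measurable_fun setT (fun q : R * R * R => q.1.1).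
  exact: (measurableT_comp measurable_fst m1).
have m12 : measurable_fun setT (fun q : R * R * R => q.1.2).
  exact: (measurableT_comp measurable_snd m1).
have mF : measurable_fun setT F.
  apply/measurable_EFinP; apply: measurable_funM; last first.
    by apply: (measurableT_comp (f := \1_`[0, b] : R -> R)).
  apply: measurable_funM; last exact: (measurableT_comp mphi m12).
  apply: measurable_funM.
    by apply: (measurableT_comp (measurable_pk kap)); exact: measurable_funB.
  apply: (measurableT_comp (fam_meas fam) (g := fun q : R * R * R => (q.1.1, q.2))).
  exact: measurable_fun_pair.
pose g (p : R * R) := (\int[lam]_s F (p, s))%E.
have mg : measurable_fun setT g.
  exact: (@measurable_fun_fubini_tonelli_F _ _ _ _ R lam F mF F0).
have g0 p : (0 <= g p)%E by apply: integral_ge0 => s _; exact: F0.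
have BF x : (Bf (pk kap) (psi x) phi * \1_`[0, b] x)%:E = (\int[lam]_t g (x, t))%E.
  rewrite /g /F /= indicE; have [xb|_] := boolP (x \in _); last first.
    rewrite mulr0 -[LHS](@integral0 _ _ R lam setT); apply: eq_integral => t _.
    rewrite -[LHS](@integral0 _ _ R lam setT); apply: eq_integral => s _.
    by rewrite /= mulr0.
  have xb' : 0 <= x <= b by move: xb; rewrite inE /= in_itv.
  have i := kern_intg_pk kap01 N0 (fam_kern fam xb') ky.
  rewrite mulr1 /Bf -(EInt i).
  rewrite (@fubini_tonelli1 _ _ _ _ R lam lam); last 2 first.
  - by apply/measurable_EFinP; exact: intg_meas i.
  - by move=> p; rewrite lee_fin !mulr_ge0 ?pk_ge0//; exact: fam_ge0 fam _ _.
  apply: eq_integral => t _; apply: eq_integral => s _.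
  by rewrite /= mulr1.
have mB : measurable_fun setT (fun x => Bf (pk kap) (psi x) phi * \1_`[0, b] x).
  have h := @measurable_fun_fubini_tonelli_F _ _ _ _ R lam g mg g0.
  apply/measurable_EFinP; move: h; congr measurable_fun.
  by apply/funext => x; rewrite /= BF.
have B0 x : 0 <= Bf (pk kap) (psi x) phi * \1_`[0, b] x.
  rewrite mulr_ge0//; apply: Int_ge0 => p; rewrite !mulr_ge0 ?pk_ge0//; exact: fam_ge0 fam _ _.
have iphi : intg lam phi.
  have [i _] := indic_itv_intg N0.
  have mm := @intg_le _ _ _ lam phi _ mphi (bcs_le hK').
  exact: mm (intgZ K' i).
pose H (t s : R) := phi t * (pk kap (t - s) * \1_`[0, N] s).
have H0 t s : 0 <= H t s by rewrite !mulr_ge0 ?pk_ge0.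
have inner t : (\int[lam]_x g (x, t) <= ((C + N) * phi t)%:E)%E.
  have mFt : measurable_fun setT (fun q : R * R => F ((q.1, t), q.2)).
    apply: (measurableT_comp mF (g := fun q : R * R => ((q.1, t), q.2))).
    by apply: measurable_fun_pair => //; exact: measurable_fun_pair.
  have sw := @fubini_tonelli _ _ _ _ R lam lam _ mFt (fun q => F0 _).
  rewrite (_ : (\int[lam]_x g (x, t))%E = (\int[lam]_s \int[lam]_x F ((x, t), s))%E); last first.
    exact: sw.
  have [i l] := hC t N N0.
  apply: (@le_trans _ _ (\int[lam]_s (H t s)%:E)%E); last first.
    by rewrite (EInt (intgZ _ i)) (IntZ _ i) lee_fin mulrC ler_wpM2r.
  apply: (@ge0_le_int _ _ R lam).
  - by move=> p; apply: integral_ge0 => x _; exact: F0.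
  - exact: (@measurable_fun_fubini_tonelli_G _ _ _ _ R lam _ mFt (fun q => F0 _)).
  - by apply/measurable_EFinP; exact: intg_meas (intgZ _ i).
  move=> s; rewrite /F; cbn [fst snd].
  have [K hK] := fam_bound fam.
  have e x : pk kap (t - s) * psi x s * phi t * \1_`[0, b] x =
      H t s * (psi x s * \1_`[0, b] x).
    rewrite /H !indicE.
    have [pN|pN] := boolP (s \in _); first by rewrite mulr1; ring.
    have [xb|xb] := boolP (x \in _); last by rewrite !mulr0.
    have xb' : 0 <= x <= b by move: xb; rewrite inE /= in_itv.
    have [_ _ ->] := hK x xb'; first by rewrite !(mulr0, mul0r).
    by move: pN; rewrite notin_setE /= in_itv/= => /negP.
  under eq_integral do rewrite e.
  rewrite (@int_scale _ _ R lam).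
  - rewrite -[leRHS]mule1; apply: lee_wpmul2l; first by rewrite lee_fin.
    exact: fam_col fam _.
  - exact: H0.
  - apply: measurable_funM; last exact: measurable_indic.
    apply: (measurableT_comp (fam_meas fam) (g := fun x : R => (x, s))).
    exact: measurable_fun_pair.
  - by move=> x; apply: mulr_ge0; [exact: fam_ge0 fam _ _|rewrite indicE; exact: ler0n].
have h : (\int[lam]_x (Bf (pk kap) (psi x) phi * \1_`[0%R, b] x)%:E <= (C + N)%:E)%E.
  under eq_integral do rewrite BF.
  have sw := @fubini_tonelli _ _ _ _ R lam lam _ mg g0.
  rewrite (_ : (\int[lam]_x \int[lam]_t g (x, t))%E = (\int[lam]_t \int[lam]_x g (x, t))%E); last first.
    exact: sw.
  apply: (@le_trans _ _ (\int[lam]_t ((C + N) * phi t)%:E)%E); last first.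
    have e1 := EInt (intgZ (C + N) iphi); have e2 := IntZ (C + N) iphi.
    rewrite [leLHS]e1 e2 lee_fin; apply: ler_piMr; first exact: addr_ge0.
    exact: kern_int ky.
  apply: (@ge0_le_int _ _ R lam).
  - by move=> t; apply: integral_ge0 => s _; exact: g0.
  - exact: (@measurable_fun_fubini_tonelli_G _ _ _ _ R lam g mg g0).
  - by apply/measurable_EFinP; exact: measurable_funM.
  - exact: inner.
split; last by apply: Int_ge0_le => //; rewrite addr_ge0.
by apply: intg_ge0P => //; apply: le_lt_trans h _; rewrite ltry.
Qed.

End kappa.

End kernel_families.

Section field_bound.
Context d (T : measurableType d) (R : realType) (P : probability T R).
Notation lam := (@lebesgue_measure R).
Context (kap : R).
Hypothesis kap01 : 0 <= kap < 1.

Definition kbound (psi1 psi2 : R -> R -> R) (x y : R) :=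
  Bf (pk kap) (psi1 x) (psi1 y) + Bf (pk kap) (psi1 x) (psi2 y) +
  Bf (pk kap) (psi2 x) (psi1 y) + Bf (pk kap) (psi2 x) (psi2 y) +
  pk kap (y - x) + pk kap x + pk kap y.

Let ae_neq0 : {ae lam, forall y : R, y != 0}.
Proof.
exists [set 0]; split; [exact: measurable_set1|exact: lebesgue_measure_set1|].
by move=> y /= /negP; rewrite negbK => /eqP ->.
Qed.

Lemma kbound_ge0 N b eps psi1 psi2 x y : kfamily N b eps psi1 -> kfamily N b eps psi2 ->
  0 <= kbound psi1 psi2 x y.
Proof.
move=> f1 f2; have p psi psi' : (forall s, 0 <= psi s) -> (forall s, 0 <= psi' s) ->
    0 <= Bf (pk kap) psi psi'.
  by move=> h h'; apply: Int_ge0 => q; rewrite !mulr_ge0 ?pk_ge0.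
have g1 := fam_ge0 f1; have g2 := fam_ge0 f2.
by rewrite /kbound !addr_ge0 ?pk_ge0//; apply: p.
Qed.

(** The covariance bound is integrated in [x] for fixed [y]. The result is uniform in [y] except for
    a multiple of [|y|^-kap], which is integrable in turn. *)
Lemma msq_field_bound N b : 0 <= N -> 0 <= b -> exists2 C, 0 <= C &
  forall eps psi1 psi2 a K (Phi : R -> T -> R) c0 c1,
  kfamily N b eps psi1 -> kfamily N b eps psi2 -> 0 <= a <= b -> 0 <= c0 -> 0 <= c1 ->
  sqfield lam P `[a, b] K Phi ->
  (forall x y, 0 < x <= b -> 0 < y <= b ->
    `|\int[P]_w (Phi y w * Phi x w)| <= c0 + c1 * kbound psi1 psi2 x y) ->
  msq P (integrated lam Phi) <= C * (c0 + c1).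
Proof.
move=> N0 b0; have [C C0 hC] := column_bound kap01 N0.
have [D D0 hD] := pk_intg kap01.
have [ib eb] := indic_itv_intg b0.
pose m := 4 * C + 2 * (D + b).
have m0 : 0 <= m by rewrite addr_ge0// mulr_ge0// addr_ge0.
exists (b * b + m * b + b * (D + b)) => [|eps psi1 psi2 a K Phi c0 c1 f1 f2 /andP[a0 ab] c00 c10 sP hP].
  by rewrite !addr_ge0// mulr_ge0// addr_ge0.
have pk0 (b' : R) : 0 <= b' -> intg lam (fun x => pk kap x * \1_`[0, b'] x) /\
    \int[lam]_x (pk kap x * \1_`[0, b'] x) <= D + b'.
  move=> h; have [i l] := hD 0 b' h.
  have e : (fun x => pk kap (0 - x) * \1_`[0, b'] x) = (fun x => pk kap x * \1_`[0, b'] x).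
    by apply/funext => x; rewrite sub0r pkN.
  by rewrite e in i l.
have [ip lp] := pk0 b b0.
pose V y := (c0 * b + c1 * m) * \1_`[0, b] y + c1 * b * (pk kap y * \1_`[0, b] y).
have V0 y : 0 <= V y.
  by rewrite addr_ge0 ?mulr_ge0 ?addr_ge0 ?mulr_ge0 ?pk_ge0.
have iV : intg lam V by apply: intgD; exact: intgZ.
have h1 := @msq_integrated_le _ _ _ T R lam P _ _ _ sP V iV.
apply: le_trans (h1 _) _; last first.
  rewrite /V IntD; [|exact: intgZ|exact: intgZ].
  rewrite !IntZ// eb; have : c1 * b * \int[lam]_x (pk kap x * \1_`[0, b] x) <= c1 * b * (D + b).
    by rewrite ler_wpM2l// mulr_ge0.
  have t1 : 0 <= c1 * (b * b) by rewrite !mulr_ge0.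
  have t2 : 0 <= c0 * (m * b) by rewrite !mulr_ge0.
  have t3 : 0 <= c0 * (b * (D + b)) by rewrite !mulr_ge0// addr_ge0.
  move: (\int[lam]_x _) => q hq; move: t1 t2 t3 hq; clear; lra.
have sqf := sP; case: sP => mab _ mPhi Phi0 sPhi.
(* The covariance bound is assumed at positive points only; the origin is a null set. *)
apply: (@filterS _ _ (ae_filter_ringOfSetsType lam) _ _ _ ae_neq0) => y yn0.
have [yab|yab] := boolP (a <= y <= b); last first.
  rewrite Int_eq0 ?V0// => x; rewrite Int_eq0 ?normr0// => w.
  by rewrite Phi0 ?mul0r//= in_itv/=; apply/negP.
have /andP[ya yb] := yab.
have y0 : 0 < y by rewrite lt_neqAle eq_sym yn0 (le_trans a0).
have yb0 : 0 <= y <= b by rewrite ltW.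
have k1 := fam_kern f1 yb0; have k2 := fam_kern f2 yb0.
have [i11 l11] := hC _ _ _ _ _ f1 k1; have [i12 l12] := hC _ _ _ _ _ f1 k2.
have [i21 l21] := hC _ _ _ _ _ f2 k1; have [i22 l22] := hC _ _ _ _ _ f2 k2.
have [iy ly] := hD y b b0.
pose S x := ((Bf (pk kap) (psi1 x) (psi1 y) * \1_`[0, b] x +
  Bf (pk kap) (psi1 x) (psi2 y) * \1_`[0, b] x) +
  (Bf (pk kap) (psi2 x) (psi1 y) * \1_`[0, b] x +
  Bf (pk kap) (psi2 x) (psi2 y) * \1_`[0, b] x)) +
  (pk kap (y - x) * \1_`[0, b] x + pk kap x * \1_`[0, b] x).
have iA := intgD i11 i12; have iB := intgD i21 i22; have iC := intgD iy ip.
have iS : intg lam S by apply: intgD => //; exact: intgD.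
have lS : \int[lam]_x S x <= m.
  rewrite /S (IntD (intgD iA iB) iC) (IntD iA iB) (IntD i11 i12) (IntD i21 i22) (IntD iy ip).
  rewrite /m; move: l11 l12 l21 l22 ly lp.
  move: (\int[lam]_x _) => q1; move: (\int[lam]_x _) => q2; move: (\int[lam]_x _) => q3.
  move: (\int[lam]_x _) => q4; move: (\int[lam]_x _) => q5; move: (\int[lam]_x _) => q6.
  clear; lra.
pose U x := (c0 + c1 * pk kap y) * \1_`[0, b] x + c1 * S x.
have iU : intg lam U by apply: intgD; exact: intgZ.
have lU : \int[lam]_x U x <= V y.
  rewrite /U (IntD (intgZ _ ib) (intgZ _ iS)) !IntZ// eb.
  have : c1 * \int[lam]_x S x <= c1 * m by rewrite ler_wpM2l.
  have -> : V y = c0 * b + c1 * m + c1 * b * pk kap y.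
    by rewrite /V indicE mem_set ?mulr1//= in_itv.
  move: (c1 * \int[lam]_x _) (c1 * m) => q q'; clear; lra.
apply: le_trans lU.
have [iP _] := Int_integrated sqf (sPhi y).1.
apply: ae_le_Int => //; first exact: intg_abs.
apply: (@filterS _ _ (ae_filter_ringOfSetsType lam) _ _ _ ae_neq0) => x xn0.
have g1 := fam_ge0 f1; have g2 := fam_ge0 f2.
have [xab|xab] := boolP (a <= x <= b); last first.
  rewrite Int_eq0 ?normr0; last by move=> w; rewrite (Phi0 x) ?mulr0//= in_itv/=; apply/negP.
  have B0 psi psi' : (forall s, 0 <= psi s) -> (forall s, 0 <= psi' s) ->
      0 <= Bf (pk kap) psi psi'.
    by move=> h h'; apply: Int_ge0 => q; rewrite !mulr_ge0 ?pk_ge0.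
  by rewrite /U /S addr_ge0// mulr_ge0 ?addr_ge0 ?mulr_ge0 ?pk_ge0//; exact: B0.
have /andP[xa xb] := xab.
have x0 : 0 < x by rewrite lt_neqAle eq_sym xn0 (le_trans a0).
apply: le_trans (hP x y _ _) _; rewrite ?x0 ?y0//.
rewrite /U /S indicE mem_set /= ?in_itv/= ?(ltW x0)// !mulr1 /kbound.
by rewrite le_eqVlt; apply/orP; left; apply/eqP; ring.
Qed.

End field_bound.

(** * Wick fields *)

Section wick_fields.
Context d (T : measurableType d) (R : realType) (P : probability T R).
Notation lam := (@lebesgue_measure R).

Lemma measurable_He d' (S : measurableType d') (v y : S -> R) k :
  measurable_fun setT v -> measurable_fun setT y ->
  measurable_fun setT (fun s => (He (v s) k).[y s]).
Proof.
move=> mv my; elim/ltn_ind: k => -[_|[_|k IH]].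
- by under eq_fun do rewrite hornerE; exact: measurable_cst.
- rewrite (_ : (fun s => _) = y)//; apply/funext => s.
  by rewrite /= derivC scaler0 subr0 mulr1 hornerX.
rewrite (_ : (fun s => _) = fun s => y s * (He (v s) k.+1).[y s] -
    v s * (k.+1%:R * (He (v s) k).[y s])); last first.
  apply/funext => s; rewrite -[He _ k.+2]/('X * He (v s) k.+1 - v s *: (He (v s) k.+1)^`()).
  by rewrite deriv_He hornerD hornerN hornerM hornerX !hornerZ.
apply: measurable_funB; apply: measurable_funM => //; first exact: IH.
by apply: measurable_funM => //; exact: IH.
Qed.

Definition wick_field (k : nat) (Y : R -> T -> R) (x : R) (w : T) :=
  (He (msq P (Y x)) k).[Y x w].

Lemma measurable_wick_field k (Y : R -> T -> R) :
  measurable_fun setT (fun p : R * T => Y p.1 p.2) ->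
  measurable_fun setT (fun p : R * T => wick_field k Y p.1 p.2).
Proof.
move=> mY; apply: (measurable_He k _ mY).
have m2 : measurable_fun setT (fun p : R * T => (Y p.1 p.2 ^+ 2)%:E).
  by apply/measurable_EFinP; exact: measurable_funX.
have h : measurable_fun setT (fun x => (\int[P]_w (Y x w ^+ 2)%:E)%E).
  by apply: (@measurable_fun_fubini_tonelli_F _ _ _ _ R P _ m2) => p; rewrite lee_fin sqr_ge0.
apply: (measurableT_comp (f := fun x => msq P (Y x)) _ measurable_fst).
rewrite /msq /Rintegral; apply: (@measurableT_comp _ _ _ _ _ _ (@fine R)) => //; exact: h.
Qed.

Lemma sqfieldB d1 (T1 : measurableType d1) (m1 : {sigma_finite_measure set T1 -> \bar R}) A K K'
  (Phi Phi' : T1 -> T -> R) : sqfield m1 P A K Phi -> sqfield m1 P A K' Phi' ->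
  sqfield m1 P A (2 * K + 2 * K') (fun x w => Phi x w - Phi' x w).
Proof.
move=> [mA [fA K0] mP P0 sP] [_ [_ K'0] mP' P0' sP']; split=> //.
- by split=> //; rewrite addr_ge0// mulr_ge0.
- exact: measurable_funB.
- by move=> x w nA; rewrite P0// P0'// subrr.
move=> x; have [s1 b1] := sP x; have [s2 b2] := sP' x; split; first exact: sqintgB.
have := msqD_le s1 (sqintgN s2); rewrite msqN => /le_trans; apply.
by apply: lerD; rewrite ler_wpM2l.
Qed.

Context (G : R -> T -> R) (sigma2 rho : R -> R) (zeta : R).
Hypothesis vd : variance_density sigma2 rho zeta.
Hypothesis hG : centered_gaussian_process P G.
Hypothesis hS : forall x y : R, 0 <= x -> 0 <= y ->
  msq P (fun w => G x w - G y w) = sigma2 (x - y).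

Lemma wick_cov j N g Y g' Y' : 0 <= N -> version P G N g Y -> version P G N g' Y' ->
  intg P (fun w => (He (msq P Y) j).[Y w] * (He (msq P Y') j).[Y' w]) /\
  \int[P]_w ((He (msq P Y) j).[Y w] * (He (msq P Y') j).[Y' w]) = j`!%:R * Bf rho g g' ^+ j.
Proof.
move=> N0 h h'; have gp := version_gpair hG h h'.
split; first by apply: sqintgM; apply: sqintg_poly; [exact: gpair1 gp|exact: gpair2 gp].
by rewrite (wick_formula _ _ gp) eqxx mul1r (version_cov vd hG hS N0 h h').
Qed.

Lemma wick_sqfield j N b eps a psi Y : 0 <= N -> 0 <= a <= b -> kfamily N b eps psi ->
  measurable_fun setT (fun p : R * T => Y p.1 p.2) ->
  (forall x, 0 <= x <= b -> version P G N (psi x) (Y x)) ->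
  exists K, sqfield lam P `[a, b] K (fun x w => wick_field j Y x w * \1_`[a, b] x).
Proof.
move=> N0 /andP[a0 ab] fam mY hY; have [K hK] := fam_bound fam.
have K0 : 0 <= K by apply: bcs_K0 (hK 0 _); rewrite lexx (le_trans a0).
have [C C0 hC] := Bf_bound vd N0.
exists (j`!%:R * (C * K * K) ^+ j); split.
- exact: measurable_itv.
- split; last by rewrite mulr_ge0// exprn_ge0// !mulr_ge0.
  by rewrite /= lebesgue_measure_itv/=; case: ifP => _; rewrite ?ltry// -EFinB ltry.
- apply: measurable_funM; first exact: measurable_wick_field.
  by apply: (measurableT_comp (f := \1_`[a, b] : R -> R)).
- by move=> x w nx; rewrite indicE memNset// mulr0.
move=> x; rewrite indicE; have [xab|_] := boolP (x \in _); last first.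
  rewrite (_ : (fun w => _) = fun=> 0); last by apply/funext => w; rewrite mulr0.
  split; first exact: sqintg0.
  rewrite /msq Int_eq0; last by move=> w; rewrite expr0n.
  by rewrite mulr_ge0// exprn_ge0// !mulr_ge0.
have xb : 0 <= x <= b.
  by move: xab; rewrite inE /= in_itv/= => /andP[h ->]; rewrite (le_trans a0).
rewrite (_ : (fun w => _) = wick_field j Y x); last by apply/funext => w; rewrite mulr1.
have [i e] := wick_cov j N0 (hY x xb) (hY x xb).
have gx := version_gmom hG (hY x xb).
split; first exact: sqintg_poly gx.
rewrite /msq (_ : \int[P]_w _ = \int[P]_w ((He (msq P (Y x)) j).[Y x w] *
   (He (msq P (Y x)) j).[Y x w])); last by apply: eq_Rintegral => w _; rewrite expr2.
rewrite e ler_wpM2l//.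
have b1 := (hC _ _ _ _ (hK x xb) (hK x xb)).2.
have b0 : 0 <= Bf rho (psi x) (psi x).
  by rewrite -(version_cov vd hG hS N0 (hY x xb) (hY x xb)); apply: Int_ge0 => w; rewrite -expr2 sqr_ge0.
rewrite lerXn2r ?nnegrE//; first by rewrite !mulr_ge0.
exact: le_trans (ler_norm _) b1.
Qed.

Context (n : nat) (kap : R).
Hypothesis kapP : n.+1%:R * zeta < kap < 1.
Let tau := kap - n.+1%:R * zeta.

(** The covariance of the difference field is a signed sum of four powers of [Bf rho]. Each is close
    to the same [rho (y - x)^(n+1)], which cancels. *)
Lemma wick_diff_bound N b : 0 <= N -> 0 <= b -> b <= N -> exists2 C, 0 <= C &
  forall eps a psi1 Y1 psi2 Y2, 0 < eps -> 0 <= a <= b ->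
  kfamily N b eps psi1 -> kfamily N b eps psi2 ->
  measurable_fun setT (fun p : R * T => Y1 p.1 p.2) ->
  measurable_fun setT (fun p : R * T => Y2 p.1 p.2) ->
  (forall x, 0 <= x <= b -> version P G N (psi1 x) (Y1 x)) ->
  (forall x, 0 <= x <= b -> version P G N (psi2 x) (Y2 x)) ->
  msq P (integrated lam (fun x w => wick_field n.+1 Y1 x w * \1_`[a, b] x -
    wick_field n.+1 Y2 x w * \1_`[a, b] x)) <= C * eps `^ tau.
Proof.
move=> N0 b0 bN.
have z0 : 0 < zeta by case/andP: (vd_zeta vd).
have kap01 : 0 <= kap < 1.
  by case/andP: kapP => h ->; rewrite andbT; apply: le_trans (ltW h); rewrite mulr_ge0// ltW.
have [C C0 hC] := msq_field_bound (T := T) P kap01 N0 b0.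
have [D D0 hD] := kernel_estimate vd kapP N0.
exists (C * (4 * (n.+1)`!%:R * D)) => [|eps a psi1 Y1 psi2 Y2 e0 hab f1 f2 mY1 mY2 v1 v2].
  by rewrite !mulr_ge0// ltW.
have [K1 s1] := wick_sqfield n.+1 N0 hab f1 mY1 v1.
have [K2 s2] := wick_sqfield n.+1 N0 hab f2 mY2 v2.
have /andP[a0 ab] := hab.
pose c1 := 4 * (n.+1)`!%:R * D * eps `^ tau.
have c10 : 0 <= c1 by rewrite !mulr_ge0 ?powR_ge0// ltW.
have -> : C * (4 * (n.+1)`!%:R * D) * eps `^ tau = C * (0 + c1) by rewrite /c1 add0r !mulrA.
apply: (hC _ _ _ _ _ _ _ _ f1 f2 hab (lexx 0) c10 (sqfieldB s1 s2)).
move=> x y hx hy; rewrite add0r.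
have kb0 := kbound_ge0 kap x y f1 f2.
have [[xa ya]|nab] := pselect ((a <= x) /\ (a <= y)); last first.
  rewrite Int_eq0; first by rewrite normr0; exact: mulr_ge0.
  move=> w; rewrite !indicE.
  have [ax|xa] := leP a x; last first.
    by rewrite [x \in _]memNset ?mulr0 ?subr0 ?mulr0//= in_itv/= leNgt xa.
  have [ay|ya] := leP a y; last first.
    by rewrite [y \in _]memNset ?mulr0 ?subr0 ?mul0r//= in_itv/= leNgt ya.
  by exfalso; apply: nab.
have /andP[x0 xb] := hx; have /andP[y0 yb] := hy.
have hx' : 0 <= x <= b by rewrite ltW.
have hy' : 0 <= y <= b by rewrite ltW.
have [i11 e11] := wick_cov n.+1 N0 (v1 x hx') (v1 y hy').
have [i12 e12] := wick_cov n.+1 N0 (v1 x hx') (v2 y hy').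
have [i21 e21] := wick_cov n.+1 N0 (v2 x hx') (v1 y hy').
have [i22 e22] := wick_cov n.+1 N0 (v2 x hx') (v2 y hy').
rewrite (_ : \int[P]_w _ = (n.+1)`!%:R * ((Bf rho (psi1 x) (psi1 y) ^+ n.+1 -
   Bf rho (psi1 x) (psi2 y) ^+ n.+1) - (Bf rho (psi2 x) (psi1 y) ^+ n.+1 -
   Bf rho (psi2 x) (psi2 y) ^+ n.+1))); last first.
  rewrite !mulrBr -e11 -e12 -e21 -e22 -IntB// -IntB// -IntB; [|exact: intgB|exact: intgB].
  apply: eq_Rintegral => w _; rewrite !indicE !mem_set /= ?in_itv/= ?xa ?xb ?ya ?yb// !mulr1.
  rewrite /wick_field; ring.
have hx2 : 0 < x <= N by rewrite x0 (le_trans xb).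
have hy2 : 0 < y <= N by rewrite y0 (le_trans yb).
have k1x := fam_kern f1 hx'; have k2x := fam_kern f2 hx'.
have k1y := fam_kern f1 hy'; have k2y := fam_kern f2 hy'.
have d11 := hD _ _ _ _ _ e0 hx2 hy2 k1x k1y; have d12 := hD _ _ _ _ _ e0 hx2 hy2 k1x k2y.
have d21 := hD _ _ _ _ _ e0 hx2 hy2 k2x k1y; have d22 := hD _ _ _ _ _ e0 hx2 hy2 k2x k2y.
have ge psi psi' : (forall s, 0 <= psi s) -> (forall s, 0 <= psi' s) ->
    0 <= Bf (pk kap) psi psi'.
  by move=> h h'; apply: Int_ge0 => q; rewrite !mulr_ge0 ?pk_ge0.
have g1 := fam_ge0 f1; have g2 := fam_ge0 f2.
have B1 := ge _ _ (g1 x) (g1 y); have B2 := ge _ _ (g1 x) (g2 y).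
have B3 := ge _ _ (g2 x) (g1 y); have B4 := ge _ _ (g2 x) (g2 y).
have E0 : 0 <= D * eps `^ tau by rewrite mulr_ge0 ?powR_ge0// ltW.
have kbE : kbound kap psi1 psi2 x y = Bf (pk kap) (psi1 x) (psi1 y) + Bf (pk kap) (psi1 x) (psi2 y) +
  Bf (pk kap) (psi2 x) (psi1 y) + Bf (pk kap) (psi2 x) (psi2 y) +
  pk kap (y - x) + pk kap x + pk kap y by [].
have {}d11 : `|Bf rho (psi1 x) (psi1 y) ^+ n.+1 - rho (y - x) ^+ n.+1| <=
    D * eps `^ tau * kbound kap psi1 psi2 x y.
  by apply: (le_trans d11); apply: (ler_wpM2l E0); rewrite kbE; lra.
have {}d12 : `|Bf rho (psi1 x) (psi2 y) ^+ n.+1 - rho (y - x) ^+ n.+1| <=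
    D * eps `^ tau * kbound kap psi1 psi2 x y.
  by apply: (le_trans d12); apply: (ler_wpM2l E0); rewrite kbE; lra.
have {}d21 : `|Bf rho (psi2 x) (psi1 y) ^+ n.+1 - rho (y - x) ^+ n.+1| <=
    D * eps `^ tau * kbound kap psi1 psi2 x y.
  by apply: (le_trans d21); apply: (ler_wpM2l E0); rewrite kbE; lra.
have {}d22 : `|Bf rho (psi2 x) (psi2 y) ^+ n.+1 - rho (y - x) ^+ n.+1| <=
    D * eps `^ tau * kbound kap psi1 psi2 x y.
  by apply: (le_trans d22); apply: (ler_wpM2l E0); rewrite kbE; lra.
rewrite normrM ger0_norm ?ler0n//.
rewrite (_ : c1 * _ = (n.+1)`!%:R * (4 * (D * eps `^ tau * kbound kap psi1 psi2 x y))); last first.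
  by rewrite /c1; ring.
rewrite ler_wpM2l//; move: d11 d12 d21 d22; rewrite !ler_norml.
move: (D * _ * kbound _ _ _ _ _) => q.
by move=> /andP[? ?] /andP[? ?] /andP[? ?] /andP[? ?]; apply/andP; split; lra.
Qed.

End wick_fields.

(** * Smooth and increment kernels *)

Section translation.
Context (R : realType).
Notation lam := (@lebesgue_measure R).

Lemma ge0_int_shift (c : R) (f : R -> R) : continuous f -> (forall x, 0 <= f x) ->
  (\int[lam]_s (f (s + c))%:E = \int[lam]_s (f s)%:E)%E.
Proof.
move=> cf f0; pose F (x : R) := x + c.
have dF (x : R) : is_derive x 1 F 1.
  exact: is_derive_eq (dvD (is_derive_id x 1) (is_derive_cst c x 1)) (addr0 1).
have F1 : derive1 F = fun=> 1 by apply/funext => x; rewrite derive1E; exact: derive_val.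
rewrite [RHS](@increasing_ge0_integration_by_substitutionT R F f) ?F1//.
- by apply: eq_integral => s _; rewrite /= fctE /= mulr1.
- by move=> x y xy; rewrite /F ltrD2r.
- by move=> x; exact: cvg_cst.
- exact: is_cvg_cst.
- exact: is_cvg_cst.
- apply/cvgrNyPle => A; near=> x; rewrite /F -lerBrDr; near: x.
  by apply: nbhs_ninfty_le; exact: num_real.
- apply/cvgryPge => A; near=> x; rewrite /F -lerBlDr; near: x.
  by apply: nbhs_pinfty_ge; exact: num_real.
Unshelve. all: end_near. Qed.

(** Compactness of [[-2, 2]]; beyond it, [d <= 1] keeps both points outside the support. *)
Lemma heine (f : R -> R) : continuous f -> (forall s, 1 < `|s| -> f s = 0) ->
  forall e, 0 < e -> exists2 d, 0 < d <= 1 &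
    forall x t, `|t - x| <= d -> `|f t - f x| <= e.
Proof.
move=> cf f0 e e0; have e20 : 0 < e / 2 by rewrite divr_gt0.
have cK : compact (`[(- 2)%R, 2%R]%classic : set R) by exact: segment_compact.
pose Q (d x : R) := forall t, `|t - x| <= d -> `|f t - f x| <= e.
have : \forall d \near (0 : R)^'+, `[(- 2)%R, 2%R]%classic `<=` Q d.
  move/compact_near_coveringP : cK; apply => x _.
  have /cvgrPdist_le/(_ _ e20) := cf x; rewrite -nbhs_nearE => /nbhs_ballP[r /= r0 hr].
  have r20 : 0 < r / 2 by rewrite divr_gt0.
  exists (ball x (r / 2), [set d | d < r / 2]); first split => /=.
  - exact: nbhsx_ballx.
  - exact: nbhs_right_lt.
  case=> x' d [/= h1 h2] t td; rewrite /ball /= in h1.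
  have b1 : `|f x - f x'| <= e / 2 by apply: hr; rewrite /ball/=; lra.
  have b2 : `|f x - f t| <= e / 2.
    apply: hr; rewrite /ball/=; have := ler_normD (x - x') (x' - t).
    rewrite addrA subrK (distrC x' t); lra.
  have := ler_normD (f t - f x) (f x - f x'); rewrite addrA subrK (distrC (f t) (f x)); lra.
move=> h; have hn : \forall d \near (0 : R)^'+,
    (`[(- 2)%R, 2%R]%classic `<=` Q d /\ 0 < d) /\ d <= 1.
  near=> d; split; [split|]; near: d; [exact: h|exact: nbhs_right_gt|].
  by apply: nbhs_right_le; exact: ltr01.
have [d [[hd d0] d1]] := @filter_ex _ _ (at_right_proper_filter (0 : R)) _ hn.
exists d; first by rewrite d0.
move=> x t td; have [x2|x2] := leP `|x| 2.
  by apply: hd => //=; rewrite in_itv/= -ler_norml.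
rewrite (f0 x) ?(f0 t) ?subrr ?normr0 ?(ltW e0)//; last by lra.
have := ler_normB t (t - x); rewrite subKr; lra.
Unshelve. all: end_near. Qed.

End translation.

Section smooth_kernels.
Context (R : realType).
Notation lam := (@lebesgue_measure R).

(* The value at [s = 0] is removed: elementary functions vanish there, so that no
   uniform approximation could reach it. *)
Definition smooth (f : R -> R) (x s : R) : R := f (s - x) * \1_`]0%R, +oo[ s.

Definition increment (h x s : R) : R := h^-1 * \1_`]x, x + h] s.

Lemma increment_kfamily (N b h : R) : 0 < h -> b + h <= N -> kfamily N b h (increment h).
Proof.
move=> h0 bN; have hi : 0 <= h^-1 by rewrite invr_ge0 ltW.
have B x : 0 <= x <= b -> bcs N (`|h^-1| * 1) (increment h x).
  by move=> /andP[x0 xb]; apply: bcsZ; apply: bcs_indic => //; lra.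
have int1 x : \int[lam]_s increment h x s = 1.
  have i1 : (\int[lam]_s (\1_`]x, (x + h)%R] s)%:E = h%:E)%E.
    rewrite integral_indic// setIT/= lebesgue_measure_itv/= lte_fin ltrDl h0 -EFinB.
    by congr EFin; ring.
  have i2 : intg lam (\1_`]x, (x + h)%R] : R -> R) by apply: intg_ge0P => //; rewrite i1 ltry.
  rewrite /increment IntZ// /Rintegral i1/= mulVf// gt_eqF//.
have ge x s : 0 <= increment h x s by rewrite mulr_ge0// indicE.
have swap x s : \1_`]x, (x + h)%R] s = \1_`[(s - h)%R, s[ x :> R.
  rewrite !indicE; congr ((nat_of_bool _)%:R).
  apply/idP/idP; rewrite !inE /= !in_itv/=; move=> /andP[? ?]; apply/andP; split; lra.
split=> //.
- move=> x xb; split=> //.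
  + by exists (`|h^-1| * 1); exact: B.
  + move=> s; rewrite /increment indicE => hs; rewrite memNset ?mulr0//= in_itv/= => /andP[h1 h2].
    by move: hs; rewrite gtr0_norm ?subr_gt0//; lra.
  + by rewrite int1.
- by exists (`|h^-1| * 1).
- have m : measurable [set p : R * R | p.1 < p.2 <= p.1 + h].
    have -> : [set p : R * R | p.1 < p.2 <= p.1 + h] =
        ((fun p : R * R => p.2 - p.1) @^-1` `]0, h]%classic).
      apply/seteqP; split => p /=; rewrite in_itv/=; move=> /andP[? ?]; apply/andP; split; lra.
    rewrite -[X in measurable X]setTI.
    have mm : measurable_fun setT (fun p : R * R => p.2 - p.1) by exact: measurable_funB.
    by apply: mm => //; exact: measurable_itv.
  rewrite (_ : (fun p => _) = fun p : R * R => h^-1 * \1_[set p : R * R | p.1 < p.2 <= p.1 + h] p).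
    by apply: measurable_funM => //; exact: measurable_indic.
  apply/funext => p; rewrite /increment !indicE; congr (_ * (nat_of_bool _)%:R).
- move=> s; apply: (@le_trans _ _ (\int[lam]_x (h^-1 * \1_`[(s - h)%R, s[ x)%:E)%E).
    apply: ge0_le_int.
    + by move=> x; rewrite lee_fin mulr_ge0// indicE.
    + apply/measurable_EFinP; apply: measurable_funM; last exact: measurable_indic.
      rewrite /increment; apply: measurable_funM => //.
      rewrite (_ : (fun x => _) = \1_`[(s - h)%R, s[ :> (R -> R)); first exact: measurable_indic.
      by apply/funext => x; exact: swap.
    + by apply/measurable_EFinP; apply: measurable_funM => //; exact: measurable_indic.
    + move=> x; rewrite lee_fin /increment swap -mulrA ler_wpM2l// ler_piMr//.
  rewrite int_scale//.
  rewrite integral_indic// setIT/= lebesgue_measure_itv/= lte_fin gtrBl h0 -EFinB opprB addrCA subrr addr0.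
  by rewrite -EFinM mulVf// gt_eqF.
Qed.

Context (f : R -> R) (delta : R).
Hypothesis d01 : 0 < delta <= 1.
Hypothesis cf : continuous f.
Hypothesis f_ge0 : forall s, 0 <= f s.
Hypothesis f_even : forall s, f (- s) = f s.
Hypothesis f_supp : forall s, delta < `|s| -> f s = 0.
Hypothesis f_int : (\int[lam]_s (f s)%:E = 1)%E.

Let mf : measurable_fun setT f.
Proof. exact: continuous_measurable_fun. Qed.

Let f1 s : 1 < `|s| -> f s = 0.
Proof. by move=> h; apply: f_supp; case/andP: d01 => _ /le_lt_trans; apply. Qed.

Let fK : exists K, forall s, f s <= K.
Proof.
have cw : {within `[(-1)%R, 1%R], continuous f} by exact: continuous_subspaceT.
have h : (-1 : R) <= 1 by lra.
have [c _ hc] := EVT_max h cw.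
exists (f c) => s; have [s1|s1] := leP `|s| 1; last by rewrite f1.
by apply: hc; rewrite in_itv/= -ler_norml.
Qed.

Lemma smooth_bcs : exists K, forall N x, 0 <= x -> x + 1 <= N -> bcs N K (smooth f x).
Proof.
have [K hK] := fK; exists K => N x x0 xN; split.
- apply: measurable_funM; last exact: measurable_indic.
  by apply: (measurableT_comp mf); exact: measurable_funB.
- move=> s; rewrite /smooth ger0_norm; last by rewrite mulr_ge0// indicE.
  apply: le_trans (hK (s - x)); rewrite ler_piMr// indicE; by case: (_ \in _).
move=> s hs; rewrite /smooth indicE; have [|_] := boolP (s \in _); last by rewrite mulr0.
rewrite inE /= in_itv/= andbT => s0; rewrite f1 ?mul0r//.
move: hs; rewrite (ltW s0)/= -ltNge => Ns.
by rewrite ger0_norm; lra.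
Qed.

Lemma smooth_kfamily N b : b + 1 <= N -> kfamily N b delta (smooth f).
Proof.
move=> bN; have [K hK] := smooth_bcs.
have B x : 0 <= x <= b -> bcs N K (smooth f x).
  by move=> /andP[x0 xb]; apply: hK => //; lra.
have ge x s : 0 <= smooth f x s by rewrite mulr_ge0// indicE.
have ms x : measurable_fun setT (smooth f x).
  apply: measurable_funM; last exact: measurable_indic.
  by apply: (measurableT_comp mf); exact: measurable_funB.
have le x s : smooth f x s <= f (s + - x).
  by rewrite /smooth ler_piMr// indicE; case: (_ \in _).
have mfs (c : R) : measurable_fun setT (fun s : R => f (s + c)).
  by apply: (measurableT_comp mf); exact: measurable_funD.
have i1 x : (\int[lam]_s (f (s + - x)%R)%:E = 1)%E by rewrite ge0_int_shift.
split=> //.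
- move=> x xb; split=> //.
  + by exists K; exact: B.
  + by move=> s hs; rewrite /smooth f_supp ?mul0r.
  + apply: Int_ge0_le => //; rewrite -(i1 x); apply: ge0_le_int.
    * by move=> s; rewrite lee_fin.
    * by apply/measurable_EFinP; exact: ms.
    * by apply/measurable_EFinP; exact: mfs.
    * by move=> s; rewrite lee_fin.
  + move=> dx; have iff : intg lam (fun s => f (s + - x)).
      apply: intg_ge0P; [exact: mfs|by move=> s; exact: f_ge0|].
      by rewrite (i1 x) ltry.
    transitivity (\int[lam]_s (f (s + - x))); last by rewrite /Rintegral i1.
    apply: ae_eq_Int; [exact: ms|exact: mfs|].
    (* For [delta <= x] the translated support lies in [s >= 0], so the cut-off changes nothing
       except possibly at [s = 0]. *)
    exists [set 0]; split; [exact: measurable_set1|exact: lebesgue_measure_set1|].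
    move=> s /= hs; apply: contrapT => s0; apply: hs.
    rewrite /smooth indicE; have [sp|] := boolP (s \in _); first by rewrite mulr1.
    rewrite notin_setE/= in_itv/= andbT => /negP; rewrite -leNgt => sn.
    have s1 : s < 0 by rewrite lt_neqAle sn andbT; apply/eqP.
    by rewrite f_supp ?mul0r// ltr0_norm; lra.
- by exists K.
- apply: measurable_funM.
    apply: (measurableT_comp mf (g := fun p : R * R => p.2 - p.1)); exact: measurable_funB.
  by apply: (measurableT_comp (f := \1_`]0%R, +oo[ : R -> R)).
- move=> s; apply: (@le_trans _ _ (\int[lam]_x (f (x + - s))%:E)%E); last by rewrite i1.
  apply: ge0_le_int.
  + by move=> x; rewrite lee_fin mulr_ge0// indicE.
  + apply/measurable_EFinP; apply: measurable_funM; last exact: measurable_indic.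
    apply: measurable_funM => //.
    by apply: (measurableT_comp mf (g := fun x : R => s - x)); exact: measurable_funB.
  + by apply/measurable_EFinP; exact: mfs.
  + move=> x; rewrite lee_fin -f_even opprB; apply: le_trans (le x s).
    by rewrite ler_piMr// indicE; case: (_ \in _).
Qed.

End smooth_kernels.

(** * Measurable paths and jointly measurable versions *)

Section measurable_paths.
Context d (T : measurableType d) (R : realType).

Lemma measurable_countable_choice (k : R -> nat) (X : nat -> T -> R) :
  (forall m, measurable (k @^-1` [set m])) -> (forall m, measurable_fun setT (X m)) ->
  measurable_fun setT (fun p : R * T => X (k p.1) p.2).
Proof.
move=> mk mX _ A mA; rewrite setTI.
rewrite (_ : _ @^-1` _ = \bigcup_m ((k @^-1` [set m]) `*` (X m @^-1` A))).
  apply: bigcupT_measurable => m; apply: measurableX => //.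
  by rewrite -[X in measurable X]setTI; exact: mX.
apply/seteqP; split=> [p /= h|p [m _ [/= <- //]]].
by exists (k p.1).
Qed.

(* [G y] carries no information for [y < 0]; freezing the path there makes it
   jointly measurable on the whole line. *)
Definition gpath (G : R -> T -> R) (y : R) (w : T) := G (Num.max 0 y) w.

Context (G : R -> T -> R).
Hypothesis mG : forall x, 0 <= x -> measurable_fun setT (G x).
Hypothesis cG : forall w, {within `[0%R, +oo[, continuous (fun x => G x w)}.

Let near_path w z : 0 <= z -> forall e, 0 < e -> exists2 r, 0 < r &
  forall u, 0 <= u -> `|z - u| < r -> `|G z w - G u w| <= e.
Proof.
move=> z0 e e0; have /subspace_continuousP/(_ z) h := @cG w.
have /h/cvgrPdist_le/(_ _ e0) : `[0%R, +oo[%classic z by rewrite /= in_itv/= z0.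
rewrite /within /= => /nbhs_ballP[r /= r0 hr]; exists r => // u u0 zu.
by apply: hr => //=; rewrite in_itv/= u0.
Qed.

(** Reading the path at the dyadic point just below [y] involves countably many variables, hence is
    jointly measurable; continuity of the paths gives convergence at every [y] and [w]. *)
Lemma measurable_path : measurable_fun setT (fun p : R * T => gpath G p.1 p.2).
Proof.
pose k n (y : R) := Num.truncn (2 ^+ n * Num.max 0 y).
pose F n (p : R * T) := G ((k n p.1)%:R / 2 ^+ n) p.2.
have e0 n : 0 < (2 : R) ^+ n by rewrite exprn_gt0.
have mF n : measurable_fun setT (F n).
  apply: (@measurable_countable_choice (k n) (fun m => G (m%:R / 2 ^+ n))) => m; last first.
    by apply: mG; rewrite divr_ge0// ltW.
  have mm : measurable_fun setT (fun y : R => 2 ^+ n * Num.max 0 y).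
    by apply: measurable_funM => //; exact: measurable_maxr.
  rewrite (_ : k n @^-1` _ = (fun y : R => 2 ^+ n * Num.max 0 y) @^-1` `[m%:R, m.+1%:R[%classic).
    by rewrite -[X in measurable X]setTI; apply: mm => //; exact: measurable_itv.
  apply/seteqP; split=> y /=; rewrite in_itv/=.
    by move=> <-; apply: truncn_itv; rewrite mulr_ge0 ?(ltW (e0 n))// le_max lexx.
  exact: truncn_def.
rewrite (_ : (fun p => _) = fun p => rlim (fun n => F n p)); first exact: measurable_rlim.
apply/funext => p; apply/esym/rlimE; set z := Num.max 0 p.1.
have z0 : 0 <= z by rewrite le_max lexx.
apply/cvgrPdist_le => e ee0; have [r r0 hr] := near_path p.2 z0 ee0.
have [N hN] := small_div_exp2 1 r0.
exists N => // n /= Nn; apply: hr; first by rewrite divr_ge0// ltW.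
have /truncn_itv : 0 <= 2 ^+ n * z by rewrite mulr_ge0// ltW.
rewrite -/(k n p.1) => /andP[h1 h2].
have h3 : (k n p.1)%:R / 2 ^+ n <= z by rewrite ler_pdivrMr// mulrC.
have h4 : z < (k n p.1)%:R / 2 ^+ n + 1 / 2 ^+ n.
  by rewrite -mulrDl ltr_pdivlMr// mulrC natr1.
have h5 : 1 / 2 ^+ n <= 1 / 2 ^+ N :> R.
  by rewrite !div1r lef_pV2 ?posrE// ler_weXn2l// ler1n.
rewrite ger0_norm ?subr_ge0//; lra.
Qed.

End measurable_paths.

Section version_construction.
Context d (T : measurableType d) (R : realType) (P : probability T R).
Context (G : R -> T -> R) (sigma2 rho : R -> R) (zeta : R).
Hypothesis vd : variance_density sigma2 rho zeta.
Hypothesis hG : centered_gaussian_process P G.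
Hypothesis hS : forall x y : R, 0 <= x -> 0 <= y ->
  msq P (fun w => G x w - G y w) = sigma2 (x - y).
Hypothesis cG : forall w, {within `[0%R, +oo[, continuous (fun x => G x w)}.
Notation dG := (elementary_deriv G).
Notation wf := (@elementary_on_Rplus R).

Lemma measurable_G x : 0 <= x -> measurable_fun setT (G x).
Proof.
move=> x0; have [|m _ _ _] := gmom_lin hG (s := [:: (1, x)]).
  by move=> q; rewrite inE => /eqP->.
move: m; rewrite (_ : (fun w => _) = G x)//.
by apply/funext => w; rewrite big_seq1 mul1r.
Qed.

Let mpath := measurable_path measurable_G cG.

Let mpath_shift (c : R) : measurable_fun setT (fun p : R * T => gpath G (p.1 + c) p.2).
Proof.
apply: (measurableT_comp mpath (g := fun p : R * T => (p.1 + c, p.2))).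
by apply: measurable_fun_pair => //; exact: measurable_funD.
Qed.

Definition quotient (h x : R) (w : T) := h^-1 * (gpath G (x + h) w - gpath G (x + 0) w).

Lemma measurable_quotient h : measurable_fun setT (fun p : R * T => quotient h p.1 p.2).
Proof. by apply: measurable_funM => //; exact: measurable_funB. Qed.

Lemma quotient_version N h x : 0 < h -> 0 <= x -> x + h <= N ->
  version P G N (increment h x) (quotient h x).
Proof.
move=> h0 x0 xN; pose E : elementary R := [:: ((h^-1, x), x + h)].
have wE : wf E by move=> p; rewrite inE => /eqP-> /=; rewrite x0 lerDl ltW.
have EY : dG E = quotient h x.
  apply/funext => w; rewrite /elementary_deriv big_seq1 /quotient /gpath /= addr0 !max_r//.
  by rewrite addr_ge0// ltW.
split.
- by exists (`|h^-1| * 1); apply: bcsZ; exact: bcs_indic.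
- by rewrite -EY; exact: gmom_sqintg (gmom_dG hG wE).
move=> e e0; exists E; split=> //.
- rewrite (_ : (fun s => _) = fun=> 0); first exact: bcsW (lexx N) (ltW e0) (bcs0 N).
  by apply/funext => s; rewrite /elementary_fun big_seq1 /increment subrr.
- by rewrite EY /msq Int_eq0 ?(ltW e0)// => w; rewrite subrr expr0n.
Qed.

Context (f : R -> R).
Hypothesis cf : continuous f.
Hypothesis f1 : forall s, 1 < `|s| -> f s = 0.
Hypothesis f_bcs : exists K, forall N x, 0 <= x -> x + 1 <= N -> bcs N K (smooth f x).

(** Left-endpoint values of [f] on cells of length [c], which cover [[x - 1, x + 1]] when [M c = 2].
    The maximum with 0 cuts the cells at the origin; those to its left become empty. *)
Definition grid (c x : R) (M : nat) : elementary R :=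
  [seq ((f (-1 + i%:R * c), Num.max 0 (x + (-1 + i%:R * c))), Num.max 0 (x + (-1 + i.+1%:R * c)))
    | i <- iota 0 M].

Lemma wf_grid c x M : 0 < c -> wf (grid c x M).
Proof.
move=> c0 p /mapP[i _ ->] /=; rewrite le_max lexx /= ge_max !le_max lexx /=.
by apply/orP; right; rewrite lerD2l lerD2l ler_wpM2r ?(ltW c0)// ler_nat.
Qed.

Let grid_step c x M s : elementary_fun (grid c x M.+1) s = elementary_fun (grid c x M) s +
  f (-1 + M%:R * c) * \1_`](Num.max 0 (x + (-1 + M%:R * c))),
    (Num.max 0 (x + (-1 + M.+1%:R * c)))] s.
Proof.
rewrite /elementary_fun /grid -[M.+1]addn1 iotaD map_cat big_cat /= big_seq1 add0n.
by rewrite addn1.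
Qed.

(** Cells are added from left to right: the sum is 0 until the cell that contains [s], and keeps
    from then on the value of [f] at the left endpoint of that cell. *)
Let grid_fun c x s e : 0 < c -> 0 < s -> (forall u, `|u - (s - x)| <= c -> `|f u - f (s - x)| <= e) ->
  -1 < s - x -> forall M,
  (s - x <= -1 + M%:R * c -> `|elementary_fun (grid c x M) s - f (s - x)| <= e) /\
  (-1 + M%:R * c < s - x -> elementary_fun (grid c x M) s = 0).
Proof.
move=> c0 s0 osc sx; elim=> [|M [IH1 IH2]].
  rewrite mul0r addr0; split; first by rewrite leNgt sx.
  by move=> _; rewrite /elementary_fun big_nil.
rewrite grid_step indicE.
have inE1 : (s \in `](Num.max 0 (x + (-1 + M%:R * c))), (Num.max 0 (x + (-1 + M.+1%:R * c)))]%classic)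
    = (-1 + M%:R * c < s - x <= -1 + M.+1%:R * c).
  apply/idP/idP; rewrite !inE /= !in_itv /= gt_max le_max s0 leNgt s0 /=;
    by move=> /andP[? ?]; apply/andP; split; lra.
rewrite inE1 => {inE1}; have cM : -1 + M.+1%:R * c = -1 + M%:R * c + c by rewrite -natr1; ring.
split=> h.
- have [le|lt] := leP (s - x) (-1 + M%:R * c); first by rewrite mulr0 addr0 IH1.
  rewrite IH2// h mulr1 add0r; apply: osc.
  by rewrite distrC ger0_norm ?subr_ge0 ?(ltW lt)//; lra.
- by rewrite leNgt h andbF mulr0 addr0 IH2//; lra.
Qed.

Lemma grid_approx c x M e N : 0 < c -> M%:R * c = 2 -> 0 <= x -> x + 1 <= N -> 0 <= e ->
  (forall u v, `|u - v| <= c -> `|f u - f v| <= e) ->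
  bcs N e (fun s => elementary_fun (grid c x M) s - smooth f x s).
Proof.
move=> c0 Mc x0 xN e0 osc; have [K hK] := f_bcs; have hb := hK N x x0 xN.
have sn s : s <= 0 -> elementary_fun (grid c x M) s = 0 /\ smooth f x s = 0.
  move=> s0; split.
    rewrite /elementary_fun big_map big1_seq// => i _ /=; rewrite indicE memNset ?mulr0//=.
    by rewrite in_itv/= gt_max ltNge s0.
  by rewrite /smooth indicE memNset ?mulr0//= in_itv/= andbT; apply/negP; rewrite -leNgt.
have sp s : 0 < s -> smooth f x s = f (s - x).
  by move=> s0; rewrite /smooth indicE mem_set ?mulr1//= in_itv/= s0.
have big s : 0 < s -> 1 < s - x -> elementary_fun (grid c x M) s = 0.
  move=> s0 sx; have s1 : -1 < s - x by lra.
  have [_ h] := grid_fun c0 s0 (fun u => osc u (s - x)) s1 M.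
  by apply: h; rewrite Mc; lra.
split.
- case: (hb) => ms _ _; have [N' [K' [_ [me _ _]]]] := bcs_elementary (@wf_grid c x M c0).
  exact: measurable_funB.
- move=> s; have [s0|s0] := leP s 0; first by have [-> ->] := sn s s0; rewrite subrr normr0.
  rewrite sp//; have [sx|sx] := leP (s - x) (-1); last first.
    have [h1 _] := grid_fun c0 s0 (fun u => osc u (s - x)) sx M.
    have [sx1|sx1] := leP (s - x) 1; first by apply: h1; rewrite Mc; lra.
    by rewrite big// f1 ?subrr ?normr0// ger0_norm; lra.
  rewrite (_ : elementary_fun _ _ = 0).
    have -> : 0 = f (s - x - c) by rewrite f1// ltr0_norm; lra.
    by apply: osc; rewrite addrAC subrr add0r normrN gtr0_norm.
  rewrite /elementary_fun big_map big1_seq// => i _ /=; rewrite indicE memNset ?mulr0//=.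
  rewrite in_itv/= gt_max => /andP[/andP[_ h] _].
  have : 0 <= i%:R * c by rewrite mulr_ge0// ltW.
  lra.
- move=> s hs; have [s0|s0] := leP s 0; first by have [-> ->] := sn s s0; rewrite subrr.
  have s1 : 1 < s - x by move: hs; rewrite (ltW s0)/= -ltNge; lra.
  by rewrite big// sp// f1 ?subrr// ger0_norm; lra.
Qed.

(** Derivatives of grids are jointly measurable because the path is. The grid of index [n] is within
    [2^-n] of the kernel, so successive differences have variance at most [4 C / 4^n], and
    [fast_cauchy] gives a limit defined for all [x] at once. *)
Lemma smooth_version : exists2 Y : R -> T -> R, measurable_fun setT (fun p : R * T => Y p.1 p.2) &
  forall N x, 0 <= x -> x + 1 <= N -> version P G N (smooth f x) (Y x).
Proof.
have hn n : exists M : nat, forall u v, `|u - v| <= 2 / M.+1%:R -> `|f u - f v| <= 2 ^- n.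
  have e0 : 0 < (2 : R) ^- n by rewrite invr_gt0 exprn_gt0.
  have [r /andP[r0 r1] hr] := heine cf f1 e0.
  have [M hM] := small_div_exp2 2 r0.
  exists (2 ^ M)%N => u v uv; apply: hr; apply: le_trans uv _; apply: le_trans (ltW hM).
  by rewrite ler_wpM2l// lef_pV2 ?posrE ?exprn_gt0// -natrX ler_nat.
have [M hM] := choice hn.
pose c n : R := 2 / (M n).+1%:R.
have c0 n : 0 < c n by rewrite divr_gt0.
have Mc n : (M n).+1%:R * c n = 2 by rewrite /c mulrC divfK// pnatr_eq0.
pose X n x := dG (grid (c n) x (M n).+1).
have mX n : measurable_fun setT (fun p : R * T => X n p.1 p.2).
  rewrite (_ : (fun p => _) = fun p : R * T => \sum_(i <- iota 0 (M n).+1) f (-1 + i%:R * c n) *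
      (gpath G (p.1 + (-1 + i.+1%:R * c n)) p.2 - gpath G (p.1 + (-1 + i%:R * c n)) p.2)).
    by apply: measurable_sum => i; apply: measurable_funM => //; apply: measurable_funB.
  by apply/funext => p; rewrite /X /elementary_deriv big_map.
exists (fun x w => rlim (fun n => X n x w)); first exact: measurable_rlim.
move=> N x x0 xN; have [K hK] := f_bcs; have hb := hK N x x0 xN.
have N0 : 0 <= N by lra.
have wE n : wf (grid (c n) x (M n).+1) by exact: wf_grid.
have p2 n : 0 <= (2 : R) ^- n by rewrite invr_ge0 exprn_ge0.
have bE n : bcs N (2 ^- n) (fun s => elementary_fun (grid (c n) x (M n).+1) s - smooth f x s).
  by apply: grid_approx => //; exact: hM.
have sX n : sqintg P (X n x) := gmom_sqintg (gmom_dG hG (wE n)).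
have [C C0 hC] := Bf_bound vd N0.
have step n : msq P (fun w => X n.+1 x w - X n x w) <= 4 * C / 4 ^+ n.
  pose E := elin 1 (grid (c n.+1) x (M n.+1).+1) (-1) (grid (c n) x (M n).+1).
  have wEE : wf E by apply: wf_elin.
  have bEE : bcs N (2 * 2 ^- n) (elementary_fun E).
    have := bcsB (bE n.+1) (bE n); move=> /(bcsW (lexx N)) h.
    have := h (2 * 2 ^- n).
    rewrite (_ : (fun s => _) = elementary_fun E); first apply.
      have : (2 : R) ^- n.+1 <= 2 ^- n.
        by rewrite lef_pV2 ?posrE ?exprn_gt0// ler_weXn2l// ler1n.
      lra.
    by apply/funext => s; rewrite elin_fun; ring.
  rewrite (_ : msq P _ = \int[P]_w (dG E w * dG E w)).
    rewrite (cov_elementary vd hG hS wEE wEE).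
    apply: le_trans (ler_norm _) _; apply: le_trans (hC _ _ _ _ bEE bEE).2 _.
    rewrite (_ : (4 : R) ^+ n = 2 ^+ n * 2 ^+ n); last by rewrite -exprMn -natrM.
    by rewrite invfM le_eqVlt; apply/orP; left; apply/eqP; ring.
  by apply: eq_Rintegral => w _; rewrite elin_deriv /X; ring.
have [_ sY hY] := @fast_cauchy R _ T P (fun n => X n x) (4 * C) sX step.
split=> //; first by exists K.
move=> e e0; have [n hn2] := small_div_exp2 (1 + 4 * (4 * C)) e0.
exists (grid (c n) x (M n).+1); split=> //.
- apply: bcsW (lexx N) _ (bE n); apply: le_trans (ltW hn2).
  by rewrite -[leLHS]mul1r ler_wpM2r// lerDl mulr_ge0// mulr_ge0.
- apply: le_trans (hY n) _; apply: le_trans (ltW hn2).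
  by rewrite ler_wpM2r// lerDr.
Qed.

End version_construction.

(** * Changes on null sets *)

Section null_modifications.
Context (R : realType) (sigma2 rho' : R -> R) (zeta : R).
Notation lam := (@lebesgue_measure R).
Hypothesis vd : variance_density sigma2 rho' zeta.

Let ae0 : {ae lam, forall t : R, t != 0}.
Proof.
exists [set 0]; split; [exact: measurable_set1|exact: lebesgue_measure_set1|].
by move=> t /= /negP; rewrite negbK => /eqP ->.
Qed.

Let aev (v : R) : {ae lam, forall t, t != v /\ t != 0}.
Proof.
exists ([set v] `|` [set 0]); split.
- by apply: measurableU; exact: measurable_set1.
- apply/eqP; rewrite eq_le measure_ge0 andbT.
  apply: le_trans (measureU2 _ _ _) _; [exact: measurable_set1|exact: measurable_set1|].
  by rewrite /= !lebesgue_measure_set1 adde0.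
- by move=> t /= nQ; apply: contrapT => /not_orP[tv t0]; apply: nQ; split; exact/eqP.
Qed.

(** Only the diagonal and the lines [s = 0] and [t = 0] are affected. This reconciles [rho],
    arbitrary at 0, and kernels restricted to [s >= 0] with [rho'] and [smooth]. *)
Lemma rho_norm_null (rho u u' : R -> R) N K K' : 0 <= N -> bcs N K u -> bcs N K' u' ->
  (forall x, x != 0 -> rho x = rho' x) -> (forall s, s != 0 -> u s = u' s) ->
  rho_norm rho u = rho_norm rho' u'.
Proof.
move=> N0 hu hu' hrho huu.
have mrho' := measurable_rho vd.
have mrho : measurable_fun setT rho.
  rewrite (_ : rho = fun x => rho' x + (rho 0 - rho' 0) * \1_[set (0 : R)] x).
    by apply: measurable_funD => //; apply: measurable_funM.
  apply/funext => x; rewrite indicE; have [->|x0] := eqVneq x 0.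
    by rewrite mem_set// mulr1; ring.
  by rewrite memNset ?mulr0 ?addr0 ?hrho//; exact/eqP.
have mu : measurable_fun setT u by case: hu.
have mu' : measurable_fun setT u' by case: hu'.
pose D := `[0%R, +oo[%classic : set R.
have mD : measurable D by exact: measurable_itv.
pose I t := \int[lam]_(s in D) (rho (t - s) * u s * u t).
pose I' t := \int[lam]_(s in D) (rho' (t - s) * u' s * u' t).
have ms (r v : R -> R) t c : measurable_fun setT r -> measurable_fun setT v ->
    measurable_fun D (fun s => (r (t - s) * v s * c)%:E).
  move=> mr mv; apply: measurable_funTS; apply/measurable_EFinP.
  apply: measurable_funM => //; apply: measurable_funM => //.
  by apply: (measurableT_comp mr); exact: measurable_funB.
have e1 t : t != 0 -> I t = I' t.
  move=> t0; rewrite /I /I' /Rintegral; congr fine.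
  apply: ae_eq_integral => //; [exact: ms|exact: ms|].
  apply: (@filterS _ _ (ae_filter_ringOfSetsType lam) _ _ _ (aev t)) => s [st s0] _; congr EFin; rewrite (huu s s0) (huu t t0) hrho//.
  by rewrite subr_eq0 eq_sym.
have g0 s : s \notin D -> u' s = 0.
  rewrite notin_setE /D /= in_itv/= andbT => /negP hx; case: hu' => _ _; apply.
  by rewrite (negbTE hx).
have mI' : measurable_fun setT I'.
  have i := (Fubini1 (intg_Bf vd N0 hu' hu')).1.
  have := intg_meas i; congr measurable_fun; apply/funext => t.
  rewrite /I' [RHS]Rintegral_mkcond; apply: eq_Rintegral => s _; rewrite patchE /=.
  by case: ifPn => // sD; rewrite g0// mulr0 mul0r.
have mI : measurable_fun setT I.
  rewrite (_ : I = fun t => I' t + (I 0 - I' 0) * \1_[set (0 : R)] t).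
    by apply: measurable_funD => //; apply: measurable_funM.
  apply/funext => x; rewrite indicE; have [->|x0] := eqVneq x 0.
    by rewrite mem_set// mulr1; ring.
  by rewrite memNset ?mulr0 ?addr0 ?e1//; exact/eqP.
rewrite /rho_norm -/D; congr Num.sqrt; rewrite -/I -/I' /Rintegral; congr fine.
apply: ae_eq_integral => //.
- by apply/measurable_EFinP; exact: measurable_funTS mI.
- by apply/measurable_EFinP; exact: measurable_funTS mI'.
- apply: (@filterS _ _ (ae_filter_ringOfSetsType lam) _ _ _ ae0) => t t0 _.
  by congr EFin; exact: e1.
Qed.

End null_modifications.

Section kfamily_monotone.
Context (R : realType).

Lemma kfamilyW N b eps eps' (psi : R -> R -> R) : eps <= eps' ->
  kfamily N b eps psi -> kfamily N b eps' psi.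
Proof.
move=> ee [h1 h2 h3 h4 h5]; split=> // x hx; case: (h1 x hx) => k1 k2 k3 k4 k5; split=> //.
- by move=> s hs; apply: k3; exact: le_lt_trans hs.
- by move=> ex; apply: k5; exact: le_trans ex.
Qed.

End kfamily_monotone.

Section wick_power_hermite.
Context d (T : measurableType d) (R : realType) (P : probability T R).

Lemma wick_powerE k Y w : gmom P Y -> wick_power P k Y w = (He (msq P Y) k).[Y w].
Proof.
move=> gY; pose e j := \int[P]_w (Y w ^+ j.*2).
have e0 : e 0%N = 1.
  by rewrite /e -[RHS](Int_prob_cst P 1); apply: eq_Rintegral => x _; rewrite expr0.
have eS j : e j.+1 = j.*2.+1%:R * msq P Y * e j by case: gY => _ _ _ h; rewrite /e doubleS h.
rewrite (He_moments e0 eS) horner_sum /wick_power.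
have tE j : (-1) ^+ j * ('C(k, 2 * j))%:R * fine ('E_P[(fun w' => Y w' ^+ (2 * j))%R]) *
    Y w ^+ (k - 2 * j) = (((-1) ^+ j * 'C(k, j.*2)%:R * e j) *: 'X^(k - j.*2)).[Y w].
  rewrite hornerZ hornerXn mul2n; congr (_ * _ * _).
  by rewrite unlock /e /Rintegral.
(* Terms with [2 j > k] have a zero binomial coefficient, so the sum may be extended to [j <= k]. *)
have kk : (k./2.+1 <= k.+1)%N by rewrite ltnS -divn2 leq_div.
rewrite (big_ord_widen _ (fun j => (-1) ^+ j * ('C(k, 2 * j))%:R *
  fine ('E_P[(fun w' => Y w' ^+ (2 * j))%R]) * Y w ^+ (k - 2 * j)) kk) big_mkcond /=.
apply: eq_bigr => j _; rewrite -tE; case: ifPn => //; rewrite -leqNgt => kj.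
by rewrite bin_small ?mulr0 ?mul0r// mul2n -ltn_half_double.
Qed.

Lemma msq_integratedB (A : set R) (K K' : R) (Phi Phi' : R -> T -> R) :
  let lam := @lebesgue_measure R in
  sqfield lam P A K Phi -> sqfield lam P A K' Phi' ->
  msq P (fun w => integrated lam Phi w - integrated lam Phi' w) =
  msq P (integrated lam (fun x w => Phi x w - Phi' x w)).
Proof.
move=> lam s1 s2; apply: ae_eq_Int.
- apply: measurable_funX; apply: measurable_funB; [exact: measurable_integrated s1|].
  exact: measurable_integrated s2.
- by apply: measurable_funX; exact: measurable_integrated (sqfieldB s1 s2).
have a1 := sqfield_ae_intg s1; have a2 := sqfield_ae_intg s2; move: a1 a2.
by apply: filterS2 => w i1 i2; rewrite /integrated IntB.
Qed.

End wick_power_hermite.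

(** * Existence of the chaos and rate of convergence *)

Section chaos.
Context d (T : measurableType d) (R : realType) (P : probability T R).
Notation lam := (@lebesgue_measure R).
Context (G : R -> T -> R) (sigma2 rho rho' : R -> R) (zeta : R).
Hypothesis vd : variance_density sigma2 rho' zeta.
Hypothesis rhoE : forall x, x != 0 -> rho x = rho' x.
Hypothesis hG : centered_gaussian_process P G.
Hypothesis hS : forall x y : R, 0 <= x -> 0 <= y ->
  msq P (fun w => G x w - G y w) = sigma2 (x - y).
Hypothesis cG : forall w, {within `[0%R, +oo[, continuous (fun x => G x w)}.
Context (phi : R -> R -> R).
Hypothesis hphi : approximate_identity phi.
Notation wf := (@elementary_on_Rplus R).

Let supp1 delta : 0 < delta <= 1 -> forall s, 1 < `|s| -> phi delta s = 0.
Proof. by move=> h s; case: (hphi h) => _ _ _ h0 _ s1; apply: h0; case/andP: h => _ /le_lt_trans; apply. Qed.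

Let sbcs delta : 0 < delta <= 1 ->
  exists K, forall N x, 0 <= x -> x + 1 <= N -> bcs N K (smooth (phi delta) x).
Proof. by move=> h; case: (hphi h) => c1 g0 _ s0 _; exact: (smooth_bcs h c1 g0 s0). Qed.

Lemma gen_deriv_translated delta x Y : 0 < delta <= 1 -> 0 <= x ->
  is_gen_deriv P G rho (translated phi delta x) Y <->
  is_gen_deriv P G rho' (smooth (phi delta) x) Y.
Proof.
move=> hd x0; have [K hK] := sbcs hd.
have [c1 g0 _ s0 _] := hphi hd.
have key (E : elementary R) : wf E ->
    rho_norm rho (fun s => elementary_fun E s - translated phi delta x s) =
    rho_norm rho' (fun s => elementary_fun E s - smooth (phi delta) x s).
  move=> wE; have [N [K1 [N0 hN]]] := bcs_elementary wE.
  pose M := Num.max N (x + 1).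
  have NM : N <= M by rewrite le_max lexx.
  have xM : x + 1 <= M by rewrite le_max lexx orbT.
  have b1 := bcsW NM (lexx _) hN; have b2 := hK M x x0 xM.
  have K0 := bcs_K0 b2.
  have tE s : s != 0 -> translated phi delta x s = smooth (phi delta) x s.
    move=> sn; rewrite /translated /smooth !indicE; congr (_ * (nat_of_bool _)%:R).
    have e : (0 <= s) = (0 < s) by rewrite lt_neqAle (eq_sym 0) sn.
    by apply/idP/idP; rewrite !inE /= !in_itv/= !andbT e.
  have b3 : bcs M (K + phi delta (- x)) (translated phi delta x).
    split.
    - apply: measurable_funM; last exact: measurable_indic.
      have mp : measurable_fun setT (phi delta) by exact: continuous_measurable_fun.
      by apply: (measurableT_comp mp); exact: measurable_funB.
    - move=> s; have [->|sn] := eqVneq s 0.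
        rewrite /translated sub0r ger0_norm; last by rewrite mulr_ge0// indicE.
        apply: (@le_trans _ _ (phi delta (- x))); last by rewrite lerDr.
        by rewrite ler_piMr// indicE; case: (_ \in _).
      by rewrite tE//; case: b2 => _ h _; apply: le_trans (h s) _; rewrite lerDl.
    - move=> s hs; rewrite tE; first by case: b2 => _ _; apply.
      by apply: contraNneq hs => ->; rewrite lexx/=; lra.
  apply: (rho_norm_null vd _ (bcsB b1 b3) (bcsB b1 b2) rhoE); first exact: le_trans N0 NM.
  by move=> s sn; rewrite tE.
have keyE (E : nat -> elementary R) (wE : forall m, wf (E m)) :
    (fun m => rho_norm rho (fun s => elementary_fun (E m) s - translated phi delta x s)) =
    (fun m => rho_norm rho' (fun s => elementary_fun (E m) s - smooth (phi delta) x s)).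
  by apply/funext => m; exact: key.
split=> -[mY [E [wE h1 h2]]]; (split; first exact: mY); exists E; split.
- exact: wE.
- by rewrite -(keyE E wE); exact: h1.
- exact: h2.
- exact: wE.
- by rewrite (keyE E wE); exact: h1.
- exact: h2.
Qed.

Lemma gen_deriv_smooth_version delta x N Y : 0 < delta <= 1 -> 0 <= x -> x + 1 <= N ->
  is_gen_deriv P G rho (translated phi delta x) Y -> version P G N (smooth (phi delta) x) Y.
Proof.
move=> hd x0 xN /(gen_deriv_translated _ hd x0) h.
have [c1 _ _ _ _] := hphi hd.
have [Y' _ hY'] := smooth_version vd hG hS cG c1 (supp1 hd) (sbcs hd).
apply: (gen_deriv_version vd hG hS _ (version_regulated (hY' N x x0 xN)) h); lra.
Qed.

Context (n : nat) (kap : R).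
Hypothesis kapP : n.+1%:R * zeta < kap < 1.
Let tau := kap - n.+1%:R * zeta.
Let tau0 : 0 < tau. Proof. by rewrite subr_gt0; case/andP: kapP. Qed.

Context (a b : R).
Hypothesis ab : 0 <= a <= b.
Let b0 : 0 <= b. Proof. by case/andP: ab; exact: le_trans. Qed.
Let N := b + 1.
Let N0 : 0 <= N. Proof. by rewrite addr_ge0. Qed.

Definition wick_integrand (Y : R -> T -> R) (x : R) (w : T) :=
  wick_field P n.+1 Y x w * \1_`[a, b] x.

Let good (delta : R) (Y : R -> T -> R) := measurable_fun setT (fun p : R * T => Y p.1 p.2) /\
  forall x, 0 <= x <= b -> version P G N (smooth (phi delta) x) (Y x).

Let chaos_integral (Y : R -> T -> R) : (forall x, a <= x <= b -> gmom P (Y x)) ->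
  (fun w => \int[lam]_(x in `[0%R, +oo[) (wick_power P n.+1 (Y x) w * \1_`[a, b] x)) =
  integrated lam (wick_integrand Y).
Proof.
move=> gY; apply/funext => w; rewrite /integrated Rintegral_mkcond; apply: eq_Rintegral => x _.
rewrite patchE /wick_integrand; case: ifPn => [_|].
  rewrite !indicE; have [xab|_] := boolP (x \in _); last by rewrite !mulr0.
  rewrite wick_powerE//; apply: gY; by move: xab; rewrite inE /= in_itv.
rewrite notin_setE/= in_itv/= andbT => /negP; rewrite -ltNge => x0.
rewrite indicE memNset ?mulr0//= in_itv/= => /andP[ax _].
by have /andP[a0 _] := ab; lra.
Qed.

Let fam delta : 0 < delta <= 1 -> kfamily N b delta (smooth (phi delta)).
Proof. by move=> h; case: (hphi h) => *; apply: smooth_kfamily. Qed.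

(** Serves twice: between two values of [delta], where it gives a Cauchy family, and between an
    arbitrary family of kernels and the smooth ones. *)
Let close : exists2 C, 0 <= C & forall eps psi1 Y1 psi2 Y2, 0 < eps ->
  kfamily N b eps psi1 -> kfamily N b eps psi2 ->
  measurable_fun setT (fun p : R * T => Y1 p.1 p.2) ->
  measurable_fun setT (fun p : R * T => Y2 p.1 p.2) ->
  (forall x, 0 <= x <= b -> version P G N (psi1 x) (Y1 x)) ->
  (forall x, 0 <= x <= b -> version P G N (psi2 x) (Y2 x)) ->
  [/\ sqintg P (integrated lam (wick_integrand Y1)), sqintg P (integrated lam (wick_integrand Y2)) &
  msq P (fun w => integrated lam (wick_integrand Y1) w - integrated lam (wick_integrand Y2) w) <=
  C * eps `^ tau].
Proof.
have bN : b <= N by rewrite lerDl.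
have [C C0 hC] := wick_diff_bound vd hG hS kapP N0 b0 bN.
exists C => // eps psi1 Y1 psi2 Y2 e0 f1 f2 m1 m2 v1 v2.
have [K1 s1] := wick_sqfield vd hG hS n.+1 N0 ab f1 m1 v1.
have [K2 s2] := wick_sqfield vd hG hS n.+1 N0 ab f2 m2 v2.
split; [exact: sqintg_integrated s1|exact: sqintg_integrated s2|].
rewrite (msq_integratedB s1 s2); exact: (hC _ _ _ _ _ _ e0 ab f1 f2 m1 m2 v1 v2).
Qed.

Lemma wick_chaos_exists : exists Z, is_wick_chaos P G rho phi n.+1 \1_`[a, b] Z.
Proof.
have hY delta : exists Y : R -> T -> R, 0 < delta <= 1 ->
    measurable_fun setT (fun p : R * T => Y p.1 p.2) /\
    forall M x, 0 <= x -> x + 1 <= M -> version P G M (smooth (phi delta) x) (Y x).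
  have [hd|nd] := boolP (0 < delta <= 1); last by exists (fun _ _ => 0).
  have [c1 _ _ _ _] := hphi hd.
  have [Y mY vY] := smooth_version vd hG hS cG c1 (supp1 hd) (sbcs hd).
  by exists Y => _; split.
have [Y hYY] := choice hY.
have vY delta : 0 < delta <= 1 -> forall x, 0 <= x <= b ->
    version P G N (smooth (phi delta) x) (Y delta x).
  by move=> hd x /andP[x0 xb]; apply: (hYY delta hd).2 => //; rewrite lerD2r.
have [C C0 hC] := close.
pose W delta := integrated lam (wick_integrand (Y delta)).
have hW d1 d2 eps : 0 < d1 <= 1 -> 0 < d2 <= 1 -> d1 <= eps -> d2 <= eps ->
    [/\ sqintg P (W d1), sqintg P (W d2) & msq P (fun w => W d1 w - W d2 w) <= C * eps `^ tau].
  move=> h1 h2 e1 e2; have e0 : 0 < eps by case/andP: h1 => h _; exact: lt_le_trans h e1.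
  apply: (hC eps _ _ _ _ e0 (kfamilyW e1 (fam h1)) (kfamilyW e2 (fam h2))).
  - exact: (hYY _ h1).1.
  - exact: (hYY _ h2).1.
  - exact: vY.
  - exact: vY.
(* Chosen so that [(dn m)^tau = 4^-m], the rate required by [fast_cauchy]. *)
pose dn m : R := ((4 : R) ^- m) `^ tau^-1.
have p4 m : 0 < (4 : R) ^- m by rewrite invr_gt0 exprn_gt0.
have q4 m : (4 : R) ^- m <= 1 by rewrite invf_le1 ?exprn_gt0// exprn_ege1// ler1n.
have dn0 m : 0 < dn m by exact: powR_gt0.
have dn1 m : dn m <= 1.
  have <- : (1 : R) `^ tau^-1 = 1 by rewrite powR1.
  by apply: ge0_ler_powR; rewrite ?nnegrE ?invr_ge0 ?(ltW tau0)// ltW.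
have dnS m : dn m.+1 <= dn m.
  apply: ge0_ler_powR; rewrite ?nnegrE ?invr_ge0 ?exprn_ge0 ?(ltW tau0)//.
  by rewrite lef_pV2 ?posrE ?exprn_gt0// ler_weXn2l// ler1n.
have dnE m : dn m `^ tau = 4 ^- m.
  by rewrite /dn -powRrM mulVf ?gt_eqF// powRr1// ltW.
have dn01 m : 0 < dn m <= 1 by rewrite dn0 dn1.
have [_ sZ hZ] := @fast_cauchy R _ T P (fun m => W (dn m)) C
  (fun m => let: And3 h _ _ := hW _ _ _ (dn01 m) (dn01 m) (lexx _) (lexx _) in h)
  (fun m => ltac:(by have [_ _ h] := hW _ _ _ (dn01 m.+1) (dn01 m) (dnS m) (lexx _); rewrite dnE in h)).
set Z := fun w => rlim _ in sZ hZ.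
exists Z; split; first exact: sZ.1.
exists Y; split=> [delta hd|delta x hd x0|].
- exact: (hYY _ hd).1.
- apply/(gen_deriv_translated _ hd x0).
  have xN : 0 <= x + 1 by rewrite addr_ge0.
  by apply: (version_gen_deriv vd hG xN); apply: (hYY _ hd).2.
apply: L2dist_cvg0 => e e0; have [m hm] := small_div_exp2 (2 * C + 2 * (4 * C)) e0.
near=> delta.
have hd : 0 < delta <= 1.
  apply/andP; split; first by near: delta; exact: nbhs_right_gt.
  by near: delta; apply: nbhs_right_le; exact: ltr01.
have dm : delta <= dn m by near: delta; apply: nbhs_right_le; exact: dn0.
have WEd : (fun w => \int[lam]_(x in `[0%R, +oo[)
    (wick_power P n.+1 (Y delta x) w * \1_`[a, b] x)) = W delta.
  apply: chaos_integral => x /andP[ax xb]; apply: (version_gmom hG (vY delta hd x _)).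
  by rewrite xb andbT; case/andP: ab => a0 _; exact: le_trans ax.
have e1 : (fun w => \int[lam]_(x in `[0%R, +oo[)
    (wick_power P n.+1 (Y delta x) w * \1_`[a, b] x) - Z w) = (fun w => W delta w - Z w).
  by rewrite -WEd.
rewrite e1.
have [s1 s2 h12] := hW _ _ _ hd (dn01 m) dm (lexx _).
split; first exact: sqintgB.
apply: le_trans (msqB_le s1 s2 sZ) _; apply: le_trans (ltW hm).
have := hZ m; rewrite dnE in h12.
have : C / 4 ^+ m <= C / 2 ^+ m.
  by rewrite ler_wpM2l// lef_pV2 ?posrE ?exprn_gt0// lerXn2r ?nnegrE// ler_nat.
have -> : (2 * C + 2 * (4 * C)) / 2 ^+ m = 2 * (C / 2 ^+ m) + 2 * (4 * C / 2 ^+ m) by ring.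
move: h12; rewrite -/(W delta); move: (msq _ _) (msq _ _) => q1 q2; lra.
Unshelve. all: end_near. Qed.

(** For given [eps], some [delta <= eps] makes the approximating integral [eps^tau]-close to [Z];
    the two kernel families are then compared at scale [eps]. The constant thus depends neither on
    [Z] nor on the versions [Y] that witness it. *)
Lemma wick_chaos_close : exists2 C, 0 <= C & forall Z, is_wick_chaos P G rho phi n.+1 \1_`[a, b] Z ->
  sqintg P Z /\ forall eps psi X, 0 < eps <= 1 -> kfamily N b eps psi ->
  measurable_fun setT (fun p : R * T => X p.1 p.2) ->
  (forall x, 0 <= x <= b -> version P G N (psi x) (X x)) ->
  sqintg P (integrated lam (wick_integrand X)) /\
  msq P (fun w => integrated lam (wick_integrand X) w - Z w) <= C * eps `^ tau.
Proof.
have [C C0 hC] := close; exists (2 * C + 2) => [|Z [mZ [Y [mY dY cY]]]]; first by rewrite addr_ge0// mulr_ge0.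
have vY delta : 0 < delta <= 1 -> forall x, 0 <= x <= b ->
    version P G N (smooth (phi delta) x) (Y delta x).
  move=> hd x /andP[x0 xb]; apply: gen_deriv_smooth_version => //; first by rewrite lerD2r.
  exact: dY.
pose W delta := integrated lam (wick_integrand (Y delta)).
have WE delta : 0 < delta <= 1 -> (fun w => \int[lam]_(x in `[0%R, +oo[)
    (wick_power P n.+1 (Y delta x) w * \1_`[a, b] x)) = W delta.
  move=> hd; apply: chaos_integral => x /andP[ax xb]; apply: (version_gmom hG (vY delta hd x _)).
  by rewrite xb andbT; case/andP: ab => a0 _; exact: le_trans ax.
have sW delta : 0 < delta <= 1 -> sqintg P (W delta).
  move=> hd; have d0 : 0 < delta by case/andP: hd.
  by have [] := hC delta _ _ _ _ d0 (fam hd) (fam hd) (mY _ hd) (mY _ hd) (vY _ hd) (vY _ hd).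
have near01 : \forall delta \near (0 : R)^'+, 0 < delta <= 1.
  near=> delta; apply/andP; split; first by near: delta; exact: nbhs_right_gt.
  by near: delta; apply: nbhs_right_le; exact: ltr01.
have mW : \forall delta \near (0 : R)^'+, measurable_fun setT (fun w => \int[lam]_(x in `[0%R, +oo[)
    (wick_power P n.+1 (Y delta x) w * \1_`[a, b] x)).
  by apply: filterS near01 => delta hd; rewrite WE//; exact: (sW _ hd).1.
have cv := cvg0_L2dist _ mZ mW cY.
have pick e eps : 0 < e -> 0 < eps -> exists delta, [/\ 0 < delta <= 1, delta <= eps,
    sqintg P (fun w => W delta w - Z w) & msq P (fun w => W delta w - Z w) <= e].
  move=> e0 eps0; have hn : \forall delta \near (0 : R)^'+, [/\ 0 < delta <= 1, delta <= eps,
    sqintg P (fun w => W delta w - Z w) & msq P (fun w => W delta w - Z w) <= e].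
    near=> delta; have hd : 0 < delta <= 1 by near: delta; exact: near01.
    have [s m] : sqintg P (fun w => \int[lam]_(x in `[0%R, +oo[)
      (wick_power P n.+1 (Y delta x) w * \1_`[a, b] x) - Z w) /\ msq P (fun w =>
      \int[lam]_(x in `[0%R, +oo[) (wick_power P n.+1 (Y delta x) w * \1_`[a, b] x) - Z w) <= e.
      by near: delta; exact: cv.
    have e1 : (fun w => \int[lam]_(x in `[0%R, +oo[)
      (wick_power P n.+1 (Y delta x) w * \1_`[a, b] x) - Z w) = (fun w => W delta w - Z w).
      by rewrite -WE.
    rewrite e1 in s m; split=> //; near: delta; exact: nbhs_right_le.
  exact: (@filter_ex _ _ (at_right_proper_filter (0 : R)) _ hn).
have sZ : sqintg P Z.
  have [delta [hd _ s _]] := pick 1 1 ltr01 ltr01.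
  by apply: eq_sqintg (sqintgB (sW _ hd) s) => w; rewrite subKr.
split=> // eps psi X /andP[eps0 eps1] fX mX vX.
have et0 : 0 < eps `^ tau by exact: powR_gt0.
have [delta [hd de s m]] := pick _ _ et0 eps0.
have [s1 s2 h12] := hC eps _ _ _ _ eps0 fX (kfamilyW de (fam hd)) mX (mY _ hd) vX (vY _ hd).
split=> //; apply: le_trans (msqB_le s1 s2 sZ) _.
have -> : (2 * C + 2) * eps `^ tau = 2 * (C * eps `^ tau) + 2 * eps `^ tau by ring.
by apply: lerD; apply: ler_wpM2l.
Unshelve. all: end_near. Qed.

End chaos.

(** Homogeneity of Wick powers: it turns Hermite polynomials of normalized increments into powers of
    [h / sigma h] times Wick powers of difference quotients. *)
Lemma He_scale (R : realType) (c v y : R) k : (He (c ^+ 2 * v) k).[c * y] = c ^+ k * (He v k).[y].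
Proof.
have step u z m : (He u m.+2).[z] = z * (He u m.+1).[z] - u * (m.+1%:R * (He u m).[z]).
  rewrite -[He _ m.+2]/('X * He u m.+1 - u *: (He u m.+1)^`()).
  by rewrite deriv_He hornerD hornerN hornerM hornerX !hornerZ.
elim/ltn_ind: k => -[_|[_|k IH]].
- by rewrite !hornerC expr0 mul1r.
- by rewrite /= derivC !scaler0 !subr0 !mulr1 !hornerX expr1.
by rewrite !step !IH// !exprS; ring.
Qed.

(** * The Hermite expansion *)

Section normalized_increments.
Context d (T : measurableType d) (R : realType) (P : probability T R).
Notation lam := (@lebesgue_measure R).
Notation gam := (normal_prob (0 : R) 1).
Context (G : R -> T -> R) (sigma2 rho : R -> R) (zeta : R).
Hypothesis vd : variance_density sigma2 rho zeta.
Hypothesis hG : centered_gaussian_process P G.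
Hypothesis hS : forall x y : R, 0 <= x -> 0 <= y ->
  msq P (fun w => G x w - G y w) = sigma2 (x - y).
Hypothesis cG : forall w, {within `[0%R, +oo[, continuous (fun x => G x w)}.

Definition normalized (h x : R) (w : T) :=
  (Num.sqrt (sigma2 h))^-1 * (gpath G (x + h) w - gpath G (x + 0) w).

Lemma measurable_normalized h : measurable_fun setT (fun p : R * T => normalized h p.1 p.2).
Proof.
have mG := measurable_path (measurable_G hG) cG.
have ms (c : R) : measurable_fun setT (fun p : R * T => gpath G (p.1 + c) p.2).
  apply: (measurableT_comp mG (g := fun p : R * T => (p.1 + c, p.2))).
  by apply: measurable_fun_pair => //; exact: measurable_funD.
by apply: measurable_funM => //; exact: measurable_funB.
Qed.

Section fixed_step.
Context (h : R).
Hypothesis h0 : 0 < h.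
Hypothesis s2 : 0 < sigma2 h.
Let c := h / Num.sqrt (sigma2 h).

Let sn0 : Num.sqrt (sigma2 h) != 0. Proof. by rewrite gt_eqF// sqrtr_gt0. Qed.
Let hn0 : h != 0. Proof. by rewrite gt_eqF. Qed.

Lemma sqr_ratio : c ^+ 2 = h ^+ 2 / sigma2 h.
Proof. by rewrite /c exprMn exprVn sqr_sqrtr// ltW. Qed.

Lemma normalizedE x w : normalized h x w = c * quotient G h x w.
Proof. by rewrite /normalized /quotient /c; field; rewrite hn0. Qed.

Lemma quotient_msq x : 0 <= x -> c ^+ 2 * msq P (quotient G h x) = 1.
Proof.
move=> x0; have xh : 0 <= x + h by rewrite addr_ge0// ltW.
have e : quotient G h x = fun w => h^-1 * (G (x + h) w - G x w).
  by apply/funext => w; rewrite /quotient /gpath addr0 !max_r.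
rewrite e msqZ; last exact: gmom_sqintg (gmom_increment hG xh x0).
rewrite hS// [x + h]addrC addrK sqr_ratio; field.
by rewrite hn0 gt_eqF.
Qed.

Lemma measurable_normalized1 x : measurable_fun setT (normalized h x).
Proof. exact: (measurableT_comp (measurable_normalized h) (pair1_measurable x)). Qed.

Lemma normalized_law x : 0 <= x ->
  forall A : set R, measurable A -> P (normalized h x @^-1` A) = gam A.
Proof.
move=> x0; have xh : 0 <= x + h by rewrite addr_ge0// ltW.
apply: centered_gaussian_std; [exact: measurable_normalized1| |].
  pose xs (i : 'I_2) := if i == 0 :> nat then x + h else x.
  pose cs (i : 'I_2) := if i == 0 :> nat then (Num.sqrt (sigma2 h))^-1 else - (Num.sqrt (sigma2 h))^-1.
  have := @hG 2 xs cs _.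
  rewrite (_ : (fun w => _) = normalized h x); first by apply => i; rewrite /xs; case: ifP.
  apply/funext => w; rewrite !big_ord_recl big_ord0 /xs /cs /= /normalized /gpath addr0.
  by rewrite !addr0 !max_r//; ring.
rewrite (_ : normalized h x = fun w => c * quotient G h x w); last first.
  by apply/funext => w; rewrite normalizedE.
have xN : x + h <= x + h by [].
rewrite msqZ ?quotient_msq//; exact: gmom_sqintg (version_gmom hG (quotient_version hG h0 x0 xN)).
Qed.

Lemma std_field (g : R -> R) (a b : R) : sqintg gam g -> 0 <= a ->
  sqfield lam P `[a, b] (msq gam g) (fun x w => g (normalized h x w) * \1_`[a, b] x).
Proof.
move=> sg a0; split.
- exact: measurable_itv.
- split; last exact: msq_ge0.
  by rewrite /= lebesgue_measure_itv/=; case: ifP => _; rewrite ?ltry// -EFinB ltry.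
- apply: measurable_funM; first exact: (measurableT_comp sg.1 (measurable_normalized h)).
  by apply: (measurableT_comp (f := \1_`[a, b] : R -> R)).
- by move=> x w nx; rewrite indicE memNset// mulr0.
move=> x; rewrite indicE; have [xab|_] := boolP (x \in _); last first.
  rewrite (_ : (fun w => _) = fun=> 0); last by apply/funext => w; rewrite mulr0.
  split; first exact: sqintg0.
  by rewrite {1}/msq Int_eq0 ?msq_ge0// => w; rewrite expr0n.
have x0 : 0 <= x by move: xab; rewrite inE /= in_itv/= => /andP[ax _]; exact: le_trans ax.
rewrite (_ : (fun w => _) = fun w => g (normalized h x w)); last by apply/funext => w; rewrite mulr1.
by have [s1 ->] := law_sqintg (measurable_normalized1 x) (normalized_law x0) sg.
Qed.

Lemma normalized_gpair N x y : 0 <= x -> x + h <= N -> 0 <= y -> y + h <= N ->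
  gpair P (normalized h x) (normalized h y) /\
  \int[P]_w (normalized h x w * normalized h y w) =
  h ^+ 2 / sigma2 h * Bf rho (increment h x) (increment h y).
Proof.
move=> x0 xN y0 yN; have v1 := quotient_version hG h0 x0 xN; have v2 := quotient_version hG h0 y0 yN.
have N0 : 0 <= N by rewrite (le_trans _ xN)// addr_ge0// ltW.
have gp := version_gpair hG v1 v2; split.
  move=> s t; have := gp (s * c) (t * c); congr gmom; apply/funext => w.
  by rewrite !normalizedE; ring.
rewrite -(version_cov vd hG hS N0 v1 v2) -sqr_ratio -IntZ.
  by apply: eq_Rintegral => w _; rewrite !normalizedE; ring.
by apply: sqintgM; apply: gmom_sqintg; [exact: gpair1 gp|exact: gpair2 gp].
Qed.

Lemma hermite_integral j a b w : 0 <= a ->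
  intg lam (fun x => wick_field P j (quotient G h) x w * \1_`[a, b] x) ->
  integrated lam (fun x w => (He1 R j).[normalized h x w] * \1_`[a, b] x) w =
  (Num.sqrt j`!%:R)^-1 * c ^+ j *
  integrated lam (fun x w => wick_field P j (quotient G h) x w * \1_`[a, b] x) w.
Proof.
move=> a0 iw; have e x : (He1 R j).[normalized h x w] * \1_`[a, b] x =
    (Num.sqrt j`!%:R)^-1 * c ^+ j * (wick_field P j (quotient G h) x w * \1_`[a, b] x).
  rewrite indicE; have [xab|_] := boolP (x \in _); last by rewrite !mulr0.
  have x0 : 0 <= x by move: xab; rewrite inE /= in_itv/= => /andP[ax _]; exact: le_trans ax.
  rewrite !mulr1 normalizedE /He1 hornerZ -(quotient_msq x0) He_scale /wick_field; ring.
by rewrite /integrated -IntZ//; apply: eq_Rintegral => x _; rewrite e.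
Qed.

End fixed_step.

(** The order of the quantifiers matters: [C] precedes [eta], while [E] depends on it. Only the term
    with [E] carries an additional factor [h^2 / sigma2 h], so [eta] can be made small first and [h]
    afterwards. *)
Lemma remainder_bound n kap a b : n.+1%:R * zeta < kap < 1 -> 0 <= a <= b ->
  exists2 C, 0 <= C & forall eta : R, 0 < eta -> exists2 E, 0 <= E &
  forall (h : R) (r : R -> R), 0 < h <= 1 -> 8 * h <= eta -> 0 < sigma2 h -> sqintg gam r ->
  (forall j, (j < n.+2)%N -> \int[gam]_x (r x * (He1 R j).[x]) = 0) ->
  msq P (integrated lam (fun x w => r (normalized h x w) * \1_`[a, b] x)) <=
  C * msq gam r * ((h ^+ 2 / sigma2 h) ^+ n.+1 * (E * (h ^+ 2 / sigma2 h) +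
    h `^ (kap - n.+1%:R * zeta) + eta `^ (kap - n.+1%:R * zeta))).
Proof.
move=> kapP hab; have /andP[a0 ab] := hab; set tau := kap - _.
have b0 : 0 <= b by exact: le_trans ab.
pose N := b + 1; have N0 : 0 <= N by rewrite addr_ge0.
have bN : b <= N by rewrite lerDl.
have z0 : 0 < zeta by case/andP: (vd_zeta vd).
have jz : 0 < n.+1%:R * zeta by rewrite mulr_gt0.
have tau0 : 0 <= tau by rewrite subr_ge0 ltW//; case/andP: kapP.
have kapE : n.+1%:R * zeta + tau = kap by rewrite /tau; ring.
have kap01 : 0 <= kap < 1.
  by case/andP: kapP => h ->; rewrite andbT; exact: le_trans (ltW jz) (ltW h).
have [C C0 hC] := msq_field_bound (T := T) P kap01 N0 b0.
have [D D0 hD] := kernel_estimate vd kapP N0.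
have [F F0 hF] := kern_far vd N0.
have [C1 C10 [hC1 _]] := rho_bound vd N.
pose c1 := C1 ^+ n.+1; have c10 : 0 <= c1 by rewrite exprn_ge0// ltW.
exists (C * (1 + D + c1)) => [|eta eta0].
  by apply: mulr_ge0 => //; rewrite !addr_ge0// ltW.
(* Off the diagonal [|y - x| >= eta >= 8 h], so the covariance of the difference quotients is at
   most [F eta^-zeta], raised here to the full power [n + 2]. *)
pose E := (F * pk zeta eta) ^+ n.+2.
have FE0 : 0 <= F * pk zeta eta by rewrite mulr_ge0 ?pk_ge0// ltW.
have E0 : 0 <= E by exact: exprn_ge0.
exists E => // h r /andP[h0 h1] heta s2 sr hr.
set q := h ^+ 2 / sigma2 h; have q0 : 0 <= q by rewrite divr_ge0 ?sqr_ge0// ltW.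
have hx : b + h <= N by rewrite lerD2l.
have fam := increment_kfamily h0 hx.
have mr0 := msq_ge0 gam r.
have qn0 : 0 <= q ^+ n.+1 by exact: exprn_ge0.
have ht0 : 0 <= h `^ tau by exact: powR_ge0.
have et0 : 0 <= eta `^ tau by exact: powR_ge0.
pose k0 := msq gam r * q ^+ n.+1 * (q * E).
pose k1 := msq gam r * q ^+ n.+1 * (D * h `^ tau + c1 * eta `^ tau).
have k00 : 0 <= k0 by apply: mulr_ge0; apply: mulr_ge0.
have D0' := ltW D0.
have k10 : 0 <= k1 by apply: mulr_ge0; [exact: mulr_ge0|apply: addr_ge0; exact: mulr_ge0].
apply: (@le_trans _ _ (C * (k0 + k1))); last first.
  have -> : C * (1 + D + c1) * msq gam r * (q ^+ n.+1 * (E * q + h `^ tau + eta `^ tau)) =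
    C * (msq gam r * q ^+ n.+1 * ((1 + D + c1) * (E * q + h `^ tau + eta `^ tau))) by ring.
  have -> : k0 + k1 = msq gam r * q ^+ n.+1 * (q * E + (D * h `^ tau + c1 * eta `^ tau)).
    by rewrite /k0 /k1; ring.
  apply: ler_wpM2l => //; apply: ler_wpM2l; first exact: mulr_ge0.
  have t1 : 0 <= (D + c1) * (E * q) by apply: mulr_ge0; [exact: addr_ge0|exact: mulr_ge0].
  have t2 : 0 <= (1 + c1) * h `^ tau by apply: mulr_ge0 => //; exact: addr_ge0.
  have t3 : 0 <= (1 + D) * eta `^ tau by apply: mulr_ge0 => //; exact: addr_ge0.
  rewrite (mulrC q); move: (E * q) (h `^ tau) (eta `^ tau) t1 t2 t3 => u v w; lra.
apply: (hC _ _ _ _ _ _ _ _ fam fam hab k00 k10 (std_field h0 s2 b sr a0)) => x y hx0 hy0.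
have K0 := kbound_ge0 kap x y fam fam.
have rhs0 : 0 <= k0 + k1 * kbound kap (increment h) (increment h) x y.
  by apply: addr_ge0 => //; exact: mulr_ge0.
have [[xa ya]|nab] := pselect ((a <= x) /\ (a <= y)); last first.
  rewrite Int_eq0; first by rewrite normr0.
  move=> w; rewrite !indicE.
  have [ax|xa] := leP a x; last first.
    by rewrite [x \in _]memNset ?mulr0//= in_itv/= leNgt xa.
  have [ay|ya] := leP a y; last first.
    by rewrite [y \in _]memNset ?mulr0 ?mul0r//= in_itv/= leNgt ya.
  by exfalso; apply: nab.
have /andP[x0 xb] := hx0; have /andP[y0 yb] := hy0.
have x0' := ltW x0; have y0' := ltW y0.
rewrite (_ : \int[P]_w _ = \int[P]_w (r (normalized h x w) * r (normalized h y w))); last first.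
  apply: eq_Rintegral => w _; rewrite !indicE !mem_set /= ?in_itv/= ?xa ?xb ?ya ?yb// !mulr1.
  by rewrite mulrC.
have xN : x + h <= N by apply: le_trans hx; rewrite lerD2r.
have yN : y + h <= N by apply: le_trans hx; rewrite lerD2r.
have [gp ec] := normalized_gpair h0 s2 x0' xN y0' yN.
have mx := measurable_normalized1 h x; have my := measurable_normalized1 h y.
have lx := normalized_law h0 s2 x0'; have ly := normalized_law h0 s2 y0'.
apply: le_trans (correlation_bound mx my lx ly gp sr hr) _.
have c1le := norm_correlation_le1 mx my lx ly.
move: c1le; rewrite ec -/q; set B := Bf rho _ _ => c1le.
have xb0 : 0 <= x <= b by rewrite x0'.
have yb0 : 0 <= y <= b by rewrite y0'.
have kx := fam_kern fam xb0; have ky := fam_kern fam yb0.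
have xN2 : 0 < x <= N by rewrite x0 (le_trans xb).
have yN2 : 0 < y <= N by rewrite y0 (le_trans yb).
have A0 : 0 <= Bf (pk kap) (increment h x) (increment h y).
  have g := fam_ge0 fam; apply: Int_ge0 => p.
  by apply: mulr_ge0; [apply: mulr_ge0; [exact: pk_ge0|exact: g]|exact: g].
have pu := pk_ge0 kap (y - x); have px := pk_ge0 kap x; have py := pk_ge0 kap y.
have [near|far] := ltP `|y - x| eta.
- apply: (@le_trans _ _ (k1 * kbound kap (increment h) (increment h) x y)); last by rewrite lerDr.
  (* One factor [|q * B| <= 1] is given up, which keeps the singularity at the integrable power
     [n + 1]. *)
  apply: (@le_trans _ _ (`|q * B| ^+ n.+1 * msq gam r)).
    by rewrite ler_wpM2r// exprS ler_piMl// exprn_ge0.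
  rewrite normrM (ger0_norm q0) exprMn /k1.
  rewrite [leLHS]mulrC -!mulrA; apply: ler_wpM2l => //; apply: ler_wpM2l => //.
  have d1 := hD _ _ _ _ _ h0 xN2 yN2 kx ky; rewrite -/tau -/B in d1.
  have d2 : `|rho (y - x)| ^+ n.+1 <= c1 * (eta `^ tau * pk kap (y - x)).
    apply: (@le_trans _ _ (c1 * pk (n.+1%:R * zeta) (y - x))).
      rewrite -pkX -exprMn; apply: lerXn2r; rewrite ?nnegrE//.
        by rewrite mulr_ge0 ?pk_ge0// ltW.
      by apply: hC1; rewrite ler_norml; apply/andP; split; lra.
    rewrite ler_wpM2l// -kapE; apply: pk_near => //; exact: ltW.
  have d3 : `|B| ^+ n.+1 <= `|B ^+ n.+1 - rho (y - x) ^+ n.+1| + `|rho (y - x)| ^+ n.+1.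
    rewrite -normrX -[`|rho _| ^+ _]normrX.
    by apply: le_trans (ler_normD _ _); rewrite subrK.
  apply: le_trans d3 _; rewrite mulrDl; apply: lerD.
    apply: le_trans d1 _; rewrite ler_wpM2l//; first by rewrite mulr_ge0.
    rewrite /kbound; move: A0 pu px py; lra.
  apply: le_trans d2 _; rewrite -mulrA; apply: ler_wpM2l => //; apply: ler_wpM2l => //.
  rewrite /kbound; move: A0 pu px py; lra.
- apply: (@le_trans _ _ k0); last by rewrite lerDl mulr_ge0.
  have far8 : 8 * h <= `|y - x| by exact: le_trans far.
  have xN3 : 0 <= x <= N by case/andP: xN2 => /ltW ->.
  have yN3 : 0 <= y <= N by case/andP: yN2 => /ltW ->.
  have f1 := hF _ _ _ _ _ h0 xN3 yN3 kx ky far8.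
  have f2 : `|B| <= F * pk zeta eta.
    apply: le_trans f1 _; apply: ler_wpM2l; first exact: ltW.
    apply: pk_le; [exact: ltW|by rewrite gt_eqF|by rewrite gtr0_norm].
  have -> : `|q * B| ^+ n.+2 * msq gam r = msq gam r * q ^+ n.+1 * (q * `|B| ^+ n.+2).
    by rewrite normrM (ger0_norm q0) exprMn (exprS q n.+1); ring.
  rewrite /k0; apply: ler_wpM2l; first exact: mulr_ge0.
  apply: ler_wpM2l => //.
  by apply: lerXn2r; rewrite ?nnegrE.
Qed.

End normalized_increments.

Section hermite_projection.
Context (R : realType).
Notation gam := (normal_prob (0 : R) 1).

Lemma hermite_remainder (f : R -> R) (m : nat) : sqintg gam f ->
  let a j := \int[gam]_x (f x * (He1 R j).[x]) in
  let r x := f x - \sum_(j < m) a j * (He1 R j).[x] in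
  sqintg gam r /\ forall j, (j < m)%N -> \int[gam]_x (r x * (He1 R j).[x]) = 0.
Proof.
move=> sf a r; have sH j : sqintg gam (horner (He1 R j)) := sqintg_horner _.
have sS : sqintg gam (fun x => \sum_(j < m) a j * (He1 R j).[x]).
  by apply: sqintg_sum => j; exact: sqintgZ.
have sr : sqintg gam r by exact: sqintgB.
split=> // j jm; rewrite /r.
rewrite (_ : \int[gam]_x _ = \int[gam]_x (f x * (He1 R j).[x] -
    \sum_(i < m) a i * ((He1 R i).[x] * (He1 R j).[x]))); last first.
  apply: eq_Rintegral => x _; rewrite mulrBl mulr_suml; congr (_ - _).
  by apply: eq_bigr => i _; rewrite mulrA.
have iij i : intg gam (fun x => a i * ((He1 R i).[x] * (He1 R j).[x])).
  by apply: intgZ; exact: sqintgM.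
rewrite IntB; [|exact: sqintgM|by apply: intg_sum => i; exact: iij].
rewrite Int_sum; last by move=> i; exact: iij.
rewrite (bigD1 (Ordinal jm))//= big1 ?addr0; last first.
  move=> i ij; rewrite IntZ; last exact: sqintgM.
  have := (orthonormal_He1 R).2 i j; rewrite /dotp => ->.
  by rewrite (_ : (i == j :> nat) = false) ?mulr0//; apply/negbTE; exact: ij.
rewrite IntZ; last exact: sqintgM.
have := (orthonormal_He1 R).2 j j; rewrite /dotp => ->.
by rewrite eqxx mulr1 subrr.
Qed.

End hermite_projection.

Section msq_of_sums.
Context d (T : measurableType d) (R : realType) (mu : {measure set T -> \bar R}).

Lemma msq_sum_le (X : nat -> T -> R) (B : R) m : 0 <= B ->
  (forall j, (j < m)%N -> sqintg mu (X j) /\ msq mu (X j) <= B) ->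
  sqintg mu (fun w => \sum_(j < m) X j w) /\
  msq mu (fun w => \sum_(j < m) X j w) <= 4 ^+ m * B.
Proof.
move=> B0; elim: m => [|m IH] hX.
  rewrite (_ : (fun w => _) = fun=> 0); last by apply/funext => w; rewrite big_ord0.
  split; first exact: sqintg0.
  by rewrite expr0 mul1r /msq Int_eq0// => w; rewrite expr0n.
have [s1 b1] := IH (fun j jm => hX j (leqW jm)); have [s2 b2] := hX m (ltnSn m).
rewrite (_ : (fun w => _) = fun w => \sum_(j < m) X j w + X m w); last first.
  by apply/funext => w; rewrite big_ord_recr.
split; first exact: sqintgD.
apply: le_trans (msqD_le s1 s2) _; have : 1 <= (4 : R) ^+ m by rewrite exprn_ege1// ler1n.
have -> : (4 : R) ^+ m.+1 * B = 4 * (4 ^+ m * B) by rewrite exprS mulrA.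
move=> h; have : B <= 4 ^+ m * B by rewrite ler_peMl.
lra.
Qed.

End msq_of_sums.

Lemma small_powR (R : realType) (theta K e : R) : 0 < theta -> 0 <= K -> 0 < e ->
  exists2 eta, 0 < eta <= 1 & forall h, 0 < h <= eta -> K * h `^ theta <= e.
Proof.
move=> t0 K0 e0; have K1 : 0 < K + 1 by rewrite ltr_wpDl.
pose m := Num.min 1 (e / (K + 1)).
have m0 : 0 < m by rewrite lt_min ltr01 divr_gt0.
have m1 : m <= 1 by rewrite ge_min lexx.
have mE : m * (K + 1) <= e by rewrite -ler_pdivlMr// ge_min lexx orbT.
have ti : 0 <= theta^-1 by rewrite invr_ge0 ltW.
have e1 : (m `^ theta^-1) `^ theta = m by rewrite -powRrM mulVf ?gt_eqF// powRr1// ltW.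
exists (m `^ theta^-1).
  rewrite powR_gt0//=; have <- : (1 : R) `^ theta^-1 = 1 by rewrite powR1.
  by apply: ge0_ler_powR; rewrite ?nnegrE// ltW.
move=> h /andP[h0 hm]; apply: (@le_trans _ _ (K * m)); last first.
  by apply: le_trans mE; rewrite mulrC ler_wpM2l ?(ltW m0)// lerDl.
by rewrite ler_wpM2l// -[leRHS]e1; apply: ge0_ler_powR; rewrite ?nnegrE ?powR_ge0// ltW.
Qed.

(** * Assembling the expansion *)

Section expansion.
Context d (T : measurableType d) (R : realType) (P : probability T R).
Notation lam := (@lebesgue_measure R).
Notation gam := (normal_prob (0 : R) 1).
Context (G : R -> T -> R) (sigma2 rho rho' : R -> R) (zeta : R).
Hypothesis vd : variance_density sigma2 rho' zeta.
Hypothesis rhoE : forall x, x != 0 -> rho x = rho' x.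
Hypothesis hG : centered_gaussian_process P G.
Hypothesis hS : forall x y : R, 0 <= x -> 0 <= y ->
  msq P (fun w => G x w - G y w) = sigma2 (x - y).
Hypothesis cG : forall w, {within `[0%R, +oo[, continuous (fun x => G x w)}.
Context (phi : R -> R -> R).
Hypothesis hphi : approximate_identity phi.
Context (a b : R).
Hypothesis ab : 0 <= a <= b.
Let a0 : 0 <= a. Proof. by case/andP: ab. Qed.
Let b0 : 0 <= b. Proof. by case/andP: ab; exact: le_trans. Qed.
Let N := b + 1.
Let N0 : 0 <= N. Proof. by rewrite addr_ge0. Qed.

Let Z j := wick_chaos P G rho phi j (\1_`[a, b] : R -> R).
Let V h j := integrated lam (fun x w => wick_field P j (quotient G h) x w * \1_`[a, b] x).

Let fam h : 0 < h <= 1 -> kfamily N b h (increment h).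
Proof. by move=> /andP[h0 h1]; apply: increment_kfamily => //; rewrite lerD2l. Qed.

Let vers h : 0 < h <= 1 -> forall x, 0 <= x <= b -> version P G N (increment h x) (quotient G h x).
Proof. by move=> /andP[h0 h1] x /andP[x0 xb]; apply: quotient_version => //; exact: lerD. Qed.

Let mquot h := measurable_quotient hG cG h.

Let sqV h j : 0 < h <= 1 -> exists K, sqfield lam P `[a, b] K
  (fun x w => wick_field P j (quotient G h) x w * \1_`[a, b] x).
Proof. by move=> hh; exact: (wick_sqfield vd hG hS j N0 ab (fam hh) (mquot h) (vers hh)). Qed.

Lemma chaos_zero h w : V h 0 w = Z 0 w.
Proof.
rewrite /V /Z /wick_chaos /= /integrated [RHS]Rintegral_mkcond; apply: eq_Rintegral => x _.
rewrite /wick_field hornerC mul1r patchE; case: ifPn => //.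
rewrite notin_setE/= in_itv/= andbT => /negP; rewrite -ltNge => x0.
rewrite indicE memNset//= in_itv/= => /andP[ax _].
by have := lt_le_trans x0 (le_trans a0 ax); rewrite ltxx.
Qed.

(** The rate in degree [m + 1] is [h^(kap - (m + 1) zeta)], better than the target by
    [h^(zeta (n - m))]; [sigma2_bound] turns each [h^zeta] into one of the missing factors
    [h^2 / sigma2 h]. *)
Lemma chaos_term n kap m : n.+1%:R * zeta < kap < 1 -> (m <= n)%N ->
  exists2 K, 0 <= K & forall h, 0 < h <= 1 -> 0 < sigma2 h ->
  [/\ sqintg P (Z m.+1), sqintg P (V h m.+1) &
  (h ^+ 2 / sigma2 h) ^+ m.+1 * msq P (fun w => V h m.+1 w - Z m.+1 w) <=
  K * h `^ (kap - n.+1%:R * zeta) * (h ^+ 2 / sigma2 h) ^+ n.+1].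
Proof.
move=> /andP[kap1 kap2] mn; have z0 : 0 < zeta by case/andP: (vd_zeta vd).
have kapm : m.+1%:R * zeta < kap < 1.
  rewrite kap2 andbT; apply: le_lt_trans kap1.
  by apply: ler_wpM2r; [exact: ltW|rewrite ler_nat].
have [C C0 hC] := wick_chaos_close vd rhoE hG hS cG hphi kapm ab.
(* Existence of a limit is what ensures that [xget] returns one rather than its default. *)
have hZ : is_wick_chaos P G rho phi m.+1 (\1_`[a, b] : R -> R) (Z m.+1).
  have [Z0 hZ0] := wick_chaos_exists vd rhoE hG hS cG hphi kapm ab.
  exact: (xgetPex (cst 0) (ex_intro _ Z0 hZ0)).
have [sZ hcl] := hC _ hZ.
have [D D0 hD] := sigma2_bound vd 1.
exists (C * D ^+ (n - m)) => [|h hh s2]; first by rewrite mulr_ge0// exprn_ge0// ltW.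
have [sV hb] := hcl h _ _ hh (fam hh) (mquot h) (vers hh).
split=> //; have /andP[h0 h1] := hh.
set q := h ^+ 2 / sigma2 h; have q0 : 0 <= q by rewrite divr_ge0 ?sqr_ge0// ltW.
have hz : h `^ zeta <= D * q.
  have := hD h hh; rewrite gtr0_norm// => hs.
  rewrite /q mulrA ler_pdivlMr//.
  have -> : D * h ^+ 2 = h `^ zeta * (D * h ^+ 2 * pk zeta h).
    have hp : h `^ zeta * pk zeta h = 1.
      by rewrite /pk gtr0_norm// powRN mulfV// gt_eqF// powR_gt0.
    by transitivity (D * h ^+ 2 * (h `^ zeta * pk zeta h)); [rewrite hp mulr1|ring].
  by rewrite ler_wpM2l// powR_ge0.
apply: (@le_trans _ _ (q ^+ m.+1 * (C * h `^ (kap - m.+1%:R * zeta)))).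
  by rewrite ler_wpM2l ?exprn_ge0//; exact: hb.
have -> : kap - m.+1%:R * zeta = (kap - n.+1%:R * zeta) + zeta * (n - m)%:R.
  by rewrite natrB// -!(natr1 n) -!(natr1 m); ring.
rewrite powRD; last by rewrite (gt_eqF h0) implybT.
rewrite powRrM powR_mulrn ?powR_ge0//.
have -> : q ^+ n.+1 = q ^+ m.+1 * q ^+ (n - m) by rewrite -exprD addSn subnKC.
have : h `^ zeta ^+ (n - m) <= (D * q) ^+ (n - m).
  by apply: lerXn2r => //; rewrite ?nnegrE ?powR_ge0// mulr_ge0// ltW.
rewrite exprMn => le1.
rewrite (_ : q ^+ m.+1 * _ = C * h `^ (kap - n.+1%:R * zeta) * q ^+ m.+1 * (h `^ zeta) ^+ (n - m)); last by ring.
rewrite (_ : C * _ * _ * (_ * _) = C * h `^ (kap - n.+1%:R * zeta) * q ^+ m.+1 *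
  (D ^+ (n - m) * q ^+ (n - m))); last by ring.
by apply: ler_wpM2l => //; rewrite !mulr_ge0 ?powR_ge0 ?exprn_ge0.
Qed.

Lemma expansion_msq n kap (f : R -> R) : n.+1%:R * zeta < kap < 1 -> sqintg gam f ->
  let A j := \int[gam]_x (f x * (He1 R j).[x]) in
  (\forall h \near (0 : R)^'+, 0 < sigma2 h) ->
  h ^+ 2 / sigma2 h @[h --> (0 : R)^'+] --> (0 : R) ->
  forall eps, 0 < eps -> \forall h \near (0 : R)^'+,
  let D w := integrated lam (fun x w => f (normalized G sigma2 h x w) * \1_`[a, b] x) w -
    \sum_(j < n.+2) (h / Num.sqrt (sigma2 h)) ^+ j * (A j / Num.sqrt j`!%:R) * Z j w in
  sqintg P D /\ msq P D <= eps ^+ 2 * (h ^+ 2 / sigma2 h) ^+ n.+1.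
Proof.
move=> kapP sf A hpos hq eps eps0.
set theta := kap - n.+1%:R * zeta.
have th0 : 0 < theta by rewrite subr_gt0; case/andP: kapP.
have [sr orth] := hermite_remainder n.+2 sf; rewrite -/A in sr orth.
set r := fun x => f x - _ in sr orth.
have [C C0 hC] := remainder_bound vd hG hS cG kapP ab.
have mr0 := msq_ge0 gam r.
have hK : forall m : nat, exists K, (m <= n)%N -> 0 <= K /\ forall h, 0 < h <= 1 -> 0 < sigma2 h ->
  [/\ sqintg P (Z m.+1), sqintg P (V h m.+1) &
  (h ^+ 2 / sigma2 h) ^+ m.+1 * msq P (fun w => V h m.+1 w - Z m.+1 w) <=
  K * h `^ theta * (h ^+ 2 / sigma2 h) ^+ n.+1].
  move=> m; have [mn|] := boolP (m <= n)%N; last by exists 0.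
  by have [K K0 h] := chaos_term kapP mn; exists K.
have [K hKK] := choice hK.
pose L := \sum_(m < n.+1) (A m.+1 / Num.sqrt (m.+1)`!%:R) ^+ 2 * K m.
have Lm m : (m <= n)%N -> (A m.+1 / Num.sqrt (m.+1)`!%:R) ^+ 2 * K m <= L.
  move=> mn; rewrite /L (bigD1 (Ordinal (mn : (m < n.+1)%N)))//= lerDl; apply: sumr_ge0 => i _.
  apply: mulr_ge0; first exact: sqr_ge0.
  by have [] := hKK i (ltn_ord i : (i <= n)%N).
have L0 : 0 <= L.
  apply: sumr_ge0 => i _; apply: mulr_ge0; first exact: sqr_ge0.
  by have [] := hKK i (ltn_ord i : (i <= n)%N).
pose M := C * msq gam r; have M0 : 0 <= M by exact: mulr_ge0.
(* Of the eight parts, the remainder takes three and the sum of the chaos errors one; [msqD_le]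
   doubles both. *)
pose e8 := eps ^+ 2 / 8; have e80 : 0 < e8 by rewrite divr_gt0// exprn_gt0.
have [eta /andP[eta0 eta1] heta] := small_powR th0 M0 e80.
have [E E0 hE] := hC _ eta0.
pose M2 := 4 ^+ n.+2 * L; have M20 : 0 <= M2 by apply: mulr_ge0 => //; exact: exprn_ge0.
have [eta2 /andP[eta20 eta21] heta2] := small_powR th0 M20 e80.
have ME0 : 0 < M * E + 1 by rewrite ltr_wpDl// mulr_ge0.
have ee0 : 0 < e8 / (M * E + 1) by exact: divr_gt0.
move/cvgrPdist_le : hq => /(_ _ ee0) hq.
near=> h.
have h0 : 0 < h by near: h; exact: nbhs_right_gt.
have h1 : h <= 1 by near: h; apply: nbhs_right_le; exact: ltr01.
have hh : 0 < h <= 1 by rewrite h0.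
have s2 : 0 < sigma2 h by near: h; exact: hpos.
have h8 : h <= eta / 8 by near: h; apply: nbhs_right_le; rewrite divr_gt0.
have h2 : h <= eta2 by near: h; exact: nbhs_right_le.
have hqe : `|0 - h ^+ 2 / sigma2 h| <= e8 / (M * E + 1) by near: h; exact: hq.
set q := h ^+ 2 / sigma2 h in hqe *; set c := h / Num.sqrt (sigma2 h).
have q0 : 0 <= q by rewrite divr_ge0 ?sqr_ge0// ltW.
have qn0 : 0 <= q ^+ n.+1 by exact: exprn_ge0.
move: hqe; rewrite sub0r normrN ger0_norm// ler_pdivlMr// => hqe.
pose D w := integrated lam (fun x w => f (normalized G sigma2 h x w) * \1_`[a, b] x) w -
  \sum_(j < n.+2) c ^+ j * (A j / Num.sqrt j`!%:R) * Z j w.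
change (sqintg P D /\ msq P D <= eps ^+ 2 * q ^+ n.+1).
have cq j : (c ^+ j) ^+ 2 = q ^+ j by rewrite -exprM mulnC exprM /c sqr_ratio.
have sE g : sqintg gam g -> sqfield lam P `[a, b] (msq gam g)
  (fun x w => g (normalized G sigma2 h x w) * \1_`[a, b] x).
  by move=> sg; exact: (std_field hG hS cG h0 s2 b sg a0).
pose Rm := integrated lam (fun x w => r (normalized G sigma2 h x w) * \1_`[a, b] x).
have sRm : sqintg P Rm := sqintg_integrated (sE _ sr).
pose X j w := c ^+ j * (A j / Num.sqrt j`!%:R) * (V h j w - Z j w).
(* The integral over [[a, b]] splits on paths where every integrand is integrable, hence an equality
   almost everywhere. *)
have ae_eq : {ae P, forall w, Rm w + \sum_(j < n.+2) X j w = D w}.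
  have aeV : {ae P, forall w, forall j, intg lam (fun x => wick_field P j (quotient G h) x w * \1_`[a, b] x)}.
    apply/ae_foralln => j; have [KK sVj] := sqV j hh; exact: sqfield_ae_intg sVj.
  have aer := sqfield_ae_intg (sE _ sr); move: aeV aer; apply: filterS2 => w hV hr.
  have hHj j : intg lam (fun x => (He1 R j).[normalized G sigma2 h x w] * \1_`[a, b] x) /\
      integrated lam (fun x w => (He1 R j).[normalized G sigma2 h x w] * \1_`[a, b] x) w =
      (Num.sqrt j`!%:R)^-1 * c ^+ j * V h j w.
    have e := hermite_integral hG hS h0 s2 a0 (hV j); split=> //.
    have ex x : (Num.sqrt j`!%:R)^-1 * c ^+ j * (wick_field P j (quotient G h) x w * \1_`[a, b] x) =
      (He1 R j).[normalized G sigma2 h x w] * \1_`[a, b] x.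
      rewrite indicE; have [xab|_] := boolP (x \in _); last by rewrite !mulr0.
      have x0 : 0 <= x by move: xab; rewrite inE /= in_itv/= => /andP[ax _]; exact: le_trans ax.
      rewrite !mulr1 (normalizedE _ h0 s2) /He1 hornerZ -(quotient_msq hG hS h0 s2 x0) He_scale.
      by rewrite /wick_field -/c; ring.
    rewrite -(_ : (fun x => (Num.sqrt j`!%:R)^-1 * c ^+ j *
      (wick_field P j (quotient G h) x w * \1_`[a, b] x)) = fun x => _); last exact/funext.
    exact: intgZ.
  rewrite /D /X; have -> : integrated lam (fun x w => f (normalized G sigma2 h x w) * \1_`[a, b] x) w =
      Rm w + \sum_(j < n.+2) A j * ((Num.sqrt j`!%:R)^-1 * c ^+ j * V h j w).
    under eq_bigr do rewrite -(hHj _).2.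
    rewrite /Rm /integrated.
    under eq_bigr do rewrite -(IntZ _ (hHj _).1).
    rewrite -Int_sum; last by move=> i; exact: intgZ (hHj i).1.
    rewrite -IntD//; last by apply: intg_sum => i; exact: intgZ (hHj i).1.
    apply: eq_Rintegral => x _; rewrite /r mulrBl mulr_suml -addrA.
    rewrite [X in _ + X](_ : _ = 0) ?addr0// addrC -sumrB big1// => i _.
    by rewrite mulrA subrr.
  rewrite -addrA; congr (_ + _); rewrite -sumrB; apply: eq_bigr => j _; ring.
have sX j : (j < n.+2)%N -> sqintg P (X j) /\ msq P (X j) <= L * h `^ theta * q ^+ n.+1.
  have Lq0 : 0 <= L * h `^ theta * q ^+ n.+1.
    by apply: mulr_ge0 => //; apply: mulr_ge0 => //; exact: powR_ge0.
  case: j => [_|m mn].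
    (* The term of degree 0 carries no error. *)
    rewrite (_ : X 0 = fun=> 0); last first.
      by apply/funext => w; rewrite /X chaos_zero subrr mulr0.
    split; first exact: sqintg0.
    by rewrite /msq Int_eq0// => w; rewrite expr0n.
  have [K0 hb] := hKK m mn; have [sZ sV hb2] := hb h hh s2.
  have sB := sqintgB sV sZ; split; first exact: sqintgZ.
  have eX : msq P (X m.+1) = (A m.+1 / Num.sqrt (m.+1)`!%:R) ^+ 2 *
      (q ^+ m.+1 * msq P (fun w => V h m.+1 w - Z m.+1 w)).
    rewrite /X (msqZ _ sB) exprMn cq; move: (msq _ _) (_ ^+ 2) => u v.
    by rewrite -mulrA mulrCA.
  rewrite eX; apply: (le_trans (ler_wpM2l (sqr_ge0 _) hb2)); rewrite -/q.
  have -> : forall u : R, u * (K m * h `^ theta * q ^+ n.+1) = u * K m * (h `^ theta * q ^+ n.+1).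
    by move=> u; rewrite !mulrA.
  rewrite -[leRHS]mulrA; apply: ler_wpM2r; first by apply: mulr_ge0 => //; exact: powR_ge0.
  exact: Lm.
have Lq0 : 0 <= L * h `^ theta * q ^+ n.+1.
  by apply: mulr_ge0 => //; apply: mulr_ge0 => //; exact: powR_ge0.
have [sS mS] := msq_sum_le Lq0 sX.
have sT := sqintgD sRm sS.
have sD : sqintg P D.
  apply: ae_sqintg sT ae_eq; apply: measurable_funB.
    exact: measurable_integrated (sE _ sf).
  apply: measurable_sum => j; apply: measurable_funM => //.
  case: j => -[|m] mn /=; first by rewrite /Z /wick_chaos; exact: measurable_cst.
  by have [_ hb] := hKK m mn; have [[mZ _] _ _] := hb h hh s2.
split=> //.
have -> : msq P D = msq P (fun w => Rm w + \sum_(j < n.+2) X j w).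
  apply: ae_eq_Int; [exact: measurable_funX sD.1|exact: measurable_funX sT.1|].
  by apply: filterS ae_eq => w ->.
apply: le_trans (msqD_le sRm sS) _.
have bR : msq P Rm <= M * (q ^+ n.+1 * (E * q + h `^ theta + eta `^ theta)).
  apply: hE => //; lra.
have hth := heta eta; rewrite eta0 lexx in hth; have {}hth := hth isT.
have hth1 : M * h `^ theta <= e8 by apply: heta; rewrite h0/=; lra.
have hth2 : M2 * h `^ theta <= e8 by apply: heta2; rewrite h0.
have hth3 : M * (E * q) <= e8.
  by apply: le_trans hqe; rewrite mulrA mulrC ler_wpM2l// lerDl.
have b1 : M * (q ^+ n.+1 * (E * q + h `^ theta + eta `^ theta)) <= q ^+ n.+1 * (3 * e8).
  rewrite mulrCA; apply: ler_wpM2l => //; lra.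
have b2 : 4 ^+ n.+2 * (L * h `^ theta * q ^+ n.+1) <= q ^+ n.+1 * e8.
  have -> : 4 ^+ n.+2 * (L * h `^ theta * q ^+ n.+1) = q ^+ n.+1 * (M2 * h `^ theta).
    by rewrite /M2 [RHS]mulrC !mulrA.
  exact: ler_wpM2l.
have -> : eps ^+ 2 * q ^+ n.+1 = 8 * (q ^+ n.+1 * e8) by rewrite /e8; field.
have := le_trans bR b1; have := le_trans mS b2.
move: (msq P Rm) (msq P _) => u v; lra.
Unshelve. all: end_near. Qed.

End expansion.

Theorem theorem1p1 (R : realType)
  (d : measure_display) (T : measurableType d) (P : probability T R)
  (d' : measure_display) (T' : measurableType d') (P' : probability T' R)
  (f : R -> R) (hf : f \in Lfun (normal_prob 0 1) 2%:E)
  (hf0 : exists x : R, f x != 0)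
  (eta : {RV P' >-> R})
  (heta : forall A : set R, measurable A ->
            distribution P' eta A = normal_prob 0 1 A)
  (H : nat -> {poly R}) (hH : hermite_polynomials H)
  (phi : R -> R -> R) (hphi : approximate_identity phi)
  (G : R -> T -> R) (sigma2 : R -> R)
  (hG : centered_gaussian_process P G)
  (hG0 : forall w, G 0 w = 0)
  (hGstat : stationary_increments P G)
  (hGcont : forall w, {within `[0%R, +oo[, continuous (fun x => G x w)})
  (hsigma2 : forall x y : R, 0 <= x -> 0 <= y ->
     'E_P[(fun w => (G x w - G y w) ^+ 2)%R]%E = (sigma2 (x - y))%:E)
  (hsigma20 : exists h : R, sigma2 h != 0)
  (beta : R) (hbeta : 1 <= beta <= 2)
  (hi : regularly_varying_at_zero sigma2 beta)
  (hii1 : h ^+ 2 / sigma2 h @[h --> 0^'] --> (0 : R))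
  (hii2 : sigma2 h / h @[h --> 0^'] --> (0 : R))
  (hiii : exists C : R, forall s h : R, 0 < s -> 0 < h <= s / 8 ->
     `|sigma2 (s + h) + sigma2 (s - h) - 2 * sigma2 s| / h ^+ 2
       <= C * (sigma2 s / s ^+ 2))
  (hiv : forall s : R, s != 0 ->
     derivable sigma2 s 1 /\ derivable (derive1 sigma2) s 1)
  (sigma : R -> R) (hsigma : forall h : R, sigma h = Num.sqrt (sigma2 h))
  (rho : R -> R) (hrho : forall s : R, s != 0 -> rho s = 2^-1 * derive1n 2 sigma2 s)
  (zeta : R) (hzeta : 0 < zeta)
  (hrhobound : forall M : R, 0 < M -> exists C : R,
     (forall x : R, 0 < `|x| <= M -> `|rho x| <= C / `|x| `^ zeta) /\
     (forall x h : R, x != 0 -> 4 * `|h| <= `|x| <= M ->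
        `|rho (x + h) - rho x| <= C * (`|h| / `|x|) * `|rho x|)) :
  forall j0 : nat, (1 <= j0)%N -> j0%:R * zeta < 1 ->
  forall a b : R, 0 <= a <= b ->
  forall eps : R, 0 < eps -> \forall h \near 0^'+,
    (L2dist P
       (fun w => \int[lebesgue_measure]_(x in `[a, b])
                   f ((G (x + h) w - G x w) / sigma h))%R
       (fun w => \sum_(0 <= j < j0.+1)
          (h / sigma h) ^+ j *
          (fine ('E_P'[(fun w' => (H j).[eta w'] * f (eta w'))%R]) /
             Num.sqrt (j`!)%:R) *
          wick_chaos P G rho phi j \1_`[a, b] w)%R
     <= (eps * (h / sigma h) ^+ j0)%:E)%E.
Proof.
case=> [//|n] _ nz a b hab eps eps0.
have hS (x y : R) : 0 <= x -> 0 <= y -> msq P (fun w => G x w - G y w) = sigma2 (x - y).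
  by move=> x0 y0; have := hsigma2 x y x0 y0; rewrite unlock /msq /Rintegral => ->.
have sE h : 0 <= h -> sigma2 (- h) = sigma2 h.
  move=> h0; rewrite -[- h]add0r -[in RHS](subr0 h) -!hS//; apply: eq_Rintegral => w _.
  by rewrite -sqrrN opprB.
have s_even h : sigma2 (- h) = sigma2 h.
  have [h0|h0] := leP 0 h; first exact: sE.
  by rewrite -sE ?opprK// oppr_ge0 ltW.
have s_zero : sigma2 0 = 0.
  rewrite -[X in sigma2 X](subr0 0) -(hS 0 0)//; rewrite /msq Int_eq0// => w.
  by rewrite subrr expr0n.
have s_ge0 h : 0 <= h -> 0 <= sigma2 h.
  by move=> h0; rewrite -(subr0 h) -hS//; exact: msq_ge0.
pose rho' x := if x == 0 then 0 else rho x.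
have rhoE (x : R) : x != 0 -> rho x = rho' x by rewrite /rho' => /negbTE ->.
have zeta1 : zeta < 1.
  by apply: le_lt_trans nz; rewrite ler_peMl ?(ltW hzeta)// ler1n.
have vd : variance_density sigma2 rho' zeta.
  split=> //.
  - by move=> s s0; rewrite -rhoE//; exact: hrho.
  - by rewrite /rho' eqxx.
  - by rewrite hzeta.
  move=> M M0; have [C [b1 b2]] := hrhobound M M0; exists C; split=> [x xM|x h x0 hx].
    by rewrite -rhoE; [exact: b1|case/andP: xM; rewrite normr_gt0].
  rewrite -!rhoE//; first exact: b2.
  apply: contraL hx => /eqP/addr0_eq e; rewrite -e normrN negb_and -ltNge.
  by apply/orP; left; have : 0 < `|x| by [rewrite normr_gt0]; lra.
have sf : sqintg (normal_prob (0 : R) 1) f.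
  split; last exact: Lfun2_integrable_sqr hf.
  by have /andP[mf _] := hf; have := set_mem mf.
(* Regular variation with [lambda = 1]: the quotient of [sigma2 h] by itself tends to 1, while it
   would be 0 wherever [sigma2 h = 0], division by zero giving 0. Hence [sigma2 h > 0] near 0. *)
have hr := hi 1 ltr01; rewrite powR1 in hr.
have hpos : \forall h \near (0 : R)^'+, 0 < sigma2 h.
  have hn : \forall h \near (0 : R)^'+, 0 < sigma2 (1 * h) / sigma2 h.
    by apply: (cvgr_gt _ hr); exact: ltr01.
  move: (nbhs_right_gt (0 : R)) hn; apply: filterS2 => h h0 h1.
  rewrite lt_neqAle s_ge0 ?(ltW h0)// andbT eq_sym; apply/eqP => e.
  by move: h1; rewrite e invr0 mulr0 ltxx.
have hq := cvg_dnbhs_at_right hii1.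
have coefE j : fine ('E_P'[(fun w' => (H j).[eta w'] * f (eta w'))%R]) =
    \int[normal_prob (0 : R) 1]_x (f x * (He1 R j).[x]).
  have sH : sqintg (normal_prob (0 : R) 1) (horner (He1 R j)) := sqintg_horner _.
  have mfH : measurable_fun setT (fun x : R => f x * (He1 R j).[x]).
    exact: measurable_funM sf.1 sH.1.
  have [_ <-] := law_intg (@measurable_funPT _ _ _ _ eta) heta mfH (sqintgM sf sH).
  rewrite unlock -/(Rintegral _ _ _) (hermiteE hH).
  by apply: eq_Rintegral => w _; rewrite mulrC.
(* [kappa] is taken as the midpoint of [j0 * zeta] and 1. *)
have kapP : n.+1%:R * zeta < n.+1%:R * zeta + (1 - n.+1%:R * zeta) / 2 < 1.
  by move: nz; move: (_ * zeta) => u u1; apply/andP; split; lra.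
have hexp := expansion_msq vd rhoE hG hS hGcont hphi hab kapP sf hpos hq eps0.
move: (nbhs_right_gt (0 : R)) hpos hexp; apply: filterS3 => h h0 s2 /= [sD mD].
have h_sigma : h / sigma h = h / Num.sqrt (sigma2 h) by rewrite hsigma.
have c0 : 0 <= h / sigma h by rewrite h_sigma divr_ge0 ?sqrtr_ge0// ltW.
have /andP[a0 _] := hab.
set X := (X in L2dist P X _); set Y := (X in L2dist P _ X).
have eD : (fun w => X w - Y w) = fun w =>
    integrated lebesgue_measure (fun x w => f (normalized G sigma2 h x w) * \1_`[a, b] x) w -
    \sum_(j < n.+2) (h / Num.sqrt (sigma2 h)) ^+ j *
      (\int[normal_prob (0 : R) 1]_x (f x * (He1 R j).[x]) / Num.sqrt j`!%:R) *
      wick_chaos P G rho phi j (\1_`[a, b] : R -> R) w.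
  apply/funext => w; congr (_ - _).
    rewrite /X Rintegral_mkcond /integrated; apply: eq_Rintegral => x _.
    rewrite patchE indicE; case: ifPn => xab; last by rewrite mulr0.
    have x0 : 0 <= x by move: xab; rewrite inE /= in_itv/= => /andP[ax _]; exact: le_trans ax.
    rewrite mulr1 /normalized /gpath addr0 !max_r ?addr_ge0 ?(ltW h0)// hsigma.
    by rewrite mulrC.
  rewrite /Y big_mkord; apply: eq_bigr => j _.
  by rewrite coefE h_sigma.
apply: L2dist_le; first by rewrite mulr_ge0 ?exprn_ge0// ltW.
  by rewrite eD.
rewrite eD exprMn -exprM mulnC exprM h_sigma (sqr_ratio s2).
exact: mD.
Qed.
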